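(* Let $\iota:(\mathfrak g',K')\to(\mathfrak g,K)$ be an inclusion of reductive pairs, in particular mapping one regular element to a regular one. Let $\mathfrak q'=\mathfrak l'+\mathfrak u'\subseteq\mathfrak g'$ and $\mathfrak q=\mathfrak l+\mathfrak u\subseteq\mathfrak g$ be germane parabolic subalgebras with $\mathfrak q'\subseteq\mathfrak q$, with Levi factors $L'\subseteq L$, and $\mathfrak u'\subseteq\mathfrak u$. Let $\mathcal Q=(\mathcal G,\mathcal L,K_{\mathcal G},K_{\mathcal L})$ be a $\mathfrak u$-admissible quadruple and $\mathcal Q'=(\mathcal G',\mathcal L',K_{\mathcal G'},K_{\mathcal L'})$ a $\mathfrak u'$-admissible quadruple such that restriction along $\iota$ induces well defined functors $\mathcal G\to\mathcal G'$ and $\mathcal L\to\mathcal L'$ and well defined maps $\iota:K_{\mathcal G}\to K_{\mathcal G'}$ and $\iota:K_{\mathcal L}\to K_{\mathcal L'}$. Assume that $$W_{\mathfrak q/\mathfrak q'}:=W_{\mathfrak q}|_{\mathfrak l',L'\cap K'}/W_{\mathfrak q'}$$ is an element of $K_{\mathcal L'}$ and that $K_{\mathcal L'}$ is closed under multiplication with $W_{\mathfrak q/\mathfrak q'}$. Then restriction defines an additive and multiplicative map $$\iota:C_{\mathfrak q}(\mathcal Q)\to C_{\mathfrak q'}(\mathcal Q')[W_{\mathfrak q/\mathfrak q'}^{-1}],\qquad c\mapsto c|_{\mathfrak l',L'\cap K'},$$ respecting duals, with the property $$\iota\circ c_{\mathfrak q}=c_{\mathfrak q'}\circ\iota .$$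
   Context: Reductive pairs. A reductive pair $(\mathfrak g,K)$ (Knapp-Vogan, Cohomological Induction and Unitary Representations, Ch. IV) corresponds to a real reductive Lie group $G$ with finitely many components, Cartan involution $\theta$ and maximal compact subgroup $K$; $\mathfrak g$ is the complexification of $\mathfrak g_0=\mathrm{Lie}(G)$. An inclusion of reductive pairs is assumed compatible with Cartan involutions and all other data attached to the pairs. $(\mathfrak g,K)$-modules are locally $K$-finite, with no admissibility imposed. A parabolic subalgebra $\mathfrak q\subseteq\mathfrak g$ is germane if it has a Levi factor $\mathfrak l$ that is the complexification of a $\theta$-stable real $\mathfrak l_0\subseteq\mathfrak g_0$; $L$ is then the intersection of the normalizers of $\mathfrak q$ and $\theta(\mathfrak q)$ in $G$, and $(\mathfrak l,L\cap K)$ is a reductive pair. $\mathfrak u$ is the nilpotent radical. $H^q(\mathfrak u;V)$, computed by $\mathrm{Hom}_{\mathbf C}(\bigwedge^\bullet\mathfrak u,V)$, is naturally an $(\mathfrak l,L\cap K)$-module. Admissibility. A pair $(\mathcal G,\mathcal L)$ of full abelian subcategories (closed under isomorphism) of the categories of all $(\mathfrak g,K)$-modules resp. $(\mathfrak l,L\cap K)$-modules is $\mathfrak u$-admissible if: (i) $\mathcal G$ contains the trivial representation and $\mathcal L$ contains $\bigwedge^q\mathfrak u^*$ for all $q$; (ii) $\mathcal L$ is closed under tensoring with every $\bigwedge^q\mathfrak u^*$; (iii) $H^q(\mathfrak u;V)\in\mathcal L$ for all $V\in\mathcal G$ and all $q$. On Grothendieck groups put $H:K(\mathcal G)\to K(\mathcal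 L)$, $H([V])=\sum_q(-1)^q[H^q(\mathfrak u;V)]$, $W_{\mathfrak q}:=H([\mathbf C])=\sum_q(-1)^q[\bigwedge^q\mathfrak u^*]$. A $\mathfrak u$-admissible quadruple $(\mathcal G,\mathcal L,K_{\mathcal G},K_{\mathcal L})$ is a $\mathfrak u$-admissible pair with subgroups $K_{\mathcal G}\subseteq K(\mathcal G)$, $K_{\mathcal L}\subseteq K(\mathcal L)$ such that $H(K_{\mathcal G})\subseteq K_{\mathcal L}$ and $W_{\mathfrak q}\cdot K_{\mathcal L}\subseteq K_{\mathcal L}$. Characters. $C_{\mathfrak q}(\mathcal Q):=K_{\mathcal L}[W_{\mathfrak q}^{-1}]=\mathbf Z[W_{\mathfrak q},W_{\mathfrak q}^{-1}]\otimes_{\mathbf Z[W_{\mathfrak q}]}K_{\mathcal L}$ and $c_{\mathfrak q}(X):=H(X)/W_{\mathfrak q}$ for $X\in K_{\mathcal G}$. Grothendieck groups and their localizations carry a partially defined product (induced by $[V]\cdot[W]=[V\otimes_{\mathbf C}W]$ when the tensor product lies in the category) and partially defined duals (induced by locally finite duals); ''multiplicative'' and ''respecting duals'' refer to these wherever they are defined.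
   Formalization: ''Respecting duals'' is stated only for classes of modules whose locally finite duals for L∩K and L'∩K' agree (false otherwise); ''closed under multiplication with W_{q/q'}'' includes that the category L' is closed under tensoring with the restricted exterior powers of u^*. *)

(* Defs.v *)
From HB Require Import structures.
From mathcomp Require Import all_boot all_order all_algebra.
From mathcomp Require Import all_classical all_reals all_analysis.
From mathcomp Require Import complex.

Set Implicit Arguments.
Unset Strict Implicit.
Unset Printing Implicit Defensive.

Import Order.TTheory GRing.Theory Num.Theory.
Import numFieldNormedType.Exports.

Local Open Scope classical_set_scope.
Local Open Scope ring_scope.

(* Grothendieck groups of categories of modules live in a universe above
   that of [lmodType], hence above that of [choiceType] and [zmodType], so
   none of the MathComp structures (nor [{eq_quot _}]) can host them. *)
Record abGroup := AbGroup {
  ab_sort :> Type;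
  ab_zero : ab_sort;
  ab_opp : ab_sort -> ab_sort;
  ab_add : ab_sort -> ab_sort -> ab_sort;
  ab_addA : forall x y z, ab_add x (ab_add y z) = ab_add (ab_add x y) z;
  ab_addC : forall x y, ab_add x y = ab_add y x;
  ab_add0 : forall x, ab_add ab_zero x = x;
  ab_addN : forall x, ab_add (ab_opp x) x = ab_zero }.

Arguments ab_zero {a}.
Arguments ab_opp {a}.
Arguments ab_add {a}.

Definition ab_mulz (A : abGroup) (m : int) (x : A) : A :=
  match m with
  | Posz n => iter n (ab_add x) ab_zero
  | Negz n => ab_opp (iter n.+1 (ab_add x) ab_zero)
  end.

Definition is_subgroup (A : abGroup) (S : A -> Prop) : Prop :=
  [/\ S ab_zero, forall x y, S x -> S y -> S (ab_add x y)
    & forall x, S x -> S (ab_opp x)].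

Inductive term (G : Type) : Type :=
  | TGen of G
  | TZero
  | TOpp of term G
  | TAdd of term G & term G.

Arguments TZero {G}.

Inductive term_eq (G : Type) (rel : term G -> term G -> Prop) :
    term G -> term G -> Prop :=
  | teq_rel s t : rel s t -> term_eq rel s t
  | teq_refl s : term_eq rel s s
  | teq_sym s t : term_eq rel s t -> term_eq rel t s
  | teq_trans s t r : term_eq rel s t -> term_eq rel t r -> term_eq rel s r
  | teq_opp s t : term_eq rel s t -> term_eq rel (TOpp s) (TOpp t)
  | teq_add s s' t t' : term_eq rel s s' -> term_eq rel t t' ->
      term_eq rel (TAdd s t) (TAdd s' t')
  | teq_addA s t r : term_eq rel (TAdd s (TAdd t r)) (TAdd (TAdd s t) r)
  | teq_addC s t : term_eq rel (TAdd s t) (TAdd t s)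
  | teq_add0 s : term_eq rel (TAdd TZero s) s
  | teq_addN s : term_eq rel (TAdd (TOpp s) s) TZero.

Section Presented.
Variables (G : Type) (rel : term G -> term G -> Prop).

Definition presented_sort : Type :=
  {c : term G -> Prop | exists t, c = term_eq rel t}.

Definition tclass (t : term G) : presented_sort :=
  exist _ (term_eq rel t) (ex_intro _ t erefl).

Definition trepr (x : presented_sort) : term G := projT1 (cid (proj2_sig x)).

Lemma treprK x : tclass (trepr x) = x.
Proof.
case: x => c hc; rewrite /trepr /=; case: (cid _) => t /= e.
by subst c; congr exist; exact: Prop_irrelevance.
Qed.

Lemma tclass_eq s t : term_eq rel s t -> tclass s = tclass t.
Proof.
move=> st; have e : term_eq rel s = term_eq rel t.
  apply/funext => r; apply/propext; split => h.
    exact: teq_trans (teq_sym st) h.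
  exact: teq_trans st h.
rewrite /tclass; move: (ex_intro _ s _) (ex_intro _ t _); rewrite e => p q.
by congr exist; exact: Prop_irrelevance.
Qed.

Lemma trepr_class t : term_eq rel (trepr (tclass t)) t.
Proof.
have := treprK (tclass t); rewrite /tclass => /(congr1 (@proj1_sig _ _)) /= ->.
exact: teq_refl.
Qed.

Definition padd (x y : presented_sort) := tclass (TAdd (trepr x) (trepr y)).
Definition popp (x : presented_sort) := tclass (TOpp (trepr x)).
Definition pzero : presented_sort := tclass TZero.

Lemma paddA x y z : padd x (padd y z) = padd (padd x y) z.
Proof.
apply: tclass_eq.
apply: teq_trans (teq_add (teq_refl _ _) (trepr_class _)) _.
apply: teq_trans (teq_addA _ _ _ _) _.
exact: teq_add (teq_sym (trepr_class _)) (teq_refl _ _).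
Qed.

Lemma paddC x y : padd x y = padd y x.
Proof. exact: tclass_eq (teq_addC _ _ _). Qed.

Lemma padd0 x : padd pzero x = x.
Proof.
rewrite -[RHS]treprK; apply: tclass_eq.
apply: teq_trans (teq_add (trepr_class _) (teq_refl _ _)) _.
exact: teq_add0.
Qed.

Lemma paddN x : padd (popp x) x = pzero.
Proof.
apply: tclass_eq.
apply: teq_trans (teq_add (trepr_class _) (teq_refl _ _)) _.
exact: teq_addN.
Qed.

Definition presented : abGroup := AbGroup paddA paddC padd0 paddN.

Definition pgen (g : G) : presented := tclass (TGen g).

Fixpoint term_eval (A : abGroup) (f : G -> A) (t : term G) : A :=
  match t with
  | TGen g => f g
  | TZero => ab_zero
  | TOpp s => ab_opp (term_eval f s)
  | TAdd s r => ab_add (term_eval f s) (term_eval f r)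
  end.

(* The homomorphism with [pgen g |-> f g], whenever [f] respects [rel]. *)
Definition pext (A : abGroup) (f : G -> A) (x : presented) : A :=
  term_eval f (trepr x).

End Presented.

(* For an additive operator [T] on a subgroup [S], [localization S T] is
   Z[T, T^-1] (x)_Z[T] S, where [fraction S T x a] is x / T^a. The operator is
   given by its graph.  Outside [S] fractions are set to 0. *)
Section Localization.
Variables (A : abGroup) (S : A -> Prop) (T : A -> A -> Prop).

Local Notation G := ({x : A | S x} * nat)%type.

Inductive frac_rel : term G -> term G -> Prop :=
  | frac_rel_add (x y z : {x : A | S x}) (a : nat) :
      sval z = ab_add (sval x) (sval y) ->
      frac_rel (TGen (z, a)) (TAdd (TGen (x, a)) (TGen (y, a)))
  | frac_rel_mul (x y : {x : A | S x}) (a : nat) :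
      T (sval x) (sval y) -> frac_rel (TGen (y, a.+1)) (TGen (x, a)).

Definition localization : abGroup := presented frac_rel.

Definition fraction (x : A) (a : nat) : localization :=
  match pselect (S x) with
  | left Sx => pgen frac_rel (exist _ x Sx, a)
  | right _ => ab_zero
  end.

End Localization.

Section OneParameter.
Variables (R : realType) (n : nat) (K : set 'M[R]_n).

(* By Peter-Weyl every compact Lie group is a compact group of matrices; its
   Lie algebra consists of the velocities of its one-parameter subgroups. *)
Definition one_param (c : R -> 'M[R]_n) (X : 'M[R]_n) : Prop :=
  [/\ forall t, K (c t), forall s t, c (s + t) = c s *m c t
    & forall i j, is_derive (0 : R) (1 : R) (fun t => c t i j) (X i j)].

Definition lie_of (X : 'M[R]_n) : Prop := exists c, one_param c X.

Definition compact_matrix_group : Prop :=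
  [/\ K 1%:M, forall k l, K k -> K l -> K (k *m l),
      forall k, K k -> k \in unitmx /\ K (invmx k) & compact K].

(* [pi] is a locally finite, continuous action of [K] on [V] whose
   differential is [dpi]: every vector lies in a finite-dimensional stable
   space (spanned by [e]) on which the matrix coefficients are continuous. *)
Definition locally_finite (V : lmodType R[i]) (pi dpi : 'M[R]_n -> V -> V) :
    Prop :=
  forall v : V, exists m (e : 'I_m -> V) (c : 'M[R]_n -> 'M[R[i]]_m),
  [/\ exists a : 'I_m -> R[i], v = \sum_i a i *: e i,
      forall k j, K k -> pi k (e j) = \sum_i c k i j *: e i,
      forall i j, {within K, continuous (fun k => complex.Re (c k i j))} /\
                  {within K, continuous (fun k => complex.Im (c k i j))}
    & forall g X j, one_param g X -> exists D : 'I_m -> R[i],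
        dpi X (e j) = \sum_i D i *: e i /\
        forall i,
          is_derive (0 : R) (1 : R)
            (fun t => complex.Re (c (g t) i j)) (complex.Re (D i)) /\
          is_derive (0 : R) (1 : R)
            (fun t => complex.Im (c (g t) i j)) (complex.Im (D i))].

End OneParameter.

(* The data of a pair: a complex Lie algebra, a compact group, its adjoint
   action and the embedding [kemb] of its Lie algebra. Only the values of
   [Ad] on [grp], and of [kemb] on [lie_of grp], are meaningful. *)
Record gk_pair (R : realType) := GKPair {
  lie : vectType R[i];
  br : lie -> lie -> lie;
  deg : nat;
  grp : set 'M[R]_deg;
  Ad : 'M[R]_deg -> lie -> lie;
  kemb : 'M[R]_deg -> lie }.

Arguments kemb {R} _ _.

Record gkmod (R : realType) (P : gk_pair R) := GKMod {
  gk_sort :> lmodType R[i];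
  gk_act : 'M[R]_(deg P) -> gk_sort -> gk_sort;
  gk_lie : lie P -> gk_sort -> gk_sort;
  gk_act_linear : forall k, grp k -> linear (gk_act k);
  gk_act1 : forall v, gk_act 1%:M v = v;
  gk_actM : forall k l v, grp k -> grp l ->
    gk_act (k *m l) v = gk_act k (gk_act l v);
  gk_lie_linear : forall X, linear (gk_lie X);
  gk_lie_linearl : forall v, linear (gk_lie^~ v);
  gk_lie_br : forall X Y v,
    gk_lie (br X Y) v = gk_lie X (gk_lie Y v) - gk_lie Y (gk_lie X v);
  gk_act_lie : forall k X v, grp k ->
    gk_act k (gk_lie X v) = gk_lie (Ad k X) (gk_act k v);
  gk_finite : locally_finite (@grp R P) gk_act (fun X => gk_lie (kemb P X)) }.

Section Modules.
Variables (R : realType) (P : gk_pair R).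
Implicit Types (V W : gkmod P).

Definition gk_hom V W (f : V -> W) : Prop :=
  [/\ linear f, forall k v, grp k -> f (gk_act k v) = gk_act k (f v)
    & forall X v, f (gk_lie X v) = gk_lie X (f v)].

Definition gk_iso V W : Prop := exists f : V -> W, gk_hom f /\ bijective f.

Definition short_exact V' V V'' : Prop :=
  exists (i : V' -> V) (p : V -> V''),
  [/\ gk_hom i /\ gk_hom p, injective i, forall w, exists v, p v = w
    & forall v, p v = 0 <-> exists v', v = i v'].

Definition is_direct_sum V W (S : gkmod P) : Prop :=
  exists (i : V -> S) (j : W -> S),
  [/\ gk_hom i, gk_hom j, forall s, exists v w, s = i v + j w
    & forall v w, i v + j w = 0 -> v = 0 /\ w = 0].

Definition is_kernel V W (f : V -> W) (N : gkmod P) : Prop :=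
  exists i : N -> V,
  [/\ gk_hom i, injective i & forall v, f v = 0 <-> exists x, v = i x].

Definition is_cokernel V W (f : V -> W) (N : gkmod P) : Prop :=
  exists p : W -> N,
  [/\ gk_hom p, forall x, exists w, p w = x
    & forall w, p w = 0 <-> exists v, w = f v].

Definition full_abelian (C : gkmod P -> Prop) : Prop :=
  [/\ forall V W, gk_iso V W -> C V -> C W,
      forall V, (forall v : V, v = 0) -> C V,
      forall V W S, is_direct_sum V W S -> C V -> C W -> C S,
      forall V W (f : V -> W) N, gk_hom f -> is_kernel f N -> C V -> C W -> C N
    & forall V W (f : V -> W) N,
        gk_hom f -> is_cokernel f N -> C V -> C W -> C N].

Definition is_trivial V : Prop :=
  exists j : V -> R[i]^o,
  [/\ linear j /\ bijective j, forall k (v : V), grp k -> gk_act k v = v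
    & forall X (v : V), gk_lie X v = 0].

Definition is_tensor V W (T : gkmod P) : Prop :=
  exists b : V -> W -> T,
  [/\ (forall w, linear (b^~ w)) /\ (forall v, linear (b v)),
      forall (Z : lmodType R[i]) (c : V -> W -> Z),
        (forall w, linear (c^~ w)) -> (forall v, linear (c v)) ->
        exists! f : T -> Z, linear f /\ forall v w, f (b v w) = c v w,
      forall k v w, grp k -> gk_act k (b v w) = b (gk_act k v) (gk_act k w)
    & forall X v w,
        gk_lie X (b v w) = b (gk_lie X v) w + b v (gk_lie X w)].

(* Finiteness of a functional under the group [S] acting through [pi]. *)
Definition finite_functional n (S : set 'M[R]_n) (V : lmodType R[i])
    (pi : 'M[R]_n -> V -> V) (f : V -> R[i]^o) : Prop :=
  exists m (e : 'I_m -> V -> R[i]^o),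
  (exists a : 'I_m -> R[i], forall v, f v = \sum_i a i * e i v) /\
  forall k j, S k -> exists a : 'I_m -> R[i],
    forall v, e j (pi (invmx k) v) = \sum_i a i * e i v.

Definition is_dual V (D : gkmod P) : Prop :=
  exists j : D -> V -> R[i]^o,
  [/\ forall a x y v, j (a *: x + y) v = a * j x v + j y v,
      injective j,
      forall f : V -> R[i]^o, (exists x, f = j x) <->
        (linear f /\ finite_functional (@grp R P) (@gk_act R P V) f),
      forall k x v, grp k -> j (gk_act k x) v = j x (gk_act (invmx k) v)
    & forall X x v, j (gk_lie X x) v = - j x (gk_lie X v)].

Section Grothendieck.
Variable C : gkmod P -> Prop.

Inductive ses_rel :
    term {V : gkmod P | C V} -> term {V : gkmod P | C V} -> Prop :=
  | ses_rel_intro (V' V V'' : {V : gkmod P | C V}) :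
      short_exact (sval V') (sval V) (sval V'') ->
      ses_rel (TGen V) (TAdd (TGen V') (TGen V'')).

Definition Kgroup : abGroup := presented ses_rel.

(* Set to 0 outside [C]. *)
Definition cls (V : gkmod P) : Kgroup :=
  match pselect (C V) with
  | left CV => pgen ses_rel (exist _ V CV)
  | right _ => ab_zero
  end.

(* Tensor products, cohomology, restrictions are given by predicates
   ([is_tensor V W], [is_cohomology q V]) that determine a module up to
   isomorphism, hence up to its class; [cls_of D] is the class of the module
   in [C] satisfying [D], and 0 if there is none. *)
Definition cls_of (D : gkmod P -> Prop) : Kgroup :=
  match pselect (exists V, C V /\ D V) with
  | left h => cls (projT1 (cid h))
  | right _ => ab_zero
  end.

(* [Kgroup_ext f] is the additive map with [V] |-> f V. *)
Definition Kgroup_ext (A : abGroup) (f : gkmod P -> A) : Kgroup -> A :=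
  pext (rel := ses_rel) (fun X => f (sval X)).

Definition K_lincomb m (a : 'I_m -> int) (V : 'I_m -> gkmod P) : Kgroup :=
  \big[ab_add/ab_zero]_i ab_mulz (a i) (cls (V i)).

(* The partial product: [K_mul x y z] says that x * y is defined through
   representatives whose tensor products lie in [C], and equals z. *)
Definition K_mul (x y z : Kgroup) : Prop :=
  exists m n (a : 'I_m -> int) (V : 'I_m -> gkmod P)
    (b : 'I_n -> int) (W : 'I_n -> gkmod P) (T : 'I_m -> 'I_n -> gkmod P),
  [/\ (forall i, C (V i)) /\ (forall j, C (W j)),
      forall i j, C (T i j) /\ is_tensor (V i) (W j) (T i j),
      x = K_lincomb a V, y = K_lincomb b W
    & z = \big[ab_add/ab_zero]_i \big[ab_add/ab_zero]_j
            ab_mulz (a i * b j) (cls (T i j))].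

(* The partial dual, through representatives satisfying [E]. *)
Definition K_dual (E : gkmod P -> Prop) (x y : Kgroup) : Prop :=
  exists m (a : 'I_m -> int) (V D : 'I_m -> gkmod P),
  [/\ forall i, [/\ C (V i), C (D i), is_dual (V i) (D i) & E (V i)],
      x = K_lincomb a V & y = K_lincomb a D].

End Grothendieck.

Definition alt_sum (A : abGroup) (d : nat) (x : nat -> A) : A :=
  \big[ab_add/ab_zero]_(q < d.+1) ab_mulz ((-1) ^+ q) (x q).

End Modules.

Section LieSubspaces.
Variables (R : realType) (P : gk_pair R).
Implicit Types U V W J : {vspace lie P}.

Definition brv U V : {vspace lie P} :=
  <<[seq br x y | x <- vbasis U, y <- vbasis V]>>%VS.

Definition subalgebra U : Prop := (brv U U <= U)%VS.

Definition is_ideal U J : Prop := (J <= U)%VS /\ (brv U J <= J)%VS.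

Definition solvable_alg U : Prop :=
  exists n, iter n (fun W => brv W W) U = 0%VS.

Definition borel U : Prop :=
  [/\ subalgebra U, solvable_alg U
    & forall V, subalgebra V -> solvable_alg V -> (U <= V)%VS -> V = U].

Definition parabolic U : Prop :=
  subalgebra U /\ exists2 b, borel b & (b <= U)%VS.

Definition is_radical U J : Prop :=
  [/\ is_ideal U J, solvable_alg J
    & forall V, is_ideal U V -> solvable_alg V -> (V <= J)%VS].

(* The nilpotent radical [U, rad U], as opposed to the largest nilpotent
   ideal, which would contain the center of the ambient algebra. *)
Definition is_nilpotent_radical U J : Prop :=
  exists2 r, is_radical U r & J = brv U r.

Definition is_nilspace (X : lie P) U : Prop :=
  forall Y, Y \in U <-> exists n, iter n (br X) Y = 0.

Definition regular (X : lie P) : Prop :=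
  forall Y U V, is_nilspace X U -> is_nilspace Y V -> (\dim U <= \dim V)%N.

End LieSubspaces.

(* The real form g_0 is the fixed space of the conjugation [sigma]; the Cartan
   involution [theta] and the invariant form [B] are extended complex
   (bi)linearly from g_0 to g. *)
Record reductive_axioms (R : realType) (P : gk_pair R)
    (sigma theta : lie P -> lie P) (B : lie P -> lie P -> R[i]^o) : Prop :=
  ReductiveAxioms {
  ra_brl : forall Y : lie P, linear (fun X : lie P => br X Y);
  ra_brr : forall X : lie P, linear (br X);
  ra_alt : forall X : lie P, br X X = 0;
  ra_jacobi : forall X Y Z : lie P,
    br X (br Y Z) + br Y (br Z X) + br Z (br X Y) = 0;
  ra_sigma_semilinear : forall (a : R[i]) X Y,
    sigma (a *: X + Y) = (a^*)%C *: sigma X + sigma Y;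
  ra_sigmaK : involutive sigma;
  ra_sigma_br : forall X Y, sigma (br X Y) = br (sigma X) (sigma Y);
  (* g_0 is reductive; ideals of g_0 are the sigma-stable ideals of g *)
  ra_reductive : forall J : {vspace lie P},
    is_ideal fullv J -> (forall X, X \in J -> sigma X \in J) ->
    exists J' : {vspace lie P},
    [/\ is_ideal fullv J', forall X, X \in J' -> sigma X \in J',
        (J + J')%VS = fullv & (J :&: J')%VS = 0%VS];
  ra_theta_linear : linear theta;
  ra_thetaK : involutive theta;
  ra_theta_br : forall X Y, theta (br X Y) = br (theta X) (theta Y);
  ra_theta_sigma : forall X, theta (sigma X) = sigma (theta X);
  ra_compact : compact_matrix_group (@grp R P);
  ra_Ad_linear : forall k, grp k -> linear (@Ad R P k);
  ra_Ad1 : forall X : lie P, Ad 1%:M X = X;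
  ra_AdM : forall k l (X : lie P), grp k -> grp l ->
    Ad (k *m l) X = Ad k (Ad l X);
  ra_Ad_br : forall k (X Y : lie P), grp k ->
    Ad k (br X Y) = br (Ad k X) (Ad k Y);
  ra_Ad_sigma : forall k X, grp k -> Ad k (sigma X) = sigma (Ad k X);
  ra_Ad_theta : forall k X, grp k -> Ad k (theta X) = theta (Ad k X);
  ra_Ad_diff : locally_finite (@grp R P) (@Ad R P) (fun X => br (kemb P X));
  ra_kemb_linear : forall (a : R) X Y, lie_of (@grp R P) X ->
    lie_of (@grp R P) Y ->
    kemb P (a *: X + Y) = (a%:C)%C *: kemb P X + kemb P Y;
  ra_kemb_inj : forall X Y, lie_of (@grp R P) X -> lie_of (@grp R P) Y ->
    kemb P X = kemb P Y -> X = Y;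
  ra_kemb_br : forall X Y, lie_of (@grp R P) X -> lie_of (@grp R P) Y ->
    kemb P (X *m Y - Y *m X) = br (kemb P X) (kemb P Y);
  ra_kemb_Ad : forall k X, grp k -> lie_of (@grp R P) X ->
    kemb P (k *m X *m invmx k) = Ad k (kemb P X);
  ra_kemb_image : forall Y, (sigma Y = Y /\ theta Y = Y) <->
    exists2 X, lie_of (@grp R P) X & Y = kemb P X;
  ra_B_linear : forall X, linear (B X);
  ra_B_sym : forall X Y, B X Y = B Y X;
  ra_B_real : forall X Y, B (sigma X) (sigma Y) = ((B X Y)^*)%C;
  ra_B_br : forall X Y Z, B (br X Y) Z = B X (br Y Z);
  ra_B_Ad : forall k X Y, grp k -> B (Ad k X) (Ad k Y) = B X Y;
  ra_B_theta : forall X Y, B (theta X) (theta Y) = B X Y;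
  ra_B_neg : forall X, sigma X = X -> theta X = X -> X <> 0 ->
    (B X X : R[i]) < 0;
  ra_B_pos : forall X, sigma X = X -> theta X = - X -> X <> 0 ->
    0 < (B X X : R[i]) }.

Record reductive_pair (R : realType) := ReductivePair {
  rp_pair :> gk_pair R;
  rp_sigma : lie rp_pair -> lie rp_pair;
  rp_theta : lie rp_pair -> lie rp_pair;
  rp_form : lie rp_pair -> lie rp_pair -> R[i]^o;
  rp_axioms : reductive_axioms rp_sigma rp_theta rp_form }.

Record germane_parabolic (R : realType) (P : reductive_pair R) := Germane {
  levi : {vspace lie P};
  nrad : {vspace lie P};
  ge_parabolic : parabolic (levi + nrad)%VS;
  ge_nrad : is_nilpotent_radical (levi + nrad)%VS nrad;
  ge_direct : (levi :&: nrad)%VS = 0%VS;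
  ge_levi : subalgebra levi;
  ge_sigma : forall X, X \in levi -> rp_sigma X \in levi;
  ge_theta : forall X, X \in levi -> rp_theta X \in levi }.

Section LeviPair.
Variables (R : realType) (P : reductive_pair R) (Q : germane_parabolic P).

Definition parab : {vspace lie P} := (levi Q + nrad Q)%VS.

(* L \cap K: the normalizer in K of q and of theta(q) *)
Definition levi_grp : set 'M[R]_(deg P) :=
  [set k | grp k /\ forall X, X \in parab ->
     Ad k X \in parab /\ rp_theta (Ad k (rp_theta X)) \in parab].

Definition levi_pair : gk_pair R :=
  @GKPair R (subvs_of (levi Q))
    (fun X Y => vsproj (levi Q) (br (vsval X) (vsval Y)))
    (deg P) levi_grp
    (fun k X => vsproj (levi Q) (Ad k (vsval X)))
    (fun X => vsproj (levi Q) (kemb P X)).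

Local Notation u := (subvs_of (nrad Q)).

Definition form q (V : Type) := ('I_q -> u) -> V.

Definition upd q (x : 'I_q -> u) (i : 'I_q) (y : lie P) : 'I_q -> u :=
  fun j => if j == i then vsproj (nrad Q) y else x j.

Definition alternating q (V : lmodType R[i]) (f : form q V) : Prop :=
  (forall x i (a : R[i]) (y z : u),
     f (upd x i (vsval (a *: y + z))) =
     a *: f (upd x i (vsval y)) + f (upd x i (vsval z))) /\
  (forall x i j, i != j -> x i = x j -> f x = 0).

(* In the second sum the bracket is put in the place of x_i instead of in
   front, which changes the usual sign (-1)^(i+j) to (-1)^j. *)
Definition ce_diff q (V : gkmod P) (f : form q V) : form q.+1 V := fun x =>
  \sum_(i < q.+1)
      ((-1) ^+ i : R[i]) *: gk_lie (vsval (x i)) (f (fun s => x (lift i s)))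
  + \sum_(i < q.+1) \sum_(j < q.+1 | (i < j)%N)
      ((-1) ^+ j : R[i]) *:
        f (fun s => upd x i (br (vsval (x i)) (vsval (x j))) (lift j s)).

Definition cocycle q (V : gkmod P) (f : form q V) : Prop :=
  alternating f /\ forall x, ce_diff f x = 0.

Definition coboundary q (V : gkmod P) : form q V -> Prop :=
  match q with
  | 0 => fun f => f = (fun=> 0)
  | p.+1 => fun f => exists2 g : form p V, alternating g & f = ce_diff g
  end.

Definition form_act q (V : Type) (pi : V -> V) (k : 'M[R]_(deg P))
    (f : form q V) : form q V :=
  fun x => pi (f (fun s => vsproj (nrad Q) (Ad (invmx k) (vsval (x s))))).

Definition form_lie q (V : lmodType R[i]) (rho : V -> V) (X : lie P)
    (f : form q V) : form q V :=
  fun x => rho (f x) - \sum_s f (upd x s (br X (vsval (x s)))).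

(* [E] is the q-th exterior power of the dual of the nilpotent radical. *)
Definition is_ext q (E : gkmod levi_pair) : Prop :=
  exists j : E -> form q R[i]^o,
  [/\ forall a e e' x, j (a *: e + e') x = a *: j e x + j e' x,
      injective j,
      forall f, alternating f <-> exists e, f = j e,
      forall k e, levi_grp k -> j (gk_act (k : 'M[R]_(deg levi_pair)) e)
                                = form_act id k (j e)
    & forall (X : lie levi_pair) e,
        j (gk_lie X e) = form_lie (fun=> 0) (vsval X) (j e)].

Definition is_cohomology q (V : gkmod P) (H : gkmod levi_pair) : Prop :=
  exists p : form q V -> H,
  [/\ forall a f g, cocycle f -> cocycle g ->
        p (fun x => a *: f x + g x) = a *: p f + p g,
      forall h, exists2 f, cocycle f & p f = h,
      forall f, cocycle f -> (p f = 0 <-> coboundary f),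
      forall k f, levi_grp k -> cocycle f ->
        p (form_act (gk_act k) k f)
        = gk_act (k : 'M[R]_(deg levi_pair)) (p f)
    & forall (X : lie levi_pair) f, cocycle f ->
        p (form_lie (gk_lie (vsval X)) (vsval X) f) = gk_lie X (p f)].

Definition is_tensor_ext q (V T : gkmod levi_pair) : Prop :=
  exists2 E, is_ext q E & is_tensor V E T.

Definition admissible_pair (G : gkmod P -> Prop) (L : gkmod levi_pair -> Prop)
    : Prop :=
  [/\ full_abelian G /\ full_abelian L,
      (forall V, is_trivial V -> G V) /\ (forall q E, is_ext q E -> L E),
      forall q V T, L V -> is_tensor_ext q V T -> L T
    & forall q V H, G V -> is_cohomology q V H -> L H].

Section EulerMaps.
Variables (G : gkmod P -> Prop) (L : gkmod levi_pair -> Prop).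

Definition Hmap : Kgroup G -> Kgroup L :=
  Kgroup_ext (fun V =>
    alt_sum (\dim (nrad Q)) (fun q => cls_of L (is_cohomology q V))).

Definition Wq : Kgroup L :=
  alt_sum (\dim (nrad Q)) (fun q => cls_of L (@is_ext q)).

Definition Wq_mul : Kgroup L -> Kgroup L :=
  Kgroup_ext (fun V =>
    alt_sum (\dim (nrad Q)) (fun q => cls_of L (is_tensor_ext q V))).

(* Multiplication with the class of the top exterior power of u^*. *)
Definition top_mul : Kgroup L -> Kgroup L :=
  Kgroup_ext (fun V => cls_of L (is_tensor_ext (\dim (nrad Q)) V)).

End EulerMaps.

Record quadruple := Quadruple {
  catG : gkmod P -> Prop;
  catL : gkmod levi_pair -> Prop;
  KG : Kgroup catG -> Prop;
  KL : Kgroup catL -> Prop;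
  qd_admissible : admissible_pair catG catL;
  qd_KG : is_subgroup KG;
  qd_KL : is_subgroup KL;
  qd_H : forall X, KG X -> KL (Hmap catL X);
  qd_W : forall x, KL x -> KL (Wq_mul x) }.

Arguments KG : clear implicits.
Arguments KL : clear implicits.

Section Characters.
Variable A : quadruple.

Definition Wgraph (x y : Kgroup (catL A)) : Prop := y = Wq_mul x.

Definition Cq : abGroup := localization (KL A) Wgraph.

Definition Cfrac (x : Kgroup (catL A)) (a : nat) : Cq :=
  fraction (KL A) Wgraph x a.

Definition cq (X : Kgroup (catG A)) : Cq := Cfrac (Hmap (catL A) X) 1.

Definition C_mul (c d e : Cq) : Prop :=
  exists x y z a b,
  [/\ [/\ KL A x, KL A y & KL A z], K_mul x y z, c = Cfrac x a, d = Cfrac y b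
    & e = Cfrac z (a + b)].

(* The dual of x / W^a is y / (W^dual)^a for y dual to x. Since W^dual is
   (-1)^d [top exterior power of u] * W with d = dim u, this fraction is
   (-1)^(da) [top exterior power of u^*]^a * y / W^a. *)
Definition C_dual (E : gkmod levi_pair -> Prop) (c e : Cq) : Prop :=
  exists x y a (y' := iter a (@top_mul (catL A)) y),
  [/\ KL A x /\ KL A y', K_dual E x y, c = Cfrac x a
    & e = ab_mulz ((-1) ^+ (\dim (nrad Q) * a)) (Cfrac y' a)].

(* K(L)[W^-1], which contains C_q. *)
Definition Kloc : abGroup := localization (fun=> True) Wgraph.

Definition Kfrac (x : Kgroup (catL A)) (a : nat) : Kloc :=
  fraction (fun=> True) Wgraph x a.

End Characters.

End LeviPair.

Arguments KG {R P Q} _ _.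
Arguments KL {R P Q} _ _.

Record pair_map (R : realType) (P' P : gk_pair R) := PairMap {
  pm_lie : lie P' -> lie P;
  pm_grp : 'M[R]_(deg P') -> 'M[R]_(deg P) }.

Definition is_restriction (R : realType) (P' P : gk_pair R) (i : pair_map P' P)
    (V : gkmod P) (V' : gkmod P') : Prop :=
  exists j : V -> V',
  [/\ linear j, bijective j,
      forall k v, grp k -> j (gk_act (pm_grp i k) v) = gk_act k (j v)
    & forall X v, j (gk_lie (pm_lie i X) v) = gk_lie X (j v)].

Definition Kres (R : realType) (P' P : gk_pair R) (i : pair_map P' P)
    (C : gkmod P -> Prop) (C' : gkmod P' -> Prop) : Kgroup C -> Kgroup C' :=
  Kgroup_ext (fun V => cls_of C' (is_restriction i V)).

Record inclusion (R : realType) (P' P : reductive_pair R)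
    (i : pair_map P' P) : Prop := Inclusion {
  in_lie_linear : linear (pm_lie i);
  in_lie_inj : injective (pm_lie i);
  in_lie_br : forall X Y, pm_lie i (br X Y) = br (pm_lie i X) (pm_lie i Y);
  in_sigma : forall X, pm_lie i (rp_sigma X) = rp_sigma (pm_lie i X);
  in_theta : forall X, pm_lie i (rp_theta X) = rp_theta (pm_lie i X);
  in_form : forall X Y, rp_form (pm_lie i X) (pm_lie i Y) = rp_form X Y;
  in_grp : forall k, grp k -> grp (pm_grp i k);
  in_grpM : forall k l, grp k -> grp l ->
    pm_grp i (k *m l) = pm_grp i k *m pm_grp i l;
  in_grp_inj : forall k l, grp k -> grp l -> pm_grp i k = pm_grp i l -> k = l;
  in_grp_cont : {within @grp R P', continuous (pm_grp i)};
  in_Ad : forall k X, grp k ->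
    pm_lie i (Ad k X) = Ad (pm_grp i k) (pm_lie i X);
  (* the differential of [pm_grp i] is the restriction of [pm_lie i] *)
  in_diff : forall c X, one_param (@grp R P') c X ->
    exists2 Y, one_param (@grp R P) (pm_grp i \o c) Y
      & kemb P Y = pm_lie i (kemb P' X);
  in_regular : exists2 X, regular X & regular (pm_lie i X) }.

Section Relative.
Variables (R : realType) (P' P : reductive_pair R) (i : pair_map P' P).
Variables (Q' : germane_parabolic P') (Q : germane_parabolic P).

Record parabolic_inclusion : Prop := ParabolicInclusion {
  pi_parab : forall X, X \in parab Q' -> pm_lie i X \in parab Q;
  pi_levi : forall X, X \in levi Q' -> pm_lie i X \in levi Q;
  pi_levi_grp : forall k, levi_grp Q' k -> levi_grp Q (pm_grp i k);
  pi_nrad : forall X, X \in nrad Q' -> pm_lie i X \in nrad Q }.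

Definition levi_map : pair_map (levi_pair Q') (levi_pair Q) :=
  @PairMap R (levi_pair Q') (levi_pair Q)
    (fun X => vsproj (levi Q) (pm_lie i (vsval X))) (pm_grp i).

(* [T] is the tensor product of [V] with the restriction of the q-th exterior
   power of u^* to (l', L' \cap K'). *)
Definition is_tensor_ext_res q (V T : gkmod (levi_pair Q')) : Prop :=
  exists E E', [/\ @is_ext R P Q q E, is_restriction levi_map E E'
    & is_tensor V E' T].

Variables (A : quadruple Q) (A' : quadruple Q').

Local Notation L' := (catL A').

Record restrictable : Prop := Restrictable {
  re_G : forall V V', catG A V -> is_restriction i V V' -> catG A' V';
  re_L : forall V V', catL A V -> is_restriction levi_map V V' -> L' V';
  re_KG : forall X, KG A X -> KG A' (Kres i (catG A') X);
  re_KL : forall x, KL A x -> KL A' (Kres levi_map L' x) }.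

Definition Wres : Kgroup L' := Kres levi_map L' (Wq (catL A)).

Definition Wres_mul : Kgroup L' -> Kgroup L' :=
  Kgroup_ext (fun V =>
    alt_sum (\dim (nrad Q)) (fun q => cls_of L' (is_tensor_ext_res q V))).

Definition topres_mul : Kgroup L' -> Kgroup L' :=
  Kgroup_ext (fun V => cls_of L' (is_tensor_ext_res (\dim (nrad Q)) V)).

(* Multiplication with W_(q/q') = W_q| / W_q' in K(L')[W_q'^-1] makes sense as
   soon as L' is closed under tensoring with the constituents of W_q|. *)
Definition Wquot_multiplies : Prop :=
  forall q V T, L' V -> is_tensor_ext_res q V T -> L' T.

(* x * W_(q/q') = z in K(L')[W_q'^-1] *)
Definition Wquot_mul (x z : Kgroup L') : Prop :=
  Kfrac z 0 = Kfrac (Wres_mul x) 1.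

Record Wquot_closed : Prop := WquotClosed {
  wc_elt : exists2 w : Kgroup L', KL A' w & Kfrac w 0 = Kfrac Wres 1;
  wc_multiplies : Wquot_multiplies;
  wc_KL : forall x : Kgroup L', KL A' x -> exists2 z, KL A' z & Wquot_mul x z }.

(* Multiplication with W_(q/q') on C_q'(Q'). *)
Definition Cquot_graph (c d : Cq A') : Prop :=
  exists x z a, [/\ KL A' x /\ KL A' z, Wquot_mul x z, c = Cfrac x a
    & d = Cfrac z a].

Definition Cquot : abGroup := localization (fun=> True) Cquot_graph.

Definition Cqfrac (c : Cq A') (b : nat) : Cquot :=
  fraction (fun=> True) Cquot_graph c b.

Definition Cquot_mul (c d e : Cquot) : Prop :=
  exists x y z a a' b b',
  [/\ [/\ KL A' x, KL A' y & KL A' z], K_mul x y z, c = Cqfrac (Cfrac x a) b,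
      d = Cqfrac (Cfrac y a') b'
    & e = Cqfrac (Cfrac z (a + a')) (b + b')].

(* As in [C_dual]; every element of [Cquot] can be written with the
   denominator (W_q' * W_(q/q'))^a = (W_q|)^a. *)
Definition Cquot_dual (c e : Cquot) : Prop :=
  exists x y a (y' := iter a topres_mul y),
  [/\ KL A' x /\ KL A' y', K_dual (fun=> True) x y, c = Cqfrac (Cfrac x a) a
    & e = ab_mulz ((-1) ^+ (\dim (nrad Q) * a)) (Cqfrac (Cfrac y' a) a)].

(* The locally finite duals of [V] with respect to L \cap K and to
   L' \cap K' are the same space of functionals. *)
Definition same_dual (V : gkmod (levi_pair Q)) : Prop :=
  forall f : V -> R[i]^o, linear f ->
  finite_functional (levi_grp Q')
    (fun k => gk_act (pm_grp i k : 'M[R]_(deg (levi_pair Q)))) f ->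
  finite_functional (levi_grp Q) (@gk_act R (levi_pair Q) V) f.

End Relative.

(* Main.v *)
(* The compatibility with Euler characteristics amounts to the identity
   W_q' . H(V)| = W_q| . H'(V|) in K(L'). Both sides are the alternating sum over
   p and r of the "classes" of H^r(u'; C^p), where C^p = Hom(Lambda^p u, V) is
   regarded as a module over (q', L' \cap K'). On the one hand, long exact
   sequences replace the complex C^p by its cohomology H^p(u; V), whose
   restriction lies in L', and the complex computing H^r(u'; H^p(u; V)) has terms
   in L'. On the other hand, C^p = Hom(D, V) with u' acting nilpotently on D, and
   a filtration of D reduces the computation to trivial D, where H^r(u'; -) is
   H^r(u'; V) tensored with Lambda^p u^*. The modules in between need not lie in
   L', which is not closed under extensions; they have finite filtrations with
   subquotients in L', and the resulting class is independent of the filtration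
   because L' is closed under kernels and cokernels of its morphisms. *)

Require Import Defs.
From HB Require Import structures.
From mathcomp Require Import all_boot all_order all_algebra all_fingroup.
From mathcomp Require Import all_classical all_reals all_analysis.
From mathcomp Require Import complex ring zify.

Set Implicit Arguments.
Unset Strict Implicit.
Unset Printing Implicit Defensive.

Import Order.TTheory GRing.Theory Num.Theory.
Import numFieldNormedType.Exports.

Local Open Scope classical_set_scope.
Local Open Scope ring_scope.

(** * Abelian groups given by generators and relations *)

(** Two features of the data shape the work. The categories of a quadruple are closed under kernels
    and cokernels of their morphisms, but not under subobjects or extensions. So each piece of a
    filtration must be exhibited as the kernel or cokernel of a morphism between objects already in
    the category. For the largest quotient D'' of D with trivial action, Hom(D'', N) is the kernel
    of Hom(D, N) -> Hom(u', Hom(D, N)), x |-> (y |-> x(y .)).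

    Moreover u' must act on the complex Hom(Lambda u, V), which is therefore taken over the pairs
    (q, L cap K) and (q', L' cap K'), for modules whose restriction to the Levi pair lies in the
    category. Using these pairs requires Lie(L cap K) to lie in l. This is not part of the data; it
    follows from the definiteness of B(X, theta sigma X) and the maximality of a Borel subalgebra.
    That u' acts nilpotently on D rests on the fact that [q, rad q] acts nilpotently in
    finite-dimensional representations of q. *)

Lemma ab_addr0 (A : abGroup) : right_id (@ab_zero A) ab_add.
Proof. by move=> x; rewrite ab_addC ab_add0. Qed.

HB.instance Definition _ (A : abGroup) :=
  Monoid.isComLaw.Build A ab_zero (@ab_add A)
    (@ab_addA A) (@ab_addC A) (@ab_add0 A).

Section AbGroup.
Variable A : abGroup.
Implicit Types x y z : A.

Lemma ab_addrN x : ab_add x (ab_opp x) = ab_zero.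
Proof. by rewrite ab_addC ab_addN. Qed.

Lemma ab_addKr x y : ab_add (ab_opp x) (ab_add x y) = y.
Proof. by rewrite ab_addA ab_addN ab_add0. Qed.

Lemma ab_addI x y z : ab_add x y = ab_add x z -> y = z.
Proof. by move=> e; rewrite -(ab_addKr x y) e ab_addKr. Qed.

Lemma ab_oppP x y : ab_add x y = ab_zero -> y = ab_opp x.
Proof. by move=> e; apply: (@ab_addI x); rewrite e ab_addrN. Qed.

Lemma ab_opp0 : ab_opp ab_zero = ab_zero :> A.
Proof. by apply: esym; apply: ab_oppP; rewrite ab_add0. Qed.

Lemma ab_oppK x : ab_opp (ab_opp x) = x.
Proof. by apply: esym; apply: ab_oppP; rewrite ab_addN. Qed.

Lemma ab_addACA x y z t :
  ab_add (ab_add x y) (ab_add z t) = ab_add (ab_add x z) (ab_add y t).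
Proof. exact: Monoid.mulmACA. Qed.

Lemma ab_oppD x y : ab_opp (ab_add x y) = ab_add (ab_opp x) (ab_opp y).
Proof.
by apply: esym; apply: ab_oppP; rewrite ab_addACA !ab_addrN ab_add0.
Qed.

Lemma ab_mulz_sign q x :
  ab_mulz ((-1) ^+ q) x = if odd q then ab_opp x else x.
Proof.
by rewrite -signr_odd; case: (odd q); rewrite /= ?ab_addr0.
Qed.

Lemma ab_mulz_signS q x :
  ab_mulz ((-1) ^+ q.+1) x = ab_opp (ab_mulz ((-1) ^+ q) x).
Proof. by rewrite !ab_mulz_sign /=; case: (odd q) => //=; rewrite ab_oppK. Qed.

Lemma ab_mulz_signD q x y : ab_mulz ((-1) ^+ q) (ab_add x y) =
  ab_add (ab_mulz ((-1) ^+ q) x) (ab_mulz ((-1) ^+ q) y).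
Proof. by rewrite !ab_mulz_sign; case: (odd q) => //; rewrite ab_oppD. Qed.

Lemma ab_mulz_sign0 q : ab_mulz ((-1) ^+ q) ab_zero = ab_zero :> A.
Proof. by rewrite ab_mulz_sign ab_opp0 if_same. Qed.

Lemma alt_sumD d (x y : nat -> A) :
  alt_sum d (fun q => ab_add (x q) (y q)) = ab_add (alt_sum d x) (alt_sum d y).
Proof.
rewrite /alt_sum -big_split; apply: eq_bigr => q _; exact: ab_mulz_signD.
Qed.

Lemma eq_alt_sum d (x y : nat -> A) :
  (forall q, (q <= d)%N -> x q = y q) -> alt_sum d x = alt_sum d y.
Proof. by move=> e; apply: eq_bigr => q _; rewrite e // -ltnS. Qed.

Lemma alt_sumS d (x : nat -> A) :
  alt_sum d.+1 x = ab_add (alt_sum d x) (ab_mulz ((-1) ^+ d.+1) (x d.+1)).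
Proof. by rewrite /alt_sum big_ord_recr. Qed.

(** Euler-Poincare principle, with [x], [z], [b], [h] the classes of cochains, cocycles,
    coboundaries and cohomology: each [b n] occurs in degrees [n - 1] and [n] with opposite
    signs. *)
Lemma alt_sum_telescope d (x z b h : nat -> A) :
  (forall n, x n = ab_add (z n) (b n.+1)) ->
  (forall n, z n = ab_add (b n) (h n)) ->
  b 0%N = ab_zero -> b d.+1 = ab_zero -> alt_sum d x = alt_sum d h.
Proof.
move=> ex ez b0 bd.
(* The only term that a truncated sum leaves uncancelled is the coboundary in the next degree. *)
suff {bd} e n : alt_sum n x =
    ab_add (alt_sum n h) (ab_mulz ((-1) ^+ n) (b n.+1)).
  by rewrite e bd ab_mulz_sign0 ab_addr0.
elim: n => [|n IHn].
  by rewrite /alt_sum !big_ord1 ex ez b0 ab_add0 ab_mulz_signD.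
rewrite !alt_sumS IHn ex ez !ab_mulz_signD (ab_mulz_signS _ (b n.+1)).
rewrite -!ab_addA; congr ab_add; rewrite 2!ab_addA ab_addrN ab_add0.
by rewrite ab_addC.
Qed.

End AbGroup.

Definition additive_map (A B : abGroup) (f : A -> B) : Prop :=
  forall x y, f (ab_add x y) = ab_add (f x) (f y).

Section AdditiveMap.
Variables (A B : abGroup) (f : A -> B).
Hypothesis fD : additive_map f.

Lemma additive_map0 : f ab_zero = ab_zero.
Proof. by apply: (@ab_addI _ (f ab_zero)); rewrite -fD ab_addr0 ab_addr0. Qed.

Lemma additive_mapN x : f (ab_opp x) = ab_opp (f x).
Proof. by apply: ab_oppP; rewrite -fD ab_addrN additive_map0. Qed.

Lemma additive_map_mulz m x : f (ab_mulz m x) = ab_mulz m (f x).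
Proof.
have fiter n : f (iter n (ab_add x) ab_zero) = iter n (ab_add (f x)) ab_zero.
  by elim: n => [|n IHn]; rewrite ?additive_map0 //= fD IHn.
by case: m => n /=; rewrite ?additive_mapN ?fD fiter.
Qed.

Lemma additive_map_sum (I : Type) (r : seq I) (x : I -> A) :
  f (\big[ab_add/ab_zero]_(i <- r) x i) =
  \big[ab_add/ab_zero]_(i <- r) f (x i).
Proof. by apply: big_morph; [exact: fD | exact: additive_map0]. Qed.

Lemma additive_map_alt_sum d (x : nat -> A) :
  f (alt_sum d x) = alt_sum d (fun q => f (x q)).
Proof.
rewrite /alt_sum additive_map_sum; apply: eq_bigr => q _.
exact: additive_map_mulz.
Qed.

End AdditiveMap.

Lemma additive_map_comp (A B C : abGroup) (f : A -> B) (g : B -> C) :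
  additive_map f -> additive_map g -> additive_map (g \o f).
Proof. by move=> fD gD x y /=; rewrite fD gD. Qed.

Lemma additive_map_iter (A : abGroup) (f : A -> A) n :
  additive_map f -> additive_map (iter n f).
Proof. by move=> fD; elim: n => // n IHn x y /=; rewrite IHn fD. Qed.

Section PresentedTheory.
Variables (G : Type) (rel : term G -> term G -> Prop).

Lemma tclassD s t :
  tclass rel (TAdd s t) = ab_add (tclass rel s : presented rel) (tclass rel t).
Proof. by apply/esym/tclass_eq/teq_add; exact: trepr_class. Qed.

Lemma tclassN s :
  tclass rel (TOpp s) = ab_opp (tclass rel s : presented rel).
Proof. by apply/esym/tclass_eq/teq_opp; exact: trepr_class. Qed.

(** Makes equality in a presented group analysable: an equality of classes yields a derivation, on
    which [fraction_eq] does induction. *)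
Lemma tclass_term_eq s t : tclass rel s = tclass rel t -> term_eq rel s t.
Proof.
move=> e; apply: teq_trans (trepr_class rel t); rewrite -e.
exact/teq_sym/trepr_class.
Qed.

Lemma presented_ind (S : presented rel -> Prop) :
  (forall g, S (pgen rel g)) -> S ab_zero ->
  (forall x, S x -> S (ab_opp x)) ->
  (forall x y, S x -> S y -> S (ab_add x y)) -> forall x, S x.
Proof.
move=> Sg S0 SN SD x; rewrite -(treprK x).
elim: (trepr x) => [g||t St|s Ss t St].
- exact: Sg.
- exact: S0.
- by rewrite tclassN; exact: SN.
- by rewrite tclassD; exact: SD.
Qed.

Lemma pgen_rel s t : rel s t -> tclass rel s = tclass rel t.
Proof. by move=> st; apply: tclass_eq; exact: teq_rel. Qed.

Variables (A : abGroup) (f : G -> A).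
Hypothesis f_rel : forall s t, rel s t -> term_eval f s = term_eval f t.

Lemma term_eval_eq s t : term_eq rel s t -> term_eval f s = term_eval f t.
Proof.
elim=> //=.
- by move=> u v r _ -> _ ->.
- by move=> u v _ ->.
- by move=> u v u' v' _ -> _ ->.
- by move=> *; rewrite ab_addA.
- by move=> *; rewrite ab_addC.
- by move=> *; rewrite ab_add0.
- by move=> *; rewrite ab_addN.
Qed.

Lemma pext_class t : pext f (tclass rel t) = term_eval f t.
Proof. exact/term_eval_eq/trepr_class. Qed.

Lemma pext_gen g : pext f (pgen rel g) = f g.
Proof. exact: pext_class. Qed.

Lemma pextD : additive_map (pext (rel := rel) f).
Proof. by move=> x y; rewrite -(treprK x) -(treprK y) -tclassD !pext_class. Qed.

End PresentedTheory.

Lemma additive_map_presented (G : Type) (rel : term G -> term G -> Prop)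
    (A : abGroup) (f g : presented rel -> A) :
  additive_map f -> additive_map g ->
  (forall x, f (pgen rel x) = g (pgen rel x)) -> f =1 g.
Proof.
move=> fD gD e; elim/presented_ind => // [|x|x y].
- by rewrite !additive_map0.
- by rewrite !additive_mapN // => ->.
- by rewrite fD gD => -> ->.
Qed.

Section LocalizationTheory.
Variables (A : abGroup) (S : A -> Prop) (T : A -> A -> Prop).
Implicit Types x y : A.

Local Notation frac := (fraction S T).

Lemma fractionE x a (Sx : S x) :
  frac x a = pgen (@frac_rel A S T) (exist _ x Sx, a).
Proof.
rewrite /fraction; case: pselect => // Sx'.
by congr (pgen _ (exist _ _ _, _)); exact: Prop_irrelevance.
Qed.

Lemma fractionD x y a : S x -> S y -> S (ab_add x y) ->
  frac (ab_add x y) a = ab_add (frac x a) (frac y a).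
Proof.
move=> Sx Sy Sxy; rewrite !fractionE -tclassD.
by apply: pgen_rel; exact: frac_rel_add.
Qed.

Lemma fraction_mul x y a : S x -> S y -> T x y -> frac y a.+1 = frac x a.
Proof.
by move=> Sx Sy Txy; rewrite !fractionE; apply: pgen_rel; exact: frac_rel_mul.
Qed.

Variable W : A -> A.
Hypothesis S_W : forall x, S x -> S (W x).
Hypothesis WD : additive_map W.
Hypothesis TW : forall x y, T x y <-> y = W x.

Lemma fraction_iter x a n : S x -> frac (iter n W x) (n + a) = frac x a.
Proof.
move=> Sx; elim: n => // n IHn.
have Sn : S (iter n W x) by elim: (n) => //= m; exact: S_W.
by rewrite addSn (@fraction_mul (iter n W x)) //=; [exact: S_W | exact/TW].
Qed.

(* Clearing a common denominator [W^N] makes every defining relation of the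
   localization an identity, so equal fractions agree after clearing any large
   enough denominator. *)
Lemma fraction_eq x y a b : S x -> S y -> frac x a = frac y b ->
  exists N, [/\ (a <= N)%N, (b <= N)%N & iter (N - a) W x = iter (N - b) W y].
Proof.
move=> Sx Sy; rewrite !fractionE => /tclass_term_eq.
(* [ev N] multiplies x / W^a by W^N. Subtraction truncates for [a > N], hence the claim only for [N]
   beyond some [N0]. *)
pose ev N : term ({x : A | S x} * nat) -> A :=
  term_eval (fun g => iter (N - g.2) W (sval g.1)).
suff H s t : term_eq (@frac_rel A S T) s t ->
    exists N0, forall N, (N0 <= N)%N -> ev N s = ev N t.
  move=> /H[N0 e]; exists (maxn N0 (maxn a b)).
  split; [by rewrite !leq_max leqnn orbT | by rewrite !leq_max leqnn !orbT |].
  by rewrite -[LHS]/(ev _ (TGen (exist _ x Sx, a))) e // leq_max leqnn.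
elim=> {s t}.
- move=> _ _ [x' y' z c e|x' y' c /TW e].
    by exists 0%N => N _; rewrite /ev /= e additive_map_iter.
  by exists c.+1 => N cN; rewrite /ev /= e -iterSr subnSK.
- by exists 0%N.
- by move=> s t _ [N0 e]; exists N0 => N /e ->.
- move=> s t r _ [N0 e] _ [N1 e']; exists (maxn N0 N1) => N.
  by rewrite geq_max => /andP[/e -> /e' ->].
- move=> s t _ [N0 e]; exists N0 => N /e h.
  by rewrite -[LHS]/(ab_opp (ev N s)) h.
- move=> s s' t t' _ [N0 e] _ [N1 e']; exists (maxn N0 N1) => N.
  rewrite geq_max => /andP[/e h /e' h'].
  by rewrite -[LHS]/(ab_add (ev N s) (ev N t)) h h'.
- by move=> s t r; exists 0%N => N _; rewrite /ev /= ab_addA.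
- by move=> s t; exists 0%N => N _; rewrite /ev /= ab_addC.
- by move=> s; exists 0%N => N _; rewrite /ev /= ab_add0.
- by move=> s; exists 0%N => N _; rewrite /ev /= ab_addN.
Qed.

End LocalizationTheory.

(** * Matrix coefficients *)

Section ComplexCoefficients.
Variable R : realType.

Definition cderiv (f : R -> R[i]) (D : R[i]) : Prop :=
  is_derive (0 : R) (1 : R) (fun t => complex.Re (f t)) (complex.Re D) /\
  is_derive (0 : R) (1 : R) (fun t => complex.Im (f t)) (complex.Im D).

Lemma cderiv_cst c : cderiv (fun=> c) 0.
Proof. by split; exact: is_derive_cst. Qed.

Lemma cderivD f g D E : cderiv f D -> cderiv g E ->
  cderiv (fun t => f t + g t) (D + E).
Proof.
case=> fr fi [gr gi]; split; rewrite raddfD /=; under eq_fun do rewrite raddfD /=;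
exact: is_deriveD.
Qed.

Lemma cderivM f g D E : cderiv f D -> cderiv g E ->
  cderiv (fun t => f t * g t) (f 0 * E + g 0 * D).
Proof.
case=> fr fi [gr gi]; split.
- rewrite (_ : (fun t => _) = (fun t => complex.Re (f t)) * (fun t => complex.Re (g t))
      - (fun t => complex.Im (f t)) * (fun t => complex.Im (g t))); last first.
    by apply/funext => t /=; rewrite !fctE; case: (f t) => a b; case: (g t) => c d.
  apply: is_derive_eq.
  rewrite /=; case: (f 0) => a b; case: (g 0) => c d; case: D fr fi => D1 D2 fr fi.
  case: E gr gi => E1 E2 gr gi /=; rewrite /GRing.scale /=; ring.
- rewrite (_ : (fun t => _) = (fun t => complex.Re (f t)) * (fun t => complex.Im (g t))
      + (fun t => complex.Im (f t)) * (fun t => complex.Re (g t))); last first.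
    by apply/funext => t /=; rewrite !fctE; case: (f t) => a b; case: (g t) => c d.
  apply: is_derive_eq.
  rewrite /=; case: (f 0) => a b; case: (g 0) => c d; case: D fr fi => D1 D2 fr fi.
  case: E gr gi => E1 E2 gr gi /=; rewrite /GRing.scale /=; ring.
Qed.

Lemma cderivZ c f D : cderiv f D -> cderiv (fun t => c * f t) (c * D).
Proof.
by move=> fD; have := cderivM (cderiv_cst c) fD; rewrite mulr0 addr0.
Qed.

Lemma eq_cderiv f g D : f =1 g -> cderiv f D -> cderiv g D.
Proof. by move=> /funext ->. Qed.

Lemma cderiv_sum (I : Type) (r : seq I) (f : I -> R -> R[i]) (D : I -> R[i]) :
  (forall i, cderiv (f i) (D i)) ->
  cderiv (fun t => \sum_(i <- r) f i t) (\sum_(i <- r) D i).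
Proof.
move=> fD; elim: r => [|i r IHr].
  by rewrite big_nil; apply: eq_cderiv (cderiv_cst 0) => t; rewrite big_nil.
rewrite big_cons; apply: eq_cderiv (cderivD (fD i) IHr) => t.
by rewrite big_cons.
Qed.

(** Serves contragredient actions, where [g t] is replaced by its inverse [g (- t)]. *)
Lemma cderiv_opp f D : cderiv f D -> cderiv (fun t => f (- t)) (- D).
Proof.
have H (h : R -> R) d : is_derive (0 : R) (1 : R) h d ->
    is_derive (0 : R) (1 : R) (fun t => h (- t)) (- d).
  move=> hd; have h' : is_derive (- 0 : R) (1 : R) h d by rewrite oppr0.
  have := is_derive1_comp h' (is_deriveN (is_derive_id (0 : R) (1 : R))).
  by rewrite mulrN1.
by case: D => a b [/= fr fi]; split; exact: H.
Qed.

Lemma cderiv_uniq f D E : cderiv f D -> cderiv f E -> D = E.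
Proof.
by case: D => a b; case: E => c d [/= [_ <-] [_ <-]] [/= [_ <-] [_ <-]].
Qed.

End ComplexCoefficients.

Section ContinuousCoefficients.
Variables (R : realType) (n : nat) (K : set 'M[R]_n).
Implicit Types f g : 'M[R]_n -> R[i].

Definition ccont f : Prop :=
  {within K, continuous (fun k => complex.Re (f k))} /\
  {within K, continuous (fun k => complex.Im (f k))}.

Lemma ccontP f : ccont f <-> forall x, K x ->
  complex.Re (f y) @[y --> within K (nbhs x)] --> complex.Re (f x) /\
  complex.Im (f y) @[y --> within K (nbhs x)] --> complex.Im (f x).
Proof.
split=> [[/subspace_continuousP fr /subspace_continuousP fi] x Kx|fc].
  by split; [exact: fr | exact: fi].
by split; apply/subspace_continuousP => x /fc[].
Qed.

Lemma eq_ccont f g : (forall k, K k -> f k = g k) -> ccont f -> ccont g.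
Proof.
move=> fg /ccontP fc; apply/ccontP => x Kx; have [fr fi] := fc x Kx.
by split; rewrite -fg //; apply: cvg_trans; [apply: near_eq_cvg| exact: fr
  |apply: near_eq_cvg| exact: fi]; near=> y; rewrite fg //; near: y;
  exact: withinT.
Unshelve. all: by end_near. Qed.

Lemma ccont_cst c : ccont (fun=> c).
Proof. by apply/ccontP => x _; split; exact: cvg_cst. Qed.

Lemma ccontD f g : ccont f -> ccont g -> ccont (fun k => f k + g k).
Proof.
move=> /ccontP fc /ccontP gc; apply/ccontP => x Kx.
have [fr fi] := fc x Kx; have [gr gi] := gc x Kx.
by split; rewrite raddfD /=; under eq_fun do rewrite raddfD /=; exact: cvgD.
Qed.

Lemma ccontM f g : ccont f -> ccont g -> ccont (fun k => f k * g k).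
Proof.
move=> /ccontP fc /ccontP gc; apply/ccontP => x Kx.
have [fr fi] := fc x Kx; have [gr gi] := gc x Kx.
have eR (a b : R[i]) : complex.Re (a * b) =
    complex.Re a * complex.Re b - complex.Im a * complex.Im b.
  by case: a b => [? ?] [? ?].
have eI (a b : R[i]) : complex.Im (a * b) =
    complex.Re a * complex.Im b + complex.Im a * complex.Re b.
  by case: a b => [? ?] [? ?].
split; rewrite ?eR ?eI; under eq_fun do rewrite ?eR ?eI.
  by apply: cvgB; exact: cvgM.
by apply: cvgD; exact: cvgM.
Qed.

Lemma ccont_sum (I : Type) (r : seq I) (f : I -> 'M[R]_n -> R[i]) :
  (forall i, ccont (f i)) -> ccont (fun k => \sum_(i <- r) f i k).
Proof.
move=> fc; elim: r => [|i r IHr].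
  by apply: eq_ccont (ccont_cst 0) => k _; rewrite big_nil.
by apply: eq_ccont (ccontD (fc i) IHr) => k _; rewrite big_cons.
Qed.

End ContinuousCoefficients.

Lemma ccont_comp (R : realType) n m (K : set 'M[R]_n) (L : set 'M[R]_m)
    (h : 'M[R]_n -> 'M[R]_m) (f : 'M[R]_m -> R[i]) :
  {within K, continuous h} -> (forall k, K k -> L (h k)) -> ccont L f ->
  ccont K (f \o h).
Proof.
move=> /subspace_continuousP hc KL /ccontP fc; apply/ccontP => x Kx.
have hx : h y @[y --> within K (nbhs x)] --> within L (nbhs (h x)).
  move=> A hA; have H : nbhs x (fun y => K y -> L (h y) -> A (h y)).
    exact: (hc x Kx (fun z => L z -> A z) hA).
  change (nbhs x (fun y => K y -> A (h y))).
  by apply: filterS H => y Hy Ky; apply: Hy => //; exact: KL.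
have [fr fi] := fc _ (KL _ Kx); split.
- exact: cvg_comp hx fr.
- exact: cvg_comp hx fi.
Qed.

Lemma cvg_mx (R : realType) m n (T : Type) (F : set_system T) {FF : Filter F}
    (f : T -> 'M[R]_(m, n)) (M : 'M[R]_(m, n)) :
  (forall i j, f x i j @[x --> F] --> M i j) -> f x @[x --> F] --> M.
Proof.
move=> fc A [P MP PA].
have FP : \forall x \near F, forall i j, P i j (f x i j).
  by apply: filter_forall => i; apply: filter_forall => j; apply: fc; exact: MP.
by change (F (fun x => A (f x))); apply: filterS FP => x Px; exact: PA.
Qed.

(** Cramer's rule: the entries of the inverse are cofactors divided by the determinant. It makes the
    coefficients of k |-> k^-1 on dual spaces continuous. *)
Lemma invmx_continuous (R : realType) n (K : set 'M[R]_n) :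
  (forall k, K k -> k \in unitmx) -> {within K, continuous (@invmx R n)}.
Proof.
move=> Ku; apply/subspace_continuousP => x Kx.
have cc i j : (fun y : 'M[R]_n => y i j) @ within K (nbhs x) --> (x : 'M[R]_n) i j.
  by apply: cvg_within_filter; exact: coord_continuous.
have cdet m (f : 'M[R]_n -> 'M[R]_m) :
    (forall i j, (fun y => f y i j) @ within K (nbhs x) --> f x i j) ->
    (fun y => \det (f y)) @ within K (nbhs x) --> \det (f x).
  move=> fc; rewrite /determinant.
  apply: cvg_big => [|s _]; first exact: add_continuous.
  apply: cvgMl_tmp.
  by apply: cvg_big => [|i _]; [exact: mul_continuous | exact: fc].
apply: cvg_mx => i j.
rewrite (_ : invmx x i j = (\det x)^-1 * cofactor x j i); last first.
  by rewrite /invmx Ku // !mxE.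
apply: (@cvg_trans _ ((fun y : 'M[R]_n => (\det y)^-1 * cofactor y j i) @ within K (nbhs x))).
  apply: near_eq_cvg; near=> y; rewrite /from_subspace /invmx ifT ?mxE //; apply: Ku.
  near: y; exact: withinT.
apply: cvgM.
  apply: cvgV; last by apply: cdet.
  by rewrite -unitfE -unitmxE Ku.
rewrite /cofactor; apply: cvgMl_tmp; apply: cdet => a b.
under eq_fun do rewrite !mxE; rewrite !mxE; exact: cc.
Unshelve. all: by end_near. Qed.

(** * Locally finite vectors *)

Section LinearProp.
Variables (F : fieldType) (V W : lmodType F) (f : V -> W).
Hypothesis f_lin : linear f.

Lemma lin0 : f 0 = 0.
Proof. by have := f_lin (-1) 0 0; rewrite !scaleN1r !addNr. Qed.

Lemma linD x y : f (x + y) = f x + f y.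
Proof. by have := f_lin 1 x y; rewrite !scale1r. Qed.

Lemma linZ a x : f (a *: x) = a *: f x.
Proof. by have := f_lin a x 0; rewrite !addr0 lin0 addr0. Qed.

Lemma linN x : f (- x) = - f x.
Proof. by rewrite -scaleN1r linZ scaleN1r. Qed.

Lemma linB x y : f (x - y) = f x - f y.
Proof. by rewrite linD linN. Qed.

Lemma lin_sum (I : Type) (r : seq I) (P : pred I) (x : I -> V) :
  f (\sum_(i <- r | P i) x i) = \sum_(i <- r | P i) f (x i).
Proof. by apply: big_morph; [exact: linD | exact: lin0]. Qed.

End LinearProp.

Definition subspace_pred (F : fieldType) (V : lmodType F) (S : V -> Prop) :=
  S 0 /\ forall a x y, S x -> S y -> S (a *: x + y).

Section SubspacePred.
Variables (F : fieldType) (V : lmodType F) (S : V -> Prop).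
Hypothesis hS : subspace_pred S.

Lemma subsp0 : S 0. Proof. by case: hS. Qed.

Lemma subspD x y : S x -> S y -> S (x + y).
Proof. by move=> Sx Sy; have [_ /(_ 1 x y Sx Sy)] := hS; rewrite scale1r. Qed.

Lemma subspZ a x : S x -> S (a *: x).
Proof. by move=> Sx; have [S0 /(_ a x 0 Sx S0)] := hS; rewrite addr0. Qed.

Lemma subspN x : S x -> S (- x).
Proof. by move=> Sx; rewrite -scaleN1r; exact: subspZ. Qed.

Lemma subspB x y : S x -> S y -> S (x - y).
Proof. by move=> Sx Sy; apply: subspD => //; exact: subspN. Qed.

Lemma subsp_sum (I : Type) (r : seq I) (P : pred I) (x : I -> V) :
  (forall i, P i -> S (x i)) -> S (\sum_(i <- r | P i) x i).
Proof. by move=> Sx; apply: big_ind => //; [exact: subsp0 | exact: subspD]. Qed.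

End SubspacePred.

(** As long as some vector of [S] escapes the row space of [A], adjoining it raises the rank, which
    is bounded by [m]. This brings subspaces given by predicates into matrix algebra. *)
Lemma subspace_matrix (F : fieldType) m (S : 'rV[F]_m -> Prop) :
  subspace_pred S -> exists A : 'M[F]_m, forall v, S v <-> (v <= A)%MS.
Proof.
move=> hS.
have H r : forall A : 'M[F]_m, (forall v, (v <= A)%MS -> S v) ->
    (m - \rank A <= r)%N -> exists A : 'M[F]_m, forall v, S v <-> (v <= A)%MS.
  elim: r => [|r IHr] A SA rA.
    exists A => v; split; last exact: SA.
    move=> _; apply: submx_full; rewrite /row_full eqn_leq rank_leq_row /=.
    by move: rA; rewrite leqn0 subn_eq0.
  have [h|/existsNP[v /not_implyP[Sv nv]]] := pselect (forall v, S v -> (v <= A)%MS).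
    by exists A => v; split; [exact: h | exact: SA].
  apply: (IHr (v + A)%MS).
    move=> w /sub_addsmxP[[u1 u2] /= ->].
    apply: (subspD hS); last by apply: SA; exact: submxMl.
    rewrite (_ : u1 *m v = u1 0 0 *: v); first exact: (subspZ hS).
    by rewrite -mul_scalar_mx; congr (_ *m _); apply: mx11_scalar.
  have : (\rank A < \rank (v + A)%MS)%N.
    rewrite ltn_neqAle mxrankS ?addsmxSr // andbT.
    apply: contra_notN nv => /eqP e.
    have := mxrank_leqif_sup (addsmxSr v A).
    by case=> _; rewrite e eqxx => /esym; rewrite addsmx_sub => /andP[].
  by move: rA; have := rank_leq_col A; lia.
apply: (H m 0); last by rewrite mxrank0 subn0.
by move=> v; rewrite submx0 => /eqP ->; exact: subsp0.
Qed.

Section LocallyFiniteVectors.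
Variables (R : realType) (n : nat) (K : set 'M[R]_n).

Section Ops.
Variables (V : lmodType R[i]) (pi dpi : 'M[R]_n -> V -> V).

Definition lf_system (J : finType) (e : J -> V) : Prop :=
  exists c : 'M[R]_n -> J -> J -> R[i],
  [/\ forall k j, K k -> pi k (e j) = \sum_i c k i j *: e i,
      forall i j, ccont K (fun k => c k i j)
    & forall g X j, one_param K g X -> exists D : J -> R[i],
        dpi X (e j) = \sum_i D i *: e i /\
        forall i, cderiv (fun t => c (g t) i j) (D i)].

(** Local finiteness of a single vector. An arbitrary finite index type lets sums of vectors use
    [J + J'] and elementary tensors use products of index types. *)
Definition lf_vec (v : V) : Prop :=
  exists (J : finType) (e : J -> V),
    (exists a : J -> R[i], v = \sum_i a i *: e i) /\ lf_system e.

Lemma lf_vecP : (forall v, lf_vec v) <-> locally_finite K pi dpi.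
Proof.
split=> h v; last first.
  have [m [e [c [ea ec cc dd]]]] := h v.
  by exists 'I_m, e; split => //; exists c; split.
have [J [e [[a ->] [c [ec cc dd]]]]] := h v.
have sumE (f : J -> V) : \sum_i f i = \sum_(i < #|J|) f (enum_val i).
  by rewrite (reindex (@enum_val _ J)) //; apply: onW_bij; exact: enum_val_bij.
exists #|J|, (e \o enum_val),
  (fun k => \matrix_(i, j) c k (enum_val i) (enum_val j)); split.
- by exists (a \o enum_val); rewrite sumE.
- move=> k j Kk /=; rewrite ec // sumE; apply: eq_bigr => i _; by rewrite mxE.
- move=> i j; under eq_fun do rewrite mxE; under [X in _ /\ {within _, continuous X}]eq_fun do rewrite mxE.
  exact: cc.
- move=> g X j gX; have [D [eD dD]] := dd _ _ (enum_val j) gX.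
  exists (D \o enum_val); split; first by rewrite /= eD sumE.
  move=> i; under eq_fun do rewrite mxE.
  under [X in _ /\ is_derive _ _ X _]eq_fun do rewrite mxE.
  exact: dD.
Qed.

Lemma lf_vec0 : lf_vec 0.
Proof.
exists void, (fun=> 0); split; first by exists (fun=> 0); rewrite big_pred0 //; case.
by exists (fun _ _ _ => 0); split => [k []|[]|g X []].
Qed.

Lemma lf_vecZ a v : lf_vec v -> lf_vec (a *: v).
Proof.
case=> J [e [[b ->] s]]; exists J, e; split => //.
exists (fun i => a * b i); rewrite scaler_sumr.
by apply: eq_bigr => i _; rewrite scalerA.
Qed.

Lemma lf_vecD v w : lf_vec v -> lf_vec w -> lf_vec (v + w).
Proof.
case=> J [e [[a ->] [c [ec cc dd]]]] [J' [e' [[a' ->] [c' [ec' cc' dd']]]]].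
exists (J + J')%type, (fun x => match x with inl i => e i | inr i => e' i end).
have sE (f : J + J' -> V) : \sum_x f x = \sum_i f (inl i) + \sum_i f (inr i).
  by rewrite big_sumType.
split.
  exists (fun x => match x with inl i => a i | inr i => a' i end).
  by rewrite sE.
exists (fun k x y => match x, y with
  | inl i, inl j => c k i j | inr i, inr j => c' k i j | _, _ => 0 end); split.
- move=> k [j|j] Kk; rewrite sE ?ec ?ec' //.
    rewrite [X in _ = _ + X]big1 ?addr0 // => i _; exact: scale0r.
  rewrite [X in _ = X + _]big1 ?add0r // => i _; exact: scale0r.
- by case=> i [] j; do ?exact: cc; do ?exact: cc'; exact: ccont_cst.
- move=> g X [j|j] gX.
    have [D [eD dD]] := dd _ _ j gX.
    exists (fun x => match x with inl i => D i | inr _ => 0 end); split.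
      rewrite sE eD [X in _ = _ + X]big1 ?addr0 // => i _; exact: scale0r.
    by case=> // i; exact: cderiv_cst.
  have [D [eD dD]] := dd' _ _ j gX.
  exists (fun x => match x with inr i => D i | inl _ => 0 end); split.
    rewrite sE eD [X in _ = X + _]big1 ?add0r // => i _; exact: scale0r.
  by case=> // i; exact: cderiv_cst.
Qed.

Lemma lf_vec_subspace : subspace_pred lf_vec.
Proof.
by split=> [|a x y hx hy]; [exact: lf_vec0 | apply: lf_vecD => //; exact: lf_vecZ].
Qed.

Hypothesis pi_lin : forall k, K k -> linear (pi k).
Hypothesis dpi_lin : forall X, linear (dpi X).

(** Passes from the auxiliary matrix [c], which depends on a chosen family, to the coefficients k
    |-> l(pi(k) v), which depend on [v] and [l] only. *)
Lemma lf_vec_coef v (l : V -> R[i]^o) : linear l -> lf_vec v ->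
  ccont K (fun k => l (pi k v)) /\
  forall g X, one_param K g X -> cderiv (fun t => l (pi (g t) v)) (l (dpi X v)).
Proof.
move=> l_lin [J [e [[a ->] [c [ec cc dd]]]]].
have E k : K k -> l (pi k (\sum_i a i *: e i)) =
    \sum_j \sum_i (a j * l (e i)) * c k i j.
  move=> Kk; rewrite (lin_sum (pi_lin Kk)) (lin_sum l_lin).
  apply: eq_bigr => j _; rewrite (linZ (pi_lin Kk)) (linZ l_lin) ec //.
  rewrite (lin_sum l_lin) scaler_sumr; apply: eq_bigr => i _.
  by rewrite (linZ l_lin) /GRing.scale /=; ring.
split.
  apply: (@eq_ccont _ _ _ (fun k => \sum_j \sum_i (a j * l (e i)) * c k i j)).
    by move=> k Kk; rewrite E.
  apply: ccont_sum => j; apply: ccont_sum => i.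
  by apply: ccontM (cc _ _); exact: ccont_cst.
move=> g X gX; have [Kg _ _] := gX.
apply: (@eq_cderiv _ (fun t => \sum_j \sum_i (a j * l (e i)) * c (g t) i j)).
  by move=> t; rewrite E.
have [D HD] := choice (fun j => dd g X j gX).
have -> : l (dpi X (\sum_i a i *: e i)) =
    \sum_j \sum_i (a j * l (e i)) * D j i.
  rewrite (lin_sum (dpi_lin X)) (lin_sum l_lin).
  apply: eq_bigr => j _; rewrite (linZ (dpi_lin X)) (linZ l_lin) (HD j).1.
  rewrite (lin_sum l_lin) scaler_sumr; apply: eq_bigr => i _.
  by rewrite (linZ l_lin) /GRing.scale /=; ring.
apply: cderiv_sum => j; apply: cderiv_sum => i; apply: cderivZ; exact: (HD j).2.
Qed.

End Ops.

(* The combinations of a finite spanning family that lie in the stable subspace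
   [S] form the row space of a matrix, whose rows give a spanning family of the
   part of the span in [S]. *)
Lemma lf_vec_transfer (V W : lmodType R[i]) (pi dpi : 'M[R]_n -> V -> V)
    (pi' dpi' : 'M[R]_n -> W -> W) (S : V -> Prop) (p : V -> W) :
  (forall k, K k -> linear (pi k)) -> (forall X, linear (dpi X)) ->
  subspace_pred S -> (forall k x, K k -> S x -> S (pi k x)) ->
  (forall X x, S x -> S (dpi X x)) ->
  (forall a x y, S x -> S y -> p (a *: x + y) = a *: p x + p y) ->
  (forall k x, K k -> S x -> p (pi k x) = pi' k (p x)) ->
  (forall X x, S x -> p (dpi X x) = dpi' X (p x)) ->
  forall v, S v -> lf_vec pi dpi v -> lf_vec pi' dpi' (p v).
Proof.
move=> pi_lin dpi_lin hS Spi Sdpi p_lin p_pi p_dpi v Sv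
  [J [e0 [[a0 ev] [c0 [ec0 cc0 dd0]]]]].
pose m := #|J|; pose e (i : 'I_m) := e0 (enum_val i).
pose comb (a : 'rV[R[i]]_m) := \sum_i a 0 i *: e i.
have sumE (f : J -> V) : \sum_i f i = \sum_(i < #|J|) f (enum_val i).
  by rewrite (reindex (@enum_val _ J)) //; apply: onW_bij; exact: enum_val_bij.
pose c k : 'M[R[i]]_m := \matrix_(i, j) c0 k (enum_val j) (enum_val i).
have comb_lin : linear comb.
  move=> a x y; rewrite /comb scaler_sumr -big_split; apply: eq_bigr => i _.
  by rewrite !mxE scalerDl scalerA.
have combM q (M : 'M[R[i]]_(q, m)) (x : 'rV[R[i]]_q) : comb (x *m M) =
    \sum_l x 0 l *: comb (row l M).
  rewrite mulmx_sum_row (lin_sum comb_lin); apply: eq_bigr => l _.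
  by rewrite (linZ comb_lin).
have combd l : comb (delta_mx 0 l) = e l.
  rewrite /comb (bigD1 l) //= !mxE !eqxx scale1r big1 ?addr0 // => i il.
  by rewrite mxE eqxx (negPf il) scale0r.
have ec k x : K k -> pi k (comb x) = comb (x *m c k).
  move=> Kk; rewrite combM /comb (lin_sum (pi_lin _ Kk)); apply: eq_bigr => l _.
  rewrite (linZ (pi_lin _ Kk)) /e ec0 // sumE; congr (_ *: _).
  by apply: eq_bigr => i _; rewrite !mxE.
have [A SA] : exists A : 'M[R[i]]_m, forall x, S (comb x) <-> (x <= A)%MS.
  apply: subspace_matrix; split; first by rewrite (lin0 comb_lin); exact: subsp0.
  by move=> a x y Sx Sy; rewrite comb_lin; have [_] := hS; apply.
have p_sum q (x : 'I_q -> R[i]) (w : 'I_q -> V) : (forall i, S (w i)) ->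
    p (\sum_i x i *: w i) = \sum_i x i *: p (w i).
  move=> Sw; have p0 : p 0 = 0.
    have := p_lin (-1) 0 0 (subsp0 hS) (subsp0 hS).
    by rewrite !scaleN1r !addNr.
  have H (s : seq 'I_q) : S (\sum_(i <- s) x i *: w i) /\
      p (\sum_(i <- s) x i *: w i) = \sum_(i <- s) x i *: p (w i).
    elim: s => [|i s [IH1 IH2]]; first by rewrite !big_nil; split=> //; exact: subsp0.
    rewrite !big_cons; split; first by have [_] := hS; apply.
    by rewrite p_lin // IH2.
  exact: (H _).2.
have Srow l : S (comb (row l A)) by apply/SA; exact: row_sub.
have expand x : S (comb x) ->
    p (comb x) = \sum_l (x *m pinvmx A) 0 l *: p (comb (row l A)).
  by move=> /SA xA; rewrite -{1}(mulmxKpV xA) combM p_sum.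
exists 'I_m, (fun l => p (comb (row l A))); split.
  pose a : 'rV[R[i]]_m := \row_i a0 (enum_val i).
  have ea : v = comb a.
    by rewrite ev sumE; apply: eq_bigr => i _; rewrite mxE.
  by exists (fun l => (a *m pinvmx A) 0 l); rewrite -expand -?ea.
(* [pinvmx A] reads off coordinates with respect to the rows of [A]. The indices are swapped because
   coefficient vectors are rows here, while a system stores them in columns. *)
exists (fun k i j => (A *m c k *m pinvmx A) j i); split.
- move=> k j Kk; rewrite -p_pi // ec // expand; last by rewrite -ec //; exact: Spi.
  apply: eq_bigr => i _; congr (_ *: _).
  by rewrite -!row_mul mxE.
- move=> i j.
  apply: (@eq_ccont _ _ _ (fun k => \sum_s \sum_r (pinvmx A s i * A j r) *
      c0 k (enum_val s) (enum_val r))).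
    move=> k _; rewrite mxE; apply: eq_bigr => s _.
    by rewrite !mxE mulr_suml; apply: eq_bigr => r _; rewrite !mxE; ring.
  by do 2!apply: ccont_sum => ?; apply: ccontM (cc0 _ _); exact: ccont_cst.
- move=> g X j gX; have [D HD] := choice (fun j => dd0 g X j gX).
  pose Dm : 'M[R[i]]_m := \matrix_(i, j) D (enum_val i) (enum_val j).
  have eD x : dpi X (comb x) = comb (x *m Dm).
    rewrite combM /comb (lin_sum (dpi_lin X)); apply: eq_bigr => l _.
    rewrite (linZ (dpi_lin X)) /e (HD _).1 sumE; congr (_ *: _).
    by apply: eq_bigr => i _; rewrite !mxE.
  exists (fun i => (A *m Dm *m pinvmx A) j i); split.
    rewrite -p_dpi // eD expand; last by rewrite -eD; exact: Sdpi.
    by apply: eq_bigr => i _; congr (_ *: _); rewrite -!row_mul mxE.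
  move=> i; rewrite [X in cderiv _ X](_ : _ = \sum_s \sum_r
      (pinvmx A s i * A j r) * D (enum_val r) (enum_val s)); last first.
    rewrite mxE; apply: eq_bigr => s _.
    by rewrite !mxE mulr_suml; apply: eq_bigr => r _; rewrite !mxE; ring.
  apply: (@eq_cderiv _ (fun t => \sum_s \sum_r (pinvmx A s i * A j r) *
      c0 (g t) (enum_val s) (enum_val r))).
    move=> t; rewrite mxE; apply: eq_bigr => s _.
    by rewrite !mxE mulr_suml; apply: eq_bigr => r _; rewrite !mxE; ring.
  do 2!apply: cderiv_sum => ?; apply: cderivZ; exact: (HD _).2.
Qed.

End LocallyFiniteVectors.

(** * Subquotients of modules *)

Section SubquotientSpace.
Variables (F : fieldType) (V : lmodType F) (S U : V -> Prop).

(** A chosen representative of the coset x + U. Replacing [x] by 0 outside [S] makes all values lie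
    in [S], so the subquotient is a subtype of [V] and inherits its choice structure and
    universe. *)
Definition canon (x : V) : V :=
  xget 0 [set y | S y /\ U (y - (if `[< S x >] then x else 0))].

Definition subquot : Type := {x : V | `[< S x /\ canon x = x >]}.

Hypothesis hS : subspace_pred S.
Hypothesis hU : subspace_pred U.

Lemma canonP x : S x -> S (canon x) /\ U (canon x - x).
Proof.
move=> Sx; rewrite /canon asboolT //.
case: xgetP => [y _ //|/(_ x)[]].
by split => //; rewrite subrr; exact: subsp0.
Qed.

Lemma canon_eq x y : S x -> S y -> U (x - y) -> canon x = canon y.
Proof.
move=> Sx Sy Uxy; rewrite /canon !asboolT //; congr xget.
apply/predeqP => z; split=> -[Sz Uz]; split=> //.
  by have := subspD hU Uz Uxy; rewrite addrA subrK.
by have := subspB hU Uz Uxy; rewrite opprB addrA subrK.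
Qed.

Lemma canon_dom x : S (canon x).
Proof.
have [Sx|nSx] := pselect (S x); first by have [] := canonP Sx.
suff -> : canon x = canon 0 by have [] := canonP (subsp0 hS).
rewrite /canon (asboolF nSx) asboolT //; exact: subsp0.
Qed.

Lemma canonK x : canon (canon x) = canon x.
Proof.
have [Sx|nSx] := pselect (S x).
  by have [Sc Uc] := canonP Sx; exact: canon_eq.
have -> : canon x = canon 0.
  by rewrite /canon (asboolF nSx) asboolT //; exact: subsp0.
have [Sc Uc] := canonP (subsp0 hS); apply: canon_eq => //; exact: subsp0.
Qed.

Definition sqpi (x : V) : subquot :=
  exist _ (canon x) (asboolT (conj (canon_dom x) (canonK x))).

Lemma sqpi_eq x y : S x -> S y -> U (x - y) -> sqpi x = sqpi y.
Proof. by move=> Sx Sy /(canon_eq Sx Sy) e; apply: val_inj. Qed.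

Lemma sqpiP x y : S x -> S y -> sqpi x = sqpi y -> U (x - y).
Proof.
move=> Sx Sy [e]; have [_ Ux] := canonP Sx; have [_ Uy] := canonP Sy.
have := subspB hU Uy Ux; rewrite e.
by rewrite opprB addrC addrA subrK.
Qed.

Lemma sqvalP (q : subquot) : S (sval q).
Proof. by have /asboolP[] := valP q. Qed.

Lemma sqvalK (q : subquot) : sqpi (sval q) = q.
Proof. by apply: val_inj; have /asboolP[] := valP q. Qed.

Lemma sqpi_val x : S x -> U (sval (sqpi x) - x).
Proof. by move=> /canonP[]. Qed.

Definition sqzero := sqpi 0.
Definition sqopp (p : subquot) := sqpi (- sval p).
Definition sqadd (p q : subquot) := sqpi (sval p + sval q).
Definition sqscale a (p : subquot) := sqpi (a *: sval p).

Lemma sqpiD x y : S x -> S y -> sqpi (x + y) = sqadd (sqpi x) (sqpi y).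
Proof.
move=> Sx Sy; apply: sqpi_eq; rewrite ?/sqadd.
- exact: subspD.
- by apply: subspD => //; exact: sqvalP.
- rewrite opprD addrACA; apply: (subspD hU); rewrite -opprB;
  by apply: (subspN hU); exact: sqpi_val.
Qed.

Lemma sqpiN x : S x -> sqpi (- x) = sqopp (sqpi x).
Proof.
move=> Sx; apply: sqpi_eq; rewrite ?/sqopp.
- exact: subspN.
- by apply: (subspN hS); exact: sqvalP.
- by rewrite opprK addrC; exact: sqpi_val.
Qed.

Lemma sqpiZ a x : S x -> sqpi (a *: x) = sqscale a (sqpi x).
Proof.
move=> Sx; apply: sqpi_eq; rewrite ?/sqscale.
- exact: subspZ.
- by apply: (subspZ hS); exact: sqvalP.
- by rewrite -scalerBr; apply: (subspZ hU); rewrite -opprB;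
  apply: (subspN hU); exact: sqpi_val.
Qed.

Lemma sq_ind (T : subquot -> Prop) : (forall x, S x -> T (sqpi x)) -> forall q, T q.
Proof. by move=> h q; rewrite -(sqvalK q); apply: h; exact: sqvalP. Qed.

Lemma sqaddA : associative sqadd.
Proof.
elim/sq_ind=> x Sx; elim/sq_ind=> y Sy; elim/sq_ind=> z Sz.
by rewrite -!sqpiD ?addrA //; exact: subspD.
Qed.

Lemma sqaddC : commutative sqadd.
Proof. by move=> p q; rewrite /sqadd addrC. Qed.

Lemma sqadd0 : left_id sqzero sqadd.
Proof.
by elim/sq_ind=> x Sx; rewrite -sqpiD ?add0r //; exact: subsp0.
Qed.

Lemma sqaddN : left_inverse sqzero sqopp sqadd.
Proof.
by elim/sq_ind=> x Sx; rewrite -sqpiN // -sqpiD ?addNr //; exact: subspN.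
Qed.

HB.instance Definition _ := Choice.on subquot.
HB.instance Definition _ :=
  GRing.isZmodule.Build subquot sqaddA sqaddC sqadd0 sqaddN.

Lemma sqscaleA a b p : sqscale a (sqscale b p) = sqscale (a * b) p.
Proof.
elim/sq_ind: p => x Sx; rewrite -!sqpiZ ?scalerA //; exact: subspZ.
Qed.

Lemma sqscale1 : left_id 1 sqscale.
Proof. by elim/sq_ind=> x Sx; rewrite -sqpiZ ?scale1r. Qed.

Lemma sqscaleDr : right_distributive sqscale +%R.
Proof.
move=> a; elim/sq_ind=> x Sx; elim/sq_ind=> y Sy.
rewrite -[sqpi x + sqpi y]/(sqadd _ _) -[RHS]/(sqadd _ _).
rewrite -!(sqpiD, sqpiZ) ?scalerDr //;
  do ?[exact: (subspD hS)|exact: (subspZ hS)].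
Qed.

Lemma sqscaleDl p : {morph sqscale^~ p : a b / a + b}.
Proof.
move=> a b; elim/sq_ind: p => x Sx.
by rewrite -[RHS]/(sqadd _ _) -!(sqpiD, sqpiZ) ?scalerDl //; exact: subspZ.
Qed.

HB.instance Definition _ :=
  GRing.Zmodule_isLmodule.Build F subquot sqscaleA sqscale1 sqscaleDr sqscaleDl.

Definition subquot_lmod : lmodType F := subquot.

Lemma subquot_exists : exists (W : lmodType F) (p : V -> W),
  [/\ forall a x y, S x -> S y -> p (a *: x + y) = a *: p x + p y,
      forall q, exists2 x, S x & p x = q
    & forall x, S x -> (p x = 0 <-> U x)].
Proof.
exists subquot_lmod, sqpi; split.
- move=> a x y Sx Sy; rewrite sqpiD ?sqpiZ //; exact: subspZ.
- by move=> q; exists (sval q); [exact: sqvalP | exact: sqvalK].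
- move=> x Sx; split=> [/(sqpiP Sx (subsp0 hS))|Ux]; first by rewrite subr0.
  by apply: sqpi_eq => //; [exact: subsp0 | rewrite subr0].
Qed.

End SubquotientSpace.

(* A space with operators satisfying the axioms of a [gkmod] on a subspace. *)
Record ambient (R : realType) (P : gk_pair R) := Ambient {
  am_sort :> lmodType R[i];
  am_act : 'M[R]_(deg P) -> am_sort -> am_sort;
  am_lie : lie P -> am_sort -> am_sort;
  am_dom : am_sort -> Prop;
  am_dom_subspace : subspace_pred am_dom;
  am_dom_act : forall k x, grp k -> am_dom x -> am_dom (am_act k x);
  am_dom_lie : forall X x, am_dom x -> am_dom (am_lie X x);
  am_act_linear : forall k, grp k -> linear (am_act k);
  am_act1 : forall x, am_act 1%:M x = x;
  am_actM : forall k l x, grp k -> grp l -> am_dom x ->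
    am_act (k *m l) x = am_act k (am_act l x);
  am_lie_linear : forall X, linear (am_lie X);
  am_lie_linearl : forall a X Y x, am_dom x ->
    am_lie (a *: X + Y) x = a *: am_lie X x + am_lie Y x;
  am_lie_br : forall X Y x, am_dom x ->
    am_lie (br X Y) x = am_lie X (am_lie Y x) - am_lie Y (am_lie X x);
  am_act_lie : forall k X x, grp k -> am_dom x ->
    am_act k (am_lie X x) = am_lie (Ad k X) (am_act k x);
  am_finite : forall x, am_dom x ->
    lf_vec (@grp R P) am_act (fun X => am_lie (kemb P X)) x }.

Arguments am_act {R P} _.
Arguments am_lie {R P} _.
Arguments am_dom {R P} _.

(** A [gk_pair] is bare data; these are the group axioms that constructing modules over it
    requires. *)
Record gk_group (R : realType) (P : gk_pair R) : Prop := GkGroup {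
  gg_1 : @grp R P 1%:M;
  gg_M : forall k l, @grp R P k -> grp l -> @grp R P (k *m l);
  gg_unit : forall k, @grp R P k -> k \in unitmx;
  gg_V : forall k, @grp R P k -> @grp R P (invmx k) }.

Section Subquotients.
Variables (R : realType) (P : gk_pair R).
Hypothesis hP : gk_group P.

Definition gk_ambient (V : gkmod P) : ambient P.
Proof.
apply: (@Ambient R P V (@gk_act R P V) (@gk_lie R P V) (fun=> True)) => //.
- exact: gk_act_linear.
- exact: gk_act1.
- by move=> *; rewrite gk_actM.
- exact: gk_lie_linear.
- by move=> a X Y x _; exact: gk_lie_linearl.
- by move=> *; rewrite gk_lie_br.
- by move=> *; rewrite gk_act_lie.
- by move=> x _; have /lf_vecP := @gk_finite R P V; apply.
Defined.

Definition stable (X : ambient P) (S : X -> Prop) : Prop :=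
  [/\ subspace_pred S, forall x, S x -> am_dom X x,
      forall k x, grp k -> S x -> S (am_act X k x)
    & forall Y x, S x -> S (am_lie X Y x)].

(** [Q] is the subquotient S / U, seen through a total function [p] that is constrained on [S]
    only. *)
Definition sq_proj (X : ambient P) (S U : X -> Prop) (Q : gkmod P) (p : X -> Q) : Prop :=
  [/\ forall a x y, S x -> S y -> p (a *: x + y) = a *: p x + p y,
      forall q, exists2 x, S x & p x = q,
      forall x, S x -> (p x = 0 <-> U x),
      forall k x, grp k -> S x -> p (am_act X k x) = gk_act k (p x)
    & forall Y x, S x -> p (am_lie X Y x) = gk_lie Y (p x)].

(** The operators are defined through a section [s] of [p]; stability of [U] makes them independent
    of it, and [lf_vec_transfer] supplies local finiteness. *)
Lemma sq_exists (X : ambient P) (S U : X -> Prop) :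
  stable S -> stable U -> (forall x, U x -> S x) ->
  exists (Q : gkmod P) (p : X -> Q), sq_proj S U p.
Proof.
case=> [hS Sd Sa Sl] [hU Ud Ua Ul] US.
have [W [p [p_lin p_surj p_ker]]] := subquot_exists hS hU.
have /choice[s sP] : forall q, exists x, S x /\ p x = q.
  by move=> q; have [x Sx e] := p_surj q; exists x.
have Ss q : S (s q) by have [] := sP q.
have ps q : p (s q) = q by have [] := sP q.
have pB x y : S x -> S y -> p (x - y) = p x - p y.
  move=> Sx Sy; have := p_lin (-1) y x Sy Sx.
  by rewrite !scaleN1r addrC => ->; rewrite addrC.
have Uker x : S x -> U (x - s (p x)).
  by move=> Sx; apply/p_ker; [exact: subspB | rewrite pB // ps subrr].
have pU x y : S x -> S y -> U (x - y) -> p x = p y.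
  by move=> Sx Sy h; apply/eqP; rewrite -subr_eq0 -pB //; apply/eqP/p_ker;
    [exact: subspB |].
pose ga k q := p (am_act X k (s q)).
pose gl Y q := p (am_lie X Y (s q)).
have p_act k x : grp k -> S x -> p (am_act X k x) = ga k (p x).
  move=> Kk Sx; apply: pU; [exact: Sa|exact: Sa|].
  by rewrite -(linB (am_act_linear Kk)); apply: Ua => //; exact: Uker.
have p_lie Y x : S x -> p (am_lie X Y x) = gl Y (p x).
  move=> Sx; apply: pU; [exact: Sl|exact: Sl|].
  by rewrite -(linB (am_lie_linear Y)); apply: Ul => //; exact: Uker.
have ind (T : W -> Prop) : (forall x, S x -> T (p x)) -> forall q, T q.
  by move=> h q; rewrite -(ps q); exact: h.
have SZ a x y : S x -> S y -> S (a *: x + y) by case: hS => _; apply.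
unshelve epose (Q := @GKMod R P W ga gl _ _ _ _ _ _ _ _).
- move=> k Kk a; elim/ind=> x Sx; elim/ind=> y Sy.
  by rewrite -p_lin // -!p_act ?am_act_linear ?p_lin //; [exact: Sa|exact: Sa|exact: SZ].
- by elim/ind=> x Sx; rewrite -p_act ?am_act1 //; exact: gg_1.
- move=> k l; elim/ind=> x Sx Kk Kl; rewrite -!p_act ?am_actM //;
  by [exact: Sd|exact: Sa|exact: gg_M].
- move=> Y a; elim/ind=> x Sx; elim/ind=> y Sy.
  by rewrite -p_lin // -!p_lie ?am_lie_linear ?p_lin //; [exact: Sl|exact: Sl|exact: SZ].
- elim/ind=> x Sx a Y Z; rewrite -!p_lie // am_lie_linearl; last exact: Sd.
  by rewrite p_lin //; exact: Sl.
- move=> Y Z; elim/ind=> x Sx; have Sx' A : S (am_lie X A x) by exact: Sl.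
  rewrite -!(p_lie _ _ Sx) -!(p_lie _ _ (Sx' _)) am_lie_br ?pB //; last exact: Sd.
    by apply: Sl.
  by apply: Sl.
- move=> k Y; elim/ind=> x Sx Kk; rewrite -!(p_act, p_lie) ?am_act_lie //;
  by [exact: Sd|exact: Sa|exact: Sl].
- apply/lf_vecP; elim/ind=> x Sx.
  apply: (@lf_vec_transfer _ _ _ _ _ (@am_act _ _ X) (fun Y => am_lie X (kemb P Y)) _ _ S) => //.
  + exact: am_act_linear.
  + by move=> Y; exact: am_lie_linear.
  + by move=> *; exact: Sl.
  + by move=> *; exact: p_lie.
  + by apply: am_finite; exact: Sd.
by exists Q, p; split.
Qed.

End Subquotients.

Section SubquotientMaps.
Variables (R : realType) (P : gk_pair R).

Lemma sq_proj0 (X : ambient P) (S U : X -> Prop) (Q : gkmod P) (p : X -> Q) :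
  subspace_pred S -> sq_proj S U p -> p 0 = 0.
Proof.
move=> hS [p_lin _ _ _ _].
by have := p_lin (-1) 0 0 (subsp0 hS) (subsp0 hS); rewrite !scaleN1r !addNr.
Qed.

Lemma sq_projB (X : ambient P) (S U : X -> Prop) (Q : gkmod P) (p : X -> Q) x y :
  sq_proj S U p -> S x -> S y -> p (x - y) = p x - p y.
Proof.
move=> [p_lin _ _ _ _] Sx Sy; have := p_lin (-1) y x Sy Sx.
by rewrite !scaleN1r addrC => ->; rewrite addrC.
Qed.

Lemma sq_proj_eq (X : ambient P) (S U : X -> Prop) (Q : gkmod P) (p : X -> Q) x y :
  subspace_pred S -> sq_proj S U p -> S x -> S y -> (p x = p y <-> U (x - y)).
Proof.
move=> hS hp Sx Sy; have [_ _ p_ker _ _] := hp; have SB := subspB hS Sx Sy.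
rewrite -(p_ker _ SB) (sq_projB hp) //.
by split=> [->|/eqP]; [rewrite subrr | rewrite subr_eq0 => /eqP].
Qed.

(** Formulated for a linear relation [r] in place of a function, since the connecting homomorphism
    of a long exact sequence arises from a relation between cocycles. *)
Lemma sq_hom (X Y : ambient P) (S U : X -> Prop) (S' U' : Y -> Prop)
    (Q Q' : gkmod P) (p : X -> Q) (p' : Y -> Q') (r : X -> Y -> Prop) :
  subspace_pred S -> subspace_pred S' -> sq_proj S U p -> sq_proj S' U' p' ->
  (forall x, S x -> exists2 y, S' y & r x y) ->
  (forall a x y x' y', r x y -> r x' y' -> r (a *: x + x') (a *: y + y')) ->
  (forall k x y, grp k -> S x -> r x y -> r (am_act X k x) (am_act Y k y)) ->
  (forall A x y, S x -> r x y -> r (am_lie X A x) (am_lie Y A y)) ->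
  (forall k x, grp k -> S x -> S (am_act X k x)) ->
  (forall A x, S x -> S (am_lie X A x)) ->
  (forall k x, grp k -> S' x -> S' (am_act Y k x)) ->
  (forall A x, S' x -> S' (am_lie Y A x)) ->
  (forall x y, r x y -> U x -> S' y -> U' y) ->
  exists f : Q -> Q', gk_hom f /\ forall x y, S x -> S' y -> r x y -> f (p x) = p' y.
Proof.
move=> hS hS' hp hp' r_ex r_lin r_act r_lie Sa Sl Sa' Sl' r_ker.
have [p_lin p_surj p_ker p_act p_lie] := hp.
have [p'_lin p'_surj p'_ker p'_act p'_lie] := hp'.
have /choice[f fP] : forall q, exists q', exists x y,
    [/\ S x, S' y, r x y, p x = q & p' y = q'].
  move=> q; have [x Sx <-] := p_surj q; have [y Sy rxy] := r_ex x Sx.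
  by exists (p' y), x, y.
have fE x y : S x -> S' y -> r x y -> f (p x) = p' y.
  move=> Sx Sy rxy; have [x0 [y0 [Sx0 Sy0 r0 e0 <-]]] := fP (p x).
  (* Independence of representatives: the difference of two related pairs is related, and [r]
     carries [U] into [U']. *)
  apply/(sq_proj_eq hS' hp') => //; rewrite addrC -scaleN1r.
  apply: (r_ker (-1 *: x + x0)); first exact: r_lin.
    by rewrite scaleN1r addrC; apply/(sq_proj_eq hS hp).
  by rewrite scaleN1r addrC; exact: subspB.
exists f; split => //; split.
- move=> a q1 q2; have [x1 Sx1 <-] := p_surj q1; have [x2 Sx2 <-] := p_surj q2.
  have [y1 Sy1 r1] := r_ex x1 Sx1; have [y2 Sy2 r2] := r_ex x2 Sx2.
  rewrite -p_lin // (fE _ _ Sx1 Sy1 r1) (fE _ _ Sx2 Sy2 r2).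
  rewrite (fE _ (a *: y1 + y2)) ?p'_lin //; last exact: r_lin.
    by have [_] := hS; apply.
  by have [_] := hS'; apply.
- move=> k q Kk; have [x Sx <-] := p_surj q; have [y Sy rxy] := r_ex x Sx.
  rewrite -p_act // (fE _ _ Sx Sy rxy) (fE _ (am_act Y k y)) ?p'_act //;
  by [exact: Sa|exact: Sa'|exact: r_act].
- move=> A q; have [x Sx <-] := p_surj q; have [y Sy rxy] := r_ex x Sx.
  rewrite -p_lie // (fE _ _ Sx Sy rxy) (fE _ (am_lie Y A y)) ?p'_lie //;
  by [exact: Sl|exact: Sl'|exact: r_lie].
Qed.

Lemma sq_hom_fun (X Y : ambient P) (S U : X -> Prop) (S' U' : Y -> Prop)
    (Q Q' : gkmod P) (p : X -> Q) (p' : Y -> Q') (h : X -> Y) :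
  stable S -> stable S' -> sq_proj S U p -> sq_proj S' U' p' ->
  linear h -> (forall x, S x -> S' (h x)) ->
  (forall k x, grp k -> S x -> h (am_act X k x) = am_act Y k (h x)) ->
  (forall A x, S x -> h (am_lie X A x) = am_lie Y A (h x)) ->
  (forall x, S x -> U x -> U' (h x)) ->
  exists f : Q -> Q', gk_hom f /\ forall x, S x -> f (p x) = p' (h x).
Proof.
move=> [hS _ Sa Sl] [hS' _ Sa' Sl'] hp hp' h_lin hSS h_act h_lie hUU.
have [|||||||||] := @sq_hom X Y S U S' U' Q Q' p p'
  (fun x y => S x /\ y = h x) hS hS' hp hp'.
- by move=> x Sx; exists (h x) => //; exact: hSS.
- move=> a x y x' y' [Sx ->] [Sx' ->]; split; last by rewrite h_lin.
  by have [_] := hS; apply.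
- by move=> k x y Kk Sx [_ ->]; rewrite h_act //; split=> //; exact: Sa.
- by move=> A x y Sx [_ ->]; rewrite h_lie //; split=> //; exact: Sl.
- exact: Sa.
- exact: Sl.
- exact: Sa'.
- exact: Sl'.
- by move=> x y [Sx ->] Ux _; exact: hUU.
move=> f [f_hom fE]; exists f; split=> // x Sx.
by apply: fE => //; exact: hSS.
Qed.

Lemma gk_hom_comp (V W Z : gkmod P) (f : V -> W) (g : W -> Z) :
  gk_hom f -> gk_hom g -> gk_hom (g \o f).
Proof.
move=> [f1 f2 f3] [g1 g2 g3]; split=> /=.
- by move=> a x y /=; rewrite f1 g1.
- by move=> k v Kk; rewrite f2 // g2.
- by move=> X v; rewrite f3 g3.
Qed.

Lemma gk_hom_id (V : gkmod P) : gk_hom (@id V).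
Proof. by split. Qed.

Lemma gk_hom_inv (V W : gkmod P) (f : V -> W) (g : W -> V) :
  gk_hom f -> cancel f g -> cancel g f -> gk_hom g.
Proof.
move=> [f1 f2 f3] fK gK.
by split=> [a x y|k v Kk|X v]; apply: (can_inj fK); rewrite ?f1 ?f2 ?f3 ?gK.
Qed.

Lemma gk_iso_sym (V W : gkmod P) : gk_iso V W -> gk_iso W V.
Proof.
move=> [f [f_hom [g fK gK]]]; exists g.
by split; [exact: gk_hom_inv fK gK | exists f].
Qed.

Lemma gk_iso_trans (V W Z : gkmod P) : gk_iso V W -> gk_iso W Z -> gk_iso V Z.
Proof.
move=> [f [f_hom f_bij]] [g [g_hom g_bij]]; exists (g \o f).
by split; [exact: gk_hom_comp | exact: bij_comp].
Qed.

Lemma gk_isoP (V W : gkmod P) (f : V -> W) : gk_hom f -> injective f ->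
  (forall w, exists v, f v = w) -> gk_iso V W.
Proof.
move=> f_hom f_inj /choice[g gK]; exists f; split=> //; exists g => //.
by move=> v; apply: f_inj; rewrite gK.
Qed.

Lemma gk_hom_ker0 (V W : gkmod P) (f : V -> W) : gk_hom f ->
  (forall v, f v = 0 -> v = 0) -> injective f.
Proof.
move=> [f_lin _ _] f0 x y e; apply/eqP; rewrite -subr_eq0; apply/eqP/f0.
by rewrite (linB f_lin) e subrr.
Qed.

Lemma sq_iso (X Y : ambient P) (S U : X -> Prop) (S' U' : Y -> Prop)
    (Q Q' : gkmod P) (p : X -> Q) (p' : Y -> Q') (h : X -> Y) :
  stable S -> stable S' -> sq_proj S U p -> sq_proj S' U' p' ->
  linear h -> (forall x, S x -> S' (h x)) ->
  (forall k x, grp k -> S x -> h (am_act X k x) = am_act Y k (h x)) ->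
  (forall A x, S x -> h (am_lie X A x) = am_lie Y A (h x)) ->
  (forall x, S x -> (U x <-> U' (h x))) ->
  (forall y, S' y -> exists2 x, S x & U' (y - h x)) ->
  gk_iso Q Q'.
Proof.
move=> sS sS' hp hp' h_lin hSS h_act h_lie hUU h_surj.
have [hS _ _ _] := sS; have [hS' _ _ _] := sS'.
have [f [f_hom fE]] := sq_hom_fun sS sS' hp hp' h_lin hSS h_act h_lie
  (fun x Sx => (hUU x Sx).1).
have [_ p_surj p_ker _ _] := hp; have [_ p'_surj p'_ker _ _] := hp'.
apply: (@gk_isoP _ _ f) => //.
  apply: gk_hom_ker0 => // q; have [x Sx <-] := p_surj q.
  rewrite fE // => /(p'_ker _ (hSS _ Sx)) Ux; apply/p_ker => //.
  exact/hUU.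
move=> q; have [y Sy <-] := p'_surj q; have [x Sx Uxy] := h_surj y Sy.
by exists (p x); rewrite fE //; apply/esym/(sq_proj_eq hS' hp') => //; exact: hSS.
Qed.

Lemma sq_short_exact (X : ambient P) (S T U : X -> Prop)
    (Q1 Q Q2 : gkmod P) (p1 : X -> Q1) (p : X -> Q) (p2 : X -> Q2) :
  stable S -> stable T -> (forall x, U x -> T x) -> (forall x, T x -> S x) ->
  sq_proj T U p1 -> sq_proj S U p -> sq_proj S T p2 -> short_exact Q1 Q Q2.
Proof.
move=> sS sT UT TS h1 h h2.
have [hS _ _ _] := sS; have [hT _ _ _] := sT.
have [i [i_hom iE]] := @sq_hom_fun X X T U S U _ _ p1 p id sT sS h1 h
  (fun _ _ _ => erefl) TS (fun _ _ _ _ => erefl) (fun _ _ _ => erefl)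
  (fun _ _ h => h).
have [q [q_hom qE]] := @sq_hom_fun X X S U S T _ _ p p2 id sS sS h h2
  (fun _ _ _ => erefl) (fun _ h => h) (fun _ _ _ _ => erefl)
  (fun _ _ _ => erefl) (fun x _ => UT x).
have [_ p1_surj p1_ker _ _] := h1; have [_ p_surj p_ker _ _] := h.
have [_ p2_surj p2_ker _ _] := h2.
exists i, q; split => //.
- apply: gk_hom_ker0 => // v; have [x Tx <-] := p1_surj v.
  by rewrite iE // => /(p_ker _ (TS _ Tx)) Ux; apply/p1_ker.
- by move=> w; have [x Sx <-] := p2_surj w; exists (p x); rewrite qE.
- move=> v; have [x Sx <-] := p_surj v; rewrite qE // p2_ker //; split.
    by move=> Tx; exists (p1 x); rewrite iE.
  move=> [v']; have [y Ty <-] := p1_surj v'; rewrite iE //.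
  move=> /(sq_proj_eq hS h Sx (TS _ Ty)) /UT Txy.
  by have := subspD hT Txy Ty; rewrite subrK.
Qed.

End SubquotientMaps.

Section SubmodulesOf.
Variables (R : realType) (P : gk_pair R).
Hypothesis hP : gk_group P.

Definition submod (M : gkmod P) (S : M -> Prop) : Prop := stable (X := gk_ambient M) S.

Lemma submodP (M : gkmod P) (S : M -> Prop) : subspace_pred S ->
  (forall k x, grp k -> S x -> S (gk_act k x)) ->
  (forall A x, S x -> S (gk_lie A x)) -> submod S.
Proof. by move=> *; split. Qed.

Lemma submodT (M : gkmod P) : submod (fun _ : M => True).
Proof. by apply: submodP => //; split. Qed.

Lemma submod_ker (M N : gkmod P) (f : M -> N) (S : N -> Prop) :
  gk_hom f -> submod S -> submod (fun x => S (f x)).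
Proof.
move=> [f1 f2 f3] [hS _ Sa Sl]; apply: submodP.
- split=> [|a x y Sx Sy]; first by rewrite (lin0 f1); exact: subsp0.
  by rewrite f1; have [_] := hS; apply.
- by move=> k x Kk Sx; rewrite f2 //; exact: Sa.
- by move=> A x Sx; rewrite f3; exact: Sl.
Qed.

Lemma submod_im (M N : gkmod P) (f : M -> N) (S : M -> Prop) :
  gk_hom f -> submod S -> submod (fun y => exists2 x, S x & y = f x).
Proof.
move=> [f1 f2 f3] [hS _ Sa Sl]; apply: submodP.
- split=> [|a _ _ [x Sx ->] [y Sy ->]].
    by exists 0; [exact: subsp0 | rewrite (lin0 f1)].
  by exists (a *: x + y); [have [_] := hS; apply | rewrite f1].
- by move=> k _ Kk [x Sx ->]; exists (gk_act k x); rewrite ?f2 //; exact: Sa.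
- by move=> A _ [x Sx ->]; exists (gk_lie A x); rewrite ?f3 //; exact: Sl.
Qed.

Lemma submod0 (M : gkmod P) : submod (fun x : M => x = 0).
Proof.
apply: submodP.
- by split=> // a x y -> ->; rewrite scaler0 addr0.
- by move=> k x Kk ->; rewrite (lin0 (gk_act_linear Kk)).
- by move=> A x ->; rewrite (lin0 (gk_lie_linear A)).
Qed.

Lemma submodI (M : gkmod P) (S T : M -> Prop) :
  submod S -> submod T -> submod (fun x => S x /\ T x).
Proof.
move=> [hS _ Sa Sl] [hT _ Ta Tl]; apply: submodP.
- split=> [|a x y [Sx Tx] [Sy Ty]]; first by split; exact: subsp0.
  by split; [have [_] := hS; apply | have [_] := hT; apply].
- by move=> k x Kk [Sx Tx]; split; [exact: Sa | exact: Ta].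
- by move=> A x [Sx Tx]; split; [exact: Sl | exact: Tl].
Qed.

Lemma submodD (M : gkmod P) (S T : M -> Prop) : submod S -> submod T ->
  submod (fun x => exists y z, [/\ S y, T z & x = y + z]).
Proof.
move=> [hS _ Sa Sl] [hT _ Ta Tl]; apply: submodP.
- split=> [|a _ _ [x [y [Sx Ty ->]]] [x' [y' [Sx' Ty' ->]]]].
    by exists 0, 0; split; [exact: subsp0 | exact: subsp0 | rewrite addr0].
  exists (a *: x + x'), (a *: y + y'); split.
  + by have [_] := hS; apply.
  + by have [_] := hT; apply.
  + by rewrite scalerDr addrACA.
- move=> k _ Kk [x [y [Sx Ty ->]]]; exists (gk_act k x), (gk_act k y).
  by split; [exact: Sa | exact: Ta | rewrite (linD (gk_act_linear Kk))].
- move=> A _ [x [y [Sx Ty ->]]]; exists (gk_lie A x), (gk_lie A y).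
  by split; [exact: Sl | exact: Tl | rewrite (linD (gk_lie_linear A))].
Qed.

Lemma gk_exists (M : gkmod P) (S U : M -> Prop) : submod S -> submod U ->
  (forall x, U x -> S x) ->
  exists (Q : gkmod P) (p : M -> Q), sq_proj (X := gk_ambient M) S U p.
Proof. by move=> sS sU US; have := sq_exists hP sS sU US. Qed.

Lemma sq_proj_hom (M N : gkmod P) (f : M -> N) : gk_hom f ->
  (forall y, exists x, f x = y) ->
  sq_proj (X := gk_ambient M) (fun=> True) (fun x => f x = 0) f.
Proof.
move=> [f1 f2 f3] f_surj; split => //=.
- by move=> a x y _ _; exact: f1.
- by move=> q; have [x <-] := f_surj q; exists x.
- by move=> k x Kk _; exact: f2.
Qed.

Lemma zero_exists (M : gkmod P) : exists Z : gkmod P, forall z : Z, z = 0.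
Proof.
have [Z [p hp]] := gk_exists (submodT M) (submodT M) (fun _ h => h).
exists Z => z; have [_ p_surj p_ker _ _] := hp.
by have [x _ <-] := p_surj z; apply/p_ker.
Qed.

End SubmodulesOf.

(** * Devissage in Grothendieck groups *)

Section GrothendieckGroup.
Variables (R : realType) (P : gk_pair R) (C : gkmod P -> Prop).
Hypothesis hP : gk_group P.
Hypothesis hC : full_abelian C.

Lemma clsE V (CV : C V) : cls C V = pgen (@ses_rel R P C) (exist _ V CV).
Proof.
rewrite /cls; case: pselect => // CV'.
by congr (pgen _ (exist _ _ _)); exact: Prop_irrelevance.
Qed.

Lemma cls_ses V' V V'' : C V' -> C V -> C V'' -> short_exact V' V V'' ->
  cls C V = ab_add (cls C V') (cls C V'').
Proof.
move=> CV' CV CV'' e; rewrite !clsE -tclassD; apply: pgen_rel.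
exact: ses_rel_intro.
Qed.

Lemma cat_zero (Z : gkmod P) : (forall z : Z, z = 0) -> C Z.
Proof. by have [_ + _ _ _] := hC; apply. Qed.

Lemma cls_zero (Z : gkmod P) : (forall z : Z, z = 0) -> cls C Z = ab_zero.
Proof.
move=> Z0; have CZ := cat_zero Z0.
have e : cls C Z = ab_add (cls C Z) (cls C Z).
  apply: cls_ses => //; exists id, id; split => //.
  - by move=> w; exists w.
  - by move=> v; split=> _; [exists v | exact: Z0].
by apply: (@ab_addI _ (cls C Z)); rewrite -e ab_addr0.
Qed.

Lemma cat_iso V W : gk_iso V W -> C V -> C W.
Proof. by have [+ _ _ _ _] := hC; apply. Qed.

Lemma cls_iso V W : gk_iso V W -> cls C V = cls C W.
Proof.
move=> VW; have [CV|nCV] := pselect (C V); last first.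
  rewrite /cls; case: pselect => // _; case: pselect => // CW.
  by case: nCV; apply: cat_iso CW; exact: gk_iso_sym.
have CW := cat_iso VW CV.
have [Z Z0] := zero_exists hP V; have CZ := cat_zero Z0.
rewrite (@cls_ses V W Z) // ?(cls_zero Z0) ?ab_addr0 //.
have [f [f_hom [g fK gK]]] := VW.
exists f, (fun=> 0); split.
- split=> //; split=> [a x y|k v Kk|A v]; first by rewrite scaler0 addr0.
    by rewrite (lin0 (gk_act_linear Kk)).
  by rewrite (lin0 (gk_lie_linear A)).
- exact: can_inj fK.
- by move=> w; exists 0; rewrite (Z0 w).
- by move=> v; split=> // _; exists (g v); rewrite gK.
Qed.

Lemma cls_of_eq (D : gkmod P -> Prop) V :
  (forall V W, D V -> D W -> gk_iso V W) -> C V -> D V -> cls_of C D = cls C V.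
Proof.
move=> D_iso CV DV; rewrite /cls_of; case: pselect => [h|[]]; last by exists V.
by case: (cid h) => W [CW DW] /=; apply: cls_iso; exact: D_iso.
Qed.

Lemma Kgroup_ext_cls (A : abGroup) (f : gkmod P -> A) :
  (forall V' V V'', C V' -> C V -> C V'' -> short_exact V' V V'' ->
    f V = ab_add (f V') (f V'')) ->
  additive_map (Kgroup_ext (C := C) f) /\
  forall V, C V -> Kgroup_ext (C := C) f (cls C V) = f V.
Proof.
move=> fS.
have h s t : @ses_rel R P C s t ->
    term_eval (fun X => f (sval X)) s = term_eval (fun X => f (sval X)) t.
  by case=> -[V' CV'] [V CV] [V'' CV''] /= e; exact: fS.
split; first exact: pextD.
by move=> V CV; rewrite clsE /Kgroup_ext pext_gen.
Qed.

(* [C] need not be closed under extensions. [Eu M k] says that [M] has a finite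
   filtration with subquotients in [C] whose classes add up to [k]. *)
Inductive Eu : gkmod P -> Kgroup C -> Prop :=
  | Eu_zero (M : gkmod P) : (forall x : M, x = 0) -> Eu M ab_zero
  | Eu_step (M' M M'' : gkmod P) k : C M' -> short_exact M' M M'' -> Eu M'' k ->
      Eu M (ab_add (cls C M') k).

Lemma Eu_iso M N k : gk_iso M N -> Eu M k -> Eu N k.
Proof.
move=> MN h; case: h MN => [{}M M0|M' {}M M'' {}k CM' [i [p [[i_hom p_hom] i_inj p_surj ex]]] h] MN.
  have [f [[f1 _ _] [g fK gK]]] := MN.
  by apply: Eu_zero => x; rewrite -(gK x) (M0 (g x)) (lin0 f1).
have [f [f_hom [h' hK fh]]] := MN; have h_hom := gk_hom_inv f_hom hK fh.
apply: (Eu_step CM') h; exists (f \o i), (p \o h'); split.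
- by split; exact: gk_hom_comp.
- by apply: inj_comp => //; exact: can_inj hK.
- by move=> w; have [v <-] := p_surj w; exists (f v); rewrite /= hK.
- move=> v /=; rewrite ex; split=> -[v' e]; exists v'; first by rewrite /= -e fh.
  by rewrite e /= hK.
Qed.

Lemma Eu_cat M : C M -> Eu M (cls C M).
Proof.
move=> CM; have [Z Z0] := zero_exists hP M; rewrite -[cls C M]ab_addr0.
apply: (Eu_step CM) (Eu_zero Z0); exists id, (fun=> 0); split => //.
- split; first exact: gk_hom_id.
  split=> [a x y|k v Kk|A v]; first by rewrite scaler0 addr0.
    by rewrite (lin0 (gk_act_linear Kk)).
  by rewrite (lin0 (gk_lie_linear A)).
- by move=> w; exists 0; rewrite (Z0 w).
- by move=> v; split=> // _; exists v.
Qed.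

(** Induction on the filtration of [M']: dividing [M] by its first step [A] leaves an extension of
    [M''] by M' / A, which has a shorter filtration. *)
Lemma Eu_ext M' M M'' k' k'' : Eu M' k' -> short_exact M' M M'' -> Eu M'' k'' ->
  Eu M (ab_add k' k'').
Proof.
move=> h; elim: h M M'' k'' => {M' k'} [M' M'0|A M' N k CA eA hN IH] M M'' k'' eM h''.
  rewrite ab_add0; apply: Eu_iso h''; apply: gk_iso_sym.
  have [i [p [[i_hom p_hom] i_inj p_surj ex]]] := eM.
  apply: (@gk_isoP _ _ _ _ p) => //; apply: gk_hom_ker0 => // v /ex[x ->].
  by rewrite (M'0 x); have [i1 _ _] := i_hom; rewrite (lin0 i1).
have [i [p [[i_hom p_hom] i_inj p_surj ex]]] := eM.
have [j [q [[j_hom q_hom] j_inj q_surj exA]]] := eA.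
have [i1 _ _] := i_hom.
have sA : submod (fun y => exists2 x, True & y = (i \o j) x).
  by apply: submod_im (submodT A); exact: gk_hom_comp.
have [Q [r hr]] := gk_exists hP (submodT M) sA (fun _ _ => I).
rewrite -ab_addA; apply: (Eu_step CA (M'' := Q)).
  exists (i \o j), r; split.
  - split; first exact: gk_hom_comp.
    have [r1 _ _ r4 r5] := hr; split=> [a x y|k0 v Kk|A0 v];
    by rewrite ?(r1, r4, r5).
  - by apply: inj_comp.
  - by move=> w; have [_ + _ _ _] := hr => /(_ w)[x _ <-]; exists x.
  - move=> v; have [_ _ + _ _] := hr => /(_ v I) ->.
    by split=> [[x _ ->]|[x ->]]; exists x.
apply: IH h''.
have sM' : submod (fun y => exists2 x, True & y = i x).
  by apply: submod_im (submodT M').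
have sq_q := sq_proj_hom q_hom q_surj.
have [i' [i'_hom i'E]] := @sq_hom_fun _ _ (gk_ambient M') (gk_ambient M) (fun=> True)
  (fun x => q x = 0) (fun=> True) _ N Q q r i (submodT M') (submodT M) sq_q hr i1
  (fun _ _ => I) (fun k x Kk _ => let: And3 _ h _ := i_hom in h k x Kk)
  (fun A x _ => let: And3 _ _ h := i_hom in h A x)
  (fun x _ e => let: ex_intro a ea := (exA x).1 e in
     ex_intro2 _ _ a I (congr1 i ea)).
have [p' [p'_hom p'E]] := @sq_hom_fun _ _ (gk_ambient M) (gk_ambient M'') (fun=> True)
  (fun y => exists2 x, True & y = (i \o j) x) (fun=> True) (fun x => x = 0) Q M'' r id
  p (submodT M) (submodT M'') hr (sq_proj_hom (gk_hom_id M'') (fun y => ex_intro _ y erefl))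
  (let: And3 h _ _ := p_hom in h)
  (fun _ _ => I) (fun k x Kk _ => let: And3 _ h _ := p_hom in h k x Kk)
  (fun A x _ => let: And3 _ _ h := p_hom in h A x)
  (fun x _ h => (ex x).2 (let: ex_intro2 a _ ea := h in ex_intro _ (j a) ea)).
have [_ r_surj r_ker _ _] := hr.
exists i', p'; split => //.
- apply: gk_hom_ker0 => // n; have [x <-] := q_surj n.
  rewrite i'E // => /(r_ker _ I)[a _ /= /i_inj ->].
  by apply/exA; exists a.
- by move=> w; have [v <-] := p_surj w; exists (r v); rewrite p'E.
- move=> v; have [x _ <-] := r_surj v; rewrite p'E //= ex; split.
    by move=> [x' ->]; exists (q x'); rewrite i'E.
  move=> [n]; have [x' <-] := q_surj n; rewrite i'E // => /esym e.
  have [sT _ _ _] := submodT M.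
  have [/(_ e)[a _ /= ea] _] := @sq_proj_eq _ _ (gk_ambient M) _ _ _ r (i x') x sT hr I I.
  exists (x' - j a); rewrite (linB i1) -ea opprB addrC subrK //.
Qed.

(** The class of the subquotient S / U of a fixed [M]. Working with submodules of one [M] turns the
    isomorphism theorems into statements about a lattice. The variant [CS] demands that S / U itself
    lie in [C]. *)
Definition EuS (M : gkmod P) (S U : M -> Prop) (k : Kgroup C) : Prop :=
  [/\ submod S, submod U, forall x, U x -> S x & exists (Q : gkmod P) (p : M -> Q),
    sq_proj (X := gk_ambient M) S U p /\ Eu Q k].

Definition CS (M : gkmod P) (S U : M -> Prop) (k : Kgroup C) : Prop :=
  [/\ submod S, submod U, forall x, U x -> S x & exists (Q : gkmod P) (p : M -> Q),
    [/\ sq_proj (X := gk_ambient M) S U p, C Q & k = cls C Q]].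

Lemma CS_EuS (M : gkmod P) (S U : M -> Prop) k : CS S U k -> EuS S U k.
Proof.
move=> [sS sU US [Q [p [hp CQ ->]]]]; split=> //; exists Q, p; split=> //.
exact: Eu_cat.
Qed.

Lemma sub_iso (M N : gkmod P) (f : M -> N) (S U : M -> Prop) (S' U' : N -> Prop) :
  gk_hom f -> submod S -> submod U -> submod S' -> submod U' ->
  (forall x, U x -> S x) -> (forall x, U' x -> S' x) ->
  (forall x, S x -> S' (f x)) -> (forall x, S x -> (U x <-> U' (f x))) ->
  (forall y, S' y -> exists2 x, S x & U' (y - f x)) ->
  forall (Q Q' : gkmod P) (p : M -> Q) (p' : N -> Q'),
  sq_proj (X := gk_ambient M) S U p -> sq_proj (X := gk_ambient N) S' U' p' ->
  gk_iso Q Q'.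
Proof.
move=> [f1 f2 f3] sS sU sS' sU' US US' SS UU surj Q Q' p p' hp hp'.
by apply: (sq_iso sS sS' hp hp' f1) => // *; rewrite /= ?f2 ?f3.
Qed.

Section Transport.
Variables (M N : gkmod P) (f : M -> N) (S U : M -> Prop) (S' U' : N -> Prop).
Hypotheses (f_hom : gk_hom f) (sS : submod S) (sU : submod U)
  (sS' : submod S') (sU' : submod U')
  (US : forall x, U x -> S x) (US' : forall x, U' x -> S' x)
  (SS : forall x, S x -> S' (f x)) (UU : forall x, S x -> (U x <-> U' (f x)))
  (surj : forall y, S' y -> exists2 x, S x & U' (y - f x)).

Lemma EuS_transport k : EuS S U k <-> EuS S' U' k.
Proof.
have iso := sub_iso f_hom sS sU sS' sU' US US' SS UU surj.
split=> -[_ _ _ [Q [p [hp h]]]]; split=> //.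
  have [Q' [p' hp']] := gk_exists hP sS' sU' US'.
  by exists Q', p'; split=> //; apply: Eu_iso h; exact: iso hp hp'.
have [Q' [p' hp']] := gk_exists hP sS sU US.
by exists Q', p'; split=> //; apply: Eu_iso h; apply: gk_iso_sym; exact: iso hp' hp.
Qed.

Lemma CS_transport k : CS S U k <-> CS S' U' k.
Proof.
have iso := sub_iso f_hom sS sU sS' sU' US US' SS UU surj.
split=> -[_ _ _ [Q [p [hp CQ ->]]]]; split=> //.
  have [Q' [p' hp']] := gk_exists hP sS' sU' US'.
  exists Q', p'; have h := iso _ _ _ _ hp hp'.
  by split=> //; [exact: cat_iso h CQ | exact: cls_iso].
have [Q' [p' hp']] := gk_exists hP sS sU US.
exists Q', p'; have h := gk_iso_sym (iso _ _ _ _ hp' hp).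
by split=> //; [exact: cat_iso h CQ | exact: cls_iso].
Qed.

End Transport.

Lemma EuS_ses (M : gkmod P) (S T U : M -> Prop) k1 k2 :
  EuS T U k1 -> EuS S T k2 -> EuS S U (ab_add k1 k2).
Proof.
move=> [sT sU UT [Q1 [p1 [h1 e1]]]] [sS _ TS [Q2 [p2 [h2 e2]]]].
have US x : U x -> S x by move=> /UT /TS.
have [Q [p hp]] := gk_exists hP sS sU US.
split=> //; exists Q, p; split=> //.
apply: Eu_ext e1 _ e2; exact: (sq_short_exact sS sT UT TS h1 hp h2).
Qed.

Lemma CS_ker (M : gkmod P) (S T U : M -> Prop) k k2 : (forall x, U x -> T x) ->
  CS S U k -> CS S T k2 -> exists2 k1, CS T U k1 & k = ab_add k1 k2.
Proof.
move=> UT [sS sU US [Q [p [hp CQ ->]]]] [_ sT TS [Q2 [p2 [h2 CQ2 ->]]]].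
have [Q1 [p1 h1]] := gk_exists hP sT sU UT.
have ex := sq_short_exact sS sT UT TS h1 hp h2.
have CQ1 : C Q1.
  have [i [q [[i_hom q_hom] i_inj q_surj e]]] := ex.
  have [_ _ _ hker _] := hC; apply: (hker _ _ q) CQ CQ2 => //.
  by exists i; split.
exists (cls C Q1); last exact: cls_ses.
by split=> //; exists Q1, p1.
Qed.

Lemma CS_coker (M : gkmod P) (S T U : M -> Prop) k k1 : (forall x, T x -> S x) ->
  CS S U k -> CS T U k1 -> exists2 k2, CS S T k2 & k = ab_add k1 k2.
Proof.
move=> TS [sS sU US [Q [p [hp CQ ->]]]] [sT _ UT [Q1 [p1 [h1 CQ1 ->]]]].
have [Q2 [p2 h2]] := gk_exists hP sS sT TS.
have ex := sq_short_exact sS sT UT TS h1 hp h2.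
have CQ2 : C Q2.
  have [i [q [[i_hom q_hom] i_inj q_surj e]]] := ex.
  have [_ _ _ _ hcok] := hC; apply: (hcok _ _ i) CQ1 CQ => //.
  by exists q; split.
exists (cls C Q2); last exact: cls_ses.
by split=> //; exists Q2, p2.
Qed.

Lemma CS_full (M : gkmod P) : C M -> CS (fun _ : M => True) (fun x => x = 0) (cls C M).
Proof.
move=> CM; split; [exact: submodT | exact: submod0 | by [] |].
exists M, id; split=> //.
exact: (sq_proj_hom (gk_hom_id M) (fun y => ex_intro _ y erefl)).
Qed.

Lemma EuS_full (M : gkmod P) k :
  EuS (fun _ : M => True) (fun x => x = 0) k <-> Eu M k.
Proof.
have hid := sq_proj_hom (gk_hom_id M) (fun y => ex_intro _ y erefl).
split=> [[sS sU US [Q [p [hp h]]]]|h]; last first.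
  by split; [exact: submodT | exact: submod0 | by [] | exists M, id].
apply: Eu_iso h; apply: (sub_iso (gk_hom_id M) sS sU sS sU US US _ _ _ hp hid) => //.
by move=> y _; exists y => //; rewrite subrr.
Qed.

Lemma EuS_zero (M : gkmod P) (S : M -> Prop) : submod S -> EuS S S ab_zero.
Proof.
move=> sS; split=> //; have [Q [p hp]] := gk_exists hP sS sS (fun _ h => h).
exists Q, p; split=> //; apply: Eu_zero => q.
have [_ p_surj p_ker _ _] := hp; have [x Sx <-] := p_surj q.
by apply/p_ker.
Qed.

End GrothendieckGroup.

Definition zerop (R : realType) (P : gk_pair R) (M : gkmod P) : M -> Prop :=
  fun x => x = 0.
Definition fullp (R : realType) (P : gk_pair R) (M : gkmod P) : M -> Prop :=
  fun=> True.
Definition kerp (R : realType) (P : gk_pair R) (M N : gkmod P) (f : M -> N) :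
  M -> Prop := fun x => f x = 0.
Definition imp (R : realType) (P : gk_pair R) (M N : gkmod P) (f : M -> N) :
  N -> Prop := fun y => exists2 x, True & y = f x.
Definition addp (R : realType) (P : gk_pair R) (M : gkmod P) (S T : M -> Prop) :
  M -> Prop := fun x => exists y z, [/\ S y, T z & x = y + z].
Definition meetp (R : realType) (P : gk_pair R) (M : gkmod P) (S T : M -> Prop) :
  M -> Prop := fun x => S x /\ T x.

Section Devissage.
Variables (R : realType) (P : gk_pair R) (C : gkmod P -> Prop).
Hypothesis hP : gk_group P.
Hypothesis hC : full_abelian C.

Local Notation EuS := (EuS (C := C)).
Local Notation CS := (CS (C := C)).
Local Notation Eu := (Eu (C := C)).

Lemma hom_lin (M N : gkmod P) (f : M -> N) : gk_hom f -> linear f.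
Proof. by case. Qed.

Lemma sub_zero (M : gkmod P) (S : M -> Prop) : submod S ->
  forall x, zerop x -> S x.
Proof. by move=> [hS _ _ _] x ->; exact: subsp0. Qed.

Lemma submod_kerp (M N : gkmod P) (f : M -> N) : gk_hom f -> submod (kerp f).
Proof. by move=> f_hom; exact: (submod_ker f_hom (submod0 N)). Qed.

Lemma submod_imp (M N : gkmod P) (f : M -> N) : gk_hom f -> submod (imp f).
Proof. by move=> f_hom; exact: (submod_im f_hom (submodT M)). Qed.

Section Isomorphisms.
Variables (M N : gkmod P) (f : M -> N).
Hypothesis f_hom : gk_hom f.

Lemma first_iso k : EuS (@fullp _ _ M) (kerp f) k <-> EuS (imp f) (@zerop _ _ N) k.
Proof.
apply: (EuS_transport hP f_hom) => //.
- exact: submod_kerp.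
- exact: submod_imp.
- exact: submod0.
- exact: sub_zero (submod_imp f_hom).
- by move=> x _; exists x.
- by move=> _ [x _ ->]; exists x => //; rewrite /zerop subrr.
Qed.

Lemma first_isoC k : CS (@fullp _ _ M) (kerp f) k <-> CS (imp f) (@zerop _ _ N) k.
Proof.
apply: (CS_transport hP hC f_hom) => //.
- exact: submod_kerp.
- exact: submod_imp.
- exact: submod0.
- exact: sub_zero (submod_imp f_hom).
- by move=> x _; exists x.
- by move=> _ [x _ ->]; exists x => //; rewrite /zerop subrr.
Qed.

Variables (S U : M -> Prop) (S' U' : N -> Prop).
Hypotheses (sS : submod S) (sU : submod U) (sS' : submod S') (sU' : submod U').
Hypotheses (US : forall x, U x -> S x) (US' : forall y, U' y -> S' y).
Hypotheses (SS : forall x, S x <-> S' (f x)) (UU : forall x, U x <-> U' (f x)).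
Hypothesis f_surj : forall y, exists x, f x = y.

Lemma quot_pull k : EuS S' U' k -> EuS S U k.
Proof.
apply: (EuS_transport hP f_hom _ _ _ _ _ _ _ _ _ k).2 => //; first by move=> x /SS.
move=> y Sy; have [x e] := f_surj y; exists x; first by apply/SS; rewrite e.
by rewrite e subrr; have [h _ _ _] := sU'; exact: subsp0.
Qed.

Lemma quot_pullC k : CS S' U' k -> CS S U k.
Proof.
apply: (CS_transport hP hC f_hom _ _ _ _ _ _ _ _ _ k).2 => //; first by move=> x /SS.
move=> y Sy; have [x e] := f_surj y; exists x; first by apply/SS; rewrite e.
by rewrite e subrr; have [h _ _ _] := sU'; exact: subsp0.
Qed.

End Isomorphisms.

Section SubIsomorphisms.
Variables (M N : gkmod P) (f : M -> N).
Hypothesis f_hom : gk_hom f.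
Hypothesis f_inj : injective f.
Variables (S U : M -> Prop) (S' U' : N -> Prop).
Hypotheses (sS : submod S) (sU : submod U) (sS' : submod S') (sU' : submod U').
Hypotheses (US : forall x, U x -> S x) (US' : forall y, U' y -> S' y).
Hypotheses (SS : forall y, S' y <-> exists2 x, S x & y = f x).
Hypotheses (UU : forall y, U' y <-> exists2 x, U x & y = f x).

Lemma sub_UU x : U x <-> U' (f x).
Proof.
by split=> [Ux|/UU[z Uz /f_inj ->] //]; apply/UU; exists x.
Qed.

Lemma subincl_iso k : EuS S U k <-> EuS S' U' k.
Proof.
apply: (EuS_transport hP f_hom) => //.
- by move=> x Sx; apply/SS; exists x.
- by move=> x _; exact: sub_UU.
- move=> y /SS[x Sx ->]; exists x => //.
  by rewrite subrr; have [h _ _ _] := sU'; exact: subsp0.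
Qed.

Lemma subincl_push k : EuS S U k -> EuS S' U' k.
Proof. by move/subincl_iso. Qed.

Lemma subincl_pull k : EuS S' U' k -> EuS S U k.
Proof. by move/subincl_iso. Qed.

End SubIsomorphisms.

Section SecondIso.
Variables (M : gkmod P) (S T : M -> Prop).
Hypotheses (sS : submod S) (sT : submod T).

Let hS : subspace_pred S. Proof. by case: sS. Qed.
Let hT : subspace_pred T. Proof. by case: sT. Qed.

Lemma second_iso k : EuS S (meetp S T) k <-> EuS (addp S T) T k.
Proof.
apply: (EuS_transport hP (gk_hom_id M)) => //.
- exact: submodI.
- exact: submodD.
- by move=> x [].
- by move=> x Tx; exists 0, x; rewrite add0r; split=> //; exact: subsp0.
- by move=> x Sx; exists x, 0; rewrite addr0; split=> //; exact: subsp0.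
- by move=> x Sx; split=> [[]|].
- by move=> _ [y [z [Sy Tz ->]]]; exists y => //; rewrite addrC addKr.
Qed.

End SecondIso.

Lemma CS_uniq (M : gkmod P) (S U : M -> Prop) k k' : CS S U k -> CS S U k' -> k = k'.
Proof.
move=> [sS sU US [Q [p [hp CQ ->]]]] [_ _ _ [Q' [p' [hp' CQ' ->]]]].
apply: (cls_iso hP hC).
apply: (sub_iso (gk_hom_id M) sS sU sS sU US US _ _ _ hp hp') => //.
by move=> y Sy; exists y => //; rewrite subrr; have [h _ _ _] := sU; exact: subsp0.
Qed.

(** The image is in [C] because it is the cokernel of the inclusion of the kernel. *)
Lemma CS_map (M N : gkmod P) (f : M -> N) : gk_hom f -> C M -> C N ->
  exists k0 k1 k2, [/\ CS (kerp f) (@zerop _ _ M) k0,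
    CS (imp f) (@zerop _ _ N) k1, CS (@fullp _ _ N) (imp f) k2,
    cls C M = ab_add k0 k1 & cls C N = ab_add k1 k2].
Proof.
move=> f_hom CM CN.
have sK := submod_kerp f_hom; have sI := submod_imp f_hom.
have [K [p hp]] := gk_exists hP sK (submod0 M) (sub_zero sK).
have CK : C K.
  have [_ _ _ hker _] := hC; apply: (hker _ _ f) CM CN => //.
  have [i [i_hom iE]] := @sq_hom_fun _ _ (gk_ambient M) (gk_ambient M) (kerp f)
    (@zerop _ _ M) (@fullp _ _ M) (@zerop _ _ M) K M p id id sK (submodT M) hp
    (sq_proj_hom (gk_hom_id M) (fun y => ex_intro _ y erefl))
    (fun _ _ _ => erefl) (fun _ _ => I) (fun _ _ _ _ => erefl)
    (fun _ _ _ => erefl) (fun _ _ h => h).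
  have [_ p_surj p_ker _ _] := hp.
  exists i; split=> //.
    apply: gk_hom_ker0 => // v; have [x Kx <-] := p_surj v.
    by rewrite iE // => x0; apply/p_ker.
  move=> v; split=> [e|[x ->]]; first by exists (p v); rewrite iE.
  by have [y Ky <-] := p_surj x; rewrite iE.
have hK : CS (kerp f) (@zerop _ _ M) (cls C K).
  by split=> //; [exact: submod0 | exact: sub_zero | exists K, p].
have [k1 h1 e1] := CS_coker hP hC (fun _ _ => I) (CS_full CM) hK.
have h1' : CS (imp f) (@zerop _ _ N) k1 by exact/first_isoC.
have [k2 h2 e2] := CS_coker hP hC (fun _ _ => I) (CS_full CN) h1'.
by exists (cls C K), k1, k2.
Qed.

(** Induction on the filtration of the source. If [A] is its first step, then [f] induces a map from
    [M''] to N / f(A), and this target is still in [C] as a cokernel. *)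
Lemma Eu_map_cat (M : gkmod P) k : Eu M k -> forall (N : gkmod P) (f : M -> N),
  C N -> gk_hom f ->
  exists k0 k1 k2, [/\ EuS (kerp f) (@zerop _ _ M) k0,
    CS (imp f) (@zerop _ _ N) k1, CS (@fullp _ _ N) (imp f) k2,
    k = ab_add k0 k1 & cls C N = ab_add k1 k2].
Proof.
elim=> {M k} [M M0|A M M'' k CA eA hM IH] N f CN f_hom.
  have CM : C M by exact: (cat_zero hC).
  have [k0 [k1 [k2 [h0 h1 h2 e1 e2]]]] := CS_map f_hom CM CN.
  exists k0, k1, k2; split=> //; first exact: (CS_EuS hP).
  by rewrite -e1 (cls_zero hC).
have [i [q [[i_hom q_hom] i_inj q_surj ex]]] := eA.
have g_hom := gk_hom_comp i_hom f_hom.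
have [a0 [a1 [a2 [ha0 ha1 ha2 eA1 eN]]]] := CS_map g_hom CA CN.
have [sN sI IN [N1 [r [hr CN1 ea2]]]] := ha2.
have [f1 f2 f3] := f_hom; have [_ r_surj r_ker _ _] := hr.
have [fb [fb_hom fbE]] := @sq_hom_fun _ _ (gk_ambient M) (gk_ambient N) (@fullp _ _ M)
  (kerp q) (@fullp _ _ N) (imp (f \o i)) M'' N1 q r f (submodT M) (submodT N)
  (sq_proj_hom q_hom q_surj) hr f1 (fun _ _ => I) (fun k x Kk _ => f2 k x Kk)
  (fun A x _ => f3 A x)
  (fun x _ h => let: ex_intro a ea := (ex x).1 h in
     ex_intro2 _ _ a I (congr1 f ea)).
have {}fbE x : fb (q x) = r (f x) by exact: fbE.
have [k0 [k1 [k2 [h0 h1 h2 e1 e2]]]] := IH N1 fb CN1 fb_hom.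
have r_hom : gk_hom r.
  have [r1 _ _ r4 r5] := hr; split=> [a x y|k' v Kk|B v].
  - exact: r1.
  - exact: r4.
  - exact: r5.
have r_surj' y : exists x, r x = y by have [x _ <-] := r_surj y; exists x.
have kr x : r x = 0 <-> imp (f \o i) x by exact: r_ker.
have sK := submod_kerp f_hom; have sQ := submod_kerp q_hom.
have sIf := submod_imp f_hom.
have gf y : imp (f \o i) y -> imp f y by move=> [x _ ->]; exists (i x).
(* The kernel of the map induced on [M''] is (ker f + A) / A, that is ker f / (ker f cap A). The
   rest, ker f cap A, is the kernel of [f] on [A]. *)
have hk0 : EuS (kerp f) (meetp (kerp f) (kerp q)) k0.
  apply/(second_iso sK sQ).
  apply: (quot_pull q_hom) h0 => //.
  - exact: submodD.
  - exact: submod_kerp.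
  - exact: submod0.
  - move=> x qx; exists 0, x; split=> //; last by rewrite add0r.
    by rewrite /kerp (lin0 f1).
  - exact: sub_zero (submod_kerp fb_hom).
  - move=> x; rewrite /kerp fbE kr; split.
      move=> [y [z [fy /ex[a ->] ->]]]; exists a => //=.
      by rewrite (linD f1) fy add0r.
    move=> [a _ e]; exists (x - i a), (i a); split; last by rewrite subrK.
      by rewrite (linB f1) e subrr.
    by apply/ex; exists a.
have hk0' : EuS (meetp (kerp f) (kerp q)) (@zerop _ _ M) a0.
  apply: (subincl_push i_hom i_inj) (CS_EuS hP ha0) => //.
  - exact: submod_kerp.
  - exact: submod0.
  - exact: submodI.
  - exact: submod0.
  - exact: sub_zero (submod_kerp g_hom).
  - exact: sub_zero (submodI sK sQ).
  - move=> y; split=> [[fy /ex[a e]]|[x fx ->]].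
      by exists a => //; rewrite /kerp /= -e.
    by split=> //; apply/ex; exists x.
  - move=> y; have [i1 _ _] := i_hom; split=> [->|[x -> ->]].
      by exists 0 => //; rewrite (lin0 i1).
    by rewrite /zerop (lin0 i1).
have h1' : CS (imp f) (imp (f \o i)) k1.
  apply: (quot_pullC r_hom) h1 => //.
  - exact: submod_imp.
  - exact: submod0.
  - exact: sub_zero (submod_imp fb_hom).
  - move=> y; split=> [[x _ ->]|[z _ ez]]; first by exists (q x); rewrite ?fbE.
    have [x ex'] := q_surj z; move: ez; rewrite -ex' fbE => /eqP.
    have [rl _ _] := r_hom; rewrite -subr_eq0 -(linB rl) => /eqP/kr[a _ e].
    exists (x + i a) => //; rewrite (linD f1) -[f (i a)]/((f \o i) a) -e.
    by rewrite addrC subrK.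
  - by move=> y; rewrite -kr.
have h2' : CS (@fullp _ _ N) (imp f) k2.
  apply: (quot_pullC r_hom) h2 => //.
  - exact: submod_imp.
  - move=> y; split=> [[x _ ->]|[z _ ez]]; first by exists (q x); rewrite ?fbE.
    have [x ex'] := q_surj z; move: ez; rewrite -ex' fbE => /eqP.
    have [rl _ _] := r_hom; rewrite -subr_eq0 -(linB rl) => /eqP/kr[a _ e].
    exists (x + i a) => //; rewrite (linD f1) -[f (i a)]/((f \o i) a) -e.
    by rewrite addrC subrK.
(* As built so far, im f is an extension of two objects of [C]. It lies in [C] because it is also
   the kernel of N -> N / im f. *)
have [k1' h1'' ek1] := CS_ker hP hC (sub_zero sIf) (CS_full CN) h2'.
have [kk hkk ekk] := CS_coker hP hC gf h1'' ha1.
have {hkk}ekk' : kk = k1 := CS_uniq hkk h1'.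
exists (ab_add a0 k0), k1', k2; split=> //.
  exact: (EuS_ses hP hk0' hk0).
by rewrite eA1 e1 ekk ekk' ab_addACA.
Qed.

Lemma EuS_zero_pred (M : gkmod P) (S : M -> Prop) : submod S -> (forall x, S x -> x = 0) ->
  EuS S (@zerop _ _ M) ab_zero.
Proof.
move=> sS S0; have -> : S = @zerop _ _ M.
  by apply/predeqP => x; split=> [/S0 //|]; exact: sub_zero.
exact: (EuS_zero _ hP (submod0 M)).
Qed.

Lemma Eu_lift (K A N : gkmod P) (u : K -> N) (i : A -> N) : gk_hom u -> gk_hom i ->
  injective i -> (forall x, exists a, u x = i a) ->
  exists g : K -> A, gk_hom g /\ forall x, i (g x) = u x.
Proof.
move=> [u1 u2 u3] [i1 i2 i3] i_inj /choice[g gP]; exists g; split=> //.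
by split=> [a x y|k x Kk|B x]; apply: i_inj; rewrite ?(i1, i2, i3) -?gP ?(u1, u2, u3).
Qed.

Lemma EuS_sub (M : gkmod P) (S : M -> Prop) k : EuS S (@zerop _ _ M) k ->
  exists (K : gkmod P) (j : K -> M),
    [/\ gk_hom j, injective j, forall x, S x <-> exists y, x = j y & Eu K k].
Proof.
move=> [sS _ _ [K [p [hp hK]]]].
have [i [i_hom iE]] := @sq_hom_fun _ _ (gk_ambient M) (gk_ambient M) S
    (@zerop _ _ M) (@fullp _ _ M) (@zerop _ _ M) K M p id id sS (submodT M) hp
    (sq_proj_hom (gk_hom_id M) (fun y => ex_intro _ y erefl))
    (fun _ _ _ => erefl) (fun _ _ => I) (fun _ _ _ _ => erefl)
    (fun _ _ _ => erefl) (fun _ _ h => h).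
have [_ p_surj p_ker _ _] := hp.
exists K, i; split=> //.
  apply: gk_hom_ker0 => // v; have [x Kx <-] := p_surj v.
  by rewrite iE // => x0; apply/p_ker.
move=> v; split=> [e|[x ->]]; first by exists (p v); rewrite iE.
by have [y Ky <-] := p_surj x; rewrite iE.
Qed.

(** Kernel, image and cokernel inherit filtrations whose classes are compatible with the given [k]
    and [n]. Induction on the filtration of the target: the case of [f] followed by N -> N' is
    known, and on its kernel [f] takes values in the first step [A], where [Eu_map_cat] applies. *)
Lemma Eu_map (M N : gkmod P) (f : M -> N) k n : Eu M k -> Eu N n -> gk_hom f ->
  exists k0 k1 k2, [/\ EuS (kerp f) (@zerop _ _ M) k0,
    EuS (imp f) (@zerop _ _ N) k1, EuS (@fullp _ _ N) (imp f) k2,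
    k = ab_add k0 k1 & n = ab_add k1 k2].
Proof.
move=> + hN; elim: hN M f k => {N n} [N N0|A N N'' n CA eA hN IH] M f k hM f_hom.
  have e : kerp f = @fullp _ _ M by apply/predeqP => x; split=> // _; exact: N0.
  exists k, ab_zero, ab_zero; split; rewrite ?ab_addr0 //.
  - by rewrite e; apply/EuS_full.
  - by apply: EuS_zero_pred (submod_imp f_hom) _ => x _; exact: N0.
  - have -> : imp f = @fullp _ _ N.
      apply/predeqP => x; split=> // _; exists 0 => //.
      by rewrite (N0 x) (lin0 (hom_lin f_hom)).
    exact: (EuS_zero _ hP (submodT N)).
have [i [q [[i_hom q_hom] i_inj q_surj ex]]] := eA.
have fb_hom := gk_hom_comp f_hom q_hom.
have f1 := hom_lin f_hom; have i1 := hom_lin i_hom; have q1 := hom_lin q_hom.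
have [k0' [k1' [k2' [h0 h1 h2 e1 e2]]]] := IH _ _ _ hM fb_hom.
have [K [j [j_hom j_inj jP hK]]] := EuS_sub h0.
have j1 := hom_lin j_hom.
have [|g [g_hom gE]] := Eu_lift (gk_hom_comp j_hom f_hom) i_hom i_inj.
  by move=> x; apply/ex; apply: (proj2 (jP (j x))); exists x.
have g1 := hom_lin g_hom.
have [k0 [k1 [k2 [hk0 hk1 hk2 e3 e4]]]] := Eu_map_cat hK CA g_hom.
have sK := submod_kerp f_hom; have sQ := submod_kerp q_hom.
have sIf := submod_imp f_hom; have sKb := submod_kerp fb_hom.
have KK x : kerp f x -> kerp (q \o f) x by rewrite /kerp /= => ->; rewrite (lin0 q1).
have a0 : EuS (kerp f) (@zerop _ _ M) k0.
  apply: (subincl_push j_hom j_inj) hk0 => //.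
  - exact: submod_kerp.
  - exact: submod0.
  - exact: submod0.
  - exact: sub_zero (submod_kerp g_hom).
  - exact: sub_zero.
  - move=> y; split=> [fy|[x gx ->]].
      have [x e] := (jP y).1 (KK _ fy); exists x => //.
      by apply: i_inj; rewrite gE (lin0 i1) /= -e.
    by rewrite /kerp -[f (j x)]/((f \o j) x) -gE gx (lin0 i1).
  - move=> y; split=> [->|[x -> ->]]; last by rewrite /zerop (lin0 j1).
    by exists 0 => //; rewrite (lin0 j1).
have imf_meet y : meetp (imp f) (kerp q) y <-> exists2 x, imp g x & y = i x.
  split=> [[[x _ ->] qy]|[_ [x _ ->] ->]].
    have [z e] := (jP x).1 qy; exists (g z); first by exists z.
    by rewrite gE /= e.
  by rewrite gE; split; [exists (j x) | apply: (proj2 (jP (j x))); exists x].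
have a1 : EuS (meetp (imp f) (kerp q)) (@zerop _ _ N) k1.
  apply: (subincl_push i_hom i_inj) (CS_EuS hP hk1) => //.
  - exact: submod_imp.
  - exact: submod0.
  - exact: submodI.
  - exact: submod0.
  - exact: sub_zero (submod_imp g_hom).
  - exact: sub_zero (submodI sIf sQ).
  - move=> y; split=> [->|[x -> ->]]; last by rewrite /zerop (lin0 i1).
    by exists 0 => //; rewrite (lin0 i1).
have a2 : EuS (kerp q) (meetp (kerp q) (imp f)) k2.
  apply: (subincl_push i_hom i_inj) (CS_EuS hP hk2) => //.
  - exact: submod_imp.
  - exact: submodI.
  - by move=> x [].
  - move=> y; split=> [/ex[x ->]|[x _ ->]]; first by exists x.
    by apply/ex; exists x.
  - by move=> y; rewrite -imf_meet; split=> -[].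
have a2' := (second_iso sQ sIf k2).1 a2.
have sum_im y : addp (imp f) (kerp q) y <-> imp (q \o f) (q y).
  split=> [[_ [z [[x _ ->] qz ->]]]|[x _ e]].
    by exists x => //=; rewrite (linD q1) qz addr0.
  exists (f x), (y - f x); split; first by exists x.
    by rewrite /kerp (linB q1) e subrr.
  by rewrite addrC subrK.
have sum_im' y : addp (kerp q) (imp f) y <-> imp (q \o f) (q y).
  rewrite -sum_im; split=> -[a [b [h h' ->]]]; exists b, a; by rewrite addrC.
have b1 : EuS (imp f) (meetp (imp f) (kerp q)) k1'.
  apply/(second_iso sIf sQ); apply: (quot_pull q_hom) h1 => //.
  - exact: submodD.
  - exact: submod_imp.
  - exact: submod0.
  - move=> x qx; exists 0, x; split=> //; last by rewrite add0r.
    by exists 0; rewrite ?(lin0 f1).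
  - exact: sub_zero (submod_imp fb_hom).
have b2 : EuS (@fullp _ _ N) (addp (kerp q) (imp f)) k2'.
  apply: (quot_pull q_hom) h2 => //.
  - exact: submodD.
  - exact: submod_imp.
exists k0, (ab_add k1 k1'), (ab_add k2 k2'); split.
- exact: a0.
- exact: (EuS_ses hP a1 b1).
- exact: (EuS_ses hP a2' b2).
- by rewrite e1 e3 ab_addA.
- by rewrite e4 e2 ab_addACA.
Qed.

Lemma Eu_cat_uniq (M : gkmod P) k : Eu M k -> C M -> k = cls C M.
Proof.
elim=> {M k} [M M0 _|A M M'' k CA eA hM IH CM]; first by rewrite (cls_zero hC).
have CM'' : C M''.
  have [i [q [[i_hom q_hom] i_inj q_surj ex]]] := eA.
  have [_ _ _ _ hcok] := hC; apply: (hcok _ _ i) CA CM => //.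
  by exists q; split.
by rewrite IH // -(cls_ses CA CM CM'' eA).
Qed.

Lemma Eu_zero_uniq (M : gkmod P) k : Eu M k -> (forall x : M, x = 0) -> k = ab_zero.
Proof.
move=> h M0; rewrite (Eu_cat_uniq h) ?(cls_zero hC) //; exact: (cat_zero hC).
Qed.

Lemma EuS_zero_uniq (M : gkmod P) (S U : M -> Prop) k : EuS S U k ->
  (forall x, S x -> U x) -> k = ab_zero.
Proof.
move=> [_ _ _ [Q [p [[_ p_surj p_ker _ _] h]]]] SU; apply: Eu_zero_uniq h _ => q.
by have [x Sx <-] := p_surj q; apply/p_ker => //; exact: SU.
Qed.

(** Independence of the filtration. [Eu_map], applied to M -> M'' with the second class on [M] and
    the given one on [M''], splits [k'] into the class of the kernel [A] and the class of [M'']; for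
    [A], an object of [C], [Eu_cat_uniq] applies. *)
Lemma Eu_uniq (M : gkmod P) k k' : Eu M k -> Eu M k' -> k = k'.
Proof.
move=> h; case: h k' => {M k} [M M0|A M M'' k CA eA hM] k' h'.
  by rewrite (Eu_zero_uniq h').
have [i [q [[i_hom q_hom] i_inj q_surj ex]]] := eA.
have [k0 [k1 [k2 [h0 h1 h2 -> ->]]]] := Eu_map h' hM q_hom.
rewrite (EuS_zero_uniq h2) ?ab_addr0; last first.
  by move=> x _; have [y <-] := q_surj x; exists y.
congr ab_add; apply/esym.
have hA : EuS (@fullp _ _ A) (@zerop _ _ A) k0.
  apply: (subincl_pull i_hom i_inj) h0 => //.
  - exact: submod0.
  - exact: submod_kerp.
  - exact: submod0.
  - exact: sub_zero (submod_kerp q_hom).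
  - by move=> y; rewrite /kerp ex; split=> [[x ->]|[x _ ->]]; exists x.
  - have i1 := hom_lin i_hom; move=> y; split=> [->|[x -> ->]].
      by exists 0 => //; rewrite (lin0 i1).
    by rewrite /zerop (lin0 i1).
by apply: Eu_cat_uniq CA; apply/EuS_full.
Qed.

(** * Euler characteristics in long exact sequences *)

Section LongExactSequence.
Variables (X Y Z : nat -> gkmod P).
Variables (f : forall n, X n -> Y n) (g : forall n, Y n -> Z n)
  (h : forall n, Z n -> X n.+1).
Hypotheses (f_hom : forall n, gk_hom (@f n)) (g_hom : forall n, gk_hom (@g n))
  (h_hom : forall n, gk_hom (@h n)).
Hypotheses (exY : forall n, kerp (@g n) = imp (@f n))
  (exZ : forall n, kerp (@h n) = imp (@g n))
  (exX : forall n, kerp (@f n.+1) = imp (@h n)).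
Hypothesis f0_inj : forall x, @f 0%N x = 0 -> x = 0.
Variable d : nat.
Hypothesis Xd : forall x : X d.+1, x = 0.

(** Here [t n] stands for the class of ker (f n), the image of the connecting map. It enters in
    degrees [n - 1] and [n] and cancels. *)
Lemma alt_sum_shift (x y z : nat -> Kgroup C) t :
  (forall n, ab_add (x n) (z n) = ab_add (y n) (ab_add (t n) (t n.+1))) ->
  t 0%N = ab_zero -> t d.+1 = ab_zero ->
  alt_sum d y = ab_add (alt_sum d x) (alt_sum d z).
Proof.
move=> e t0 td; rewrite -alt_sumD (eq_alt_sum (fun n _ => e n)) alt_sumD.
rewrite [X in _ = ab_add _ X](_ : _ = ab_zero) ?ab_addr0 //.
rewrite (@alt_sum_telescope _ d (fun n => ab_add (t n) (t n.+1)) t t (fun=> ab_zero)) //.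
  by rewrite /alt_sum big1 // => q _; exact: ab_mulz_sign0.
by move=> n; rewrite ab_addr0.
Qed.

Lemma les_middle (x z : nat -> Kgroup C) :
  (forall n, Eu (X n) (x n)) -> (forall n, Eu (Z n) (z n)) ->
  exists2 y, forall n, Eu (Y n) (y n) &
    alt_sum d y = ab_add (alt_sum d x) (alt_sum d z).
Proof.
move=> hX hZ.
have /choice[k0 H0] n := Eu_map (hZ n) (hX n.+1) (h_hom n).
have /choice[k1 H1] n := H0 n.
have /choice[k2 {H0}H] n := H1 n.
(* No connecting map ends in degree 0, and there [f] is injective, so its kernel has class zero and
   its image the class of all of [X 0]. *)
pose t n := if n is m.+1 then k1 m else ab_zero.
pose a n := if n is m.+1 then k2 m else x 0%N.
have ex n : x n = ab_add (t n) (a n).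
  by case: n => [|n]; rewrite /t /a ?ab_add0 //; have [] := H n.
have ha n : EuS (@fullp _ _ (X n)) (kerp (@f n)) (a n).
  case: n => [|n] /=; last by rewrite exX; have [] := H n.
  rewrite (_ : kerp _ = @zerop _ _ (X 0%N)); first exact/EuS_full.
  apply/predeqP => v; split=> [/f0_inj //|->].
  by rewrite /kerp (lin0 (hom_lin (f_hom 0))).
exists (fun n => ab_add (a n) (k0 n)).
  move=> n; apply/EuS_full.
  apply: (EuS_ses hP ((first_iso (f_hom n) _).1 (ha n))).
  rewrite -exY; apply/(first_iso (g_hom n)); rewrite -exZ.
  by have [] := H n.
apply: (@alt_sum_shift _ _ _ t) => //.
  move=> n; rewrite ex; have [_ _ _ -> _] := H n.
  by rewrite (ab_addC (t n)) ab_addACA.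
have [_ h1 _ _ _] := H d; apply: EuS_zero_uniq h1 _ => v _; exact: Xd.
Qed.

(** [Z n] is an extension of the kernel of [f] in degree [n + 1] by the cokernel of [f] in degree
    [n]; both have filtrations by [Eu_map]. *)
Lemma les_right (x y : nat -> Kgroup C) :
  (forall n, Eu (X n) (x n)) -> (forall n, Eu (Y n) (y n)) ->
  exists2 z, forall n, Eu (Z n) (z n) &
    alt_sum d y = ab_add (alt_sum d x) (alt_sum d z).
Proof.
move=> hX hY.
have /choice[t H0] n := Eu_map (hX n) (hY n) (f_hom n).
have /choice[k1 H1] n := H0 n.
have /choice[k2 {H0}H] n := H1 n.
exists (fun n => ab_add (k2 n) (t n.+1)).
  move=> n; apply/EuS_full.
  have [_ _ h2 _ _] := H n; have [h0 _ _ _ _] := H n.+1.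
  apply: (EuS_ses hP (T := imp (@g n))).
    by apply/(first_iso (g_hom n)); rewrite exY.
  by rewrite -exZ; apply/(first_iso (h_hom n)); rewrite -exX.
apply: (@alt_sum_shift _ _ _ t).
- move=> n; have [_ _ _ -> ->] := H n.
  by rewrite (ab_addC (t n)) ab_addACA.
- by have [h0 _ _ _ _] := H 0%N; apply: EuS_zero_uniq h0 _ => v /f0_inj.
- by have [h0 _ _ _ _] := H d.+1; apply: EuS_zero_uniq h0 _ => v _; exact: Xd.
Qed.

End LongExactSequence.

End Devissage.

(** * Alternating forms and the Chevalley-Eilenberg complex *)

(** A spanning family with linear coordinates. In this form finite-dimensionality passes to sub- and
    quotient spaces along linear retractions and sections. *)
Definition findim (F : fieldType) (b : lmodType F) : Prop :=
  exists d (e : 'I_d -> b) (l : 'I_d -> b -> F^o),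
    (forall i, linear (l i)) /\ forall x, x = \sum_i l i x *: e i.

Lemma invmxM_unit (R : comUnitRingType) n (A B : 'M[R]_n) :
  A \in unitmx -> B \in unitmx -> invmx (A *m B) = invmx B *m invmx A.
Proof.
move=> uA uB; have uAB : A *m B \in unitmx by rewrite unitmx_mul uA.
apply: (can_inj (mulKmx uAB)); rewrite mulmxV //.
by rewrite mulmxA -(mulmxA A) mulmxV // mulmx1 mulmxV.
Qed.

Lemma zmod_bracket (V : zmodType) (a b x y e g : V) :
  a - b - (x - y) = a - e - (g - y) - (b - g - (e - x)).
Proof.
rewrite !opprB !addrA [RHS](ACl (1*8*3*6*(2*5)*(7*4)))%AC /=.
by rewrite addNr subrr !addr0.
Qed.

Section OneParam.
Variables (R : realType) (P : gk_pair R) (hP : gk_group P).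

Lemma one_param0 g X : one_param (@grp R P) g X -> g 0 = 1%:M.
Proof.
move=> [Kg gD _]; have u := gg_unit hP (Kg 0).
by apply: (can_inj (mulKmx u)); rewrite -gD addr0 mulmx1.
Qed.

Lemma one_paramN g X t : one_param (@grp R P) g X -> invmx (g t) = g (- t).
Proof.
move=> gX; have [Kg gD _] := gX; have u := gg_unit hP (Kg t).
by apply: (can_inj (mulKmx u)); rewrite mulmxV // -gD subrr (one_param0 gX).
Qed.

Lemma gk_actVK (V : gkmod P) k (v : V) : grp k -> gk_act k (gk_act (invmx k) v) = v.
Proof.
move=> Kk; have Kv := gg_V hP Kk; have u := gg_unit hP Kk.
by rewrite -gk_actM // mulmxV // gk_act1.
Qed.

Lemma gk_actKV (V : gkmod P) k (v : V) : grp k -> gk_act (invmx k) (gk_act k v) = v.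
Proof.
move=> Kk; have Kv := gg_V hP Kk; have u := gg_unit hP Kk.
by rewrite -gk_actM // mulVmx // gk_act1.
Qed.

Lemma gk_actVlin (V : gkmod P) k : grp k -> linear (@gk_act R P V (invmx k)).
Proof. by move=> Kk; apply: gk_act_linear; exact: gg_V. Qed.

Lemma dual_coef (b : gkmod P) (l : b -> R[i]^o) (v : b) : linear l ->
  ccont (@grp R P) (fun k => l (gk_act (invmx k) v)) /\
  forall g X, one_param (@grp R P) g X ->
    cderiv (fun t => l (gk_act (invmx (g t)) v)) (- l (gk_lie (kemb P X) v)).
Proof.
move=> l_lin; have lfv : lf_vec (@grp R P) (@gk_act R P b) (fun X => gk_lie (kemb P X)) v.
  by have /lf_vecP := @gk_finite R P b; apply.
have [cc cd] := @lf_vec_coef _ _ _ b _ _ (@gk_act_linear R P b)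
  (fun X => @gk_lie_linear R P b (kemb P X)) v l l_lin lfv.
split.
  apply: (@ccont_comp _ _ _ _ (@grp R P) (@invmx R (deg P)) (fun k => l (gk_act k v))) cc.
    by apply: invmx_continuous => k; exact: gg_unit.
  by move=> k; exact: gg_V.
move=> g X gX; apply: (@eq_cderiv _ (fun t => l (gk_act (g (- t)) v))).
  by move=> t; rewrite (one_paramN _ gX).
exact/(cderiv_opp (cd _ _ gX)).
Qed.

End OneParam.

Section HomAmbient.
Variables (R : realType) (P : gk_pair R) (hP : gk_group P).
Variables (b : gkmod P) (fb : findim b) (V : ambient P).

Definition hom_act k (F : b -> V) : b -> V :=
  fun y => am_act V k (F (gk_act (invmx k) y)).
Definition hom_lie X (F : b -> V) : b -> V :=
  fun y => am_lie V X (F y) - F (gk_lie X y).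
Definition hom_dom (F : b -> V) : Prop := linear F /\ forall y, am_dom V (F y).

(** [F] is the sum of the tensors l_i (x) F(e_i). The tensors l_j (x) G_s span a stable space with
    matrix coefficients l_j(k^-1 e_j') c(k)_(s' s), whose derivatives come from the product rule. *)
Lemma hom_lf (F : b -> V) : linear F ->
  (forall y, lf_vec (@grp R P) (@am_act R P V) (fun X => am_lie V (kemb P X)) (F y)) ->
  lf_vec (@grp R P) hom_act (fun X => hom_lie (kemb P X)) F.
Proof.
move=> F_lin hF; have [d [e [l [l_lin le]]]] := fb.
pose ten i (v : V) : b -> V := fun y => l i y *: v.
have -> : F = \sum_i ten i (F (e i)).
  apply/funext => y; rewrite {1}(le y) (lin_sum F_lin) fct_sumE.
  by apply: eq_bigr => i _; rewrite (linZ F_lin).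
apply: (subsp_sum (lf_vec_subspace _ _ _)) => i _.
have [J [G [[a eF] [c [Gc cc cd]]]]] := hF (e i).
exists ('I_d * J)%type, (fun js => ten js.1 (G js.2)); split.
  exists (fun js => if js.1 == i then a js.2 else 0).
  apply/funext => y; rewrite /ten eF fct_sumE.
  rewrite -(pair_bigA _ (fun j s => ((if j == i then a s else 0) *:
     (fun y : b => l j y *: G s)) y)) /=.
  rewrite (bigD1 i) //= [X in _ = _ + X]big1 ?addr0; last first.
    by move=> j /negPf ->; rewrite big1 // => s _; rewrite scale0r.
  rewrite scaler_sumr; apply: eq_bigr => s _; rewrite eqxx.
  by rewrite scalrfctE !scalerA mulrC.
exists (fun k js' js => l js.1 (gk_act (invmx k) (e js'.1)) * c k js'.2 js.2).
split.
- move=> k [j s] Kk; apply/funext => y; rewrite /hom_act /ten /=.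
  rewrite (linZ (am_act_linear Kk)) Gc // fct_sumE.
  rewrite -(pair_bigA _ (fun j' s' => ((l j (gk_act (invmx k) (e j')) *
     c k s' s) *: (fun y : b => l j' y *: G s')) y)) /= exchange_big /=.
  rewrite scaler_sumr; apply: eq_bigr => s' _.
  rewrite {1}(le y) (lin_sum (gk_actVlin hP Kk)) (lin_sum (l_lin j)) scaler_suml.
  apply: eq_bigr => j' _; rewrite (linZ (gk_actVlin hP Kk)) (linZ (l_lin j)).
  rewrite scalrfctE !scalerA; congr (_ *: _).
  by rewrite [X in X * _]/(_ *: _) /=; ring.
- move=> [j' s'] [j s] /=; apply: ccontM; last exact: cc.
  by have [] := dual_coef hP (e j') (l_lin j).
- move=> g X [j s] gX; have [D [eD dD]] := cd _ _ s gX.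
  exists (fun js' => - l j (gk_lie (kemb P X) (e js'.1)) * c 1%:M js'.2 s
     + l j (e js'.1) * D js'.2); split; last first.
    move=> [j' s'] /=; have [_ /(_ _ _ gX) h] := dual_coef hP (e j') (l_lin j).
    have := cderivM h (dD s'); rewrite (one_param0 hP gX) invmx1 gk_act1.
    by rewrite addrC (mulrC (c _ _ _)).
  apply/funext => y; rewrite fct_sumE.
  rewrite -(pair_bigA _ (fun j' s' => ((- l j (gk_lie (kemb P X) (e j')) *
     c 1%:M s' s + l j (e j') * D s') *: (fun y : b => l j' y *: G s')) y)) /=.
  rewrite /hom_lie /ten /= (linZ (am_lie_linear _)) eD addrC.
  (* The family [G] may be linearly dependent, so [c 1%:M] need not be the identity matrix; all that
     is known is that it fixes the family. *)
  have eG : G s = \sum_s' c 1%:M s' s *: G s'.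
    by rewrite -Gc ?am_act1 //; exact: gg_1.
  rewrite {1}eG {1}(le y) (lin_sum (gk_lie_linear _)) (lin_sum (l_lin j)).
  have ly : l j y = \sum_j' l j (l j' y *: e j') by rewrite -(lin_sum (l_lin j)) -le.
  rewrite [X in _ + X *: _]ly.
  rewrite !scaler_suml -sumrN -big_split; apply: eq_bigr => j' _ /=.
  rewrite (linZ (gk_lie_linear _)) !(linZ (l_lin j)) !scaler_sumr.
  rewrite -sumrN -big_split; apply: eq_bigr => s' _ /=.
  rewrite scalrfctE !scalerA -scaleNr -scalerDl; congr (_ *: _).
  by rewrite /GRing.scale /=; ring.
Qed.

Definition hom_ambient : ambient P.
Proof.
apply: (@Ambient R P ((b -> V) : lmodType R[i]) hom_act hom_lie hom_dom).
- split; first by split=> [a x y|y]; rewrite ?scaler0 ?addr0 //;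
    exact: (subsp0 (am_dom_subspace V)).
  move=> a F G [F1 F2] [G1 G2]; split=> [c x y|y]; last first.
    by have [_] := am_dom_subspace V; apply.
  rewrite !fctE F1 G1 !scalerDr !scalerA mulrC addrACA; congr (_ + _).
- move=> k F Kk [F1 F2]; split=> [a x y|y]; last exact: am_dom_act.
  by rewrite /hom_act (gk_actVlin hP Kk) F1 (am_act_linear Kk).
- move=> X F [F1 F2]; split=> [a x y|y]; last first.
    apply: (subspB (am_dom_subspace V)); last exact: F2.
    exact: am_dom_lie.
  rewrite /hom_lie (gk_lie_linear X) !F1 (am_lie_linear X).
  by rewrite scalerBr opprD addrACA.
- move=> k Kk a F G; apply/funext => y; rewrite /hom_act !fctE.
  exact: am_act_linear.
- by move=> F; apply/funext => y; rewrite /hom_act invmx1 gk_act1 am_act1.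
- move=> k l F Kk Kl [F1 F2]; apply/funext => y; rewrite /hom_act.
  have [Kk' Kl'] := (gg_V hP Kk, gg_V hP Kl).
  have [uk ul] := (gg_unit hP Kk, gg_unit hP Kl).
  by rewrite invmxM_unit // gk_actM // am_actM.
- move=> X a F G; apply/funext => y; rewrite /hom_lie !fctE (am_lie_linear X).
  by rewrite scalerBr opprD addrACA.
- move=> a X Y F [F1 F2]; apply/funext => y; rewrite /hom_lie !fctE.
  rewrite am_lie_linearl // (gk_lie_linearl y) F1.
  by rewrite scalerBr opprD addrACA.
- move=> X Y F [F1 F2]; apply/funext => y; rewrite /hom_lie !fctE.
  rewrite am_lie_br // gk_lie_br (linB F1) !(linB (am_lie_linear _)).
  exact: zmod_bracket.
- move=> k X F Kk [F1 F2]; apply/funext => y; rewrite /hom_act /hom_lie.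
  rewrite (linB (am_act_linear Kk)) am_act_lie //; congr (_ - am_act V k (F _)).
  rewrite -[LHS](gk_actKV hP (k := k)) //; congr gk_act.
  by rewrite gk_act_lie // gk_actVK.
- by move=> F [F1 F2]; apply: hom_lf => // y; exact: am_finite.
Defined.

End HomAmbient.

Lemma zmod_cartan (V : zmodType) (a b c e : V) :
  a - (e - c) = b - e - (b - a - c).
Proof.
rewrite !opprB !addrA [RHS](ACl (4*3*2*(1*5)))%AC /=.
by rewrite subrr addr0.
Qed.

Section IteratedHom.
Variables (R : realType) (P : gk_pair R) (hP : gk_group P).
Variables (b : gkmod P) (fb : findim b).

Section OneModule.
Variable M : gkmod P.

(* Forms of degree [q] on [b], curried: [ML q] is [b -> ... -> b -> M]. *)
Fixpoint ML q : ambient P :=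
  if q is q'.+1 then hom_ambient hP fb (ML q') else gk_ambient M.

(** Together with the recursion in [alt], this imposes alternation on neighbouring arguments only,
    which suits the curried form; [alt_altb] recovers it for all pairs. *)
Definition alt2 q : ML q.+1 -> Prop :=
  match q return ML q.+1 -> Prop with
  | 0 => fun=> True
  | q'.+1 => fun F : b -> b -> ML q' => forall y, F y y = 0
  end.

Fixpoint alt q : ML q -> Prop :=
  match q return ML q -> Prop with
  | 0 => fun=> True
  | q'.+1 => fun F : b -> ML q' =>
      [/\ linear F, forall y, alt (F y) & alt2 (F : ML q'.+1)]
  end.

Lemma alt_dom q (F : ML q) : alt F -> am_dom _ F.
Proof.
by elim: q F => [//|q IHq] F [F_lin Fa _]; split=> // y; apply: IHq; exact: Fa.
Qed.

Lemma alt_subspace q : subspace_pred (@alt q).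
Proof.
elim: q => [|q IHq]; first by split.
split=> [|a F G [F1 F2 F3] [G1 G2 G3]].
  split=> [a x y|y|]; rewrite ?scaler0 ?addr0 //; first exact: (subsp0 IHq).
  by case: (q) => [//|q'] y.
split=> [c x y|y|].
- rewrite !fctE F1 G1 !scalerDr !scalerA mulrC addrACA; congr (_ + _).
- by have [_] := IHq; apply; [exact: F2 | exact: G2].
- case: q F G {IHq F1 F2 G1 G2} F3 G3 => [//|q] F G F3 G3 y.
  by rewrite -[LHS]/(a *: F y y + G y y) F3 G3 scaler0 addr0.
Qed.

Lemma alt_act q k (F : ML q) : grp k -> alt F -> alt (am_act _ k F).
Proof.
move=> Kk; elim: q F => [//|q IHq] F [F1 F2 F3]; split=> [c x y|y|].
- by rewrite /= /hom_act (gk_actVlin hP Kk) F1 (am_act_linear Kk).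
- by apply: IHq; exact: F2.
- case: q F {IHq F1 F2} F3 => [//|q] F F3 y.
  rewrite -[LHS]/(am_act _ k (F (gk_act (invmx k) y) (gk_act (invmx k) y))).
  by rewrite F3 (lin0 (am_act_linear Kk)).
Qed.

Lemma alt_lie q X (F : ML q) : alt F -> alt (am_lie _ X F).
Proof.
elim: q F => [//|q IHq] F [F1 F2 F3]; split=> [c x y|y|].
- rewrite /= /hom_lie (gk_lie_linear X) !F1 (am_lie_linear X).
  by rewrite scalerBr opprD addrACA.
- by apply: (subspB (@alt_subspace q)); [apply: IHq|]; exact: F2.
- case: q F {IHq} F1 F2 F3 => [//|q] F F1 F2 F3 y.
  rewrite -[LHS]/(am_lie _ X (F y y) - F y (gk_lie X y) - F (gk_lie X y) y).
  (* What remains is F y z + F z y = 0, the polarization of F (y + z) (y + z) = 0. *)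
  rewrite F3 (lin0 (am_lie_linear X)) sub0r -opprD; apply/eqP.
  rewrite oppr_eq0; apply/eqP; set z := gk_lie X y.
  have [Fl _ _] := F2 y; have [Fz _ _] := F2 z; have := F3 (y + z).
  rewrite (linD F1) -[LHS]/(F y (y + z) + F z (y + z)) (linD Fl) (linD Fz) !F3.
  by rewrite add0r addr0.
Qed.

Lemma alt_stable q : stable (@alt q).
Proof.
split; [exact: alt_subspace | exact: alt_dom | | ].
- by move=> k F; exact: alt_act.
- by move=> X F; exact: alt_lie.
Qed.

Section Differential.
Variable iota : b -> lie P.
Hypothesis iota_lin : linear iota.
Hypothesis iota_alt : forall y : b, gk_lie (iota y) y = 0.
Hypothesis iota_lie : forall X (y : b), iota (gk_lie X y) = br X (iota y).
Hypothesis iota_act : forall k (y : b), grp k -> iota (gk_act k y) = Ad k (iota y).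

(* The Chevalley-Eilenberg differential, defined by Cartan's formula
   [(dF) y = L_y F - d (F y)]. *)
Fixpoint ce q : ML q -> ML q.+1 :=
  match q return ML q -> ML q.+1 with
  | 0 => fun F => fun y => am_lie (ML 0) (iota y) F
  | q'.+1 => fun F => fun y => am_lie (ML q'.+1) (iota y) F - ce ((F : b -> ML q') y)
  end.

Lemma ceE q (F : ML q.+1) y :
  ce F y = am_lie _ (iota y) F - ce ((F : b -> ML q) y).
Proof. by []. Qed.

Lemma ce_linear q : linear (@ce q).
Proof.
elim: q => [|q IHq] a F G; apply/funext => y; first exact: am_lie_linear.
rewrite ceE am_lie_linear -[X in ce X]/(a *: F y + G y) IHq.
by rewrite opprD addrACA -scalerBr.
Qed.

Lemma alt_ce q (F : ML q) : alt F -> alt (ce F).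
Proof.
elim: q F => [|q IHq] F hF.
  split=> // a x y; rewrite /= iota_lin; exact: gk_lie_linearl.
have hF' := hF; have [F1 F2 F3] := hF; split=> [a x y|y|].
- rewrite !ceE iota_lin am_lie_linearl; last exact: (alt_dom hF).
  by rewrite F1 ce_linear opprD addrACA -scalerBr.
- apply: (subspB (@alt_subspace q.+1)); first exact: alt_lie.
  exact/IHq/F2.
- move=> y.
  rewrite -[LHS]/((am_lie (ML q.+1) (iota y) F : b -> ML q) y - (ce (F y) : b -> ML q) y).
  rewrite -[X in X - _]/(am_lie _ (iota y) (F y) - F (gk_lie (iota y) y)).
  rewrite iota_alt (lin0 F1) subr0.
  case: q F {IHq hF hF' F1 F2} F3 => [|q] F F3; first by rewrite subrr.
  by rewrite ceE F3 (lin0 (@ce_linear q)) subr0 subrr.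
Qed.

Lemma ce_act q k (F : ML q) : grp k -> alt F ->
  ce (am_act _ k F) = am_act _ k (ce F).
Proof.
move=> Kk; elim: q F => [|q IHq] F hF; apply/funext => y.
  rewrite -[RHS]/(am_act (ML 0) k (am_lie (ML 0) (iota (gk_act (invmx k) y)) F)).
  by rewrite am_act_lie // -iota_act // gk_actVK.
have [F1 F2 F3] := hF.
rewrite -[RHS]/(am_act _ k (am_lie _ (iota (gk_act (invmx k) y)) F -
  ce (F (gk_act (invmx k) y)))).
rewrite ceE (linB (am_act_linear Kk)) am_act_lie //; last exact: alt_dom.
by rewrite -iota_act // gk_actVK // -IHq //; exact: F2.
Qed.

Lemma ce_lie q X (F : ML q) : alt F -> ce (am_lie _ X F) = am_lie _ X (ce F).
Proof.
elim: q F => [|q IHq] F hF; apply/funext => y.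
  rewrite -[RHS]/(gk_lie X (gk_lie (iota y) (F : M)) - gk_lie (iota (gk_lie X y)) (F : M)).
  by rewrite iota_lie gk_lie_br opprB addrC subrK.
have [F1 F2 F3] := hF.
rewrite -[RHS]/(am_lie _ X (am_lie _ (iota y) F - ce (F y))
   - (am_lie _ (iota (gk_lie X y)) F - ce (F (gk_lie X y)))).
rewrite ceE -[X in ce X]/(am_lie _ X (F y) - F (gk_lie X y)).
rewrite (linB (@ce_linear q)) (linB (am_lie_linear X)) -IHq; last exact: F2.
rewrite iota_lie am_lie_br; last exact: (alt_dom hF).
exact: zmod_cartan.
Qed.

(** Cartan's formula gives (ddF) y = L_y dF - d(L_y F) + dd(F y). The first two terms cancel by
    [ce_lie], and the last is the induction hypothesis. *)
Lemma ceK q (F : ML q) : alt F -> ce (ce F) = 0.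
Proof.
elim: q F => [|q IHq] F hF; apply/funext => y; rewrite ceE.
  by rewrite -(ce_lie _ hF) subrr.
have [_ F2 _] := hF; rewrite -(ce_lie _ hF).
rewrite [X in _ - ce X](ceE F y) (linB (@ce_linear _) _ (ce (F y))).
by rewrite (IHq _ (F2 y)) subr0 subrr.
Qed.

Definition cocyc q (F : ML q) : Prop := alt F /\ ce F = 0.

Definition cobord q : ML q -> Prop :=
  match q return ML q -> Prop with
  | 0 => fun F => F = 0
  | p.+1 => fun F => exists2 G : ML p, alt G & F = ce G
  end.

Lemma cocyc_stable q : stable (@cocyc q).
Proof.
have [aS ad _ _] := @alt_stable q; split.
- split=> [|a F G [aF cF] [aG cG]]; first by split; [exact: subsp0 | exact: (lin0 (@ce_linear q))].
  by split; [have [_] := aS; apply | rewrite ce_linear cF cG scaler0 addr0].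
- by move=> F [/ad].
- move=> k F Kk [aF cF]; split; first exact: alt_act.
  by rewrite ce_act // cF (lin0 (am_act_linear Kk)).
- move=> X F [aF cF]; split; first exact: alt_lie.
  by rewrite ce_lie // cF (lin0 (am_lie_linear X)).
Qed.

Lemma cobord_cocyc q (F : ML q) : cobord F -> cocyc F.
Proof.
case: q F => [|q] F /=; first by move=> ->; split=> //; exact: (lin0 (@ce_linear 0)).
by move=> [G aG ->]; split; [exact: alt_ce | exact: ceK].
Qed.

Lemma zero_stable (X : ambient P) : stable (fun x : X => x = 0).
Proof.
split.
- by split=> // a x y -> ->; rewrite scaler0 addr0.
- by move=> x ->; exact: (subsp0 (am_dom_subspace X)).
- by move=> k x Kk ->; rewrite (lin0 (am_act_linear Kk)).
- by move=> Y x ->; rewrite (lin0 (am_lie_linear Y)).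
Qed.

Lemma cobord_stable q : stable (@cobord q).
Proof.
case: q => [|q]; first exact: zero_stable.
have [aS ad _ _] := @alt_stable q; split.
- split=> [|a F F' [G aG ->] [G' aG' ->]].
    by exists 0; [exact: subsp0 | rewrite (lin0 (@ce_linear q))].
  by exists (a *: G + G'); [have [_] := aS; apply | rewrite ce_linear].
- by move=> F /cobord_cocyc[/alt_dom].
- move=> k _ Kk [G aG ->]; exists (am_act _ k G); first exact: alt_act.
  by rewrite ce_act.
- move=> X _ [G aG ->]; exists (am_lie _ X G); first exact: alt_lie.
  by rewrite ce_lie.
Qed.

End Differential.
End OneModule.
End IteratedHom.

(** * Forms as functions of argument lists, and their comparison with curried forms *)

Section ArgumentLists.
Variable T : Type.

Definition fcons q (y : T) (x : 'I_q -> T) : 'I_q.+1 -> T :=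
  fun i => oapp x y (unlift ord0 i).

Definition ftail q (x : 'I_q.+1 -> T) : 'I_q -> T := fun s => x (lift ord0 s).

Definition updb q (x : 'I_q -> T) (i : 'I_q) (y : T) : 'I_q -> T :=
  fun j => if j == i then y else x j.

Lemma fcons0 q y (x : 'I_q -> T) : fcons y x ord0 = y.
Proof. by rewrite /fcons unlift_none. Qed.

Lemma fconsS q y (x : 'I_q -> T) s : fcons y x (lift ord0 s) = x s.
Proof. by rewrite /fcons liftK. Qed.

Lemma ftail_cons q y (x : 'I_q -> T) : ftail (fcons y x) = x.
Proof. by apply/funext => s; exact: fconsS. Qed.

Lemma fcons_eta q (x : 'I_q.+1 -> T) : fcons (x ord0) (ftail x) = x.
Proof.
by apply/funext => i; case: (unliftP ord0 i) => [j|] ->; rewrite ?fconsS ?fcons0.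
Qed.

Lemma updb_cons0 q y (x : 'I_q -> T) z : updb (fcons y x) ord0 z = fcons z x.
Proof.
apply/funext => i; rewrite /updb; case: (unliftP ord0 i) => [j|] ->.
  by rewrite eq_sym (negPf (neq_lift _ _)) !fconsS.
by rewrite eqxx fcons0.
Qed.

Lemma updb_consS q y (x : 'I_q -> T) s z :
  updb (fcons y x) (lift ord0 s) z = fcons y (updb x s z).
Proof.
apply/funext => i; rewrite /updb; case: (unliftP ord0 i) => [j|] ->.
  by rewrite (inj_eq (@lift_inj _ _)) !fconsS.
by rewrite (negPf (neq_lift _ _)) !fcons0.
Qed.

Lemma updb_same q (x : 'I_q -> T) i : updb x i (x i) = x.
Proof. by apply/funext => j; rewrite /updb; case: eqP => // ->. Qed.

Lemma fcons_lift q y (x : 'I_q.+1 -> T) (j : 'I_q.+1) :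
  (fun s => fcons y x (lift (lift ord0 j) s)) = fcons y (fun s => x (lift j s)).
Proof.
apply/funext => s; case: (unliftP ord0 s) => [s'|] ->.
  rewrite fconsS -(fconsS y x); congr fcons; apply: val_inj.
  by rewrite /= /bump /= !add1n ltnS addnS.
by rewrite fcons0 -{2}(fcons0 y x); congr fcons; apply: val_inj.
Qed.

End ArgumentLists.

Section AlternatingForms.
Variables (F : fieldType) (b M : lmodType F).

Definition mlin q (f : ('I_q -> b) -> M) : Prop :=
  forall x i a y z, f (updb x i (a *: y + z)) =
    a *: f (updb x i y) + f (updb x i z).

Definition altb q (f : ('I_q -> b) -> M) : Prop :=
  mlin f /\ forall x i j, i != j -> x i = x j -> f x = 0.

Lemma mlinD q (f : ('I_q -> b) -> M) x i y z : mlin f ->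
  f (updb x i (y + z)) = f (updb x i y) + f (updb x i z).
Proof. by move=> h; have := h x i 1 y z; rewrite !scale1r. Qed.

Lemma altb_swap q (f : ('I_q -> b) -> M) x i j y z : altb f -> i != j ->
  f (updb (updb x i y) j z) = - f (updb (updb x i z) j y).
Proof.
move=> [f_lin f_alt] ij; apply/eqP; rewrite -subr_eq0 opprK; apply/eqP.
have uC u v : updb (updb x i u) j v = updb (updb x j v) i u.
  apply/funext => k; rewrite /updb; case: eqP => // ->.
  by rewrite eq_sym (negPf ij).
have z0 u : f (updb (updb x i u) j u) = 0.
  apply: (f_alt _ i j) => //; rewrite /updb eqxx (negPf ij) eqxx //.
have E w : f (updb (updb x i (y + z)) j w) =
    f (updb (updb x i y) j w) + f (updb (updb x i z) j w).
  by rewrite !uC mlinD.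
by have := z0 (y + z); rewrite mlinD // !E !z0 add0r addr0 addrC.
Qed.

Lemma altb_perm q (f : ('I_q -> b) -> M) x (s : {perm 'I_q}) : altb f ->
  f (fun k => x (s k)) = (-1) ^+ s *: f x.
Proof.
move=> hf; have [ts -> ts_ne] := prod_tpermP s.
elim: ts ts_ne x => [|[i j] ts IH] /=.
  move=> _ x; rewrite big_nil odd_perm1 scale1r; congr f.
  by apply/funext => k; rewrite perm1.
move=> /andP[ij ts_ne] x; rewrite big_cons /= odd_permM odd_tperm ij.
pose x' k := x ((\prod_(t <- ts) tperm t.1 t.2)%g k).
have e : (fun k => x' (tperm i j k)) = updb (updb x' i (x' j)) j (x' i).
  apply/funext => k; rewrite /updb; case: eqP => [->|/eqP kj]; first by rewrite tpermR.
  case: eqP => [->|/eqP ki]; first by rewrite tpermL.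
  by rewrite tpermD // eq_sym.
have -> : (fun k => x ((tperm i j * \prod_(t <- ts) tperm t.1 t.2)%g k)) =
    (fun k => x' (tperm i j k)) by apply/funext => k; rewrite permM.
rewrite e altb_swap // !updb_same IH //.
by rewrite -scaleNr signr_addb /= expr1 mulN1r.
Qed.

(** Moving the argument in slot [j] to the front takes [j] transpositions of neighbours. *)
Lemma altb_cons_lift q (f : ('I_q.+1 -> b) -> M) (x : 'I_q.+1 -> b) j z : altb f ->
  f (fcons z (fun s => x (lift j s))) = (-1) ^+ j *: f (updb x j z).
Proof.
elim: q f x j => [|q IHq] f x j hf.
  rewrite (ord1 j) scale1r; congr f; rewrite -{2}(fcons_eta x) updb_cons0.
  by congr fcons; apply/funext => -[].
rewrite -(fcons_eta x); case: (unliftP ord0 j) => [j'|] ->; last first.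
  by rewrite scale1r updb_cons0 -/(ftail _) ftail_cons.
rewrite fcons_lift updb_consS.
set y := x ord0; set x' := ftail x.
pose g (u : 'I_q.+1 -> b) := f (fcons y u).
have hg : altb g.
  have [f1 f2] := hf; split.
    by move=> u i a v w; rewrite /g -!updb_consS f1.
  move=> u i k ik e; apply: (f2 _ (lift ord0 i) (lift ord0 k)).
    by rewrite (inj_eq (@lift_inj _ _)).
  by rewrite !fconsS.
rewrite -[f (fcons y _)]/(g _) lift0 exprS mulN1r scaleNr -IHq // /g.
set w := fun s => x' (lift j' s).
have e u v : fcons u (fcons v w) =
    updb (updb (fcons u (fcons v w)) ord0 u) (lift ord0 ord0) v.
  by rewrite updb_cons0 updb_consS updb_cons0.
rewrite e [X in - f X]e.
rewrite altb_swap //; congr (- f _).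
by rewrite !updb_cons0 !updb_consS !updb_cons0.
Qed.

End AlternatingForms.

Section Uncurrying.
Variables (R : realType) (P : gk_pair R) (hP : gk_group P).
Variables (b : gkmod P) (fb : findim b).
Variable M : gkmod P.

Local Notation ML := (ML hP fb M).

Fixpoint ev q : ML q -> ('I_q -> b) -> M :=
  match q return ML q -> ('I_q -> b) -> M with
  | 0 => fun F _ => F
  | q'.+1 => fun F x => ev ((F : b -> ML q') (x ord0)) (ftail x)
  end.

Fixpoint cur q : (('I_q -> b) -> M) -> ML q :=
  match q return (('I_q -> b) -> M) -> ML q with
  | 0 => fun f => f (fun=> 0)
  | q'.+1 => fun f y => cur (fun x => f (fcons y x))
  end.

Lemma evK q : cancel (@ev q) (@cur q).
Proof.
elim: q => [//|q IHq] F; apply/funext => y /=.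
rewrite -[RHS]IHq; congr cur; apply/funext => x.
by rewrite fcons0 ftail_cons.
Qed.

Lemma curK q : cancel (@cur q) (@ev q).
Proof.
elim: q => [|q IHq] f; apply/funext => x /=; first by congr f; apply/funext => -[].
by rewrite IHq fcons_eta.
Qed.

Lemma ev_cons q (F : ML q.+1) y x : ev F (fcons y x) = ev ((F : b -> ML q) y) x.
Proof. by rewrite /= fcons0 ftail_cons. Qed.

Lemma ev_linear q a (F G : ML q) x : ev (a *: F + G) x = a *: ev F x + ev G x.
Proof. by elim: q F G x => [//|q IHq] F G x; exact: IHq. Qed.

Lemma ev_lin q : linear (@ev q).
Proof. by move=> a F G; apply/funext => x; rewrite ev_linear. Qed.

Lemma ev_act q k (F : ML q) x :
  ev (am_act _ k F) x = gk_act k (ev F (fun s => gk_act (invmx k) (x s))).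
Proof. by elim: q F x => [//|q IHq] F x; exact: IHq. Qed.

Lemma ev_lie q X (F : ML q) x : ev (am_lie _ X F) x =
  gk_lie X (ev F x) - \sum_s ev F (updb x s (gk_lie X (x s))).
Proof.
elim: q F x => [|q IHq] F x; first by rewrite big_ord0 subr0.
rewrite -{1}(fcons_eta x) ev_cons -[X in ev X]/(am_lie _ X (F (x ord0)) - F (gk_lie X (x ord0))).
rewrite (linB (@ev_lin q)) !fctE IHq big_ord_recl opprD addrA [RHS]addrAC.
by congr (_ - _ - _).
Qed.

Lemma alt_altb q (F : ML q) : alt F -> altb (ev F).
Proof.
elim: q F => [|q IHq] F; first by move=> _; split=> [x []|x []].
move=> [F1 F2 F3].
have H a u j' : a = u j' -> ev F (fcons a u) = 0.
  rewrite ev_cons; case: q F IHq F1 F2 F3 u j' => [|q] F IHq F1 F2 F3 u j'; first by case: j'.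
  move=> e; have Fa : F a a = 0 by exact: F3.
  have hb := IHq _ (F2 a).
  rewrite -(fcons_eta u) in e *; case: (unliftP ord0 j') e => [j''|] -> e; last first.
    rewrite fcons0 in e; rewrite ev_cons -e Fa.
    by rewrite (lin0 (@ev_lin q)).
  rewrite -[fcons _ _](updb_same _ (lift ord0 j'')) -e.
  rewrite -[X in updb X](updb_same _ ord0) altb_swap ?neq_lift // updb_cons0.
  rewrite updb_consS ev_cons Fa.
  by rewrite (lin0 (@ev_lin q)) oppr0.
split=> [x i a y z|x i j].
  rewrite -(fcons_eta x); case: (unliftP ord0 i) => [i'|] ->.
    by rewrite !updb_consS !ev_cons; have [h _] := IHq _ (F2 (x ord0)); exact: h.
  by rewrite !updb_cons0 !ev_cons F1 ev_linear.
rewrite -(fcons_eta x); set a := x ord0; set u := ftail x.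
case: (unliftP ord0 i) => [i'|] ->; case: (unliftP ord0 j) => [j'|] -> ij; rewrite ?fconsS ?fcons0.
- rewrite ev_cons; have [_ h] := IHq _ (F2 a); apply: h.
  by rewrite -(inj_eq (@lift_inj _ ord0)).
- by move/esym; exact: H.
- exact: H.
- by rewrite eqxx in ij.
Qed.

Lemma altb_alt q (F : ML q) : altb (ev F) -> alt F.
Proof.
elim: q F => [//|q IHq] F [f1 f2]; split.
- move=> a y z; apply: (can_inj (@evK q)); apply/funext => x.
  by rewrite ev_linear -!ev_cons -(updb_cons0 0 x) f1 !updb_cons0.
- move=> y; apply: IHq; split=> [x i a u v|x i j ij e].
    by rewrite -!ev_cons -!updb_consS f1.
  rewrite -ev_cons; apply: (f2 _ (lift ord0 i) (lift ord0 j)).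
    by rewrite (inj_eq (@lift_inj _ _)).
  by rewrite !fconsS.
- case: q F {IHq} f1 f2 => [//|q] F f1 f2 y.
  apply: (can_inj (@evK q)); apply/funext => x; rewrite (lin0 (@ev_lin q)).
  rewrite -ev_cons -(@ev_cons q.+1); apply: (f2 _ ord0 (lift ord0 ord0)) => //.
  by rewrite fcons0 fconsS fcons0.
Qed.

Section DifferentialFormula.
Variable iota : b -> lie P.

(** The formula of [ce_diff] for a general [iota]; [ev_ce] identifies it with the recursive [ce]. *)
Definition ced q (f : ('I_q -> b) -> M) : ('I_q.+1 -> b) -> M := fun x =>
  \sum_(i < q.+1)
      ((-1) ^+ i : R[i]) *: gk_lie (iota (x i)) (f (fun s => x (lift i s)))
  + \sum_(i < q.+1) \sum_(j < q.+1 | (i < j)%N)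
      ((-1) ^+ j : R[i]) *:
        f (fun s => updb x i (gk_lie (iota (x i)) (x j)) (lift j s)).

(** Cartan's formula for the explicit differential. The terms with i = 0 of the two sums form the
    Lie derivative along [y]: moving the bracket from slot 0 to slot j contributes (-1)^j and leaves
    the sign -1. The other terms have all indices shifted by one, whence the sign before [ced]. *)
Lemma ced_cons q (f : ('I_q.+1 -> b) -> M) y u : altb f ->
  ced f (fcons y u) = gk_lie (iota y) (f u)
    - \sum_s f (updb u s (gk_lie (iota y) (u s))) - ced (fun z => f (fcons y z)) u.
Proof.
move=> hf; rewrite /ced [X in X + _ = _]big_ord_recl /= expr0 scale1r fcons0.
have -> : (fun s => fcons y u (lift ord0 s)) = u by apply/funext => s; rewrite fconsS.
rewrite -!addrA; congr (_ + _).
rewrite [X in _ + X = _]big_ord_recl /= addrCA; congr (_ + _).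
- rewrite -sumrN big_mkcond big_ord_recl /= add0r; apply: eq_bigr => j _.
  rewrite fcons0 fconsS /bump /= add1n updb_cons0.
  have -> : (fun s => fcons (gk_lie (iota y) (u j)) u (lift (lift ord0 j) s)) =
     fcons (gk_lie (iota y) (u j)) (fun s => u (lift j s)) by rewrite fcons_lift.
  rewrite altb_cons_lift // scalerA exprS -mulrA -exprMn mulrNN mulr1 expr1n.
  by rewrite mulr1 scaleN1r.
- rewrite opprD -!sumrN; congr (_ + _); apply: eq_bigr => i _.
    by rewrite /bump /= add1n exprS mulN1r scaleNr fconsS fcons_lift.
  rewrite -sumrN big_mkcond [RHS]big_mkcond big_ord_recl /= add0r.
  apply: eq_bigr => j _; rewrite /bump /= !add1n ltnS; case: ifP => // _.
  by rewrite !fconsS updb_consS fcons_lift exprS mulN1r scaleNr.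
Qed.

Lemma ev_ce q (F : ML q) : alt F -> ev (ce iota F) = ced (ev F).
Proof.
elim: q F => [|q IHq] F hF; apply/funext => x.
  rewrite /ced !big_ord1 /= scale1r big_pred0 ?addr0 // => j.
  by rewrite (ord1 j).
have [_ F2 _] := hF.
rewrite -(fcons_eta x) ced_cons; last exact: alt_altb.
rewrite ev_cons ceE (linB (@ev_lin _)) !fctE ev_lie (IHq _ (F2 _)).
by congr (_ - ced _ _); apply/funext => z; rewrite ev_cons.
Qed.

End DifferentialFormula.

End Uncurrying.

Lemma cards_ord_noninj m n (t : 'I_m -> 'I_n) : (n < m)%N ->
  exists i j, i != j /\ t i = t j.
Proof.
move=> nm; apply: contrapT => h; suff /leq_card : injective t.
  by rewrite !card_ord leqNgt nm.
move=> i j e; apply/eqP/negPn/negP => ij; apply: h; by exists i, j.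
Qed.

Section AltSum.
Variables (F : fieldType) (b M : lmodType F) (q : nat).

Lemma altb_sum (I : Type) (r : seq I) (f : I -> ('I_q -> b) -> F^o) (m : I -> M) :
  (forall i, altb (f i)) -> altb (fun x => \sum_(i <- r) f i x *: m i).
Proof.
move=> hf; split=> [x i a y z|x i j ij e].
  rewrite scaler_sumr -big_split; apply: eq_bigr => k _.
  by have [-> _] := hf k; rewrite scalerDl scalerA.
by apply: big1 => k _; have [_ h] := hf k; rewrite (h _ _ _ ij e) scale0r.
Qed.

Lemma altbZ (f : ('I_q -> b) -> F^o) (m : M) :
  altb f -> altb (fun x => f x *: m).
Proof.
move=> [f1 f2]; split=> [x i a y z|x i j ij e].
  by rewrite f1 scalerDl scalerA.
by rewrite (f2 _ _ _ ij e) scale0r.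
Qed.

End AltSum.

Section PostComposition.
Variables (R : realType) (P : gk_pair R) (hP : gk_group P).
Variables (b : gkmod P) (fb : findim b).
Variables (M N : gkmod P) (p : M -> N).
Hypothesis p_hom : gk_hom p.

Fixpoint pc q : ML hP fb M q -> ML hP fb N q :=
  match q return ML hP fb M q -> ML hP fb N q with
  | 0 => p
  | q'.+1 => fun F y => pc ((F : b -> ML hP fb M q') y)
  end.

Lemma ev_pc q (F : ML hP fb M q) x : ev (pc F) x = p (ev F x).
Proof. by elim: q F x => [//|q IHq] F x; exact: IHq. Qed.

Lemma pc_linear q : linear (@pc q).
Proof.
elim: q => [|q IHq]; first by case: p_hom.
by move=> a F G; apply/funext => y; exact: IHq.
Qed.

Lemma pc_act q k (F : ML hP fb M q) : grp k -> pc (am_act _ k F) = am_act _ k (pc F).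
Proof.
move=> Kk; elim: q F => [|q IHq] F; first by case: p_hom => _ + _; apply.
by apply/funext => y; exact: IHq.
Qed.

Lemma pc_lie q X (F : ML hP fb M q) : pc (am_lie _ X F) = am_lie _ X (pc F).
Proof.
elim: q F => [|q IHq] F; first by case: p_hom => _ _; apply.
apply/funext => y.
rewrite -[LHS]/(pc (am_lie _ X ((F : b -> ML hP fb M q) y) - (F : b -> ML hP fb M q) (gk_lie X y))).
by rewrite (linB (@pc_linear q)) IHq.
Qed.

Lemma pc_alt q (F : ML hP fb M q) : alt F -> alt (pc F).
Proof.
elim: q F => [//|q IHq] F [F1 F2 F3]; split=> [a x y|y|].
- by rewrite /= F1 pc_linear.
- by apply: IHq; exact: F2.
- case: q F {IHq F1 F2} F3 => [//|q] F F3 y.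
  rewrite -[LHS]/(pc (F y y)) F3; exact: (lin0 (@pc_linear q)).
Qed.

Lemma pc_ce iota q (F : ML hP fb M q) : pc (ce iota F) = ce iota (pc F).
Proof.
elim: q F => [|q IHq] F; apply/funext => y; first by case: p_hom => _ _; apply.
rewrite ceE -IHq.
rewrite -[LHS]/(pc (am_lie _ (iota y) F - ce iota ((F : b -> ML hP fb M q) y))).
by rewrite (linB (@pc_linear q.+1)) pc_lie.
Qed.

Lemma pc_inj q : injective p -> injective (@pc q).
Proof.
move=> p_inj; elim: q => [//|q IHq] F G e; apply/funext => y; apply: IHq.
exact: (congr1 (fun H : ML hP fb N q.+1 => (H : b -> ML hP fb N q) y) e).
Qed.

Lemma pc_alt_inv q (F : ML hP fb M q) : injective p -> alt (pc F) -> alt F.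
Proof.
move=> p_inj; elim: q F => [//|q IHq] F [F1 F2 F3]; split=> [a x y|y|].
- by apply: (pc_inj p_inj); rewrite pc_linear; exact: F1.
- by apply: IHq; exact: F2.
- case: q F {IHq F1 F2} F3 => [//|q] F F3 y; apply: (pc_inj p_inj).
  by rewrite (lin0 (@pc_linear q)); exact: F3.
Qed.

Lemma pc_surj q (G : ML hP fb N q) :
  (forall x, exists m, p m = ev G x) -> exists F, pc F = G.
Proof.
move=> /choice[f fP]; exists (cur hP fb f).
by apply: (can_inj (@evK _ _ _ _ _ _ _)); apply/funext => x; rewrite ev_pc curK.
Qed.

End PostComposition.

(** * Expansion of alternating forms in coordinates *)

Section Expansion.
Variables (R : realType) (P : gk_pair R) (hP : gk_group P).
Variables (b : gkmod P) (fb : findim b).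
Variables (d : nat) (e : 'I_d -> b) (l : 'I_d -> b -> R[i]^o).
Hypothesis l_lin : forall i, linear (l i).
Hypothesis le : forall x, x = \sum_i l i x *: e i.

Fixpoint indices q : seq ('I_q -> 'I_d) :=
  match q with
  | 0 => [:: fun i : 'I_0 => match (notF (ltn_ord i)) with end]
  | q'.+1 => [seq fcons i t | i <- index_enum 'I_d, t <- indices q']
  end.

(** The antisymmetrized product of the coordinates l_(t k). Since [indices] runs through all index
    maps and not only increasing ones, each term recurs for all q! orderings, which the factor 1 /
    q! compensates. *)
Definition eps q (t : 'I_q -> 'I_d) (x : 'I_q -> b) : R[i]^o :=
  (q`!%:R)^-1 * \det (\matrix_(j, k) (l (t k) (x j) : R[i])).

Lemma eps_altb q (t : 'I_q -> 'I_d) : altb (eps t).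
Proof.
split=> [x i a y z|x i j ij exx].
  rewrite /eps (@determinant_multilinear _ _ _
    (\matrix_(j, k) (l (t k) (updb x i y j) : R[i]))
    (\matrix_(j, k) (l (t k) (updb x i z j) : R[i])) i a 1).
  - by rewrite -[a *: _]/(a * _) mul1r mulrDr mulrCA.
  - by apply/rowP => k; rewrite !mxE /updb !eqxx l_lin mul1r.
  - by apply/matrixP => j k; rewrite !mxE /updb eq_sym (negPf (neq_lift _ _)).
  - by apply/matrixP => j k; rewrite !mxE /updb eq_sym (negPf (neq_lift _ _)).
rewrite /eps (@determinant_alternate _ _ _ i j) ?mulr0 //.
by move=> k; rewrite !mxE exx.
Qed.

Lemma mlin_expand (M : lmodType R[i]) q (f : ('I_q -> b) -> M) x : mlin f ->
  f x = \sum_(t <- indices q) (\prod_k (l (t k) (x k) : R[i])) *: f (e \o t).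
Proof.
elim: q f x => [|q IHq] f x hf.
  by rewrite big_seq1 big_ord0 scale1r; congr f; apply/funext => -[].
have f_lin u : linear (fun y => f (fcons y u)).
  by move=> a y z; rewrite -(updb_cons0 0) hf !updb_cons0.
rewrite -{1}(fcons_eta x) {1}(le (x ord0)) (lin_sum (f_lin _)) /= big_allpairs_dep /=.
apply: eq_bigr => i _; rewrite (linZ (f_lin _)) (IHq (fun u => f (fcons (e i) u))).
  rewrite scaler_sumr; apply: eq_bigr => t _.
  rewrite scalerA big_ord_recl fcons0; congr (_ * _ *: _).
    by apply: eq_bigr => k _; rewrite fconsS.
  congr f; apply/funext => k /=.
  by case: (unliftP ord0 k) => [k'|] ->; rewrite ?fconsS ?fcons0.
by move=> u s a y z; rewrite -!updb_consS hf.
Qed.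

Lemma altb_expand (M : lmodType R[i]) q (f : ('I_q -> b) -> M) x : altb f ->
  f x = \sum_(t <- indices q) eps t x *: f (e \o t).
Proof.
move=> hf; have [f_lin _] := hf.
have qn0 : (q`!%:R : R[i]) != 0 by rewrite pnatr_eq0 -lt0n fact_gt0.
(* Averaging over permutations before the multilinear expansion turns the coefficients into
   determinants. *)
have E : f x = (q`!%:R : R[i])^-1 *:
    \sum_(s : {perm 'I_q}) (-1) ^+ s *: f (fun k => x (s k)).
  rewrite (eq_bigr (fun=> f x)); last first.
    by move=> s _; rewrite altb_perm // scalerA -signr_addb addbb scale1r.
  have -> : \sum_(s : {perm 'I_q}) f x = q`!%:R *: f x.
    by rewrite sumr_const scaler_nat; congr (_ *+ _); exact: card_Sn.
  by rewrite scalerA mulVf ?scale1r.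
rewrite E.
under eq_bigr do rewrite (mlin_expand _ f_lin) scaler_sumr.
rewrite exchange_big scaler_sumr; apply: eq_bigr => t _ /=.
rewrite /eps -det_tr /determinant mulr_sumr scaler_suml scaler_sumr; apply: eq_bigr => s _.
rewrite !scalerA; congr (_ *: _); rewrite -mulrA; congr (_ * (_ * _)).
by apply: eq_bigr => k _; rewrite !mxE.
Qed.

Section Module.
Variable M : gkmod P.

Lemma ev_expand q (F : ML hP fb M q) x : alt F ->
  ev F x = \sum_(t <- indices q) eps t x *: ev F (e \o t).
Proof. by move=> /alt_altb; exact: altb_expand. Qed.

Lemma alt_vanish q (F : ML hP fb M q) : (d < q)%N -> alt F -> F = 0.
Proof.
move=> dq hF; apply: (can_inj (@evK _ _ _ _ _ _ q)); apply/funext => x.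
rewrite (ev_expand _ hF) (lin0 (@ev_lin _ _ _ _ _ _ q)).
apply: big1 => t _; have [i [j [ij et]]] := cards_ord_noninj t dq.
by have [_ h] := alt_altb hF; rewrite (h _ i j) ?scaler0 //= et.
Qed.

Lemma alt_findim q (T : gkmod P) (p : ML hP fb M q -> T) (lM : M -> R[i]^o) (m0 : M) :
  sq_proj (fun F : ML hP fb M q => alt F) (fun F => F = 0) p ->
  linear lM -> (forall m, m = lM m *: m0) -> findim T.
Proof.
move=> hp lM_lin lMe; have [p_lin p_surj p_ker _ _] := hp.
have /choice[s sP] : forall z, exists F, alt F /\ p F = z.
  by move=> z; have [F hF <-] := p_surj z; exists F.
have hS := @alt_subspace _ _ hP _ fb M q.
pose r := in_tuple (indices q).
have sumE (W : zmodType) (f : _ -> W) :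
    \sum_(t <- indices q) f t = \sum_(i < size (indices q)) f (tnth r i).
  by rewrite -(big_tnth _ _ (indices q) predT f).
pose lam i z : R[i]^o := lM (ev (s z) (e \o tnth r i)).
pose bas i := p (cur hP fb (fun x => eps (tnth r i) x *: m0)).
have abas i : alt (cur hP fb (fun x => eps (tnth r i) x *: m0)).
  by apply: altb_alt; rewrite curK; apply: altbZ; exact: eps_altb.
have s_inj F : alt F -> s (p F) = F.
  move=> hF; have [h1 h2] := sP (p F).
  apply/eqP; rewrite -subr_eq0; apply/eqP.
  exact/(sq_proj_eq hS hp h1 hF).
exists (size (indices q)), bas, lam; split=> [i a x y|z].
  have [h1 e1] := sP x; have [h2 e2] := sP y.
  rewrite /lam -{1}e1 -{1}e2 -p_lin // s_inj; last by have [_] := hS; apply.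
  by rewrite ev_linear lM_lin.
have [h1 {1}<-] := sP z.
have -> : s z = \sum_i lam i z *: cur hP fb (fun x => eps (tnth r i) x *: m0).
  apply: (can_inj (@evK _ _ _ _ _ _ q)); apply/funext => x.
  rewrite (lin_sum (@ev_lin _ _ _ _ _ _ q)) fct_sumE (ev_expand _ h1) sumE.
  apply: eq_bigr => i _; rewrite (linZ (@ev_lin _ _ _ _ _ _ q)) curK scalrfctE.
  by rewrite {1}(lMe (ev (s z) _)) !scalerA mulrC.
have H (u : seq 'I_(size (indices q))) (c : _ -> R[i]) :
    alt (\sum_(i <- u) c i *: cur hP fb (fun x => eps (tnth r i) x *: m0)) /\
    p (\sum_(i <- u) c i *: cur hP fb (fun x => eps (tnth r i) x *: m0)) =
      \sum_(i <- u) c i *: bas i.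
  elim: u => [|i u [IH1 IH2]].
    by rewrite !big_nil; split; [exact: subsp0 | exact: sq_proj0 hS hp].
  rewrite !big_cons; split; first by have [_] := hS; apply.
  by rewrite p_lin // IH2.
exact: (H _ _).2.
Qed.

End Module.

(** A pointwise lift of the values would not be alternating. Only the values on tuples of the [e i]
    are lifted, and the forms [eps] reassemble them. *)
Lemma alt_lift (M N : gkmod P) (p : M -> N) q (G : ML hP fb N q) :
  gk_hom p -> (forall y, exists x, p x = y) -> alt G ->
  exists2 F : ML hP fb M q, alt F & pc p F = G.
Proof.
move=> p_hom p_surj hG; have [p_lin _ _] := p_hom.
have [m mP] := choice (fun t => p_surj (ev G (e \o t))).
exists (cur hP fb (fun x => \sum_(t <- indices q) eps t x *: m t)).
  by apply: altb_alt; rewrite curK; apply: altb_sum => t; exact: eps_altb.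
apply: (can_inj (@evK _ _ _ _ _ _ q)); apply/funext => x.
rewrite ev_pc curK (lin_sum p_lin) (ev_expand _ hG); apply: eq_bigr => t _.
by rewrite (linZ p_lin) mP.
Qed.

(* [E] is the module of alternating [q]-forms on [b] with values in [C]. *)
Definition is_extb q (E : gkmod P) (j : E -> ('I_q -> b) -> R[i]^o) : Prop :=
  [/\ forall a u v x, j (a *: u + v) x = a * j u x + j v x,
      injective j,
      forall f : ('I_q -> b) -> R[i]^o, altb f <-> exists u, f = j u,
      forall k u x, grp k -> j (gk_act k u) x = j u (fun s => gk_act (invmx k) (x s))
    & forall X u x, j (gk_lie X u) x = - \sum_s j u (updb x s (gk_lie X (x s)))].

(** The bilinear map sends (m, u) to the form x |-> u(x) m. The expansion along [eps] shows that
    such forms span and determines the map that the universal property asks for. *)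
Lemma alt_tensor q (M E T : gkmod P) (j : E -> ('I_q -> b) -> R[i]^o)
    (p : ML hP fb M q -> T) :
  is_extb j -> sq_proj (fun F : ML hP fb M q => alt F) (fun F => F = 0) p ->
  is_tensor M E T.
Proof.
move=> [j_lin j_inj j_alt j_act j_lie] hp; have [p_lin p_surj p_ker p_act p_lie] := hp.
have hS := @alt_subspace _ _ hP _ fb M q.
pose F0 m u := cur hP fb (fun x => (j u x : R[i]) *: m) : ML hP fb M q.
have F0_alt m u : alt (F0 m u).
  apply: altb_alt; rewrite curK; apply: altbZ; apply/j_alt; by exists u.
have evF0 m u x : ev (F0 m u) x = (j u x : R[i]) *: m by rewrite curK.
have inj := can_inj (@evK _ _ hP _ fb M q).
have /choice[s sP] : forall z, exists F, alt F /\ p F = z.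
  by move=> z; have [F hF <-] := p_surj z; exists F.
have s_inj F : alt F -> s (p F) = F.
  move=> hF; have [h1 h2] := sP (p F).
  apply/eqP; rewrite -subr_eq0; apply/eqP.
  exact/(sq_proj_eq hS hp h1 hF).
have /choice[u uP] : forall t : 'I_q -> 'I_d, exists u, j u = eps t.
  by move=> t; have /j_alt[u ->] := eps_altb t; exists u.
have expand F : alt F -> F = \sum_(t <- indices q) F0 (ev F (e \o t)) (u t).
  move=> hF; apply: inj; apply/funext => x.
  rewrite (ev_expand _ hF) (lin_sum (@ev_lin _ _ _ _ _ _ q)) fct_sumE.
  by apply: eq_bigr => t _; rewrite evF0 uP.
have psum (r : seq ('I_q -> 'I_d)) (f : _ -> ML hP fb M q) : (forall t, alt (f t)) ->
    p (\sum_(t <- r) f t) = \sum_(t <- r) p (f t).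
  move=> hf; suff: alt (\sum_(t <- r) f t) /\ p (\sum_(t <- r) f t) = \sum_(t <- r) p (f t).
    by case.
  elim: r => [|t r [IH1 IH2]].
    by rewrite !big_nil; split; [exact: subsp0 | exact: sq_proj0 hS hp].
  rewrite !big_cons; split; first exact: subspD.
  by have := p_lin 1 _ _ (hf t) IH1; rewrite !scale1r => ->; rewrite IH2.
exists (fun m v => p (F0 m v)); split.
- split=> [v a m m'|m a v v']; rewrite -p_lin //; congr p; apply: inj; apply/funext => x.
    by rewrite ev_linear !evF0 scalerDr !scalerA mulrC.
  by rewrite ev_linear !evF0 j_lin scalerDl scalerA.
- move=> Z c c1 c2.
  pose f z := \sum_(t <- indices q) c (ev (s z) (e \o t)) (u t).
  have f_lin : linear f.
    move=> a y z; have [h1 e1] := sP y; have [h2 e2] := sP z.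
    rewrite /f -{1}e1 -{1}e2 -p_lin // s_inj; last by have [_] := hS; apply.
    rewrite scaler_sumr -big_split; apply: eq_bigr => t _.
    by rewrite ev_linear c1.
  exists f; split.
    split=> // m v; rewrite /f s_inj //.
    have {2}-> : v = \sum_(t <- indices q) (j v (e \o t) : R[i]) *: u t.
      apply: j_inj; apply/funext => x.
      have jl : linear (fun w => j w x : R[i]^o) by move=> a w w'; exact: j_lin.
      rewrite (lin_sum jl) (@altb_expand _ _ (j v)); last by apply/j_alt; exists v.
      by apply: eq_bigr => t _; rewrite (linZ jl) uP /GRing.scale /= mulrC.
    rewrite (lin_sum (c2 m)); apply: eq_bigr => t _.
    by rewrite evF0 (linZ (c2 m)) (linZ (c1 (u t))).
  move=> g [g_lin gE]; apply/funext => z; have [h1 {2}<-] := sP z.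
  rewrite (expand _ h1) psum // (lin_sum g_lin); apply: eq_bigr => t _.
  by rewrite gE.
- move=> k m v Kk; rewrite -p_act //; congr p; apply: inj; apply/funext => x.
  by rewrite ev_act !evF0 j_act // (linZ (gk_act_linear Kk)).
- move=> X m v; rewrite -p_lie //.
  have pD F G : alt F -> alt G -> p F + p G = p (F + G).
    by move=> hF hG; have := p_lin 1 _ _ hF hG; rewrite !scale1r.
  rewrite pD //; congr p; apply: inj; apply/funext => x.
  rewrite (linD (@ev_lin _ _ _ _ _ _ q)) ev_lie !fctE !evF0 j_lie.
  rewrite (linZ (gk_lie_linear X)) scaleNr scaler_suml; congr (_ - _).
  by apply: eq_bigr => s' _; rewrite evF0.
Qed.

End Expansion.

(** * Cohomology of the nilpotent radical *)

Lemma dchoice (I : Type) (T : I -> Type) (S : forall i, T i -> Prop) :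
  (forall i, exists t, @S i t) -> exists t, forall i, @S i (t i).
Proof.
by move=> h; exists (fun i => projT1 (cid (h i))) => i; exact: projT2 (cid (h i)).
Qed.

Section TensorUniqueness.
Variables (R : realType) (P : gk_pair R).
Implicit Types V W T : gkmod P.

Lemma tensor_eq V W T (Z : lmodType R[i]) (b : V -> W -> T) (f g : T -> Z) :
  (forall w, linear (b^~ w)) -> (forall v, linear (b v)) ->
  (forall (Z : lmodType R[i]) (c : V -> W -> Z),
        (forall w, linear (c^~ w)) -> (forall v, linear (c v)) ->
        exists! f : T -> Z, linear f /\ forall v w, f (b v w) = c v w) ->
  linear f -> linear g -> (forall v w, f (b v w) = g (b v w)) -> f = g.
Proof.
move=> b1 b2 univ f_lin g_lin e.
have [||h [_ hu]] := univ Z (fun v w => f (b v w)).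
- by move=> w a x y; rewrite b1 f_lin.
- by move=> v a x y; rewrite b2 f_lin.
transitivity h; first by apply/esym/hu; split.
by apply: hu; split=> // v w; rewrite e.
Qed.

Lemma tensor_iso V W T T' : is_tensor V W T -> is_tensor V W T' -> gk_iso T T'.
Proof.
move=> [b [[b1 b2] univ b_act b_lie]] [b' [[b1' b2'] univ' b_act' b_lie']].
have [f [[f_lin fE] _]] := univ T' b' b1' b2'.
have [g [[g_lin gE] _]] := univ' T b b1 b2.
have teq := tensor_eq b1 b2 univ; have teq' := tensor_eq b1' b2' univ'.
exists f; split; last first.
  exists g => t.
    apply: (congr1 (fun h => h t) (teq _ (g \o f) id _ _ _)) => //.
      by move=> a x y /=; rewrite f_lin g_lin.
    by move=> v w /=; rewrite fE gE.
  apply: (congr1 (fun h => h t) (teq' _ (f \o g) id _ _ _)) => //.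
    by move=> a x y /=; rewrite g_lin f_lin.
  by move=> v w /=; rewrite gE fE.
split=> // [k t Kk|X t].
  apply: (congr1 (fun h => h t) (teq _ (fun t => f (gk_act k t)) (fun t => gk_act k (f t)) _ _ _)).
  - by move=> a x y; rewrite (gk_act_linear Kk) f_lin.
  - by move=> a x y; rewrite f_lin (gk_act_linear Kk).
  - by move=> v w; rewrite b_act // !fE b_act'.
apply: (congr1 (fun h => h t) (teq _ (fun t => f (gk_lie X t)) (fun t => gk_lie X (f t)) _ _ _)).
- by move=> a x y; rewrite (gk_lie_linear X) f_lin.
- by move=> a x y; rewrite f_lin (gk_lie_linear X).
- by move=> v w; rewrite b_lie (linD f_lin) !fE b_lie'.
Qed.

End TensorUniqueness.

Section AltModules.
Variables (R : realType) (P : gk_pair R) (hP : gk_group P).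
Variables (b : gkmod P) (fb : findim b).

Local Notation ML := (ML hP fb).

Definition alt_proj (M : gkmod P) q (T : gkmod P) (p : ML M q -> T) : Prop :=
  sq_proj (fun F : ML M q => alt F) (fun F => F = 0) p.

Definition is_altmod (M : gkmod P) q (T : gkmod P) : Prop := exists p, @alt_proj M q T p.

Lemma altmod_exists M q : exists T, is_altmod M q T.
Proof.
have [|T [p hp]] := sq_exists hP (@alt_stable _ _ hP _ fb M q) (zero_stable (ML M q)).
  by move=> x ->; exact: (subsp0 (@alt_subspace _ _ hP _ fb M q)).
by exists T, p.
Qed.

Lemma alt_projP (M : gkmod P) q (T : gkmod P) (p : ML M q -> T) : alt_proj p ->
  forall F G, alt F -> alt G -> p F = p G -> F = G.
Proof.
move=> hp F G hF hG e; apply/eqP; rewrite -subr_eq0; apply/eqP.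
exact/(sq_proj_eq (@alt_subspace _ _ hP _ fb M q) hp hF hG).
Qed.

Lemma altmod_iso M q T T' : is_altmod M q T -> is_altmod M q T' -> gk_iso T T'.
Proof.
move=> [p hp] [p' hp'].
have s := @alt_stable _ _ hP _ fb M q.
apply: (@sq_iso _ _ _ _ _ _ _ _ _ _ p p' id s s hp hp') => //.
by move=> y hy; exists y => //; rewrite subrr.
Qed.

Lemma altmod_short_exact M' M M'' q T' T T'' : short_exact M' M M'' ->
  is_altmod M' q T' -> is_altmod M q T -> is_altmod M'' q T'' -> short_exact T' T T''.
Proof.
move=> [i [p [[i_hom p_hom] i_inj p_surj ex]]] [pi' h'] [pi h] [pi'' h''].
have s' := @alt_stable _ _ hP _ fb M' q; have s := @alt_stable _ _ hP _ fb M q.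
have s'' := @alt_stable _ _ hP _ fb M'' q.
have [f [f_hom fE]] := @sq_hom_fun _ _ _ _ _ _ _ _ _ _ pi' pi (pc i (q := q)) s' s h' h
  (pc_linear i_hom (q := q)) (fun F => pc_alt i_hom (F := F))
  (fun k F Kk _ => pc_act i_hom F Kk) (fun X F _ => pc_lie i_hom X F)
  (fun F _ e => eq_trans (congr1 _ e) (lin0 (pc_linear i_hom (q := q)))).
have [g [g_hom gE]] := @sq_hom_fun _ _ _ _ _ _ _ _ _ _ pi pi'' (pc p (q := q)) s s'' h h''
  (pc_linear p_hom (q := q)) (fun F => pc_alt p_hom (F := F))
  (fun k F Kk _ => pc_act p_hom F Kk) (fun X F _ => pc_lie p_hom X F)
  (fun F _ e => eq_trans (congr1 _ e) (lin0 (pc_linear p_hom (q := q)))).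
have [_ surj' ker' _ _] := h'; have [_ surj ker _ _] := h; have [_ surj'' ker'' _ _] := h''.
exists f, g; split=> //.
- apply: gk_hom_ker0 => // v; have [F hF <-] := surj' v.
  rewrite fE // => /(ker _ (pc_alt i_hom hF)) e; apply/ker' => //.
  by apply: (pc_inj i_inj); rewrite e (lin0 (pc_linear i_hom (q := q))).
- move=> w; have [G hG <-] := surj'' w.
  have [d [e [l [l_lin le]]]] := fb.
  have [F hF <-] := alt_lift l_lin le p_hom p_surj hG.
  by exists (pi F); rewrite gE.
- move=> v; have [F hF <-] := surj v; rewrite gE // (ker'' _ (pc_alt p_hom hF)).
  split=> [e|[v']]; last first.
    have [G hG <-] := surj' v'; rewrite fE //.
    move=> /(alt_projP h hF (pc_alt i_hom hG)) ->.
    apply: (can_inj (@evK _ _ hP _ fb M'' q)); apply/funext => x.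
    rewrite (lin0 (@ev_lin _ _ hP _ fb M'' q)) !ev_pc; apply/ex; by exists (ev G x).
  have [G eG] : exists G : ML M' q, pc i G = F.
    apply: pc_surj => x; have /ex[m ->] : p (ev F x) = 0; last by exists m.
    by rewrite -ev_pc e (lin0 (@ev_lin _ _ hP _ fb M'' q)).
  have hG : alt G by apply: (pc_alt_inv i_hom i_inj); rewrite eG.
  by exists (pi' G); rewrite fE // eG.
Qed.

End AltModules.

(** The model is the inclusion of the ideal u into q, with q acting on u by the adjoint action. *)
Record ce_data (R : realType) (P : gk_pair R) (b : gkmod P) (iota : b -> lie P) : Prop :=
  CEData {
  ced_lin : linear iota;
  ced_alt : forall y : b, gk_lie (iota y) y = 0;
  ced_lie : forall X (y : b), iota (gk_lie X y) = br X (iota y);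
  ced_act : forall k (y : b), grp k -> iota (gk_act k y) = Ad k (iota y) }.

Section Cohomology.
Variables (R : realType) (P : gk_pair R) (hP : gk_group P).
Variables (b : gkmod P) (fb : findim b) (iota : b -> lie P) (hi : ce_data iota).

Local Notation ML := (ML hP fb).
Local Notation ce := (ce iota).

Definition coh_proj (M : gkmod P) q (H : gkmod P) (p : ML M q -> H) : Prop :=
  sq_proj (fun F : ML M q => cocyc iota F) (fun F => cobord iota F) p.

Definition is_coh (M : gkmod P) q (H : gkmod P) : Prop := exists p, @coh_proj M q H p.

Lemma cocycS (M : gkmod P) q : stable (fun F : ML M q => cocyc iota F).
Proof. by case: hi => *; apply: cocyc_stable. Qed.

Lemma cobordS (M : gkmod P) q : stable (fun F : ML M q => cobord iota F).
Proof. by case: hi => *; apply: cobord_stable. Qed.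

Lemma cobordC (M : gkmod P) q (F : ML M q) : cobord iota F -> cocyc iota F.
Proof. by case: hi => *; apply: cobord_cocyc. Qed.

Lemma coh_exists M q : exists H, is_coh M q H.
Proof.
have [|H [p hp]] := sq_exists hP (@cocycS M q) (@cobordS M q); first by move=> F; exact: cobordC.
by exists H, p.
Qed.

Lemma coh_iso M q H H' : is_coh M q H -> is_coh M q H' -> gk_iso H H'.
Proof.
move=> [p hp] [p' hp']; have s := @cocycS M q.
apply: (@sq_iso _ _ _ _ _ _ _ _ _ _ p p' id s s hp hp') => //.
move=> y hy; exists y => //; rewrite subrr.
by have [h _ _ _] := @cobordS M q; exact: subsp0.
Qed.

Lemma coh_vanish (M : gkmod P) q H d (e : 'I_d -> b) (l : 'I_d -> b -> R[i]^o) :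
  (forall i, linear (l i)) -> (forall x, x = \sum_i l i x *: e i) ->
  (d < q)%N -> is_coh M q H -> forall z : H, z = 0.
Proof.
move=> l_lin le dq [p [_ surj ker _ _]] z; have [F hF <-] := surj z; apply/ker => //.
have [aF _] := hF; rewrite (alt_vanish le dq aF).
by have [h _ _ _] := @cobordS M q; exact: subsp0.
Qed.

Section LongExact.
Variables (M' M M'' : gkmod P) (i : M' -> M) (p : M -> M'').
Hypotheses (i_hom : gk_hom i) (p_hom : gk_hom p) (i_inj : injective i)
  (p_surj : forall w, exists v, p v = w)
  (ex : forall v, p v = 0 <-> exists v', v = i v').
Variables (H' H H'' : nat -> gkmod P).
Variables (pi' : forall n, ML M' n -> H' n) (pi : forall n, ML M n -> H n)
  (pi'' : forall n, ML M'' n -> H'' n).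
Hypotheses (h' : forall n, coh_proj (@pi' n)) (h : forall n, coh_proj (@pi n))
  (h'' : forall n, coh_proj (@pi'' n)).

Let pi0 n := lin0 (pc_linear (hP := hP) (fb := fb) i_hom (q := n)).
Let pp0 n := lin0 (pc_linear (hP := hP) (fb := fb) p_hom (q := n)).

Lemma pc_ker n (F : ML M n) : pc p F = 0 -> exists G : ML M' n, pc i G = F.
Proof.
move=> e; apply: pc_surj => x; have /ex[m ->] : p (ev F x) = 0; last by exists m.
by rewrite -ev_pc e (lin0 (@ev_lin _ _ hP _ fb M'' n)).
Qed.

Lemma pc_pi n (G : ML M' n) : pc p (pc i G) = 0.
Proof.
apply: (can_inj (@evK _ _ hP _ fb M'' n)); apply/funext => x.
rewrite (lin0 (@ev_lin _ _ hP _ fb M'' n)) !ev_pc; apply/ex; by exists (ev G x).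
Qed.

Lemma pc_cocyc (N N' : gkmod P) (f : N -> N') n (F : ML N n) : gk_hom f ->
  cocyc iota F -> cocyc iota (pc f F).
Proof.
move=> f_hom [aF cF]; split; first exact: pc_alt.
by rewrite -pc_ce // cF (lin0 (pc_linear f_hom (q := n.+1))).
Qed.

Lemma pc_cobord (N N' : gkmod P) (f : N -> N') n (F : ML N n) : gk_hom f ->
  cobord iota F -> cobord iota (pc f F).
Proof.
move=> f_hom; case: n F => [|n] F /=.
  by move=> ->; exact: (lin0 (hom_lin f_hom)).
by move=> [G aG ->]; exists (pc f G); [exact: pc_alt | exact: pc_ce].
Qed.

Lemma pc_lift n (G : ML M'' n) : alt G -> exists2 F : ML M n, alt F & pc p F = G.
Proof.
by move=> hG; have [d [e [l [l_lin le]]]] := fb; exact: (alt_lift l_lin le p_hom).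
Qed.

Lemma coh_map (N N' : gkmod P) (f : N -> N') n (K K' : gkmod P) (k : ML N n -> K) (k' : ML N' n -> K') :
  gk_hom f -> coh_proj k -> coh_proj k' ->
  exists g : K -> K', gk_hom g /\ forall F, cocyc iota F -> g (k F) = k' (pc f F).
Proof.
move=> f_hom hk hk'.
exact: (@sq_hom_fun _ _ _ _ _ _ _ _ _ _ k k' (pc f (q := n)) (@cocycS N n) (@cocycS N' n)
  hk hk' (pc_linear f_hom (q := n)) (fun F => pc_cocyc f_hom (F := F))
  (fun k F Kk _ => pc_act f_hom F Kk) (fun X F _ => pc_lie f_hom X F)
  (fun F _ => pc_cobord f_hom (F := F))).
Qed.

(** The zigzag of the snake lemma. It depends on the lift [F], and [sq_hom] turns it into the
    connecting homomorphism. *)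
Definition snake n (x : ML M'' n) (y : ML M' n.+1) : Prop :=
  exists F : ML M n, [/\ alt F, pc p F = x & ce F = pc i y].

Lemma snake_ex n (x : ML M'' n) : cocyc iota x ->
  exists2 y : ML M' n.+1, cocyc iota y & snake x y.
Proof.
move=> [ax cx]; have [F aF e] := pc_lift ax.
have [G eG] : exists G : ML M' n.+1, pc i G = ce F.
  by apply: pc_ker; rewrite pc_ce // e.
exists G; last by exists F.
have [c1 c2 c3 c4] := hi.
split; first by apply: (pc_alt_inv i_hom i_inj); rewrite eG; exact: alt_ce.
apply: (pc_inj i_inj); rewrite pc_ce // eG pi0; exact: ceK.
Qed.

Lemma snake_cobord n (x : ML M'' n) (y : ML M' n.+1) :
  snake x y -> cobord iota x -> cobord iota y.
Proof.
move=> [F [aF ex' ey]] bx; have hS := @alt_subspace _ _ hP _ fb M n.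
(* A closed lift of [x]: the differential of a lift of its primitive, or 0 in degree 0, where the
   only coboundary is 0. Subtracting it from [F] leaves a form with values in [M']. *)
have [K [aK cK eK]] : exists K : ML M n, [/\ alt K, ce K = 0 & pc p K = x].
  case: n x y F aF ex' ey bx hS => [|n] x y F aF ex' ey bx hS.
    exists 0; split; [exact: subsp0 | | by rewrite bx pp0].
    exact: (lin0 (@ce_linear _ _ hP _ fb M iota 0)).
  have [L'' aL e] := bx; have [L aL' eL] := pc_lift aL.
  have [c1 c2 c3 c4] := hi.
  by exists (ce L); split; [exact: alt_ce | exact: ceK | rewrite pc_ce // eL].
have [L eL] : exists L : ML M' n, pc i L = F - K.
  by apply: pc_ker; rewrite (linB (pc_linear p_hom (q := n))) ex' eK subrr.
exists L.
  by apply: (pc_alt_inv i_hom i_inj); rewrite eL; exact: subspB.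
apply: (pc_inj i_inj); rewrite -ey pc_ce // eL.
by rewrite (linB (@ce_linear _ _ hP _ fb M iota n)) cK subr0.
Qed.

Lemma snake_hom n : exists g : H'' n -> H' n.+1, gk_hom g /\
  forall x y, cocyc iota x -> cocyc iota y -> snake x y -> g (@pi'' n x) = @pi' n.+1 y.
Proof.
have [hS'' _ Sa'' Sl''] := @cocycS M'' n; have [hS' _ Sa' Sl'] := @cocycS M' n.+1.
apply: (@sq_hom _ _ _ _ _ _ _ _ _ _ (@pi'' n) (@pi' n.+1) (@snake n) hS'' hS' (h'' n) (h' n.+1)) => //.
- exact: snake_ex.
- move=> a x y x' y' [F [aF e1 e2]] [F' [aF' e1' e2']]; exists (a *: F + F'); split.
  + by have [_] := @alt_subspace _ _ hP _ fb M n; apply.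
  + by rewrite (pc_linear p_hom) e1 e1'.
  + by rewrite ce_linear e2 e2' (pc_linear i_hom).
- move=> k x y Kk _ [F [aF e1 e2]]; have [c1 c2 c3 c4] := hi.
  exists (am_act _ k F); split; first exact: alt_act.
    by rewrite pc_act // e1.
  by rewrite ce_act // e2 pc_act.
- move=> X x y _ [F [aF e1 e2]]; have [c1 c2 c3 c4] := hi.
  exists (am_lie _ X F); split; first exact: alt_lie.
    by rewrite pc_lie // e1.
  by rewrite ce_lie // e2 pc_lie.
- by move=> x y sxy bx _; exact: snake_cobord bx.
Qed.

Lemma long_exact : exists (f : forall n, H' n -> H n) (g : forall n, H n -> H'' n)
    (k : forall n, H'' n -> H' n.+1),
  [/\ [/\ forall n, gk_hom (@f n), forall n, gk_hom (@g n) & forall n, gk_hom (@k n)],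
      forall n, kerp (@g n) = imp (@f n), forall n, kerp (@k n) = imp (@g n),
      forall n, kerp (@f n.+1) = imp (@k n)
    & forall x, @f 0%N x = 0 -> x = 0].
Proof.
have [f fP] := dchoice (fun n => coh_map i_hom (h' n) (h n)).
have [g gP] := dchoice (fun n => coh_map p_hom (h n) (h'' n)).
have [k kP] := dchoice snake_hom.
have hS n := let: And4 a _ _ _ := @cocycS M n in a.
have hS' n := let: And4 a _ _ _ := @cocycS M' n in a.
have hS'' n := let: And4 a _ _ _ := @cocycS M'' n in a.
have k0 n (F : ML M n) : cocyc iota F -> cobord iota F -> @pi n F = 0.
  by move=> cF bF; have [_ _ ker _ _] := h n; apply/ker.
exists f, g, k; split.
- by split=> n; [case: (fP n) | case: (gP n) | case: (kP n)].
- move=> n; apply/predeqP => z; have [_ surj ker _ _] := h n.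
  have [_ surj' ker' _ _] := h' n; have [_ _ ker'' _ _] := h'' n; split.
    have [F cF <-] := surj z; rewrite /kerp (gP n).2 // => /ker''.
    move=> /(_ (pc_cocyc p_hom cF)) bF.
    have [K [aK bK eK]] : exists K : ML M n, [/\ cocyc iota K, cobord iota K & pc p K = pc p F].
      case: n F cF bF {surj ker surj' ker' ker'' z} => [|n] F cF bF.
        exists 0; rewrite pp0; split=> //; exact: subsp0.
      have [L'' aL e] := bF; have [L aL' eL] := pc_lift aL.
      have bL : cobord iota (ce L : ML M n.+1) by exists L.
      by exists (ce L); split=> //; [exact: cobordC | rewrite pc_ce // eL].
    have [L eL] : exists L : ML M' n, pc i L = F - K.
      by apply: pc_ker; rewrite (linB (pc_linear p_hom (q := n))) eK subrr.
    have cL : cocyc iota L.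
      have [a1 a2] : cocyc iota (F - K) by exact: (subspB (hS n)).
      split; first by apply: (pc_alt_inv i_hom i_inj); rewrite eL.
      by apply: (pc_inj i_inj); rewrite pc_ce // eL a2 pi0.
    exists (@pi' n L) => //; rewrite (fP n).2 // eL (sq_projB (h n)) //.
    by rewrite (k0 _ _ aK bK) subr0.
  move=> [v _ ->]; have [G cG <-] := surj' v.
  rewrite (fP n).2 // /kerp (gP n).2; last exact: pc_cocyc.
  by rewrite pc_pi; exact: (sq_proj0 (hS'' n) (h'' n)).
- move=> n; apply/predeqP => z; have [_ surj'' ker'' _ _] := h'' n.
  have [_ surj ker _ _] := h n; have [_ _ ker' _ _] := h' n.+1; split.
    have [x cx <-] := surj'' z; have [y cy sxy] := snake_ex cx.
    rewrite /kerp ((kP n).2 _ _ cx cy sxy) => /(ker' _ cy)[L aL eL].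
    have [F [aF e1 e2]] := sxy.
    exists (@pi n (F - pc i L)) => //.
    have cF : cocyc iota (F - pc i L).
      split; first by apply: (subspB (@alt_subspace _ _ hP _ fb M n)) => //; exact: pc_alt.
      rewrite (linB (@ce_linear _ _ hP _ fb M iota n)) e2 -pc_ce // eL subrr //.
    by rewrite (gP n).2 // (linB (pc_linear p_hom (q := n))) pc_pi subr0 e1.
  move=> [v _ ->]; have [F cF <-] := surj v; rewrite (gP n).2 //.
  rewrite /kerp ((kP n).2 (pc p F) 0).
  + exact: (sq_proj0 (hS' n.+1) (h' n.+1)).
  + exact: pc_cocyc.
  + exact: subsp0.
  + by have [aF cF'] := cF; exists F; split=> //; rewrite cF' pi0.
- move=> n; apply/predeqP => z; have [_ surj' ker' _ _] := h' n.+1.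
  have [_ surj'' ker'' _ _] := h'' n; have [_ _ ker _ _] := h n.+1; split.
    have [G cG <-] := surj' z; rewrite /kerp (fP n.+1).2 //.
    move=> /(ker _ (pc_cocyc i_hom cG))[F aF eF].
    have cx : cocyc iota (pc p F).
      by split; [exact: pc_alt | rewrite -pc_ce // -eF pc_pi].
    exists (@pi'' n (pc p F)) => //; apply/esym/(kP n).2 => //.
    by exists F; split.
  move=> [v _ ->]; have [x cx <-] := surj'' v; have [y cy sxy] := snake_ex cx.
  rewrite ((kP n).2 _ _ cx cy sxy) /kerp (fP n.+1).2 //.
  apply/ker; first exact: pc_cocyc.
  by have [F [aF _ <-]] := sxy; exists F.
- move=> z; have [_ surj' ker' _ _] := h' 0%N; have [_ _ ker _ _] := h 0%N.
  have [G cG <-] := surj' z; rewrite (fP 0%N).2 // => /(ker _ (pc_cocyc i_hom cG)) e.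
  apply/ker' => //; apply: (pc_inj i_inj); rewrite pi0; exact: e.
Qed.

End LongExact.
End Cohomology.

(** * Nilradicals *)

Lemma subrACA (V : zmodType) (w v u x : V) : w - v - (u - x) = w - u - (v - x).
Proof. by rewrite !opprD !opprK !addrA (addrAC w). Qed.

Section MatrixFacts.
Variable F : numClosedFieldType.

Lemma mx_eigen n (A : 'M[F]_n) : (0 < n)%N ->
  exists a (v : 'rV[F]_n), v != 0 /\ v *m A = a *: v.
Proof.
case: n A => // n A _.
have [a ra] : exists a, root (char_poly A) a.
  by apply/closed_rootP; rewrite size_char_poly.
have /eigenvalueP[v vA v0] : eigenvalue A a by rewrite eigenvalue_root_char.
by exists a, v.
Qed.

(** If [w] is killed by the other matrices, then so is every w A^m, by commutation; the last nonzero
    one is killed by [A] as well. *)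
Lemma nilpotent_kernel n (s : seq 'M[F]_n) (v : 'rV[F]_n) : v != 0 ->
  (forall A, A \in s -> exists k, A ^+ k = 0) ->
  (forall A B, A \in s -> B \in s -> A * B = B * A) ->
  exists w : 'rV[F]_n, w != 0 /\ forall A, A \in s -> w *m A = 0.
Proof.
move=> v0; elim: s => [|A s IH] nil com; first by exists v.
have [] := IH; [by move=> B Bs; apply: nil; rewrite in_cons Bs orbT | |].
  by move=> B C Bs Cs; apply: com; rewrite in_cons ?Bs ?Cs orbT.
move=> w [w0 ws].
have [k Ak] := nil A (mem_head _ _).
have ex : exists k, w *m A ^+ k == 0 by exists k; rewrite Ak mulmx0.
case: (ex_minnP ex) => [[|m]]; first by rewrite expr0 mulmx1 (negbTE w0).
move=> /eqP wm min; exists (w *m A ^+ m); split.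
  by apply/negP => /min; rewrite ltnn.
move=> B; rewrite in_cons => /orP[/eqP ->|Bs].
  by rewrite -mulmxA mulmxE -exprSr.
have cAB : A ^+ m * B = B * A ^+ m.
  by apply/esym/commrX; rewrite /GRing.comm com // in_cons ?eqxx ?Bs ?orbT.
by rewrite -mulmxA mulmxE cAB -mulmxE mulmxA ws // mul0mx.
Qed.

(** Bracketing with [X] is a derivation and [Z] commutes with [A], whence [A^(m+1), X] = (m+1) A^m
    Z. *)
Lemma comm_bracket_exp n (A X Z : 'M[F]_n) : A * Z = Z * A ->
  Z = A * X - X * A -> forall m,
  X * A ^+ m.+1 = A ^+ m.+1 * X - (A ^+ m * Z) *+ m.+1.
Proof.
move=> cAZ Ze; elim=> [|m IH].
  by rewrite !expr1 expr0 mul1r mulr1n Ze opprB addrC subrK.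
have XA : X * A = A * X - Z by rewrite Ze opprB addrC subrK.
rewrite exprSr mulrA IH mulrBl -!mulrA XA mulrBr mulrA -exprSr mulrnAl.
rewrite -[A ^+ m * Z * A]mulrA -cAZ mulrA -exprSr [in RHS]mulrSr opprD addrA.
by rewrite -!addrA; congr (_ + _); rewrite addrC.
Qed.

Lemma nilpotent_index n (A : 'M[F]_n) k : (0 < n)%N -> A ^+ k = 0 ->
  exists m, A ^+ m.+1 = 0 /\ A ^+ m <> 0.
Proof.
case: n A => // n A _ Ak.
have ex : exists k, A ^+ k == 0 by exists k; rewrite Ak.
case: (ex_minnP ex) => [[|m]]; first by rewrite expr0 oner_eq0.
by move=> /eqP Am min; exists m; split=> // /eqP /min; rewrite ltnn.
Qed.

Lemma rank_stabilizes (f : nat -> nat) b :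
  (forall m, (f m <= f m.+1)%N) -> (forall m, (f m <= b)%N) ->
  exists m, f m = f m.+1.
Proof.
move=> mono bd; apply: contrapT => /forallNP h.
have lt m : (m <= f m)%N.
  elim: m => // m IH; have := mono m; have := h m; lia.
by have := lt b.+1; have := bd b.+1; lia.
Qed.

Lemma eigen_exp n (A : 'M[F]_n) m k (v : 'M[F]_(m, n)) a :
  v *m A = a *: v -> v *m A ^+ k = a ^+ k *: v.
Proof.
move=> vA; elim: k => [|k IH]; first by rewrite !expr0 mulmx1 scale1r.
by rewrite exprSr -mulmxE mulmxA IH -scalemxAl vA scalerA exprSr.
Qed.

Lemma nilpotent_eigen0 n (A : 'M[F]_n) m k (v : 'M[F]_(m, n)) a :
  v *m A = a *: v -> A ^+ k = 0 -> v != 0 -> a = 0.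
Proof.
move=> /(eigen_exp k) e Ak v0; move/esym/eqP: e; rewrite Ak mulmx0 scaler_eq0.
by rewrite (negbTE v0) orbF expf_eq0 => /andP[_ /eqP].
Qed.

End MatrixFacts.

Section Brackets.
Variables (R : realType) (P : gk_pair R).
Hypothesis brl : forall Y : lie P, linear (fun X : lie P => br X Y).
Hypothesis brr : forall X : lie P, linear (br X).
Implicit Types U V W : {vspace lie P}.

Lemma mem_brv U V x y : x \in U -> y \in V -> br x y \in brv U V.
Proof.
move=> Ux Vy; rewrite (coord_vbasis Ux) (coord_vbasis Vy).
rewrite (lin_sum (brl _)); apply: memv_suml => i _.
rewrite (linZ (brl _)); apply: memvZ.
rewrite (lin_sum (brr _)); apply: memv_suml => j _.
rewrite (linZ (brr _)); apply: memvZ; apply: memv_span.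
by apply: allpairs_f; apply: mem_nth; rewrite size_tuple.
Qed.

Lemma brv_sub U V W :
  (forall x y, x \in U -> y \in V -> br x y \in W) -> (brv U V <= W)%VS.
Proof.
move=> h; apply/span_subvP => z /allpairsP[[x y] /= [xU yV ->]].
by apply: h; apply: vbasis_mem.
Qed.

Lemma brv_ind U V (S : lie P -> Prop) : subspace_pred S ->
  (forall x y, x \in U -> y \in V -> S (br x y)) ->
  forall z, z \in brv U V -> S z.
Proof.
move=> hS h z; rewrite /brv; set X := [seq _ | _ <- _, _ <- _].
rewrite -[X]/(tval (in_tuple X)) => /coord_span ->.
apply: (subsp_sum hS) => i _; apply: (subspZ hS).
have : (in_tuple X)`_i \in X by apply: mem_nth.
by case/allpairsP => -[x y] /= [xU yV ->]; apply: h; exact: vbasis_mem.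
Qed.

Lemma brvS U U' V V' : (U <= U')%VS -> (V <= V')%VS ->
  (brv U V <= brv U' V')%VS.
Proof.
move=> /subvP sU /subvP sV; apply: brv_sub => x y /sU Ux /sV Vy.
exact: mem_brv.
Qed.

Lemma derived_sub U n : subalgebra U ->
  (iter n (fun W => brv W W) U <= U)%VS.
Proof.
by move=> sU; elim: n => //= n IH; apply: subv_trans (brvS IH IH) _.
Qed.

Lemma derivedS U V n : (U <= V)%VS ->
  (iter n (fun W => brv W W) U <= iter n (fun W => brv W W) V)%VS.
Proof. by move=> sUV; elim: n => //= n IH; exact: brvS. Qed.

Lemma solvable_sub U V : (U <= V)%VS -> solvable_alg V -> solvable_alg U.
Proof.
move=> sUV [n e]; exists n; apply/eqP; rewrite -subv0 -e.
exact: derivedS.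
Qed.

Lemma solvable_derived U n :
  solvable_alg (iter n (fun W => brv W W) U) -> solvable_alg U.
Proof. by move=> [m e]; exists (m + n)%N; rewrite iterD. Qed.

End Brackets.

Section Lie.
Variables (R : realType) (P : gk_pair R).
Hypothesis brl : forall Y : lie P, linear (fun X : lie P => br X Y).
Hypothesis brr : forall X : lie P, linear (br X).
Hypothesis bralt : forall X : lie P, br X X = 0.
Hypothesis jac : forall X Y Z : lie P,
    br X (br Y Z) + br Y (br Z X) + br Z (br X Y) = 0.

Lemma brC (X Y : lie P) : br X Y = - br Y X.
Proof.
have := bralt (X + Y); rewrite (linD (brl _)) !(linD (brr _)) !bralt add0r addr0.
by move/eqP; rewrite addr_eq0 => /eqP.
Qed.

Lemma br_derivation (X Y Z : lie P) :
  br X (br Y Z) = br (br X Y) Z + br Y (br X Z).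
Proof.
have /eqP := jac X Y Z; rewrite -addrA addr_eq0 => /eqP ->.
by rewrite (brC Z X) (brC Z (br X Y)) (linN (brr _)) opprD !opprK addrC.
Qed.

Lemma brv_add (b J W : {vspace lie P}) : (forall x z, x \in b -> z \in J -> br x z \in J) ->
  subalgebra J -> (W <= b)%VS -> (brv (W + J) (W + J) <= brv W W + J)%VS.
Proof.
move=> bJ sJ /subvP Wb; apply: brv_sub => s t.
move=> /memv_addP[x xW [z zJ ->]] /memv_addP[y yW [w wJ ->]].
rewrite (linD (brl _)) !(linD (brr _)) -addrA; apply: memv_add.
  exact: mem_brv.
apply: memvD; first exact: bJ (Wb _ xW) wJ.
apply: memvD; last by apply: (subvP sJ); exact: mem_brv.
by rewrite (brC z) memvN; exact: bJ (Wb _ yW) zJ.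
Qed.

Lemma subalgebra_add (b J : {vspace lie P}) : subalgebra b -> subalgebra J ->
  (forall x z, x \in b -> z \in J -> br x z \in J) -> subalgebra (b + J)%VS.
Proof.
move=> sb sJ bJ; apply: subv_trans (brv_add bJ sJ (subvv _)) _.
exact: addvS.
Qed.

(** The n-th derived algebra of b + J lies in that of [b] plus [J], so it ends up in the solvable
    [J]. *)
Lemma solvable_add (b J : {vspace lie P}) : subalgebra b -> solvable_alg b -> subalgebra J ->
  solvable_alg J -> (forall x z, x \in b -> z \in J -> br x z \in J) ->
  solvable_alg (b + J)%VS.
Proof.
move=> sb [n bn] sJ Js bJ; apply: (solvable_derived (n := n)).
apply: (solvable_sub brl brr) Js.
rewrite -[J in (_ <= J)%VS]add0v -bn; elim: n {bn} => //= n IH.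
apply: subv_trans (brvS brl brr IH IH) _.
exact: brv_add bJ sJ (derived_sub brl brr n sb).
Qed.

Variable q : {vspace lie P}.
Hypothesis q_sub : subalgebra q.

(** Matrices act on row vectors from the right, so products occur in reverse order. The condition
    concerns brackets of elements of [q] only. *)
Definition mrep n (rho : lie P -> 'M[R[i]]_n) : Prop :=
  linear rho /\ forall x y, x \in q -> y \in q ->
    rho (br x y) = rho y *m rho x - rho x *m rho y.

Definition mx_irr n (rho : lie P -> 'M[R[i]]_n) : Prop :=
  forall S : 'rV[R[i]]_n -> Prop, subspace_pred S ->
  (forall v x, S v -> x \in q -> S (v *m rho x)) ->
  (forall v, S v -> v = 0) \/ forall v, S v.

Lemma ideal_derived r : (r <= q)%VS -> (brv q r <= r)%VS ->
  (brv r r <= q)%VS /\ (brv q (brv r r) <= brv r r)%VS.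
Proof.
move=> rq qr; split.
  exact: subv_trans (brvS brl brr rq rq) q_sub.
apply: brv_sub => x z xq; apply: (brv_ind (S := fun z => br x z \in _)) => {z}.
  split=> [|a u v]; first by rewrite (lin0 (brr _)) mem0v.
  by rewrite (linD (brr _)) (linZ (brr _)) => h1 h2; rewrite memvD ?memvZ.
move=> a b ar rb; rewrite br_derivation; apply: memvD; apply: mem_brv => //;
by apply: (subvP qr); apply: mem_brv.
Qed.

(** A solvable ideal acts by scalars on an irreducible representation. By induction on the derived
    length, [r, r] acts by scalars, which turn out to be zero; so [r] acts by commuting matrices,
    each with a single eigenvalue, and their joint eigenspace is stable under [q]. *)
Lemma irr_solvable_scalar n (rho : lie P -> 'M[R[i]]_n) : (0 < n)%N ->
  mrep rho -> mx_irr rho ->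
  forall k r, (r <= q)%VS -> (brv q r <= r)%VS ->
  iter k (fun W => brv W W) r = 0%VS ->
  forall y, y \in r -> exists a, rho y = a%:M.
Proof.
move=> n0 [rl rb] irr; elim=> [|k IH] r rq qr.
  move=> /= -> y; rewrite memv0 => /eqP ->; exists 0.
  by rewrite (lin0 rl) raddf0.
rewrite iterSr => rk.
have sq y : y \in r -> y \in q by exact: (subvP rq).
have sr x y : x \in q -> y \in r -> br x y \in r.
  by move=> xq yr; apply: (subvP qr); apply: mem_brv.
have [r1q qr1] := ideal_derived rq qr.
(* The commutator is a scalar matrix [a%:M] of trace zero, so n a = 0 and a = 0. *)
have com0 y z : y \in r -> z \in r -> rho y *m rho z = rho z *m rho y.
  move=> yr zr.
  have [a ea] := IH _ r1q qr1 rk _ (mem_brv brl brr zr yr).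
  have := congr1 (@mxtrace _ _) ea.
  rewrite rb ?sq // raddfB /= mxtrace_mulC subrr mxtrace_scalar.
  move/esym/eqP; rewrite mulrn_eq0 (gtn_eqF n0) /= => /eqP a0.
  move: ea; rewrite rb ?sq // a0 raddf0 => /eqP.
  by rewrite subr_eq0 => /eqP.
have AZ a x y : x \in q -> y \in r ->
    (rho y - a%:M) * rho (br x y) = rho (br x y) * (rho y - a%:M) /\
    rho (br x y) = (rho y - a%:M) * rho x - rho x * (rho y - a%:M).
  move=> xq yr; split.
    rewrite mulrBl mulrBr -!mulmxE com0 ?sr //; congr (_ - _).
    exact/esym/scalar_mxC.
  rewrite rb ?(sq y) // mulrBl mulrBr -!mulmxE scalar_mxC.
  by rewrite opprB addrA subrK.
(* Once the kernels of the powers of A stop growing at m, ker A^(m+1) is stable under [q]: for u in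
   it, u rho(x) A^(m+1) is a multiple of u A^m Z, and u A^m = 0. It contains an eigenvector, so it
   is the whole space. *)
have nil y : y \in r -> exists a m, (rho y - a%:M) ^+ m = 0.
  move=> yr; have [a [v [v0 va]]] := mx_eigen (rho y) n0.
  exists a; set A := rho y - a%:M.
  have vA : v *m A = 0 by rewrite mulmxBr va mul_mx_scalar subrr.
  have sK m : (kermx (A ^+ m) <= kermx (A ^+ m.+1))%MS.
    by apply/sub_kermxP; rewrite exprSr -mulmxE mulmxA mulmx_ker mul0mx.
  have [m em] := rank_stabilizes (fun m => mxrankS (sK m))
    (fun m => rank_leq_col _).
  have eK : (kermx (A ^+ m.+1) <= kermx (A ^+ m))%MS.
    have := mxrank_leqif_sup (sK m); case=> _ <-.
    by rewrite em.
  exists m.+1.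
  pose S (u : 'rV_n) := u *m A ^+ m.+1 = 0.
  have hS : subspace_pred S.
    split=> [|b u w Su Sw]; rewrite /S ?mul0mx //.
    by rewrite mulmxDl -scalemxAl Su Sw scaler0 addr0.
  have [u x Su xq|h|h] := irr S hS.
  - have [AZ1 AZ2] := AZ a x y xq yr.
    rewrite /S -mulmxA mulmxE (comm_bracket_exp AZ1 AZ2) -mulmxE.
    have /sub_kermxP uK : (u <= kermx (A ^+ m))%MS.
      by apply: submx_trans eK; apply/sub_kermxP.
    rewrite mulmxBr mulmxA -/A Su mul0mx sub0r -scaler_nat -scalemxAr.
    by rewrite mulmxA uK mul0mx scaler0 oppr0.
  - by move: v0; rewrite (h v) ?eqxx // /S exprS -mulmxE mulmxA vA mul0mx.
  - by apply/row_matrixP => i; rewrite rowE h row0.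
(* Let A = rho y - b be nilpotent with A^(j+1) = 0 and A^j nonzero. The bracket identity gives A^j
   rho(br x y) = 0, so rho(br x y) - a acts on A^j by -a; being nilpotent, it forces a = 0. *)
have nilb x y : x \in q -> y \in r -> exists m, rho (br x y) ^+ m = 0.
  move=> xq yr; have [a [m am]] := nil _ (sr _ _ xq yr).
  have [a0|a0] := eqVneq a 0; first by exists m; rewrite -am a0 raddf0 subr0.
  have [b [l bl]] := nil _ yr.
  have [AZ1 AZ2] := AZ b x y xq yr.
  have [j [j1 j0]] := nilpotent_index n0 bl.
  have := comm_bracket_exp AZ1 AZ2 j; rewrite j1 mulr0 mul0r sub0r.
  move/esym/eqP; rewrite oppr_eq0 -scaler_nat scaler_eq0 pnatr_eq0 /= => /eqP e.
  exfalso; move/eqP: j0 => j0; move: a0; apply/negP; rewrite negbK -oppr_eq0.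
  apply/eqP; apply: (nilpotent_eigen0 (v := (rho y - b%:M) ^+ j) _ am j0).
  by rewrite mulmxBr mul_mx_scalar mulmxE e sub0r scaleNr.
have /choice[lam hl] : forall y, exists a, y \in r -> exists m,
    (rho y - a%:M) ^+ m = 0.
  move=> y; have [yr|yr] := boolP (y \in r); last by exists 0.
  by have [a h] := nil y yr; exists a.
pose c y := \sum_(i < \dim r) coord (vbasis r) i y * lam (vbasis r)`_i.
(* The joint eigenspace. It is stable under [q] because [br x y] acts on it by a scalar which is
   nilpotent, hence zero; it is nonzero by [nilpotent_kernel]. *)
pose S (v : 'rV_n) := forall y, y \in vbasis r -> v *m rho y = lam y *: v.
have Sc v y : S v -> y \in r -> v *m rho y = c y *: v.
  move=> Sv yr; rewrite {1}(coord_vbasis yr) (lin_sum rl) mulmx_sumr scaler_suml.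
  apply: eq_bigr => i _; rewrite (linZ rl) -scalemxAr Sv ?scalerA //.
  by apply: mem_nth; rewrite size_tuple.
have hS : subspace_pred S.
  split=> [|b u w Su Sw] y yb; first by rewrite mul0mx scaler0.
  by rewrite mulmxDl -scalemxAl Su // Sw // scalerDr !scalerA mulrC.
have [v x Sv xq y yb|h|h] := irr S hS.
- have yr := vbasis_mem yb; rewrite -mulmxA.
  have -> : rho x *m rho y = rho y *m rho x - rho (br x y).
    by rewrite rb ?(sq y) // opprB addrC subrK.
  rewrite mulmxBr mulmxA (Sv y) // -scalemxAl.
  suff -> : v *m rho (br x y) = 0 by rewrite subr0.
  have [->|v0] := eqVneq v 0; first by rewrite mul0mx.
  have [m hm] := nilb x y xq yr.
  have e := Sc v _ Sv (sr _ _ xq yr).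
  by rewrite e (nilpotent_eigen0 e hm v0) scale0r.
- exfalso.
  have [||//|] := @nilpotent_kernel _ n [seq rho y - (lam y)%:M | y <- vbasis r]
    (const_mx 1).
  - apply/eqP => /matrixP/(_ 0 (Ordinal n0)); rewrite !mxE => /eqP.
    by rewrite oner_eq0.
  - by move=> A /mapP[y /vbasis_mem yr ->]; exact: hl.
  - move=> A B /mapP[y /vbasis_mem yr ->] /mapP[z /vbasis_mem zr ->].
    rewrite !mulrBl !mulrBr -!mulmxE (com0 _ _ yr zr).
    rewrite (scalar_mxC (lam z) (rho y)) (scalar_mxC (lam y) (rho z)).
    rewrite (scalar_mxC (lam z) (lam y)%:M).
    move: (_ *m rho z) (_ *m rho y) (_ *m rho y) (_ *m _%:M) => U V W X.
    exact: subrACA.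
  move=> w [w0 hw]; move: w0; rewrite (h w) ?eqxx // => y yb.
  have := hw _ (map_f (fun y => rho y - (lam y)%:M) yb).
  by rewrite mulmxBr mul_mx_scalar => /eqP; rewrite subr_eq0 => /eqP.
- move=> y yr; exists (c y); apply/row_matrixP => i.
  by rewrite !rowE Sc // mul_mx_scalar.
Qed.

Definition mxprod n (rho : lie P -> 'M[R[i]]_n) (s : seq (lie P)) :=
  foldr (fun z M => rho z *m M) 1%:M s.

Lemma mxprod_cat n (rho : lie P -> 'M[R[i]]_n) s t :
  mxprod rho (s ++ t) = mxprod rho s *m mxprod rho t.
Proof. by elim: s => [|z s IH] /=; rewrite ?mul1mx // IH mulmxA. Qed.

Lemma mxprod_intertwine m n (rho : lie P -> 'M[R[i]]_m)
    (rho' : lie P -> 'M[R[i]]_n) (K : 'M[R[i]]_(m, n)) s :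
  (forall z, z \in s -> rho z *m K = K *m rho' z) ->
  mxprod rho s *m K = K *m mxprod rho' s.
Proof.
elim: s => [|z s IH] h /=; first by rewrite mul1mx mulmx1.
rewrite -mulmxA IH => [|y ys]; last by rewrite h // in_cons ys orbT.
by rewrite mulmxA h ?mem_head // mulmxA.
Qed.

Lemma mrep_sub n (rho : lie P -> 'M[R[i]]_n) m (B : 'M[R[i]]_(m, n)) :
  mrep rho -> row_free B -> (forall x, x \in q -> (B *m rho x <= B)%MS) ->
  let rho' x := B *m rho x *m pinvmx B in
  mrep rho' /\ forall x, x \in q -> B *m rho x = rho' x *m B.
Proof.
move=> [rl rb] fB sB rho'.
have e x : x \in q -> B *m rho x = rho' x *m B.
  by move=> xq; rewrite /rho' mulmxKpV ?sB.
split=> //; split=> [a x y|x y xq yq].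
  by rewrite /rho' (linD rl) (linZ rl) mulmxDr mulmxDl -scalemxAr -scalemxAl.
apply: (row_free_inj fB); rewrite -e; last first.
  by apply: (subvP q_sub); apply: mem_brv.
have e2 a b : a \in q -> b \in q -> rho' a *m rho' b *m B = B *m rho a *m rho b.
  by move=> aq bq; rewrite -mulmxA -(e b) // mulmxA -(e a).
by rewrite rb // mulmxBr mulmxBl !e2 // !mulmxA.
Qed.

Lemma mrep_quot n (rho : lie P -> 'M[R[i]]_n) m (K : 'M[R[i]]_(n, m)) :
  mrep rho -> row_full K -> (forall x, x \in q -> (kermx K *m rho x *m K = 0)) ->
  let rho' x := pinvmx K *m rho x *m K in
  mrep rho' /\ forall x, x \in q -> rho x *m K = K *m rho' x.
Proof.
move=> [rl rb] fK sK rho'.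
have e x : x \in q -> rho x *m K = K *m rho' x.
  move=> xq; apply/eqP; rewrite -subr_eq0.
  have -> : rho x *m K - K *m rho' x = (1%:M - K *m pinvmx K) *m rho x *m K.
    by rewrite !mulmxBl mul1mx /rho' !mulmxA.
  have /sub_kermxP/submxP[D ->] : (1%:M - K *m pinvmx K) *m K = 0.
    by rewrite mulmxBl mul1mx -mulmxA mulVpmx // mulmx1 subrr.
  by have := sK x xq; rewrite -!mulmxA => ->; rewrite mulmx0.
split=> //; split=> [a x y|x y xq yq].
  by rewrite /rho' (linD rl) (linZ rl) mulmxDr mulmxDl -scalemxAr -scalemxAl.
have bq : br x y \in q by apply: (subvP q_sub); apply: mem_brv.
have e2 a b : a \in q -> b \in q ->
    rho' a *m rho' b = pinvmx K *m (rho a *m rho b) *m K.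
  move=> aq b_q; rewrite [rho' a]/rho' -[_ *m K *m rho' b]mulmxA -(e b) //.
  by rewrite !mulmxA.
by rewrite !e2 // /rho' rb // mulmxBr mulmxBl.
Qed.

(* For irreducible [rho] this is because [r] acts by scalars. *)
Lemma nilradical_nilpotent r n (rho : lie P -> 'M[R[i]]_n) :
  (r <= q)%VS -> (brv q r <= r)%VS -> solvable_alg r -> mrep rho ->
  exists N, forall s, size s = N -> (forall z, z \in s -> z \in brv q r) ->
    mxprod rho s = 0.
Proof.
move=> rq qr [k rk].
have uq z : z \in brv q r -> z \in q by move=> h; apply/(subvP rq)/(subvP qr).
have [b] := ubnP n; elim: b n rho => // b IH n rho; rewrite ltnS => nb hr.
case: (posnP n) => [n0|n0].
  by exists 0%N => s _ _; apply/matrixP => j; have := ltn_ord j; lia.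
have [irr|] := pselect (mx_irr rho).
  exists 1%N => -[|z []] // _ /(_ z (mem_head _ _)) zu /=.
  rewrite mulmx1; have [rl rb] := hr.
  apply: (brv_ind (S := fun z => rho z = 0)) zu => [|x y xq yr].
    split=> [|a x y hx hy]; first by rewrite (lin0 rl).
    by rewrite (linD rl) (linZ rl) hx hy scaler0 addr0.
  have [a ea] := irr_solvable_scalar n0 hr irr rq qr rk yr.
  by rewrite rb ?(subvP rq _ yr) // ea scalar_mxC subrr.
move=> /existsNP[S /not_implyP[hS /not_implyP[stS /not_orP[nS0 nST]]]].
have [A hA] := subspace_matrix hS.
have stA x : x \in q -> (A *m rho x <= A)%MS.
  move=> xq; apply/row_subP => i; rewrite row_mul; apply/hA; apply: stS => //.
  by apply/hA; exact: row_sub.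
have rA : (\rank A < n)%N.
  rewrite ltn_neqAle rank_leq_col andbT; apply/negP => /eqP e; apply: nST => v.
  by apply/hA/submx_full; rewrite /row_full e.
have rA0 : (n - \rank A < n)%N.
  rewrite -subn_gt0 subKn ?rank_leq_col // lt0n mxrank_eq0; apply/negP => /eqP e.
  by apply: nS0 => v /hA; rewrite e submx0 => /eqP.
set B := row_base A.
have sB x : x \in q -> (B *m rho x <= B)%MS.
  by move=> xq; rewrite (eqmxMr _ (eq_row_base A)) eq_row_base stA.
have [hr1 e1] := mrep_sub hr (row_base_free A) sB.
have [N1 h1] := IH _ _ (leq_trans rA nb) hr1.
(* Multiplication by [K] is the projection onto the quotient by the row space of [A]. *)
pose K := col_base (cokermx A).
have AK : A *m K = 0.
  apply/eqP; rewrite -(mulmx_free_eq0 _ (row_base_free (cokermx A))).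
  by rewrite -mulmxA mulmx_base mulmx_coker.
have kK : (kermx K <= A)%MS.
  rewrite submxE; have -> : kermx K *m cokermx A =
    kermx K *m K *m row_base (cokermx A) by rewrite -mulmxA mulmx_base.
  by rewrite mulmx_ker mul0mx.
have [] := @mrep_quot _ _ _ K hr (col_base_full _).
  move=> x xq; have /submxP[D ->] := kK; rewrite -!mulmxA.
  by have /submxP[D' /= e] := stA x xq; rewrite (mulmxA A) e -mulmxA AK !mulmx0.
set rho2 := (fun _ => _) => hr2 e2.
have [N2 h2] : exists N, forall s, size s = N ->
    (forall z, z \in s -> z \in brv q r) -> mxprod rho2 s = 0.
  apply: IH hr2; rewrite mxrank_coker; exact: leq_trans rA0 nb.
(* Acting on row vectors from the right, the first [N2] factors come first. They vanish on the
   quotient and so map into the invariant subspace, where the other [N1] factors vanish. *)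
exists (N2 + N1)%N => s ss sz; rewrite -(cat_take_drop N2 s) mxprod_cat.
have eK : mxprod rho (take N2 s) *m K = 0.
  rewrite (mxprod_intertwine (rho' := rho2)) => [|z /mem_take /sz /uq]; last exact: e2.
  by rewrite h2 ?mulmx0 ?size_takel ?ss ?leq_addr // => z /mem_take /sz.
have /submxP[D ->] : (mxprod rho (take N2 s) <= B)%MS.
  rewrite eq_row_base submxE; set M := mxprod _ _ in eK *.
  have -> : M *m cokermx A = M *m K *m row_base (cokermx A).
    by rewrite -mulmxA mulmx_base.
  by rewrite eK mul0mx.
rewrite -mulmxA; set rho1 := (fun x => _ *m pinvmx _) in h1 e1 hr1.
have -> : B *m mxprod rho (drop N2 s) = mxprod rho1 (drop N2 s) *m B.
  have : forall z, z \in drop N2 s -> B *m rho z = rho1 z *m B.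
    by move=> z /mem_drop /sz /uq; exact: e1.
  elim: (drop N2 s) => [|z t IHt] h /=; first by rewrite mul1mx mulmx1.
  rewrite mulmxA h ?mem_head // -mulmxA IHt ?mulmxA // => y yt.
  by rewrite h // in_cons yt orbT.
rewrite h1 ?mul0mx ?mulmx0 // ?size_drop ?ss ?addKn //.
by move=> z /mem_drop /sz.
Qed.

End Lie.

(** * Germane parabolic subalgebras *)

Lemma linear_struct (F : fieldType) (U V : lmodType F) (f : U -> V) :
  linear f -> exists L : {linear U -> V}, f = L.
Proof.
move=> hf; pose i := GRing.isLinear.Build F U V *:%R f hf.
by pose L : {linear U -> V} := HB.pack f i; exists L.
Qed.

Import VectorInternalTheory.

Lemma linear_matrix (F : fieldType) (V : vectType F) (f : V -> V) : linear f ->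
  exists M : 'M[F]_(dim V), forall v, v2r v *m M = v2r (f v).
Proof.
move=> hf; have [L ->] := linear_struct hf.
by exists (lin1_mx (v2r \o L \o r2v)) => v; rewrite mul_rV_lin1 /= v2rK.
Qed.

Section Reductive.
Variables (R : realType) (P : reductive_pair R).
Let ax := rp_axioms P.
Local Notation g := (lie P).
Local Notation B := (@rp_form R P).
Local Notation sigma := (@rp_sigma R P).
Local Notation theta := (@rp_theta R P).

Let brl := ra_brl ax.
Let brr := ra_brr ax.
Let bralt := ra_alt ax.
Let jac := ra_jacobi ax.

Lemma sigmaD X Y : sigma (X + Y) = sigma X + sigma Y.
Proof.
by have := ra_sigma_semilinear ax 1 X Y; rewrite conjc1 !scale1r.
Qed.

Lemma sigma0 : sigma 0 = 0.
Proof. by apply: (addrI (sigma 0)); rewrite -sigmaD !addr0. Qed.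

Lemma sigmaZ a X : sigma (a *: X) = (a^*)%C *: sigma X.
Proof.
by have := ra_sigma_semilinear ax a X 0; rewrite sigma0 !addr0.
Qed.

Lemma sigmaN X : sigma (- X) = - sigma X.
Proof. by apply/eqP; rewrite -addr_eq0 -sigmaD addNr sigma0. Qed.

(** The conjugation of g with respect to the compact real form k_0 + i p_0, on which the form is
    negative definite. *)
Definition tau (X : g) : g := theta (sigma X).

Lemma tauD X Y : tau (X + Y) = tau X + tau Y.
Proof. by rewrite /tau sigmaD (linD (ra_theta_linear ax)). Qed.

Lemma tauZ a X : tau (a *: X) = (a^*)%C *: tau X.
Proof. by rewrite /tau sigmaZ (linZ (ra_theta_linear ax)). Qed.

Lemma tau0 : tau 0 = 0.
Proof. by rewrite /tau sigma0 (lin0 (ra_theta_linear ax)). Qed.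

Lemma tauN X : tau (- X) = - tau X.
Proof. by rewrite /tau sigmaN (linN (ra_theta_linear ax)). Qed.

Lemma tauK : involutive tau.
Proof.
by move=> X; rewrite /tau -(ra_theta_sigma ax) (ra_thetaK ax) (ra_sigmaK ax).
Qed.

Lemma tau_br X Y : tau (br X Y) = br (tau X) (tau Y).
Proof. by rewrite /tau (ra_sigma_br ax) (ra_theta_br ax). Qed.

Lemma form_linearl Y : linear (fun X => B X Y).
Proof.
move=> a X X'; rewrite !(ra_B_sym ax _ Y); exact: (ra_B_linear ax).
Qed.

Let Bl := form_linearl.
Let Br := ra_B_linear ax.

Lemma form_br X Y Z : B (br X Y) Z = - B Y (br X Z).
Proof.
by rewrite (brC brl brr bralt) (linN (Bl _)) (ra_B_br ax).
Qed.

(** 2X = U - iV with U in k_0 and V in p_0, which are orthogonal by invariance under theta. Hence 4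
    B(X, X) = B(U, U) - B(V, V). *)
Lemma form_tau_neg X : tau X = X -> X <> 0 -> (B X X : R[i]) < 0.
Proof.
move=> tX X0.
have ts : theta X = sigma X by rewrite -[X in theta X]tX /tau (ra_thetaK ax).
pose U := X + sigma X; pose V := 'i%C *: (X - sigma X).
have sU : sigma U = U by rewrite sigmaD (ra_sigmaK ax) addrC.
have tU : theta U = U.
  by rewrite (linD (ra_theta_linear ax)) -/(tau X) tX ts addrC.
have ci : (('i%C : R[i])^*)%C = - 'i%C by apply/eqP; rewrite eq_complex /= oppr0 !eqxx.
have sV : sigma V = V.
  by rewrite sigmaZ sigmaD sigmaN (ra_sigmaK ax) ci scaleNr -scalerN opprB.
have tV : theta V = - V.
  rewrite (linZ (ra_theta_linear ax)) (linB (ra_theta_linear ax)).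
  by rewrite -/(tau X) tX ts -scalerN opprB.
have UV : B U V = 0.
  have := ra_B_theta ax U V; rewrite tU tV (linN (Br _)) => /eqP.
  by rewrite eq_sym -subr_eq0 opprK -mulr2n mulrn_eq0 /= => /eqP.
have e : (2%:R : R[i]) *: X = U - 'i%C *: V.
  rewrite scalerA -expr2 sqr_i scaleN1r opprK /U addrACA subrr addr0.
  by rewrite scaler_nat mulr2n.
have BX : (4%:R : R[i]) * B X X = B U U - B V V.
  have -> : (4%:R : R[i]) * B X X = B (2%:R *: X) (2%:R *: X).
    rewrite (linZ (Bl _)) (linZ (Br _)) /GRing.scale /= mulrA -natrM //.
  rewrite e; clearbody U V.
  rewrite (linB (Bl _)) !(linB (Br _)) !(linZ (Bl _)) !(linZ (Br _)).
  rewrite (ra_B_sym ax V U) UV /GRing.scale /= !mulr0 !subr0 sub0r.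
  by rewrite opprK mulrA -expr2 sqr_i mulN1r.
have U0 : (B U U : R[i]) <= 0.
  have [->|/eqP U0] := eqVneq U 0; first by rewrite (lin0 (Bl _)).
  exact: ltW (ra_B_neg ax sU tU U0).
have V0 : 0 <= (B V V : R[i]).
  have [->|/eqP V0] := eqVneq V 0; first by rewrite (lin0 (Bl _)).
  exact: ltW (ra_B_pos ax sV tV V0).
rewrite -(pmulr_rlt0 _ (_ : 0 < 4%:R :> R[i])) ?ltr0n // BX subr_lt0.
have [U1|/eqP U1] := eqVneq U 0; last first.
  exact: lt_le_trans (ra_B_neg ax sU tU U1) V0.
have [V1|/eqP V1] := eqVneq V 0; last first.
  exact: le_lt_trans U0 (ra_B_pos ax sV tV V1).
exfalso; apply: X0; apply/eqP; move/eqP: e; rewrite U1 V1 scaler0 subr0.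
by rewrite scaler_eq0 pnatr_eq0.
Qed.

(** A = X + tau X and C = i (X - tau X) are fixed by [tau] and B(A, A) + B(C, C) = 4 B(X, tau X);
    both summands on the left are nonpositive. *)
Lemma form_tau_eq0 X : B X (tau X) = 0 -> X = 0.
Proof.
move=> BX.
pose A := X + tau X; pose C := 'i%C *: (X - tau X).
have tA : tau A = A by rewrite tauD tauK addrC.
have ci : (('i%C : R[i])^*)%C = - 'i%C by apply/eqP; rewrite eq_complex /= oppr0 !eqxx.
have tC : tau C = C by rewrite tauZ tauD tauN tauK ci scaleNr -scalerN opprB.
have e : B A A + B C C = (4%:R : R[i]) * B X (tau X).
  rewrite /A /C (linZ (Bl _)) (linZ (Br _)) !(linD (Bl _)) !(linD (Br _)).
  rewrite !(linN (Bl _)) !(linN (Br _)) (ra_B_sym ax (tau X) X).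
  rewrite /GRing.scale /= mulrA -expr2 sqr_i.
  by rewrite -[4%N]/(2 + 2)%N natrD; ring.
have A0 : (B A A : R[i]) <= 0.
  have [->|/eqP A0] := eqVneq A 0; first by rewrite (lin0 (Bl _)).
  exact: ltW (form_tau_neg tA A0).
have C0 : (B C C : R[i]) <= 0.
  have [->|/eqP C0] := eqVneq C 0; first by rewrite (lin0 (Bl _)).
  exact: ltW (form_tau_neg tC C0).
move: e; rewrite BX mulr0 => e.
have A1 : A = 0.
  apply: contrapT => A1; have := ltr_leD (form_tau_neg tA A1) C0.
  by rewrite addr0 e ltxx.
have C1 : C = 0.
  apply: contrapT => C1; have := ler_ltD A0 (form_tau_neg tC C1).
  by rewrite addr0 e ltxx.
have : (2%:R : R[i]) *: X = A - 'i%C *: C.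
  rewrite scalerA -expr2 sqr_i scaleN1r opprK /A addrACA subrr addr0.
  by rewrite scaler_nat mulr2n.
by rewrite A1 C1 scaler0 subr0 => /eqP; rewrite scaler_eq0 pnatr_eq0 => /eqP.
Qed.

(** Up to scalars, [T] is self-adjoint for the definite hermitian form B(X, tau Y). So the square
    norm of T^(n+1) Z is a multiple of B(T^n Z, T^(n+2) tau Z), and the nilpotency index can be
    lowered down to one. *)
Lemma selfadjoint_nilpotent (T : g -> g) (s t : R[i]) n : linear T ->
  (forall Z W, B (T Z) W = s * B Z (T W)) ->
  (forall Z, tau (T Z) = t *: T (tau Z)) ->
  (forall Z, iter n T Z = 0) -> forall Z, T Z = 0.
Proof.
move=> T_lin Ts Tt; elim: n => [|[|n] IH] // nil Z.
  by have /= := nil (T Z).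
apply: IH => {}Z; apply: form_tau_eq0; rewrite [iter _ _ _]/=.
rewrite Tt (linZ (Br _)) Ts.
have -> : tau (iter n T Z) = t ^+ n *: iter n T (tau Z).
  elim: n {nil} => [|n IHn]; first by rewrite expr0 scale1r.
  by rewrite /= Tt IHn (linZ T_lin) scalerA exprS.
rewrite !(linZ T_lin) (linZ (Br _)).
have -> : T (T (iter n T (tau Z))) = 0 by exact: (nil (tau Z)).
by rewrite (lin0 (Br _)) !scaler0 /GRing.scale /= !mulr0.
Qed.

Section Parabolic.
Variable Q : germane_parabolic P.
Local Notation q := (parab Q).
Local Notation u := (nrad Q).
Local Notation l := (levi Q).

Lemma parab_sub : subalgebra q.
Proof. by case: (ge_parabolic Q). Qed.

Lemma parab_br X Y : X \in q -> Y \in q -> br X Y \in q.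
Proof. by move=> Xq Yq; apply: (subvP parab_sub); apply: mem_brv. Qed.

Lemma levi_br X Y : X \in l -> Y \in l -> br X Y \in l.
Proof. by move=> Xq Yq; apply: (subvP (ge_levi Q)); apply: mem_brv. Qed.

Lemma levi_parab X : X \in l -> X \in q.
Proof. exact/subvP/addvSl. Qed.

Lemma nrad_parab X : X \in u -> X \in q.
Proof. exact/subvP/addvSr. Qed.

Lemma nrad_radical : exists2 r : {vspace g}, is_radical q r & u = brv q r.
Proof. exact: ge_nrad. Qed.

Lemma br_nrad X Y : X \in q -> Y \in u -> br X Y \in u.
Proof.
have [r [[rq qr] _ _] ->] := nrad_radical; move=> Xq.
apply: (brv_ind (S := fun Y => br X Y \in brv q r)) => {Y}.
  split=> [|a x y hx hy]; first by rewrite (lin0 (brr _)) mem0v.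
  by rewrite (linD (brr _)) (linZ (brr _)) memvD ?memvZ.
move=> a b aq b_r; rewrite (br_derivation brl brr bralt jac).
apply: memvD; apply: mem_brv => //; first exact: parab_br.
by apply: (subvP qr); apply: mem_brv.
Qed.

(** [nilradical_nilpotent] for the adjoint representation of q on all of g. *)
Lemma nrad_nilpotent : exists N, forall s, size s = N ->
  (forall z, z \in s -> z \in u) -> forall y, foldl (fun w z => br z w) y s = 0.
Proof.
have [r [[rq qr] sr _] ue] := nrad_radical.
have [rho hrho] := choice (fun X => linear_matrix (brr X)).
have rE X (v : 'rV_(dim g)) : v *m rho X = v2r (br X (r2v v)).
  by rewrite -{1}[v]r2vK hrho.
have mr : mrep q rho.
  split=> [a X Y|X Y Xq Yq]; apply/row_matrixP => i.
    rewrite !rowE mulmxDr -scalemxAr !rE (linD (brl _)) (linZ (brl _)).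
    by rewrite linearP.
  rewrite !rowE mulmxBr !mulmxA !rE !v2rK -linearB; congr v2r.
  by rewrite [X in _ = X - _](br_derivation brl brr bralt jac) addrK.
have [N hN] := nilradical_nilpotent brl brr bralt jac parab_sub rq qr sr mr.
exists N => s sN su y; apply: v2r_inj; rewrite linear0.
have <- : v2r y *m mxprod rho s = v2r (foldl (fun w z => br z w) y s).
  elim: s y {sN su} => [|z s IH] y /=; first by rewrite mulmx1.
  by rewrite mulmxA hrho IH.
by rewrite hN ?mulmx0 // => z /su; rewrite ue.
Qed.

Lemma levi_tau X : X \in l -> tau X \in l.
Proof. by move=> Xl; apply: ge_theta; apply: ge_sigma. Qed.

(** This makes l the intersection of q and tau q. H = [tau Y, Y] lies in u, so ad H is nilpotent,
    and it is skew for the invariant form, hence zero. So ad Y and ad (tau Y) commute, and their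
    product is nilpotent and self-adjoint, hence zero; definiteness gives ad Y = 0. A central Y in
    [q, rad q] satisfies B(Y, tau Y) = 0 by invariance. *)
Lemma nrad_tau_eq0 Y : Y \in u -> tau Y \in q -> Y = 0.
Proof.
move=> Yu tYq.
have [N hN] := nrad_nilpotent.
have nil z : z \in u -> forall w, iter N (br z) w = 0.
  move=> zu w; rewrite -(hN (nseq N z) (size_nseq _ _) _ w); last first.
    by move=> y /nseqP[->].
  by elim: {1 2}N w => //= n IH w; rewrite -iterS iterSr IH.
pose H := br (tau Y) Y.
have tH : tau H = - H by rewrite tau_br tauK (brC brl brr bralt).
have adH Z : br H Z = 0.
  apply: (selfadjoint_nilpotent (brr H) (s := -1) (t := -1)) (nil H _) Z.
  - by move=> Z W; rewrite form_br mulN1r.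
  - by move=> Z; rewrite tau_br tH (linN (brl _)) scaleN1r.
  - exact: br_nrad.
have com Z : br Y (br (tau Y) Z) = br (tau Y) (br Y Z).
  have := br_derivation brl brr bralt jac (tau Y) Y Z.
  by rewrite -/H adH add0r.
pose T Z := br (tau Y) (br Y Z).
have T_lin : linear T.
  by move=> a x y; rewrite /T !(linD (brr _)) !(linZ (brr _)).
have T0 Z : T Z = 0.
  apply: (selfadjoint_nilpotent T_lin (s := 1) (t := 1) (n := N)) Z.
  - by move=> Z W; rewrite /T !form_br opprK mul1r com.
  - by move=> Z; rewrite /T !tau_br tauK scale1r com.
  move=> Z; have -> : iter N T Z = iter N (br (tau Y)) (iter N (br Y) Z).
    clear hN nil; elim: N Z => // n IH Z; rewrite iterSr IH !iterSr /T.
    congr (iter n _ _).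
    by elim: n {IH} (br Y Z) => // n IHn W; rewrite !iterSr com IHn.
  rewrite (nil Y) //; elim: {hN nil} N => //= n ->; exact: (lin0 (brr _)).
have adY Z : br Y Z = 0.
  apply: form_tau_eq0; rewrite tau_br form_br.
  have -> : br Y (br (tau Y) (tau Z)) = T (tau Z) by rewrite /T com.
  by rewrite T0 (lin0 (Br _)) oppr0.
apply: form_tau_eq0.
have adtY Z : br (tau Y) Z = 0.
  by rewrite -[Z]tauK -tau_br adY tau0.
have [r _ ue] := nrad_radical; move: Yu; rewrite ue => Yb.
apply: (brv_ind (S := fun X => B X (tau Y) = 0)) Yb.
  split=> [|a x y hx hy]; first exact: (lin0 (Bl _)).
  by rewrite (linD (Bl _)) (linZ (Bl _)) hx hy scaler0 addr0.
move=> a b _ _; rewrite (ra_B_br ax) (brC brl brr bralt) adtY oppr0.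
exact: (lin0 (Br _)).
Qed.

Lemma levi_parab_tau X : X \in q -> tau X \in q -> X \in l.
Proof.
move=> /memv_addP[a al [b bu ->]] tX; rewrite [b]nrad_tau_eq0 ?addr0 //.
by rewrite -[tau b](addKr (tau a)) -tauD rpredD // rpredN levi_parab ?levi_tau.
Qed.

(** [Ad k] commutes with theta, so normalizing theta(q) amounts to normalizing q. *)
Lemma levi_grpE k : levi_grp Q k <-> grp k /\ forall X, X \in q -> Ad k X \in q.
Proof.
split=> [[Kk h]|[Kk h]]; split=> // X Xq; first by have [] := h X Xq.
split; first exact: h.
by rewrite -(ra_Ad_theta ax) // (ra_thetaK ax) h.
Qed.

Lemma grp_group : gk_group P.
Proof.
have [K1 KM KV _] := ra_compact ax.
by split=> // k /KV[].
Qed.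

Lemma Ad_KV k (X : g) : grp k -> Ad k (Ad (invmx k) X) = X.
Proof.
move=> Kk; have gg := grp_group; have Kv := gg_V gg Kk.
by rewrite -(ra_AdM ax) // mulmxV ?(gg_unit gg) // (ra_Ad1 ax).
Qed.

Lemma Ad_VK k (X : g) : grp k -> Ad (invmx k) (Ad k X) = X.
Proof.
move=> Kk; have gg := grp_group; have Kv := gg_V gg Kk.
by rewrite -(ra_AdM ax) // mulVmx ?(gg_unit gg) // (ra_Ad1 ax).
Qed.

(** [levi_grp] asks for the inclusion of Ad k (q) in q only; injectivity and equal dimensions make
    it an equality. *)
Lemma levi_grpV k : levi_grp Q k -> levi_grp Q (invmx k).
Proof.
move=> /levi_grpE[Kk h]; have Kv := gg_V grp_group Kk.
apply/levi_grpE; split=> // X Xq.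
have [L Le] := linear_struct (ra_Ad_linear ax Kk).
have LE y : linfun L y = Ad k y by rewrite lfunE /= -Le.
have sub : (linfun L @: q <= q)%VS.
  by apply/subvP => _ /memv_imgP[y yq ->]; rewrite LE h.
have ker : (q :&: lker (linfun L) = 0)%VS.
  apply/eqP; rewrite -subv0; apply/subvP => y; rewrite memv_cap memv_ker memv0.
  by rewrite LE => /andP[_ /eqP y0]; rewrite -[y](Ad_VK _ Kk) y0 (lin0 (ra_Ad_linear ax Kv)).
have /eqP e : (linfun L @: q == q)%VS.
  by rewrite eqEdim sub /=; rewrite limg_dim_eq.
move: Xq; rewrite -{1}e => /memv_imgP[y yq ->].
by rewrite LE Ad_VK.
Qed.

Lemma levi_group : gk_group (levi_pair Q).
Proof.
have gg := grp_group; split.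
- apply/levi_grpE; split; first exact: (gg_1 gg).
  by move=> X; rewrite (ra_Ad1 ax).
- move=> k k' /levi_grpE[Kk hk] /levi_grpE[Kk' hk']; apply/levi_grpE; split.
    exact: (gg_M gg).
  by move=> X Xq; rewrite (ra_AdM ax) //; apply/hk/hk'.
- by move=> k [Kk _]; exact: (gg_unit gg).
- exact: levi_grpV.
Qed.

Lemma Ad_levi k X : levi_grp Q k -> X \in l -> Ad k X \in l.
Proof.
move=> /levi_grpE[Kk h] Xl; apply: levi_parab_tau; first exact/h/levi_parab.
have -> : tau (Ad k X) = Ad k (tau X).
  by rewrite /tau -(ra_Ad_sigma ax) // -(ra_Ad_theta ax).
exact/h/levi_parab/levi_tau.
Qed.

Lemma limg_brv (L : {linear g -> g}) U V : (forall X Y, L (br X Y) = br (L X) (L Y)) ->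
  (linfun L @: brv U V = brv (linfun L @: U) (linfun L @: V))%VS.
Proof.
move=> Lb; apply/eqP; rewrite eqEsubv; apply/andP; split.
  apply/subvP => _ /memv_imgP[z zb ->].
  apply: (brv_ind (S := fun z => linfun L z \in _)) zb => [|x y xU yV].
    split=> [|a x y hx hy]; first by rewrite linear0 mem0v.
    by rewrite linearP memvD ?memvZ.
  by rewrite lfunE /= Lb -!(lfunE L); apply: mem_brv => //; apply: memv_img.
apply: brv_sub => _ _ /memv_imgP[x xU ->] /memv_imgP[y yV ->].
by rewrite !lfunE /= -Lb -(lfunE L); apply/memv_img/mem_brv.
Qed.

Lemma Ad_radical r k X : is_radical q r -> levi_grp Q k -> X \in r -> Ad k X \in r.
Proof.
move=> [[rq qr] [n rn] rmax] hk Xr.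
have [Kk h] := (levi_grpE k).1 hk; have [Kv hv] := (levi_grpE _).1 (levi_grpV hk).
have [L Le] := linear_struct (ra_Ad_linear ax Kk).
have LE y : linfun L y = Ad k y by rewrite lfunE /= -Le.
have Lb X1 Y1 : L (br X1 Y1) = br (L X1) (L Y1) by rewrite -Le (ra_Ad_br ax).
have : (linfun L @: r <= r)%VS.
  apply: rmax.
    split.
      apply/subvP => _ /memv_imgP[y yr ->]; rewrite LE h //; exact: (subvP rq).
    apply: brv_sub => x _ xq /memv_imgP[y yr ->].
    rewrite LE -[x](Ad_KV _ Kk) -(ra_Ad_br ax) // -LE.
    by apply/memv_img/(subvP qr); apply: mem_brv => //; exact: hv.
  exists n; have -> : iter n (fun W => brv W W) (linfun L @: r)%VS =
      (linfun L @: iter n (fun W => brv W W) r)%VS.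
    by elim: n {rn} => //= n ->; rewrite limg_brv.
  by rewrite rn limg0.
by move=> /subvP; apply; rewrite -LE memv_img.
Qed.

Lemma Ad_nrad k X : levi_grp Q k -> X \in u -> Ad k X \in u.
Proof.
move=> hk; have [r rr ->] := nrad_radical; have [Kk h] := (levi_grpE k).1 hk.
apply: (brv_ind (S := fun X => Ad k X \in _)) => [|x y xq yr].
  have Al := ra_Ad_linear ax Kk.
  split=> [|a x y hx hy]; first by rewrite (lin0 Al) mem0v.
  by rewrite (linD Al) (linZ Al) memvD ?memvZ.
rewrite (ra_Ad_br ax) //; apply: mem_brv => //; first exact: h.
exact: Ad_radical rr hk yr.
Qed.

(* Differentiation at [0] of the one-parameter subgroups. *)
Lemma kemb_stable (W : {vspace g}) X :
  (forall k Y, levi_grp Q k -> Y \in W -> Ad k Y \in W) ->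
  lie_of (levi_grp Q) X -> forall Y, Y \in W -> br (kemb P X) Y \in W.
Proof.
move=> hW [c [Kc cM cX]] Y YW.
have cP : one_param (@grp R P) c X by split=> // t; have [] := Kc t.
suff e : br (kemb P X) Y = projv W (br (kemb P X) Y).
  by rewrite e; apply: memv_proj.
apply/eqP; rewrite -subr_eq0; apply/eqP/v2r_inj/rowP => j; rewrite linear0 [RHS]mxE.
(* A coordinate of the component outside [W]. It vanishes along t |-> Ad (c t) Y, so its derivative
   at 0, which is its value at the bracket, vanishes too. *)
pose f (Z : g) : R[i]^o := v2r (Z - projv W Z) 0 j.
have f_lin : linear f.
  move=> a x y; rewrite /f.
  have -> : a *: x + y - projv W (a *: x + y) =
      a *: (x - projv W x) + (y - projv W y).
    by rewrite linearP scalerBr opprD addrACA.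
  by rewrite linearP !mxE.
have [_ /(_ c X cP)] := lf_vec_coef (ra_Ad_linear ax) (fun X => brr (kemb P X))
  f_lin ((lf_vecP _ _ _).2 (ra_Ad_diff ax) Y).
have c0 : cderiv (fun t => f (Ad (c t) Y)) 0.
  apply: eq_cderiv (cderiv_cst 0) => t.
  by rewrite /f projv_id ?subrr ?linear0 ?mxE // hW.
by move=> /cderiv_uniq /(_ c0).
Qed.

(** The form is nondegenerate on l, since l is stable under [tau] and B(X, tau X) is anisotropic; so
    its Gram matrix can be inverted. *)
Lemma levi_projection X : exists2 Y, Y \in l & forall Z, Z \in l -> B (X - Y) Z = 0.
Proof.
pose e i := (vbasis l)`_i.
have el (i : 'I_(\dim l)) : e i \in l.
  by apply/vbasis_mem/mem_nth; rewrite size_tuple.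
pose G : 'M[R[i]]_(\dim l) := \matrix_(i, j) B (e i) (e j).
pose s (v : 'rV[R[i]]_(\dim l)) := \sum_i v 0 i *: e i.
have sl v : s v \in l by apply: memv_suml => i _; apply: memvZ.
have sG v (j : 'I_(\dim l)) : B (s v) (e j) = (v *m G) 0 j.
  rewrite (lin_sum (Bl _)) mxE; apply: eq_bigr => i _.
  by rewrite (linZ (Bl _)) mxE.
have orth v : (forall j : 'I_(\dim l), B v (e j) = 0) -> forall Z, Z \in l -> B v Z = 0.
  move=> h Z Zl; rewrite (coord_vbasis Zl) (lin_sum (Br _)) big1 // => i _.
  by rewrite (linZ (Br _)) -/(e i) h scaler0.
have Gu : G \in unitmx.
  rewrite -row_free_unit -kermx_eq0; apply/rowV0P => v /sub_kermxP vG.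
  have : s v = 0.
    apply: form_tau_eq0; apply: orth; last exact: levi_tau.
    by move=> j; rewrite sG vG mxE.
  move=> sv; apply/rowP => i; rewrite mxE.
  have /freeP := basis_free (vbasisP l); apply; rewrite -[RHS]sv.
  by apply: eq_bigr => j _.
pose b : 'rV[R[i]]_(\dim l) := \row_j B X (e j).
exists (s (b *m invmx G)); first exact: sl.
apply: orth => j; rewrite (linB (Bl _)) sG mulmxKV // !mxE.
exact: subrr.
Qed.

(** The image Y of an element of Lie(L cap K) is fixed by [tau], so by [levi_parab_tau] it suffices
    that Y lies in q. Subtracting the projection to l leaves Y2 orthogonal to l. Invariance gives
    [Y2, l] = 0, and Y2 normalizes u, so a Borel subalgebra b inside q stays a solvable subalgebra
    when Y2 is added. Maximality puts Y2 into b. *)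
Lemma kemb_levi X : lie_of (levi_grp Q) X -> kemb P X \in l.
Proof.
move=> hX; set Y := kemb P X.
have [sY tY] : sigma Y = Y /\ theta Y = Y.
  apply/(ra_kemb_image ax); exists X => //.
  by have [c [Kc cM cX]] := hX; exists c; split=> // t; have [] := Kc t.
have tauY : tau Y = Y by rewrite /tau sY.
have [r rr ue] := nrad_radical; have [[rq qr] [n rn] rmax] := rr.
have hq := kemb_stable (fun k Z hk => ((levi_grpE k).1 hk).2 Z) hX.
have hr := kemb_stable (fun k Z hk => Ad_radical rr hk) hX.
have hu Z : Z \in u -> br Y Z \in u.
  exact: (kemb_stable (fun k Z hk => Ad_nrad hk) hX).
have hl Z : Z \in l -> br Y Z \in l.
  move=> Zl; apply: levi_parab_tau; first exact/hq/levi_parab.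
  by rewrite tau_br tauY; apply/hq/levi_parab/levi_tau.
have [Y1 Y1l orth] := levi_projection Y; set Y2 := Y - Y1 in orth.
have Y2l Z : Z \in l -> br Y2 Z = 0.
  move=> Zl; have W : br Y2 Z \in l.
    by rewrite (linB (brl _)) memvB ?hl ?levi_br.
  by apply: form_tau_eq0; rewrite (ra_B_br ax) orth // levi_br ?levi_tau.
have Y2u Z : Z \in u -> br Y2 Z \in u.
  by move=> Zu; rewrite (linB (brl _)) memvB ?hu ?br_nrad ?levi_parab.
have [_ [b [bs bsol bmax] bq]] := ge_parabolic Q.
(* The sum of [b] and the radical is again a solvable subalgebra, so maximality puts the radical,
   and with it u, into [b]. *)
have ub : (u <= b)%VS.
  apply: (@subv_trans _ _ r); first by rewrite ue.
  have brr' x z : x \in b -> z \in r -> br x z \in r.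
    by move=> xb zr; apply: (subvP qr); apply: mem_brv => //; exact: (subvP bq).
  have rs : subalgebra r by apply: subv_trans qr; exact: brvS.
  rewrite -(bmax (b + r)%VS) ?addvSr ?addvSl //.
    exact: (subalgebra_add brl brr bralt).
  by apply: (solvable_add brl brr bralt) => //; exists n.
have bl Z : Z \in b -> exists A C, [/\ A \in l, C \in u & Z = A + C].
  by move=> /(subvP bq) /memv_addP[A Al [C Cu ->]]; exists A, C.
have Y2b : Y2 \in b.
  have brb x y : x \in (b + <[Y2]>)%VS -> y \in (b + <[Y2]>)%VS -> br x y \in b.
    have Y2b Z : Z \in b -> br Y2 Z \in b.
      move=> /bl[A [C [Al Cu ->]]]; rewrite (linD (brr _)) Y2l // add0r.
      exact/(subvP ub)/Y2u.
    move=> /memv_addP[x1 x1b [_ /vlineP[s ->] ->]].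
    move=> /memv_addP[y1 y1b [_ /vlineP[t ->] ->]].
    rewrite (linD (brl _)) !(linD (brr _)) !(linZ (brl _)) !(linZ (brr _)) bralt.
    rewrite !scaler0 addr0 (brC brl brr bralt x1 Y2) !memvD ?memvZ ?memvN ?Y2b //.
    exact: (subvP bs _ (mem_brv brl brr x1b y1b)).
  have e : (b + <[Y2]>)%VS = b.
    apply: bmax; last exact: addvSl.
      by apply: brv_sub => x y xb yb; apply/(subvP (addvSl _ _))/brb.
    apply: (@solvable_derived _ _ _ 1); apply: (solvable_sub brl brr) bsol.
    exact: brv_sub.
  by rewrite -e; apply: (subvP (addvSr _ _)); exact: memv_line.
have Yq : Y \in q.
  by have := memvD (subvP bq _ Y2b) (levi_parab Y1l); rewrite subrK.
by apply: levi_parab_tau; rewrite ?tauY.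
Qed.

End Parabolic.

End Reductive.

(** * Restriction of modules *)

(** What is needed to pull modules back along a map of pairs, including local finiteness. It is
    shared by the given inclusion, its restrictions to q' and l', and the inclusions of Levi and
    parabolic pairs. *)
Record pm_ok (R : realType) (P' P : gk_pair R) (i : pair_map P' P) : Prop := PmOk {
  pm_linear : linear (pm_lie i);
  pm_br : forall X Y, pm_lie i (br X Y) = br (pm_lie i X) (pm_lie i Y);
  pm_grpP : forall k, grp k -> grp (pm_grp i k);
  pm_1 : pm_grp i 1%:M = 1%:M;
  pm_M : forall k l, grp k -> grp l -> pm_grp i (k *m l) = pm_grp i k *m pm_grp i l;
  pm_cont : {within @grp R P', continuous (pm_grp i)};
  pm_Ad : forall k X, grp k -> pm_lie i (Ad k X) = Ad (pm_grp i k) (pm_lie i X);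
  pm_diff : forall c X, one_param (@grp R P') c X ->
    exists2 Y, one_param (@grp R P) (pm_grp i \o c) Y
      & kemb P Y = pm_lie i (kemb P' X) }.

Section Restriction.
Variables (R : realType) (P' P : gk_pair R) (i : pair_map P' P).
Hypothesis hi : pm_ok i.

Lemma lf_vec_restrict (V : lmodType R[i]) (pi : 'M[R]_(deg P) -> V -> V)
    (rho : lie P -> V -> V) v :
  lf_vec (@grp R P) pi (fun X => rho (kemb P X)) v ->
  lf_vec (@grp R P') (fun k => pi (pm_grp i k))
    (fun X => rho (pm_lie i (kemb P' X))) v.
Proof.
move=> [J [e [ea [c [ec cc dd]]]]]; exists J, e; split=> //.
exists (fun k => c (pm_grp i k)); split.
- by move=> k j Kk; apply: ec; exact: pm_grpP.
- move=> a b; exact: (ccont_comp (pm_cont hi) (pm_grpP hi) (cc a b)).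
- move=> g X j gX; have [Y gY <-] := pm_diff hi gX.
  exact: (dd _ _ j gY).
Qed.

Definition gresA (X : ambient P) : ambient P'.
Proof.
apply: (@Ambient R P' X (fun k => am_act X (pm_grp i k))
  (fun A => am_lie X (pm_lie i A)) (@am_dom R P X)).
- exact: am_dom_subspace.
- by move=> k x Kk; apply: am_dom_act; exact: pm_grpP.
- by move=> A x; exact: am_dom_lie.
- by move=> k Kk; apply: am_act_linear; exact: pm_grpP.
- by move=> x; rewrite pm_1 // am_act1.
- by move=> k l x Kk Kl dx; rewrite pm_M // am_actM //; exact: pm_grpP.
- by move=> A; exact: am_lie_linear.
- by move=> a A B x dx; rewrite (pm_linear hi) am_lie_linearl.
- by move=> A B x dx; rewrite pm_br // am_lie_br.
- by move=> k A x Kk dx; rewrite am_act_lie ?pm_Ad //; exact: pm_grpP.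
- by move=> x dx; apply: lf_vec_restrict; exact: am_finite.
Defined.

Definition gres (V : gkmod P) : gkmod P'.
Proof.
apply: (@GKMod R P' V (fun k => @gk_act R P V (pm_grp i k))
  (fun A => @gk_lie R P V (pm_lie i A))).
- by move=> k Kk; apply: gk_act_linear; exact: pm_grpP.
- by move=> x; rewrite pm_1 // gk_act1.
- by move=> k l x Kk Kl; rewrite pm_M // gk_actM //; exact: pm_grpP.
- by move=> A; exact: gk_lie_linear.
- by move=> x a A B; rewrite (pm_linear hi) gk_lie_linearl.
- by move=> A B x; rewrite pm_br // gk_lie_br.
- by move=> k A x Kk; rewrite gk_act_lie ?pm_Ad //; exact: pm_grpP.
- apply/lf_vecP => x; apply: lf_vec_restrict.
  by have /lf_vecP := @gk_finite R P V; apply.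
Defined.

Lemma gres_hom (V W : gkmod P) (f : V -> W) : gk_hom f ->
  gk_hom (f : gres V -> gres W).
Proof.
move=> [f_lin f_act f_lie]; split=> // [k v Kk|X v].
  by apply: f_act; exact: pm_grpP.
exact: f_lie.
Qed.

Lemma gres_iso (V W : gkmod P) : gk_iso V W -> gk_iso (gres V) (gres W).
Proof. by move=> [f [f_hom f_bij]]; exists f; split=> //; exact: gres_hom. Qed.

Lemma gres_short_exact (U V W : gkmod P) :
  short_exact U V W -> short_exact (gres U) (gres V) (gres W).
Proof.
move=> [f [g [[f_hom g_hom] f_inj g_surj ex]]]; exists f, g; split=> //.
by split; exact: gres_hom.
Qed.

Lemma gres_restriction (V : gkmod P) : is_restriction i V (gres V).
Proof. by exists id; split=> //; exists id. Qed.

Lemma restrictionP (V : gkmod P) (V' : gkmod P') :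
  is_restriction i V V' <-> gk_iso (gres V) V'.
Proof.
split=> [[j [j_lin j_bij j_act j_lie]]|[j [[j_lin j_act j_lie] j_bij]]].
  by exists j; split=> //; split=> // k v Kk; rewrite j_act.
by exists j; split=> // k v Kk; rewrite -j_act.
Qed.

Lemma restriction_unique (V : gkmod P) (V' V'' : gkmod P') :
  is_restriction i V V' -> is_restriction i V V'' -> gk_iso V' V''.
Proof.
move=> /restrictionP h /restrictionP h'.
exact: gk_iso_trans (gk_iso_sym h) h'.
Qed.

Lemma gres_cat (C : gkmod P' -> Prop) : full_abelian C ->
  full_abelian (fun V => C (gres V)).
Proof.
move=> [c1 c2 c3 c4 c5]; split.
- by move=> V W /gres_iso; exact: c1.
- by move=> V V0; apply: c2.
- move=> V W S [f [g [f_hom g_hom h1 h2]]]; apply: c3.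
  by exists f, g; split=> //; exact: gres_hom.
- move=> V W f N f_hom [j [j_hom j_inj ex]]; apply: (c4 (gres V) (gres W) f (gres N)); first exact: gres_hom.
  by exists j; split=> //; exact: gres_hom.
- move=> V W f N f_hom [j [j_hom j_inj ex]]; apply: (c5 (gres V) (gres W) f (gres N)); first exact: gres_hom.
  by exists j; split=> //; exact: gres_hom.
Qed.

Lemma pm_V k : gk_group P -> gk_group P' -> grp k ->
  pm_grp i (invmx k) = invmx (pm_grp i k).
Proof.
move=> hP hP' Kk; have Kv := gg_V hP' Kk.
have u := gg_unit hP (pm_grpP hi Kk).
apply: (can_inj (mulmxK u)); rewrite mulVmx // -pm_M // mulVmx ?pm_1 //.
exact: (gg_unit hP').
Qed.

Lemma gres_stable (X : ambient P) (S : X -> Prop) : stable S ->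
  stable (S : gresA X -> Prop).
Proof.
move=> [S1 S2 S3 S4]; split=> //.
  by move=> k x Kk; apply: S3; exact: pm_grpP.
by move=> A x; exact: S4.
Qed.

End Restriction.

Section ParabolicPair.
Variables (R : realType) (P : reductive_pair R) (Q : germane_parabolic P).
Let ax := rp_axioms P.
Local Notation q := (parab Q).
Local Notation g := (lie P).

(** The pair (q, L cap K). It is not reductive, but over it u itself acts on the cochains and on the
    cohomology. *)
Definition q_pair : gk_pair R :=
  @GKPair R (subvs_of q) (fun X Y => vsproj q (br (vsval X) (vsval Y)))
    (deg P) (levi_grp Q) (fun k X => vsproj q (Ad k (vsval X)))
    (fun X => vsproj q (kemb P X)).

Lemma q_group : gk_group q_pair.
Proof. by have [] := levi_group Q; split. Qed.

Lemma Ad_parab k X : levi_grp Q k -> X \in q -> Ad k X \in q.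
Proof. by move=> /levi_grpE[_ h]; exact: h. Qed.

Lemma levi_grp_grp k : levi_grp Q k -> grp k. Proof. by case. Qed.

Lemma levi_one_param c X : one_param (levi_grp Q) c X -> one_param (@grp R P) c X.
Proof. by move=> [Kc cM cX]; split=> // t; have [] := Kc t. Qed.

Lemma levi_one_param_kemb c X : one_param (levi_grp Q) c X -> kemb P X \in levi Q.
Proof. by move=> h; apply: kemb_levi; exists c. Qed.

Definition q_incl : pair_map q_pair P :=
  @PairMap R q_pair P (fun X => vsval X) (fun k => k).

Lemma q_incl_ok : pm_ok q_incl.
Proof.
split=> //.
- by move=> X Y; rewrite /= vsprojK ?parab_br ?subvsP.
- by move=> k [].
- by apply: continuous_subspaceT => x; exact: cvg_id.
- by move=> k X Kk; rewrite /= vsprojK // Ad_parab ?subvsP.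
- move=> c X hc; exists X; first exact: levi_one_param.
  by rewrite /= vsprojK // levi_parab // (levi_one_param_kemb hc).
Qed.

Definition lq_incl : pair_map (levi_pair Q) q_pair :=
  @PairMap R (levi_pair Q) q_pair (fun X => vsproj q (vsval X)) (fun k => k).

Lemma lq_incl_ok : pm_ok lq_incl.
Proof.
have lq (X : subvs_of (levi Q)) : vsval X \in q by apply/levi_parab/subvsP.
split=> //.
- by move=> a X Y; rewrite /= !linearP.
- move=> X Y; have bl := levi_br (subvsP X) (subvsP Y).
  by apply: val_inj; rewrite /= (vsprojK bl) !vsprojK ?lq ?levi_parab.
- by apply: continuous_subspaceT => x; exact: cvg_id.
- move=> k X Kk; apply: val_inj.
  by rewrite /= !vsprojK ?lq ?Ad_levi ?Ad_parab ?subvsP.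
- move=> c X hc; exists X => //; have Xl := levi_one_param_kemb hc.
  by rewrite /= vsprojK.
Qed.

Definition nrad_mod : gkmod q_pair.
Proof.
unshelve refine (@GKMod R q_pair (subvs_of (nrad Q) : lmodType R[i])
  (fun k y => vsproj (nrad Q) (@Ad R P k (vsval y)))
  (fun X y => vsproj (nrad Q) (@br R P (vsval X) (vsval y))) _ _ _ _ _ _ _ _).
- move=> k [Kk _] a x y.
  by rewrite linearP (ra_Ad_linear ax Kk) linearP.
- by move=> y; rewrite (ra_Ad1 ax) vsvalK.
- move=> k l y Kk Kl; rewrite (ra_AdM ax _ (levi_grp_grp Kk) (levi_grp_grp Kl)).
  by rewrite [in RHS]vsprojK // Ad_nrad ?subvsP.
- by move=> X a x y; rewrite linearP (ra_brr ax) linearP.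
- by move=> y a X Y; rewrite linearP (ra_brl ax) linearP.
- move=> X Y y; rewrite /= -linearB; congr vsproj.
  have yu := subvsP y; have Xq := subvsP X; have Yq := subvsP Y.
  rewrite !vsprojK ?parab_br ?br_nrad //.
  rewrite [X in _ = X - _](br_derivation (ra_brl ax) (ra_brr ax) (ra_alt ax) (ra_jacobi ax)).
  by rewrite addrK.
- move=> k X y Kk; have Kg := levi_grp_grp Kk.
  have yu := subvsP y; have Xq := subvsP X.
  by rewrite /= !vsprojK ?br_nrad ?Ad_nrad ?Ad_parab // (ra_Ad_br ax).
- apply/lf_vecP => y.
  pose dpi X := @br R P (vsval (kemb q_pair X)).
  have kq X : vsval (kemb q_pair X) \in q by exact: subvsP.
  rewrite -[y]vsvalK.
  apply: (@lf_vec_transfer R (deg P) (levi_grp Q) g _ (@Ad R P) dpi _ _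
    (fun Y => Y \in nrad Q) (vsproj (nrad Q))).
  + by move=> k Kk; apply: (ra_Ad_linear ax); exact: levi_grp_grp.
  + by move=> X; exact: (ra_brr ax).
  + by split=> [|a x z xu zu]; [exact: mem0v | rewrite memvD ?memvZ].
  + by move=> k x; exact: Ad_nrad.
  + by move=> X x; exact: br_nrad.
  + by move=> a x z _ _; rewrite linearP.
  + by move=> k x _ xu; rewrite vsprojK.
  + by move=> X x xu; rewrite vsprojK.
  + exact: subvsP.
  + apply: (lf_vec_restrict q_incl_ok (rho := @br R P)).
    by have /lf_vecP := ra_Ad_diff ax; apply.
Defined.

Definition nrad_incl (y : nrad_mod) : lie q_pair := vsproj q (vsval (y : subvs_of (nrad Q))).

Lemma nrad_inclE y : vsval (nrad_incl y) = vsval (y : subvs_of (nrad Q)).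
Proof. by rewrite vsprojK // nrad_parab // subvsP. Qed.

Lemma nrad_ce_data : ce_data nrad_incl.
Proof.
split.
- by move=> a x y; rewrite /nrad_incl !linearP.
- move=> y; apply: val_inj; rewrite /= -[vsval (nrad_incl y)]/(vsval _) nrad_inclE.
  by rewrite (ra_alt ax) linear0.
- move=> X y; apply: val_inj; have yu := subvsP (y : subvs_of (nrad Q)).
  have Xq := subvsP (X : subvs_of q).
  rewrite -[LHS]/(vsval _) -[RHS]/(vsval _) nrad_inclE /= nrad_inclE.
  by have b1 := br_nrad Xq yu; rewrite (vsprojK b1) (vsprojK (nrad_parab b1)).
- move=> k y Kk; apply: val_inj; have yu := subvsP (y : subvs_of (nrad Q)).
  rewrite -[LHS]/(vsval _) -[RHS]/(vsval _) nrad_inclE /= nrad_inclE.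
  by have b1 := Ad_nrad Kk yu; rewrite (vsprojK b1) (vsprojK (nrad_parab b1)).
Qed.

Lemma nrad_basis : exists (e : 'I_(\dim (nrad Q)) -> nrad_mod)
    (l : 'I_(\dim (nrad Q)) -> nrad_mod -> R[i]^o),
  (forall i, linear (l i)) /\ forall x, x = \sum_i l i x *: e i.
Proof.
exists (fun i => vsproj (nrad Q) (vbasis (nrad Q))`_i),
  (fun i x => coord (vbasis (nrad Q)) i (vsval (x : subvs_of (nrad Q)))).
split=> [i a x y|x]; first by rewrite !linearP.
have {1}-> : x = vsproj (nrad Q) (vsval (x : subvs_of (nrad Q))) by rewrite vsvalK.
rewrite {1}(coord_vbasis (subvsP (x : subvs_of (nrad Q)))) linear_sum.
by apply: eq_bigr => i _; rewrite linearZ.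
Qed.

Lemma nrad_findim : findim nrad_mod.
Proof. by have [e [l h]] := nrad_basis; exists (\dim (nrad Q)), e, l. Qed.

Lemma nrad_mod_nilpotent : exists N, forall s, size s = N -> forall y : nrad_mod,
  foldl (fun w (z : nrad_mod) => gk_lie (nrad_incl z) w) y s = 0.
Proof.
have [N hN] := nrad_nilpotent Q; exists N => s ss y.
pose v (z : nrad_mod) : g := vsval (z : subvs_of (nrad Q)).
have e : v (foldl (fun w (z : nrad_mod) => gk_lie (nrad_incl z) w) y s) =
    foldl (fun w z => br z w) (v y) [seq v z | z <- s].
  elim: s y {ss} => //= z s IH y; rewrite IH; congr foldl.
  rewrite /v /= -[vsval (vsproj q _)]/(vsval (nrad_incl z)) nrad_inclE vsprojK //.
  by apply: br_nrad; rewrite ?nrad_parab ?subvsP.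
apply: val_inj; rewrite -[LHS]/(v _) e hN ?size_map ?linear0 //.
by move=> z /mapP[w _ ->]; exact: subvsP.
Qed.

End ParabolicPair.

Section Inclusion.
Variables (R : realType) (P' P : reductive_pair R) (i : pair_map P' P).
Hypothesis hi : inclusion i.
Variables (Q' : germane_parabolic P') (Q : germane_parabolic P).
Hypothesis hQ : parabolic_inclusion i Q' Q.

Lemma incl_1 : pm_grp i 1%:M = 1%:M.
Proof.
have g := grp_group P; have g' := grp_group P'; have k1 := in_grp hi (gg_1 g').
have u := gg_unit g k1.
apply: (can_inj (mulmxK u)); rewrite mul1mx -(in_grpM hi) ?mul1mx //; exact: gg_1.
Qed.

Lemma incl_ok : pm_ok i.
Proof.
case: hi => h1 h2 h3 h4 h5 h6 h7 h8 h9 h10 h11 h12 h13.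
by split=> //; exact: incl_1.
Qed.

Lemma levi_cont : {within levi_grp Q', continuous (pm_grp i)}.
Proof. by apply: continuous_subspaceW (in_grp_cont hi) => k []. Qed.

Definition q_map : pair_map (q_pair Q') (q_pair Q) :=
  @PairMap R (q_pair Q') (q_pair Q)
    (fun X => vsproj (parab Q) (pm_lie i (vsval X))) (pm_grp i).

Lemma q_map_ok : pm_ok q_map.
Proof.
have pq X : vsval (X : subvs_of (parab Q')) \in parab Q' by exact: subvsP.
have lin := in_lie_linear hi.
split.
- move=> a X Y; rewrite -[LHS]/(vsproj _ (pm_lie i (vsval (a *: (X : subvs_of (parab Q')) + Y)))).
  by rewrite linearP (linD lin) (linZ lin) linearP.
- move=> X Y; apply: val_inj.
  by rewrite /= !vsprojK ?parab_br ?(pi_parab hQ) ?parab_br // (in_lie_br hi).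
- exact: (pi_levi_grp hQ).
- exact: incl_1.
- by move=> k l /levi_grp_grp Kk /levi_grp_grp Kl; exact: (in_grpM hi).
- exact: levi_cont.
- move=> k X Kk; apply: val_inj; have Kk' := pi_levi_grp hQ Kk.
  by rewrite /= !vsprojK ?Ad_parab ?(pi_parab hQ) ?Ad_parab // (in_Ad hi _ (levi_grp_grp Kk)).
- move=> c X hc; have [Y hY eY] := in_diff hi (levi_one_param hc).
  exists Y; last first.
    rewrite /= [vsval (vsproj _ _)]vsprojK ?eY // levi_parab //.
    exact: levi_one_param_kemb hc.
  case: hY hc => _ h1 h2 [h3 _ _]; split=> // t.
  exact/(pi_levi_grp hQ)/h3.
Qed.

Lemma levi_map_ok : pm_ok (levi_map i Q' Q).
Proof.
have pq X : vsval (X : subvs_of (levi Q')) \in levi Q' by exact: subvsP.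
have lin := in_lie_linear hi.
split.
- move=> a X Y; rewrite -[LHS]/(vsproj _ (pm_lie i (vsval (a *: (X : subvs_of (levi Q')) + Y)))).
  by rewrite linearP (linD lin) (linZ lin) linearP.
- move=> X Y; apply: val_inj.
  by rewrite /= !vsprojK ?levi_br ?(pi_levi hQ) ?levi_br // (in_lie_br hi).
- exact: (pi_levi_grp hQ).
- exact: incl_1.
- by move=> k l /levi_grp_grp Kk /levi_grp_grp Kl; exact: (in_grpM hi).
- exact: levi_cont.
- move=> k X Kk; apply: val_inj; have Kk' := pi_levi_grp hQ Kk.
  by rewrite /= !vsprojK ?Ad_levi ?(pi_levi hQ) ?Ad_levi // (in_Ad hi _ (levi_grp_grp Kk)).
- move=> c X hc; have [Y hY eY] := in_diff hi (levi_one_param hc).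
  exists Y; last first.
    rewrite /= [vsval (vsproj _ _)]vsprojK ?eY //.
    exact: levi_one_param_kemb hc.
  case: hY hc => _ h1 h2 [h3 _ _]; split=> // t.
  exact/(pi_levi_grp hQ)/h3.
Qed.

End Inclusion.

(** * Euler characteristics *)

Section FunctionForms.
Variables (R : realType) (P : gk_pair R) (hP : gk_group P).

Definition fact (b M : gkmod P) q k (f : ('I_q -> b) -> M) : ('I_q -> b) -> M :=
  fun x => gk_act k (f (fun s => gk_act (invmx k) (x s))).

Definition flie (b M : gkmod P) q X (f : ('I_q -> b) -> M) : ('I_q -> b) -> M :=
  fun x => gk_lie X (f x) - \sum_s f (updb x s (gk_lie X (x s))).

Definition is_altf (b M : gkmod P) q (T : gkmod P) (j : T -> ('I_q -> b) -> M) : Prop :=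
  [/\ forall a u v x, j (a *: u + v) x = a *: j u x + j v x,
      injective j,
      forall f, altb f <-> exists u, f = j u,
      forall k u, grp k -> j (gk_act k u) = fact k (j u)
    & forall X u, j (gk_lie X u) = flie X (j u)].

(** [ML], and with it [is_altmod], depends on the proofs [hP] and [fb]. The description by functions
    on argument lists does not, so restriction to another pair and change of [b] pass through it. *)
Lemma altmodP (b : gkmod P) (fb : findim b) (M : gkmod P) q T :
  is_altmod hP fb M q T <-> exists j, @is_altf b M q T j.
Proof.
have [aS0 aS] := @alt_subspace _ _ hP _ fb M q.
split=> [[p hp]|[j [j_lin j_inj j_alt j_act j_lie]]].
  have [p_lin p_surj p_ker p_act p_lie] := hp.
  have /choice[s sP] : forall u, exists F, alt F /\ p F = u.
    by move=> u; have [F hF <-] := p_surj u; exists F.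
  have sE F : alt F -> s (p F) = F.
    by move=> hF; have [h1 h2] := sP (p F); exact: (alt_projP hp).
  exists (fun u => ev (s u)); split.
  - move=> a u v x; rewrite -ev_linear; congr (ev _ x).
    have [hu eu] := sP u; have [hv ev'] := sP v.
    by rewrite -{1}eu -{1}ev' -p_lin // sE //; exact: aS.
  - move=> u v e; have [_ <-] := sP u; have [_ <-] := sP v; congr p.
    exact: (can_inj (@evK _ _ hP _ fb M q)).
  - move=> f; split=> [hf|[u ->]]; last by apply: alt_altb; have [] := sP u.
    have hF : alt (cur hP fb f) by apply: altb_alt; rewrite curK.
    by exists (p (cur hP fb f)); rewrite sE // curK.
  - move=> k u Kk; have [hu eu] := sP u; apply/funext => x.
    rewrite -{1}eu -p_act // sE ?ev_act //; exact: alt_act.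
  - move=> X u; have [hu eu] := sP u; apply/funext => x.
    rewrite -{1}eu -p_lie // sE ?ev_lie //; exact: alt_lie.
have /choice[p0 p0P] : forall F : ML hP fb M q, exists u, alt F -> ev F = j u.
  move=> F; have [hF|hF] := pselect (alt F); last by exists 0.
  by have [u hu] := (j_alt (ev F)).1 (alt_altb hF); exists u.
exists p0; split.
- move=> a F G hF hG; apply: j_inj; apply/funext => x.
  by rewrite j_lin -!p0P ?ev_linear //; exact: aS.
- move=> u; exists (cur hP fb (j u)).
    by apply: altb_alt; rewrite curK; apply/j_alt; exists u.
  apply: j_inj; rewrite -p0P ?curK //.
  by apply: altb_alt; rewrite curK; apply/j_alt; exists u.
- have j0 : j 0 = fun=> 0.
    apply/funext => x; have := j_lin (-1) 0 0 x.
    by rewrite scaler0 addr0 scaleN1r addNr.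
  move=> F hF; split=> [e|->].
    apply: (can_inj (@evK _ _ hP _ fb M q)); rewrite p0P // e j0.
    by rewrite (lin0 (@ev_lin _ _ hP _ fb M q)).
  by apply: j_inj; rewrite -p0P // (lin0 (@ev_lin _ _ hP _ fb M q)) j0.
- move=> k F Kk hF; apply: j_inj; rewrite j_act // -!p0P //.
    by apply/funext => x; rewrite ev_act.
  exact: alt_act.
- move=> X F hF; apply: j_inj; rewrite j_lie // -!p0P //.
    by apply/funext => x; rewrite ev_lie.
  exact: alt_lie.
Qed.

Section Cohomology.
Variables (b : gkmod P) (fb : findim b) (iota : b -> lie P) (hi : ce_data iota).

Definition cocf (M : gkmod P) q (f : ('I_q -> b) -> M) : Prop :=
  altb f /\ ced iota f = fun=> 0.

Definition cobf (M : gkmod P) q : (('I_q -> b) -> M) -> Prop :=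
  match q with
  | 0 => fun f => f = (fun=> 0)
  | p.+1 => fun f => exists2 g : ('I_p -> b) -> M, altb g & f = ced iota g
  end.

Definition is_cohf (M : gkmod P) q (H : gkmod P) : Prop :=
  exists p : (('I_q -> b) -> M) -> H,
  [/\ forall a f g, cocf f -> cocf g -> p (fun x => a *: f x + g x) = a *: p f + p g,
      forall h, exists2 f, cocf f & p f = h,
      forall f, cocf f -> (p f = 0 <-> cobf f),
      forall k f, grp k -> cocf f -> p (fact k f) = gk_act k (p f)
    & forall X f, cocf f -> p (flie X f) = gk_lie X (p f)].

Lemma ev_fact (M : gkmod P) q k (F : ML hP fb M q) : ev (am_act _ k F) = fact k (ev F).
Proof. by apply/funext => x; rewrite ev_act. Qed.

Lemma ev_flie (M : gkmod P) q X (F : ML hP fb M q) : ev (am_lie _ X F) = flie X (ev F).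
Proof. by apply/funext => x; rewrite ev_lie. Qed.

Lemma ev0 (M : gkmod P) q : ev (0 : ML hP fb M q) = fun=> 0.
Proof. exact: (lin0 (@ev_lin _ _ hP _ fb M q)). Qed.

Lemma ev_inj (M : gkmod P) q : injective (@ev _ _ hP _ fb M q).
Proof. exact: (can_inj (@evK _ _ hP _ fb M q)). Qed.

Lemma cocyc_ev (M : gkmod P) q (F : ML hP fb M q) : cocyc iota F <-> cocf (ev F).
Proof.
have [i1 i2 i3 i4] := hi.
split=> [[hF cF]|[hF cF]].
  by split; [exact: alt_altb | rewrite -ev_ce // cF ev0].
have aF := altb_alt hF; split=> //; apply: ev_inj.
by rewrite ev_ce // cF ev0.
Qed.

Lemma cobord_ev (M : gkmod P) q (F : ML hP fb M q) : cobord iota F <-> cobf (ev F).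
Proof.
have [i1 i2 i3 i4] := hi.
case: q F => [|q] F /=.
  split=> [->//|e].
  by have := congr1 (fun f => f (fun i : 'I_0 => 0)) e.
split=> [[G aG ->]|[g ag e]].
  by exists (ev G); [exact: alt_altb | rewrite -ev_ce].
exists (cur hP fb g); first by apply: altb_alt; rewrite curK.
have aG : alt (cur hP fb g) by apply: altb_alt; rewrite curK.
by apply: (@ev_inj M q.+1); rewrite ev_ce // curK.
Qed.

Lemma coh_fun (M : gkmod P) q H : is_coh hP fb iota M q H <-> is_cohf M q H.
Proof.
split=> [[p [p_lin p_surj p_ker p_act p_lie]]|[p [p_lin p_surj p_ker p_act p_lie]]].
  have ce (f : ('I_q -> b) -> M) : cocf f -> cocyc iota (cur hP fb f) by move=> h; apply/cocyc_ev; rewrite curK.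
  exists (p \o cur hP fb (q := q)); split=> /=.
  - move=> a f g hf hg; rewrite -p_lin; [|exact: ce|exact: ce]; congr p.
    by apply: ev_inj; rewrite curK; apply/funext => x; rewrite ev_linear !curK.
  - move=> h; have [F hF <-] := p_surj h; exists (ev F); first exact/cocyc_ev.
    by rewrite evK.
  - move=> f hf; rewrite (p_ker _ (ce _ hf)); rewrite -{2}[f](curK hP fb).
    exact: cobord_ev.
  - move=> k f Kk hf; rewrite -p_act //; last exact: ce.
    by congr p; apply: ev_inj; rewrite ev_fact !curK.
  - move=> X f hf; rewrite -p_lie //; last exact: ce.
    by congr p; apply: ev_inj; rewrite ev_flie !curK.
exists (p \o ev (q := q)); split=> /=.
- move=> a F G hF hG; rewrite -p_lin; [|exact/cocyc_ev|exact/cocyc_ev].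
  by congr p; apply/funext => x; rewrite ev_linear.
- move=> h; have [f hf <-] := p_surj h; exists (cur hP fb f); last by rewrite curK.
  by apply/cocyc_ev; rewrite curK.
- move=> F hF; rewrite p_ker; [|exact/cocyc_ev].
  by apply: iff_sym; exact: cobord_ev.
- by move=> k F Kk hF; rewrite ev_fact p_act //; apply/cocyc_ev.
- by move=> X F hF; rewrite ev_flie p_lie //; apply/cocyc_ev.
Qed.

End Cohomology.

End FunctionForms.

Section EulerCharacteristic.
Variables (R : realType) (P : gk_pair R) (hP : gk_group P).
Variables (b : gkmod P) (fb : findim b) (iota : b -> lie P) (hi : ce_data iota).
Variables (d : nat) (e : 'I_d -> b) (l : 'I_d -> b -> R[i]^o).
Hypothesis l_lin : forall i, linear (l i).
Hypothesis le : forall x, x = \sum_i l i x *: e i.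
Variable C : gkmod P -> Prop.
Hypothesis hC : full_abelian C.

Local Notation coh := (is_coh hP fb iota).
Local Notation ML := (ML hP fb).

(** The Euler characteristic of M as a relation: it is defined when all the cohomology has finite
    filtrations with subquotients in [C], and quantifying over all models of the cohomology avoids
    choosing one. *)
Definition chi (M : gkmod P) (a : Kgroup C) : Prop :=
  exists h : nat -> Kgroup C, (forall q H, coh M q H -> Eu H (h q)) /\ a = alt_sum d h.

Lemma chi_uniq M a a' : chi M a -> chi M a' -> a = a'.
Proof.
move=> [h [hh ->]] [h' [hh' ->]]; apply: eq_alt_sum => q _.
have [H hH] := coh_exists hP fb hi M q.
exact: (Eu_uniq hP hC (hh q H hH) (hh' q H hH)).
Qed.

Lemma chi_family M : exists (H : nat -> gkmod P) (p : forall q, ML M q -> H q),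
  forall q, coh_proj iota (@p q).
Proof.
have [H hH] := choice (fun q => coh_exists hP fb hi M q).
by have [p hp] := dchoice hH; exists H, p.
Qed.

Lemma chi_intro M (H : nat -> gkmod P) h : (forall q, coh M q (H q)) ->
  (forall q, Eu (H q) (h q)) -> chi M (alt_sum d h).
Proof.
move=> hH hh; exists h; split=> // q H' hH'.
exact: Eu_iso (coh_iso hi (hH q) hH') (hh q).
Qed.

Section ShortExact.
Variables M' M M'' : gkmod P.
Hypothesis ses : short_exact M' M M''.

(** The long exact sequence, cut off in degree [d + 1], where alternating forms on a space spanned
    by [d] vectors vanish. *)
Lemma chi_middle a c : chi M' a -> chi M'' c -> chi M (ab_add a c).
Proof.
move=> [x [hx ->]] [z [hz ->]].
have [i [p [[i_hom p_hom] i_inj p_surj ex]]] := ses.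
have [H' [p' hp']] := chi_family M'; have [H [p0 hp]] := chi_family M.
have [H'' [p'' hp'']] := chi_family M''.
have [f [g [k [[f_hom g_hom k_hom] exY exZ exX f0]]]] :=
  long_exact hi i_hom p_hom i_inj p_surj ex hp' hp hp''.
have H'd : forall y : H' d.+1, y = 0.
  by apply: (coh_vanish hi l_lin le (ltnSn d)); exists (@p' d.+1); exact: hp'.
have [||y hy <-] := les_middle hP hC f_hom g_hom k_hom exY exZ exX f0 H'd (x := x) (z := z).
- by move=> n; apply: hx; exists (@p' n); exact: hp'.
- by move=> n; apply: hz; exists (@p'' n); exact: hp''.
by apply: chi_intro hy => q; exists (@p0 q); exact: hp.
Qed.

Lemma chi_right a c : chi M' a -> chi M c -> exists2 z, chi M'' z & c = ab_add a z.
Proof.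
move=> [x [hx ->]] [y [hy ->]].
have [i [p [[i_hom p_hom] i_inj p_surj ex]]] := ses.
have [H' [p' hp']] := chi_family M'; have [H [p0 hp]] := chi_family M.
have [H'' [p'' hp'']] := chi_family M''.
have [f [g [k [[f_hom g_hom k_hom] exY exZ exX f0]]]] :=
  long_exact hi i_hom p_hom i_inj p_surj ex hp' hp hp''.
have H'd : forall y : H' d.+1, y = 0.
  by apply: (coh_vanish hi l_lin le (ltnSn d)); exists (@p' d.+1); exact: hp'.
have [||z hz ->] := les_right hP hC f_hom g_hom k_hom exY exZ exX f0 H'd (x := x) (y := y).
- by move=> n; apply: hx; exists (@p' n); exact: hp'.
- by move=> n; apply: hy; exists (@p0 n); exact: hp.
by exists (alt_sum d z) => //; apply: chi_intro hz => q; exists (@p'' q); exact: hp''.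
Qed.

End ShortExact.

Lemma chi_zero (M : gkmod P) : (forall x : M, x = 0) -> chi M ab_zero.
Proof.
move=> M0; have [H [p hp]] := chi_family M.
have -> : ab_zero = alt_sum d (fun=> ab_zero : Kgroup C).
  by rewrite /alt_sum big1 // => q _; exact: ab_mulz_sign0.
apply: (@chi_intro M H) => q; first by exists (@p q).
apply: Eu_zero => x; have [p_lin p_surj p_ker _ _] := hp q.
have [F hF <-] := p_surj x; apply/p_ker => //.
suff -> : F = 0 by have [[]] := @cobordS _ _ hP _ fb _ hi M q.
apply: (can_inj (@evK _ _ hP _ fb M q)); apply/funext => y.
by rewrite [LHS]M0 [RHS]M0.
Qed.

Lemma alt_section (M T : gkmod P) q (p : ML M q -> T) : alt_proj p ->
  exists s : T -> ML M q, [/\ linear s, forall u, alt (s u), cancel s p,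
    forall F, alt F -> s (p F) = F
    & (forall k u, grp k -> s (gk_act k u) = am_act _ k (s u)) /\
      (forall X u, s (gk_lie X u) = am_lie _ X (s u))].
Proof.
move=> hp; have [p_lin p_surj p_ker p_act p_lie] := hp.
have /choice[s sP] : forall u, exists F, alt F /\ p F = u.
  by move=> u; have [F hF <-] := p_surj u; exists F.
have sA u : alt (s u) by have [] := sP u.
have sK u : p (s u) = u by have [] := sP u.
have sE F : alt F -> s (p F) = F by move=> hF; exact: (alt_projP hp).
have [_ aS] := @alt_subspace _ _ hP _ fb M q.
exists s; split=> //.
  by move=> a u v; rewrite -{1}(sK u) -{1}(sK v) -p_lin // sE //; exact: aS.
split=> [k u Kk|X u].
  by rewrite -{1}(sK u) -p_act // sE //; exact: alt_act.
by rewrite -{1}(sK u) -p_lie // sE //; exact: alt_lie.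
Qed.

(* The terms of the complex of a module in [C] lie in [C], so that its
   cohomology does as well, with the same alternating sum. *)
Lemma chi_complex N : (forall q T, is_altmod hP fb N q T -> C T) ->
  chi N (alt_sum d (fun q => cls_of C (is_altmod hP fb N q))).
Proof.
move=> clo; have [T hT] := choice (altmod_exists hP fb N).
have [p hp] := dchoice hT.
have [s hs] := dchoice (fun q => alt_section (hp q)).
have [i1 i2 i3 i4] := hi.
pose D q (u : T q) : T q.+1 := p q.+1 (ce iota (s q u)).
have aD q u : alt (ce iota (s q u)).
  by apply: alt_ce => //; have [_ h _ _ _] := hs q; exact: h.
have D_hom q : gk_hom (@D q).
  have [s_lin sA sK sE [s_act s_lie]] := hs q.
  have [p_lin _ _ p_act p_lie] := hp q.+1.
  split=> [a u v|k u Kk|X u]; rewrite /D.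
  - by rewrite s_lin ce_linear p_lin.
  - by rewrite s_act // ce_act // p_act.
  - by rewrite s_lie // ce_lie // p_lie.
have kerD q u : kerp (@D q) u <-> cocyc iota (s q u).
  have [s_lin sA sK sE _] := hs q; have [p_lin _ p_ker _ _] := hp q.+1.
  rewrite /kerp /D p_ker //; split=> [h|[] //]; split=> //; exact: sA.
have imD q u : imp (@D q) u <-> cobord iota (s q.+1 u).
  have [s_lin sA sK sE _] := hs q; have [s_lin' sA' sK' sE' _] := hs q.+1.
  split=> [[v _ ->]|[F hF e0]].
    by rewrite /D sE' //; exists (s q v).
  by exists (p q F) => //; rewrite /D sE // -e0 sK'.
have CT q : C (T q) by exact: clo (hT q).
have /choice[k0 H0] q := CS_map hP hC (@D_hom q) (CT q) (CT q.+1).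
have /choice[k1 H1] q := H0 q.
have /choice[k2 {H0}H] q := H1 q.
have DD q u : D q.+1 (D q u) = 0.
  apply/kerD; apply: cobord_cocyc => //; apply/imD; by exists u.
have /choice[hc Hc] : forall q, exists h, CS (kerp (@D q.+1)) (imp (@D q)) h /\
    k0 q.+1 = ab_add (k1 q) h.
  move=> q; have [h1 _ _ _ _] := H q.+1; have [_ h2 _ _ _] := H q.
  have sub : forall x, imp (@D q) x -> kerp (@D q.+1) x.
    by move=> x [u _ ->]; exact: DD.
  by have [h hh eh] := CS_coker hP hC sub h1 h2; exists h.
(* [imp (@D q)] consists of the coboundaries in degree [q + 1], whence the shifts. In degree 0 there
   are none and the cohomology is the kernel. *)
pose h q := if q is q'.+1 then hc q' else k0 0%N.
pose bb q := if q is q'.+1 then k1 q' else ab_zero.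
rewrite (@alt_sum_telescope _ d _ k0 bb h) //.
- have [H' hH'] := choice (coh_exists hP fb hi N).
  apply: (@chi_intro N H') => // q.
  have [s_lin sA sK sE [s_act s_lie]] := hs q.
  have [p' hp'] := hH' q.
  have [U [sU US UE hU]] : exists U : T q -> Prop, [/\ submod U,
      forall u, U u -> kerp (@D q) u, forall u, U u <-> cobord iota (s q u)
      & CS (kerp (@D q)) U (h q)].
    case: q s_lin sA sK sE s_act s_lie p' hp' => [|q] s_lin sA sK sE s_act s_lie p' hp'.
      exists (@zerop _ _ (T 0%N)); split.
      + exact: submod0.
      + by move=> u ->; exact: (lin0 (hom_lin (@D_hom 0))).
      + move=> u; split=> [->|su]; first exact: (lin0 s_lin).
        rewrite /zerop -[u]sK su.
        exact: (sq_proj0 (@alt_subspace _ _ hP _ fb N 0) (hp 0%N)).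
      + by have [h1 _ _ _ _] := H 0%N.
    exists (imp (@D q)); split=> //.
    + exact: submod_imp.
    + by move=> u [v _ ->]; exact: DD.
    + by have [] := Hc q.
  have [sS _ _ [Q [pQ [hQ CQ ->]]]] := hU.
  apply: (@Eu_iso _ _ _ Q); last exact: (Eu_cat hP CQ).
  have iso := @sq_iso R P (gk_ambient (T q)) (ML N q) (kerp (@D q)) U
    (fun F => cocyc iota F) (fun F => cobord iota F) Q (H' q) pQ p' (s q) sS
    (cocycS hP fb hi N q) hQ hp' s_lin (fun x => (kerD q x).1)
    (fun k x Kk _ => s_act k x Kk) (fun X x _ => s_lie X x) (fun x _ => UE x).
  apply: iso.
  + move=> F hF; exists (p q F); first by apply/kerD; rewrite sE //; case: hF.
    rewrite sE; last by case: hF.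
    by rewrite subrr; have [[]] := @cobordS _ _ hP _ fb _ hi N q.
- move=> q; have [_ _ _ eq _] := H q; rewrite -[bb q.+1]/(k1 q) -eq.
  by apply: (cls_of_eq hP hC) => // V W hV hW; exact: altmod_iso hV hW.
- by case=> [|q]; rewrite /bb /h ?ab_add0 //; have [] := Hc q.
have [_ h1 _ _ _] := H d; apply: (EuS_zero_uniq hC (CS_EuS hP h1)) => u _.
have [_ sA sK _ _] := hs d.+1.
rewrite /zerop -[u]sK (alt_vanish le (ltnSn d) (sA u)).
have [p_lin _ p_ker _ _] := hp d.+1; apply/p_ker => //.
by have [] := @alt_subspace _ _ hP _ fb N d.+1.
Qed.

End EulerCharacteristic.

(** * Modules of homomorphisms *)

Section FiniteDimensional.
Variables (F : fieldType).

(** In coordinates the image of [f] is the row space of some [A], and [pinvmx A *m A] is a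
    projection onto it. *)
Lemma findim_retract (D' D : lmodType F) (f : D' -> D) : findim D -> linear f ->
  injective f -> exists r : D -> D', linear r /\ cancel f r.
Proof.
move=> [d [e [l [l_lin le]]]] f_lin f_inj.
pose psi x : 'rV[F]_d := \row_i l i x.
have psi_lin : linear psi.
  by move=> a x y; apply/rowP => i; rewrite !mxE (linD (l_lin i)) (linZ (l_lin i)).
have psi_inj x y : psi x = psi y -> x = y.
  move=> /rowP h; rewrite (le x) (le y); apply: eq_bigr => i _.
  by have := h i; rewrite !mxE => ->.
have [A hA] : exists A : 'M[F]_d, forall v, (exists x, v = psi (f x)) <-> (v <= A)%MS.
  apply: subspace_matrix; split; first by exists 0; rewrite (lin0 f_lin) (lin0 psi_lin).
  by move=> a _ _ [x ->] [y ->]; exists (a *: x + y); rewrite f_lin psi_lin.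
have /choice[r rP] : forall v, exists x, psi (f x) = psi v *m pinvmx A *m A.
  by move=> v; have [x ->] := (hA _).2 (submxMl (psi v *m pinvmx A) A); exists x.
exists r; split=> [a x y|x].
  apply/f_inj/psi_inj; rewrite rP f_lin !psi_lin !rP.
  by rewrite !mulmxDl -!scalemxAl.
apply/f_inj/psi_inj; rewrite rP mulmxKpV //; apply/hA; by exists x.
Qed.

Lemma findim_sub (D' D : lmodType F) (f : D' -> D) : findim D -> linear f ->
  injective f -> findim D'.
Proof.
move=> fD f_lin f_inj; have [r [r_lin rK]] := findim_retract fD f_lin f_inj.
have [d [e [l [l_lin le]]]] := fD.
exists d, (r \o e), (fun i x => l i (f x)); split=> [i a x y|x].
  by rewrite f_lin l_lin.
rewrite -{1}(rK x) {1}(le (f x)) (lin_sum r_lin); apply: eq_bigr => i _.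
by rewrite (linZ r_lin).
Qed.

Lemma findim_section (D' D D'' : lmodType F) (f : D' -> D) (p : D -> D'') :
  findim D -> linear f -> linear p -> injective f ->
  (forall w, exists v, p v = w) -> (forall v, p v = 0 <-> exists v', v = f v') ->
  exists r s, [/\ linear r, linear s, cancel f r, cancel s p
    & forall v, s (p v) = v - f (r v)].
Proof.
move=> fD f_lin p_lin f_inj p_surj ex.
have [r [r_lin rK]] := findim_retract fD f_lin f_inj.
have [s0 s0P] := choice p_surj.
pose s w := s0 w - f (r (s0 w)).
have sP v : s (p v) = v - f (r v).
  have [x e] : exists x, s0 (p v) - v = f x by apply/ex; rewrite (linB p_lin) s0P subrr.
  rewrite /s; have -> : s0 (p v) = v + f x by rewrite -e addrC subrK.
  by rewrite (linD r_lin) rK (linD f_lin) opprD addrA [v + f x - _]addrAC addrK.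
exists r, s; split=> //.
  move=> a x y; have [v <-] := p_surj x; have [w <-] := p_surj y.
  rewrite -p_lin !sP r_lin f_lin scalerBr opprD addrACA //.
move=> w; have [v <-] := p_surj w.
have pf x : p (f x) = 0 by apply/ex; exists x.
by rewrite sP (linB p_lin) pf subr0.
Qed.

Lemma findim_quot (D' D D'' : lmodType F) (f : D' -> D) (p : D -> D'') :
  findim D -> linear f -> linear p -> injective f ->
  (forall w, exists v, p v = w) -> (forall v, p v = 0 <-> exists v', v = f v') ->
  findim D''.
Proof.
move=> fD f_lin p_lin f_inj p_surj ex.
have [r [s [r_lin s_lin rK sK _]]] := findim_section fD f_lin p_lin f_inj p_surj ex.
have [d [e [l [l_lin le]]]] := fD.
exists d, (p \o e), (fun i x => l i (s x)); split=> [i a x y|x].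
  by rewrite s_lin l_lin.
rewrite -{1}(sK x) {1}(le (s x)) (lin_sum p_lin); apply: eq_bigr => i _.
by rewrite (linZ p_lin).
Qed.

End FiniteDimensional.

Section HomModules.
Variables (R : realType) (P : gk_pair R) (hP : gk_group P).
Implicit Types D V X : gkmod P.

Definition is_hommod D V X (j : X -> D -> V) : Prop :=
  [/\ forall a x y v, j (a *: x + y) v = a *: j x v + j y v, injective j,
      forall f : D -> V, linear f <-> exists x, f = j x,
      forall k x v, grp k -> j (gk_act k x) v = gk_act k (j x (gk_act (invmx k) v))
    & forall A x v, j (gk_lie A x) v = gk_lie A (j x v) - j x (gk_lie A v)].

Definition is_homm D V X : Prop := exists j, @is_hommod D V X j.

(** Linear maps are alternating forms of degree one, so existence, uniqueness and exactness are
    inherited from the modules of forms. *)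
Lemma homm_altf D V X (j : X -> D -> V) : is_hommod j ->
  is_altf (fun x (f : 'I_1 -> D) => j x (f ord0)).
Proof.
move=> [j_lin j_inj j_im j_act j_lie].
have lj x : linear (j x) by apply/j_im; exists x.
split.
- by move=> a u v x; rewrite j_lin.
- move=> u v e; apply/j_inj/funext => w.
  exact: (congr1 (fun h => h (fun=> w)) e).
- move=> f; split=> [[f1 f2]|[u ->]].
    have : linear (fun w => f (fun=> w)).
      move=> a y z; have := f1 (fun=> 0) ord0 a y z.
      have e w : updb (fun=> 0) ord0 w = (fun=> w) :> ('I_1 -> D).
        by apply/funext => i; rewrite /updb (ord1 i).
      by rewrite !e.
    move=> /j_im[u e]; exists u; apply/funext => x.
    rewrite -[RHS]/(j u (x ord0)) -e; congr f; apply/funext => i.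
    by rewrite (ord1 i).
  split=> [x i a y z|x i i']; first by rewrite (ord1 i) /updb eqxx lj.
  by rewrite (ord1 i) (ord1 i') eqxx.
- by move=> k u Kk; apply/funext => x; rewrite j_act.
- move=> A u; apply/funext => x; rewrite j_lie /flie big_ord_recl big_ord0 addr0.
  by rewrite /updb eqxx.
Qed.

Lemma altf_homm D V X (j : X -> ('I_1 -> D) -> V) : is_altf j ->
  is_hommod (fun x v => j x (fun=> v)).
Proof.
move=> [j_lin j_inj j_im j_act j_lie].
have cst (x : 'I_1 -> D) : x = fun=> x ord0 by apply/funext => i; rewrite (ord1 i).
split.
- by move=> a x y v; rewrite j_lin.
- move=> u v e; apply/j_inj/funext => x; rewrite (cst x).
  exact: (congr1 (fun h => h (x ord0)) e).
- move=> f; split=> [f_lin|[u ->]].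
    have : altb (fun x : 'I_1 -> D => f (x ord0)).
      split=> [x i a y z|x i i']; first by rewrite (ord1 i) /updb eqxx f_lin.
      by rewrite (ord1 i) (ord1 i') eqxx.
    by move=> /j_im[u e]; exists u; rewrite -e.
  have [h _] := (j_im (j u)).2 (ex_intro _ u erefl).
  move=> a y z; have := h (fun=> 0) ord0 a y z.
  have e w : updb (fun=> 0) ord0 w = (fun=> w) :> ('I_1 -> D).
    by apply/funext => i; rewrite /updb (ord1 i).
  by rewrite !e.
- by move=> k x v Kk; rewrite j_act.
- move=> A x v; rewrite j_lie /flie big_ord_recl big_ord0 addr0; congr (_ - j x _).
  by apply/funext => i; rewrite /updb (ord1 i).
Qed.

Lemma homm_altmod D (fD : findim D) V X : is_homm D V X <-> is_altmod hP fD V 1 X.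
Proof.
rewrite altmodP; split=> [[j /homm_altf h]|[j /altf_homm h]]; first by eexists; exact: h.
by eexists; exact: h.
Qed.

Lemma homm_exists D (fD : findim D) V : exists X, is_homm D V X.
Proof.
by have [X hX] := altmod_exists hP fD V 1; exists X; apply/(homm_altmod fD).
Qed.

Lemma homm_iso D (fD : findim D) V X X' : is_homm D V X -> is_homm D V X' -> gk_iso X X'.
Proof. move=> /(homm_altmod fD) h /(homm_altmod fD) h'; exact: altmod_iso h h'. Qed.

Lemma homm_transport D V X X' : gk_iso X X' -> is_homm D V X -> is_homm D V X'.
Proof.
move=> [f [f_hom [g fK gK]]] [j [j_lin j_inj j_im j_act j_lie]].
have [g_lin g_act g_lie] := gk_hom_inv f_hom fK gK.
exists (j \o g); split=> /=.
- by move=> a x y v; rewrite g_lin j_lin.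
- by move=> x y /j_inj /(congr1 f); rewrite !gK.
- move=> h; rewrite j_im; split=> [[x ->]|[x ->]]; first by exists (f x); rewrite /= fK.
  by exists (g x).
- by move=> k x v Kk; rewrite g_act // j_act.
- by move=> A x v; rewrite g_lie j_lie.
Qed.

Lemma hommod_lin D V X (j : X -> D -> V) x : is_hommod j -> linear (j x).
Proof. by move=> [_ _ j_im _ _]; apply/j_im; exists x. Qed.

Lemma hommod0 D V X (j : X -> D -> V) v : is_hommod j -> j 0 v = 0.
Proof.
move=> [j_lin _ _ _ _]; have := j_lin (-1) 0 0 v.
by rewrite scaler0 addr0 scaleN1r addNr.
Qed.

Lemma homm_hom D V X (j : X -> D -> V) D' V' X' (j' : X' -> D' -> V')
    (Phi : (D -> V) -> D' -> V') : is_hommod j -> is_hommod j' ->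
  (forall x, linear (Phi (j x))) ->
  (forall a x y v, Phi (j (a *: x + y)) v = a *: Phi (j x) v + Phi (j y) v) ->
  (forall k x v, grp k ->
     Phi (j (gk_act k x)) v = gk_act k (Phi (j x) (gk_act (invmx k) v))) ->
  (forall A x v, Phi (j (gk_lie A x)) v = gk_lie A (Phi (j x) v) - Phi (j x) (gk_lie A v)) ->
  exists phi : X -> X', gk_hom phi /\ forall x, j' (phi x) = Phi (j x).
Proof.
move=> hj [j_lin j_inj j_im j_act j_lie] Plin PD Pact Plie.
have /choice[phi phiP] : forall x, exists x', j' x' = Phi (j x).
  by move=> x; have [x' ->] := (j_im _).1 (Plin x); exists x'.
exists phi; split=> //; split=> [a x y|k x Kk|A x]; apply/j_inj/funext => v.
- by rewrite j_lin !phiP PD.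
- by rewrite j_act // !phiP Pact.
- by rewrite j_lie !phiP Plie.
Qed.

Section Contravariant.
Variables (D' D D'' : gkmod P) (f : D' -> D) (p : D -> D'').
Hypotheses (fD : findim D) (f_hom : gk_hom f) (p_hom : gk_hom p) (f_inj : injective f)
  (p_surj : forall w, exists v, p v = w) (ex : forall v, p v = 0 <-> exists v', v = f v').
Variable V : gkmod P.
Variables (X'' X X' : gkmod P) (j'' : X'' -> D'' -> V) (j : X -> D -> V) (j' : X' -> D' -> V).
Hypotheses (h'' : is_hommod j'') (h : is_hommod j) (h' : is_hommod j').

Lemma homm_contra_exact : exists (i : X'' -> X) (g : X -> X'),
  [/\ gk_hom i /\ gk_hom g, injective i, forall w, exists v, g v = w,
      forall v, g v = 0 <-> exists v', v = i v'
    & forall x, (exists y, x = i y) <-> forall v, j x (f v) = 0].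
Proof.
have [f_lin f_act f_lie] := f_hom; have [p_lin p_act p_lie] := p_hom.
have [r [s [r_lin s_lin rK sK sp]]] := findim_section fD f_lin p_lin f_inj p_surj ex.
have [j''_lin j''_inj j''_im j''_act j''_lie] := h''.
have [j_lin j_inj j_im j_act j_lie] := h; have [j'_lin j'_inj j'_im j'_act j'_lie] := h'.
have [||||i [i_hom iE]] := @homm_hom _ _ _ j'' _ _ _ j (fun g v => g (p v)) h'' h.
- by move=> x a v w; rewrite p_lin (hommod_lin x h'').
- by move=> a x y v; rewrite j''_lin.
- by move=> k x v Kk; rewrite j''_act // p_act //; exact: (gg_V hP).
- by move=> A x v; rewrite j''_lie p_lie.
have [||||g [g_hom gE]] := @homm_hom _ _ _ j _ _ _ j' (fun g v => g (f v)) h h'.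
- by move=> x a v w; rewrite f_lin (hommod_lin x h).
- by move=> a x y v; rewrite j_lin.
- by move=> k x v Kk; rewrite j_act // f_act //; exact: (gg_V hP).
- by move=> A x v; rewrite j_lie f_lie.
have pf x : p (f x) = 0 by apply/ex; exists x.
have kerf x : (exists y, x = i y) <-> forall v, j x (f v) = 0.
  split=> [[y ->] v|jx]; first by rewrite iE pf (lin0 (hommod_lin y h'')).
  have jlin := hommod_lin x h.
  have /j''_im[y ey] : linear (fun w => j x (s w)) by move=> a v w; rewrite s_lin jlin.
  exists y; apply/j_inj; rewrite iE -ey; apply/funext => v.
  by rewrite sp (linB jlin) jx subr0.
exists i, g; split=> //.
- move=> x y e; apply/j''_inj/funext => w; have [v <-] := p_surj w.
  by have := congr1 (fun x => j x v) e; rewrite !iE.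
- move=> x'; have jlin := hommod_lin x' h'.
  have /j_im[x xe] : linear (fun v => j' x' (r v)) by move=> a v w; rewrite r_lin jlin.
  by exists x; apply/j'_inj; rewrite gE -xe; apply/funext => v; rewrite rK.
- move=> x; rewrite kerf; split=> [gx v|jx].
    by have := congr1 (fun x => j' x v) gx; rewrite gE (hommod0 _ h').
  apply/j'_inj; rewrite gE; apply/funext => v; by rewrite jx (hommod0 _ h').
Qed.

End Contravariant.

End HomModules.

Section Forms.
Variables (R : realType) (P : gk_pair R) (hP : gk_group P).
Variables (b : gkmod P) (fb : findim b) (iota : b -> lie P) (hi : ce_data iota).

Lemma altb_subspace (M : gkmod P) q :
  subspace_pred (fun f : ('I_q -> b) -> M => altb f).
Proof.
split=> [|a f g [f1 f2] [g1 g2]].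
  by split=> [x i a y z|//]; rewrite -[0 _]/(0 : M) scaler0 addr0.
split=> [x i c y z|x i j ij xx].
  rewrite -![(_ + _) _]/(a *: f _ + g _) f1 g1 !scalerDr !scalerA mulrC.
  by rewrite addrACA.
by rewrite -[LHS]/(a *: f x + g x) (f2 x i j) // (g2 x i j) // scaler0 addr0.
Qed.

Lemma ced_linear (M : gkmod P) q : linear (@ced R P b M iota q).
Proof.
move=> a f g; apply/funext => x; rewrite -[RHS]/(a *: ced iota f x + ced iota g x).
rewrite /ced scalerDr !scaler_sumr addrACA; congr (_ + _); rewrite -big_split.
  apply: eq_bigr => i _; rewrite -[(_ + _) _]/(a *: f _ + g _).
  rewrite (linD (gk_lie_linear _)) (linZ (gk_lie_linear _)) scalerDr !scalerA.
  by rewrite mulrC.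
apply: eq_bigr => i _; rewrite scaler_sumr -big_split; apply: eq_bigr => j _.
rewrite -[(_ + _) _]/(a *: f _ + g _) scalerDr !scalerA.
by rewrite mulrC.
Qed.

Lemma cocf_subspace (M : gkmod P) q :
  subspace_pred (fun f : ('I_q -> b) -> M => cocf iota f).
Proof.
have [aS0 aS] := altb_subspace M q.
split=> [|a f g [f1 f2] [g1 g2]]; split=> //.
- exact: (lin0 (@ced_linear M q)).
- exact: aS.
- rewrite ced_linear f2 g2; apply/funext => x.
  by rewrite -[LHS]/(a *: 0 + 0) scaler0 addr0.
Qed.

Lemma cocf_cur (M : gkmod P) q (f : ('I_q -> b) -> M) :
  cocf iota f -> cocyc iota (cur hP fb f).
Proof. by move=> h; apply/(cocyc_ev hi); rewrite curK. Qed.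

Lemma cocf_fact (M : gkmod P) q k (f : ('I_q -> b) -> M) : grp k ->
  cocf iota f -> cocf iota (fact k f).
Proof.
move=> Kk /cocf_cur hf; have [_ _ h _] := cocycS hP fb hi M q.
by have /(cocyc_ev hi) := h k _ Kk hf; rewrite ev_fact curK.
Qed.

Lemma cocf_flie (M : gkmod P) q X (f : ('I_q -> b) -> M) :
  cocf iota f -> cocf iota (flie X f).
Proof.
move=> /cocf_cur hf; have [_ _ _ h] := cocycS hP fb hi M q.
by have /(cocyc_ev hi) := h X _ hf; rewrite ev_flie curK.
Qed.

Lemma lin_sum_on (V W : lmodType R[i]) (S : V -> Prop) (p : V -> W) (I : Type)
    (r : seq I) (a : I -> R[i]) (v : I -> V) : subspace_pred S ->
  (forall a x y, S x -> S y -> p (a *: x + y) = a *: p x + p y) ->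
  (forall i, S (v i)) -> p (\sum_(i <- r) a i *: v i) = \sum_(i <- r) a i *: p (v i).
Proof.
move=> hS p_lin Sv; have S0 := subsp0 hS.
elim: r => [|i r IH].
  rewrite !big_nil; have := p_lin (-1) 0 0 S0 S0.
  by rewrite scaler0 addr0 scaleN1r addNr.
rewrite !big_cons p_lin ?IH //; apply: subsp_sum => // k _; exact: subspZ.
Qed.

Section TrivialCoefficients.
Variables (D V N X Y : gkmod P) (j : X -> D -> V) (j' : Y -> D -> N) (q : nat).
Hypotheses (D0 : forall y (v : D), gk_lie (iota y) v = 0) (fD : findim D).
Hypotheses (hj : is_hommod j) (hj' : is_hommod j') (hN : is_cohf iota V q N).

Let jv v : linear (j^~ v).
Proof. by case: hj => h _ _ _ _ a x y; exact: h. Qed.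

Let jl x : linear (j x) := hommod_lin x hj.

Let eps n (v : D) (f : ('I_n -> b) -> X) : ('I_n -> b) -> V := fun x => j (f x) v.

Let eps_altb n (f : ('I_n -> b) -> X) : altb f <-> forall v, altb (eps v f).
Proof.
have [_ j_inj _ _ _] := hj.
split=> [[f1 f2] v|h].
  split=> [x i a y z|x i i' ii xx]; first by rewrite /eps f1 (jv v).
  by rewrite /eps (f2 x i i') // (lin0 (jv v)).
split=> [x i a y z|x i i' ii xx]; apply/j_inj/funext => v; have [h1 h2] := h v.
  by rewrite (jv v); exact: h1.
by rewrite (lin0 (jv v)); exact: (h2 x i i').
Qed.

(** Evaluation at [v] commutes with the differential because the elements [iota y] kill [D]; the
    complex thus splits along coordinates of [D]. *)
Let eps_ced n v (f : ('I_n -> b) -> X) : ced iota (eps v f) = eps v (ced iota f).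
Proof.
have [_ _ _ _ j_lie] := hj.
apply/funext => x; rewrite /eps /ced (linD (jv v)) !(lin_sum (jv v)).
congr (_ + _); apply: eq_bigr => i _.
  by rewrite (linZ (jv v)) j_lie D0 (lin0 (jl _)) subr0.
by rewrite (lin_sum (jv v)); apply: eq_bigr => k _; rewrite (linZ (jv v)).
Qed.

Let eps_inj n (f g : ('I_n -> b) -> X) : (forall v, eps v f = eps v g) -> f = g.
Proof.
have [_ j_inj _ _ _] := hj.
move=> h; apply/funext => x; apply/j_inj/funext => v.
exact: (congr1 (fun f => f x) (h v)).
Qed.

Let eps_coc n (f : ('I_n -> b) -> X) : cocf iota f <-> forall v, cocf iota (eps v f).
Proof.
split=> [[f1 f2] v|h].
  split; first exact: (eps_altb f).1.
  by rewrite eps_ced f2; apply/funext => x; exact: (lin0 (jv v)).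
split; first by apply/eps_altb => v; have [] := h v.
apply: eps_inj => v; have [_] := h v; rewrite eps_ced => ->.
by apply/funext => x; rewrite /eps (lin0 (jv v)).
Qed.

Let eps_comb d (l : 'I_d -> D -> R[i]^o) n (G : 'I_d -> ('I_n -> b) -> V) :
  (forall i, linear (l i)) ->
  exists f : ('I_n -> b) -> X, forall v, eps v f = \sum_i (l i v : R[i]) *: G i.
Proof.
move=> l_lin; have [_ _ j_im _ _] := hj.
have /choice[f fP] : forall x, exists m, j m = fun v => \sum_i (l i v : R[i]) *: G i x.
  move=> x; have /j_im[m ->] : linear (fun v => \sum_i (l i v : R[i]) *: G i x).
    move=> a v w; rewrite scaler_sumr -big_split; apply: eq_bigr => i _.
    by rewrite l_lin scalerDl scalerA.
  by exists m.
exists f => v; apply/funext => x; rewrite /eps fP fct_sumE; exact: eq_bigr.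
Qed.

Let eps_expand d (e : 'I_d -> D) (l : 'I_d -> D -> R[i]^o) n (f : ('I_n -> b) -> X) v :
  (forall v, v = \sum_i l i v *: e i) ->
  eps v f = \sum_i (l i v : R[i]) *: eps (e i) f.
Proof.
move=> le; apply/funext => x; rewrite fct_sumE /eps {1}(le v) (lin_sum (jl _)).
by apply: eq_bigr => i _; rewrite (linZ (jl _)).
Qed.

Let eps_cob n (f : ('I_n -> b) -> X) : cobf iota f <-> forall v, cobf iota (eps v f).
Proof.
case: n f => [|n] f /=.
  split=> [-> v|h]; first by apply/funext => x; exact: (lin0 (jv v)).
  by apply: eps_inj => v; rewrite h; apply/funext => x; rewrite /eps (lin0 (jv v)).
split=> [[g ag ->] v|h].
  by exists (eps v g); [exact: (eps_altb g).1 | rewrite eps_ced].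
have [d [e [l [l_lin le]]]] := fD.
have /choice[g gP] : forall i, exists g : ('I_n -> b) -> V,
    altb g /\ eps (e i) f = ced iota g.
  by move=> i; have [g] := h (e i); exists g.
have [f0 f0E] := eps_comb g l_lin.
exists f0.
  apply/eps_altb => v; rewrite f0E; apply: (subsp_sum (altb_subspace V n)) => i _.
  by apply: (subspZ (altb_subspace V n)); have [] := gP i.
apply: eps_inj => v; rewrite -eps_ced f0E (eps_expand f v le).
rewrite (lin_sum (@ced_linear V n)); apply: eq_bigr => i _.
by rewrite (linZ (@ced_linear V n)); have [_ ->] := gP i.
Qed.

(** The cohomology of Hom(D, V) is Hom(D, H^q(V)): being closed or exact can be tested after
    evaluation at each vector of [D], and primitives chosen on a basis are recombined linearly. *)
Lemma cohf_hom_trivial : is_cohf iota X q Y.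
Proof.
have [p [p_lin p_surj p_ker p_act p_lie]] := hN.
have [_ j_inj j_im j_act j_lie] := hj.
have [j'_lin j'_inj j'_im j'_act j'_lie] := hj'.
have /choice[P0 P0E] : forall f : ('I_q -> b) -> X, exists y, cocf iota f ->
    forall v, j' y v = p (eps v f).
  move=> f; have [hf|hf] := pselect (cocf iota f); last by exists 0.
  have /j'_im[y ey] : linear (fun v => p (eps v f)).
    move=> a v w; have hv := (eps_coc f).1 hf.
    rewrite -p_lin //; congr p; apply/funext => x; exact: jl.
  by exists y => _ v; rewrite -ey.
exists P0; split.
- move=> a f g hf hg; apply/j'_inj/funext => v.
  have hfg : cocf iota (fun x => a *: f x + g x).
    by have [_ h] := cocf_subspace X q; exact: (h a f g).
  rewrite j'_lin !P0E // -p_lin; [|exact: (eps_coc f).1|exact: (eps_coc g).1].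
  by congr p; apply/funext => x; exact: jv.
- move=> y; have ly := hommod_lin y hj'.
  have [d [e [l [l_lin le]]]] := fD.
  have /choice[f fP] : forall i, exists f, cocf iota f /\ p f = j' y (e i).
    by move=> i; have [f] := p_surj (j' y (e i)); exists f.
  have cf i : cocf iota (f i) by have [] := fP i.
  have [f0 f0E] := eps_comb f l_lin.
  have cf0 : cocf iota f0.
    apply/eps_coc => v; rewrite f0E; apply: (subsp_sum (cocf_subspace V q)) => i _.
    exact: (subspZ (cocf_subspace V q)).
  exists f0 => //; apply/j'_inj/funext => v; rewrite P0E // f0E.
  have -> := lin_sum_on (index_enum 'I_d) (fun i => l i v) (cocf_subspace V q) p_lin cf.
  rewrite [in RHS](le v) (lin_sum ly); apply: eq_bigr => i _.
  by rewrite (linZ ly); have [_ ->] := fP i.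
- move=> f hf; rewrite eps_cob; split=> [e v|h].
    apply/p_ker; first exact: (eps_coc f).1.
    by rewrite -P0E // e (hommod0 _ hj').
  apply/j'_inj/funext => v; rewrite P0E // (hommod0 _ hj'); apply/p_ker => //.
  exact: (eps_coc f).1.
- move=> k f Kk hf; apply/j'_inj/funext => v.
  rewrite P0E; last exact: cocf_fact.
  rewrite j'_act // P0E // -p_act //; last exact: (eps_coc f).1.
  by congr p; apply/funext => x; rewrite /eps /fact j_act.
- move=> A f hf; apply/j'_inj/funext => v.
  rewrite P0E; last exact: cocf_flie.
  have hv := (eps_coc f).1 hf.
  rewrite j'_lie !P0E // -p_lie // addrC -scaleN1r -p_lin //; last exact: cocf_flie.
  congr p; apply/funext => x; rewrite /eps /flie (linB (jv v)) j_lie (lin_sum (jv v)).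
  by rewrite scaleN1r [in RHS]addrC addrAC.
Qed.

End TrivialCoefficients.

End Forms.

Section HomEuler.
Variables (R : realType) (P : gk_pair R) (hP : gk_group P).
Variables (b : gkmod P) (fb : findim b) (iota : b -> lie P) (hi : ce_data iota).
Variables (d : nat) (e : 'I_d -> b) (l : 'I_d -> b -> R[i]^o).
Hypothesis l_lin : forall i, linear (l i).
Hypothesis le : forall x, x = \sum_i l i x *: e i.
Variable C : gkmod P -> Prop.
Hypothesis hC : full_abelian C.
Hypothesis cloB : forall N q T, C N -> is_altmod hP fb N q T -> C T.

Local Notation coh := (is_coh hP fb iota).
Local Notation chi := (chi hP fb iota d (C := C)).

Definition nilpotent_on (D : gkmod P) (m : nat) (x : D) : Prop :=
  forall s : seq b, size s = m -> foldl (fun w y => gk_lie (iota y) w) x s = 0.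

Lemma foldl_lie_linear (D : gkmod P) (s : seq b) :
  linear (fun x : D => foldl (fun w y => gk_lie (iota y) w) x s).
Proof.
elim: s => [|y s IH] a u v //=; rewrite -IH; congr foldl.
by rewrite (linD (gk_lie_linear _)) (linZ (gk_lie_linear _)).
Qed.

(* The span of the vectors [y.v], as the intersection of the subspaces that
   contain them. *)
Definition lie_span (D : gkmod P) (x : D) : Prop :=
  forall T : D -> Prop, subspace_pred T -> (forall y v, T (gk_lie (iota y) v)) -> T x.

Lemma lie_span_submod (D : gkmod P) : submod (@lie_span D).
Proof.
have [i1 i2 i3 i4] := hi.
apply: submodP => //.
- split=> [T [T0 _] _ //|a x y hx hy T hT h]; have [_ TD] := hT.
  by apply: TD; [exact: hx | exact: hy].
- move=> k x Kk hx T hT h; apply: (hx (fun x => T (gk_act k x))).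
    split=> [|a u v hu hv]; first by rewrite (lin0 (gk_act_linear Kk)); exact: subsp0.
    by rewrite (gk_act_linear Kk); have [_] := hT; apply.
  by move=> y v; rewrite gk_act_lie // -i4.
- move=> A x hx T hT h; apply: (hx (fun x => T (gk_lie A x))).
    split=> [|a u v hu hv]; first by rewrite (lin0 (gk_lie_linear A)); exact: subsp0.
    by rewrite (gk_lie_linear A); have [_] := hT; apply.
  move=> y v; have e1 : gk_lie A (gk_lie (iota y) v) =
      gk_lie (iota (gk_lie A y)) v + gk_lie (iota y) (gk_lie A v).
    by rewrite i3 gk_lie_br subrK.
  by rewrite e1; apply: subspD.
Qed.

(** [D'] is b.D and [D''] is D / b.D, the largest quotient with trivial action. *)
Lemma lie_span_seq (D : gkmod P) : findim D ->
  exists (D' D'' : gkmod P) (f : D' -> D) (p : D -> D''),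
  [/\ gk_hom f /\ gk_hom p, injective f, forall w, exists v, p v = w,
      forall v, p v = 0 <-> exists v', v = f v'
    & forall v, lie_span v <-> exists v', v = f v'].
Proof.
move=> fD; have hS := lie_span_submod D.
have [D' [p' hp']] := gk_exists hP hS (submod0 D) (fun x (x0 : x = 0) =>
  eq_ind_r (fun x => lie_span x) (subsp0 (let: And4 h _ _ _ := hS in h)) x0).
have [D'' [p'' hp'']] := gk_exists hP (submodT D) hS (fun _ _ => Logic.I).
have [S0 _ Sa Sl] := hS.
have [p'_lin p'_surj p'_ker p'_act p'_lie] := hp'.
have [p''_lin p''_surj p''_ker p''_act p''_lie] := hp''.
have p'_inj x y : lie_span x -> lie_span y -> p' x = p' y -> x = y.
  by move=> hx hy /(sq_proj_eq S0 hp' hx hy) /eqP; rewrite subr_eq0 => /eqP.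
have /choice[f fP] : forall v', exists v, lie_span v /\ p' v = v'.
  by move=> v'; have [v] := p'_surj v'; exists v.
have fS v : lie_span (f v) by have [] := fP v.
have fK v : p' (f v) = v by have [] := fP v.
have fp' v : lie_span v -> f (p' v) = v by move=> hv; apply: p'_inj => //; rewrite fK.
have fim v : lie_span v <-> exists v', v = f v'.
  by split=> [hv|[v' ->] //]; exists (p' v); rewrite fp'.
exists D', D'', f, p''; split=> //.
- split; last first.
    split=> [a x y|k v Kk|A v]; first exact: p''_lin.
      exact: p''_act.
    exact: p''_lie.
  split=> [a x y|k v Kk|A v].
  + rewrite -{1}(fK x) -{1}(fK y) -p'_lin // fp' //.
    by have [_ h] := S0; exact: h.
  + by rewrite -{1}(fK v) -p'_act // fp' //; exact: Sa.
  + by rewrite -{1}(fK v) -p'_lie // fp' //; exact: Sl.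
- by move=> x y xy; rewrite -(fK x) -(fK y) xy.
- by move=> w; have [v _ <-] := p''_surj w; exists v.
- by move=> v; rewrite p''_ker.
Qed.

Definition homclosed (D : gkmod P) : Prop := forall N X, C N -> is_homm D N X -> C X.

Lemma cls_of_homm (D N X : gkmod P) : findim D -> C X -> is_homm D N X ->
  cls_of C (is_homm D N) = cls C X.
Proof.
move=> fD CX hX; apply: (cls_of_eq hP hC) => // V W hV hW; exact: (homm_iso hP fD hV hW).
Qed.

Section Filtration.
Variables (D' D D'' : gkmod P) (f : D' -> D) (p : D -> D'').
Hypotheses (fD : findim D) (f_hom : gk_hom f) (p_hom : gk_hom p) (f_inj : injective f)
  (p_surj : forall w, exists v, p v = w) (ex : forall v, p v = 0 <-> exists v', v = f v')
  (fim : forall v, lie_span v <-> exists v', v = f v').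

(** Hom(D'', N) is the kernel of [phi] from X = Hom(D, N) to Hom(b, X), x |-> (y |-> x(y .)). Its
    target lies in [C] by [cloB], as Hom is the module of forms of degree one. Then Hom(D', N) is in
    [C] as the cokernel of Hom(D'', N) -> Hom(D, N). *)
Lemma homclosed_sub : homclosed D -> homclosed D'' /\ homclosed D'.
Proof.
move=> clo; have [i1 i2 i3 i4] := hi.
have [f_lin _ _] := f_hom; have [p_lin _ _] := p_hom.
have fD'' := findim_quot fD f_lin p_lin f_inj p_surj ex.
have fD' := findim_sub fD f_lin f_inj.
have main N : C N -> exists X'' X' : gkmod P, [/\ is_homm D'' N X'', is_homm D' N X', C X'' & C X'].
  move=> CN; have [X [j hj]] := homm_exists hP fD N.
  have [X'' [j'' hj'']] := homm_exists hP fD'' N.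
  have [X' [j' hj']] := homm_exists hP fD' N.
  have [i [g [[i_hom g_hom] i_inj g_surj iex ikerf]]] :=
    homm_contra_exact hP fD f_hom p_hom f_inj p_surj ex hj'' hj hj'.
  have CX : C X by apply: clo CN _; exists j.
  have [E [jE hE]] := homm_exists hP fb X.
  have CE : C E by apply: (cloB (N := X) (q := 1) CX); apply/homm_altmod; exists jE.
  have [j_lin j_inj j_im j_act j_lie] := hj.
  have [jE_lin jE_inj jE_im jE_act jE_lie] := hE.
  have jl x := hommod_lin x hj.
  have /choice[th thP] : forall xy : X * b, exists z, forall v,
      j z v = j xy.1 (gk_lie (iota xy.2) v).
    move=> [x y] /=; have /j_im[z ez] : linear (fun v => j x (gk_lie (iota y) v)).
      by move=> a u v; rewrite (gk_lie_linear (iota y)) jl.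
    by exists z => v; rewrite -ez.
  have /choice[phi phiP] : forall x, exists z, jE z = fun y => th (x, y).
    move=> x; have /jE_im[z ez] : linear (fun y => th (x, y)).
      move=> a y z; apply/j_inj/funext => v; rewrite j_lin !thP /= i1.
      by rewrite gk_lie_linearl jl.
    by exists z.
  have phiE x y v : j (jE (phi x) y) v = j x (gk_lie (iota y) v) by rewrite phiP thP.
  have phi_hom : gk_hom phi.
    split=> [a x z|k x Kk|A x]; apply/jE_inj/funext => y; apply/j_inj/funext => v.
    - by rewrite jE_lin j_lin !phiE j_lin.
    - rewrite jE_act // j_act // !phiE j_act // gk_act_lie; last exact: (gg_V hP).
      by rewrite -i4 //; exact: (gg_V hP).
    - rewrite jE_lie -scaleN1r addrC j_lin j_lie !phiE j_lie scaleN1r.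
      rewrite i3 gk_lie_br (linB (jl x)) opprB.
      by rewrite [RHS]addrC addrA subrK.
  have CX'' : C X''.
    have [_ _ _ hk _] := hC; apply: (hk X E phi X'' phi_hom _ CX CE).
    exists i; split=> // x; rewrite ikerf; split=> [px v|h].
      have : lie_span (f v) by apply/fim; exists v.
      move=> /(_ (fun w => j x w = 0)) h; apply: h => [|y w].
        split=> [|a u w hu hw]; first exact: (lin0 (jl x)).
        by rewrite jl hu hw scaler0 addr0.
      by rewrite -phiE px (hommod0 _ hE) (hommod0 _ hj).
    apply/jE_inj/funext => y; apply/j_inj/funext => v.
    rewrite phiE (hommod0 _ hE) (hommod0 _ hj).
    have [v' ->] : exists v', gk_lie (iota y) v = f v' by apply/fim => T _; exact.
    exact: h.
  exists X'', X'; split=> //; [by exists j'' | by exists j' |].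
  have [_ _ _ _ hk] := hC; apply: (hk X'' X i X' i_hom _ CX'' CX).
  by exists g.
split=> N Y CN hY; have [X'' [X' [h1 h2 c1 c2]]] := main N CN.
  exact: (cat_iso hC (homm_iso hP fD'' h1 hY)).
exact: (cat_iso hC (homm_iso hP fD' h2 hY)).
Qed.

End Filtration.

Variables (V : gkmod P) (N : nat -> gkmod P).
Hypotheses (cohN : forall q, coh V q (N q)) (CN : forall q, C (N q)).

(** Induction on the nilpotency index along D' = b.D, which lowers the index by one; on D'' = D /
    b.D the action is trivial and [cohf_hom_trivial] computes the cohomology. *)
Lemma chi_hom m (D : gkmod P) : findim D -> (forall x : D, nilpotent_on m x) -> homclosed D ->
  forall X, is_homm D V X -> chi X (alt_sum d (fun q => cls_of C (is_homm D (N q)))).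
Proof.
elim: m D => [|m IH] D fD nil clo X hX.
  have D0 (x : D) : x = 0 by exact: (nil x [::]).
  have zero W Y : is_homm D W Y -> forall y : Y, y = 0.
    move=> [j hj] y; have [_ j_inj _ _ _] := hj; apply/j_inj/funext => v.
    by rewrite (D0 v) !(lin0 (hommod_lin _ hj)).
  have -> : alt_sum d (fun q => cls_of C (is_homm D (N q))) = ab_zero.
    rewrite /alt_sum big1 // => q _.
    have [Y hY] := homm_exists hP fD (N q).
    rewrite (cls_of_homm fD (clo _ _ (CN q) hY) hY).
    by rewrite (cls_zero hC (zero _ _ hY)) ab_mulz_sign0.
  by apply: chi_zero => //; exact: zero hX.
have [D' [D'' [f [p [[f_hom p_hom] f_inj p_surj ex fim]]]]] := lie_span_seq fD.
have [f_lin f_act f_lie] := f_hom; have [p_lin p_act p_lie] := p_hom.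
have fD'' := findim_quot fD f_lin p_lin f_inj p_surj ex.
have fD' := findim_sub fD f_lin f_inj.
have [clo'' clo'] := homclosed_sub fD f_hom p_hom f_inj p_surj ex fim clo.
have [X'' [j'' hj'']] := homm_exists hP fD'' V.
have [X' [j' hj']] := homm_exists hP fD' V.
have [j hj] := hX.
have [i [g [[i_hom g_hom] i_inj g_surj iex _]]] :=
  homm_contra_exact hP fD f_hom p_hom f_inj p_surj ex hj'' hj hj'.
have -> : alt_sum d (fun q => cls_of C (is_homm D (N q))) =
    ab_add (alt_sum d (fun q => cls_of C (is_homm D'' (N q))))
      (alt_sum d (fun q => cls_of C (is_homm D' (N q)))).
  rewrite -alt_sumD; apply: eq_alt_sum => q _.
  have [Y'' hY''] := homm_exists hP fD'' (N q); have [Y' hY'] := homm_exists hP fD' (N q).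
  have [Y hY] := homm_exists hP fD (N q).
  have c'' := clo'' _ _ (CN q) hY''; have c' := clo' _ _ (CN q) hY'; have c := clo _ _ (CN q) hY.
  rewrite (cls_of_homm fD c hY) (cls_of_homm fD'' c'' hY'') (cls_of_homm fD' c' hY').
  move: hY hY'' hY' => [k hk] [k'' hk''] [k' hk'].
  have [i0 [g0 [h1 h2 h3 h4 _]]] :=
    homm_contra_exact hP fD f_hom p_hom f_inj p_surj ex hk'' hk hk'.
  by apply: cls_ses => //; exists i0, g0.
apply: (chi_middle hi l_lin le hC (M' := X'') (M'' := X')).
- by exists i, g.
- have tr y (v : D'') : gk_lie (iota y) v = 0.
    have [w <-] := p_surj v; rewrite -p_lie; apply/ex/fim => T _; exact.
  have [Y hY] := choice (fun q => homm_exists hP fD'' (N q)).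
  rewrite (eq_alt_sum (y := fun q => cls C (Y q))); last first.
    by move=> q _; rewrite (cls_of_homm fD'' (clo'' _ _ (CN q) (hY q)) (hY q)).
  have cY q : coh X'' q (Y q).
    apply/(coh_fun hP fb hi); have [k hk] := hY q.
    exact: (cohf_hom_trivial hP fb hi tr fD'' hj'' hk ((coh_fun hP fb hi _ _ _).1 (cohN q))).
  apply: chi_intro cY _ => // q; exact: (Eu_cat hP (clo'' _ _ (CN q) (hY q))).
- apply: IH => //; last by exists j'.
  move=> x s ss; apply: f_inj; rewrite (lin0 f_lin).
  have fe : f (foldl (fun w y => gk_lie (iota y) w) x s) =
      foldl (fun w y => gk_lie (iota y) w) (f x) s.
    by elim: s x {ss} => //= y s IHs x; rewrite IHs f_lie.
  rewrite fe; have : lie_span (f x) by apply/fim; exists x.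
  have fl := foldl_lie_linear (D := D) s.
  move=> /(_ (fun x => foldl (fun w y => gk_lie (iota y) w) x s = 0)) h.
  apply: h => [|y v].
    split=> [|a u v hu hv]; first exact: (lin0 fl).
    by rewrite fl hu hv scaler0 addr0.
  by apply: (nil v (y :: s)); rewrite /= ss.
Qed.

End HomEuler.

Section TrivialModule.
Variables (R : realType) (P : gk_pair R).

Definition trivial_mod : gkmod P.
Proof.
unshelve refine (@GKMod R P (R[i]^o : lmodType R[i]) (fun _ v => v) (fun _ _ => 0) _ _ _ _ _ _ _ _) => //.
- by move=> X a u v; rewrite scaler0 addr0.
- by move=> v a X Y; rewrite scaler0 addr0.
- by move=> X Y v; rewrite subr0.
- apply/lf_vecP => v; exists 'I_1, (fun=> 1); split.
    by exists (fun=> v); rewrite big_ord_recl big_ord0 addr0 /GRing.scale /= mulr1.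
  exists (fun _ _ _ => 1); split.
  + by move=> k j _; rewrite big_ord_recl big_ord0 addr0 scale1r.
  + by move=> i j; exact: ccont_cst.
  + move=> g X j _; exists (fun=> 0); split; last by move=> i; exact: cderiv_cst.
    by rewrite big1 // => i _; rewrite scale0r.
Defined.

End TrivialModule.

Section DualTensor.
Variables (R : realType) (P : gk_pair R) (hP : gk_group P).
Local Notation Ct := (trivial_mod P).
Variables (V E D X : gkmod P) (jD : D -> E -> Ct) (jX : X -> D -> V).
Hypotheses (fE : findim E) (hD : is_hommod jD) (hX : is_hommod jX).

Let pr (phi : D) (v : E) : R[i] := jD phi v.

Let prl v : linear (fun phi => pr phi v : R[i]^o).
Proof. by case: hD => h _ _ _ _ a x y; exact: h. Qed.

Let prr phi : linear (fun v => pr phi v : R[i]^o) := hommod_lin phi hD.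

Let pr_act k phi v : grp k -> pr (gk_act k phi) v = pr phi (gk_act (invmx k) v).
Proof. by case: hD => _ _ _ h _; exact: h. Qed.

Let pr_lie A phi v : pr (gk_lie A phi) v = - pr phi (gk_lie A v).
Proof. by case: hD => _ _ _ _ h; rewrite /pr h -[gk_lie A _]/(0 : Ct) sub0r. Qed.

Lemma dual_findim : findim D.
Proof.
have [d [e [l [l_lin le]]]] := fE; have [j_lin j_inj j_im _ _] := hD.
have /choice[f fP] : forall i, exists phi, jD phi = l i.
  by move=> i; have /j_im[phi ->] : linear (l i : E -> Ct) := l_lin i; exists phi.
exists d, f, (fun i phi => pr phi (e i)); split=> [i|phi]; first exact: prl.
apply/j_inj/funext => v.
have h : linear (fun phi => jD phi v) by move=> a x y; exact: j_lin.
rewrite (lin_sum h) {1}(le v) (lin_sum (hommod_lin phi hD)); apply: eq_bigr => i _.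
by rewrite (linZ h) (linZ (hommod_lin phi hD)) fP; exact: mulrC.
Qed.

(** V (x) E = Hom(E^dual, V) for finite-dimensional E; the tensor v (x) w is the map phi |-> phi(w)
    v. *)
Lemma dual_tensor : is_tensor V E X.
Proof.
have [d [e [l [l_lin le]]]] := fE.
have [jD_lin jD_inj jD_im jD_act jD_lie] := hD.
have [jX_lin jX_inj jX_im jX_act jX_lie] := hX.
have /choice[f fP] : forall i, exists phi, forall v, pr phi v = l i v.
  move=> i; have /jD_im[phi h] : linear (l i : E -> Ct) := l_lin i.
  by exists phi => v; rewrite /pr -h.
have /choice[b0 b0P] : forall vw : V * E, exists x, forall phi,
    jX x phi = pr phi vw.2 *: vw.1.
  move=> [v w]; have /jX_im[x ex] : linear (fun phi : D => pr phi w *: v).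
    by move=> a x y; rewrite (prl w) scalerDl scalerA.
  by exists x => phi; rewrite -ex.
pose b v w := b0 (v, w).
have bE v w phi : jX (b v w) phi = pr phi w *: v by rewrite /b b0P.
have bl w : linear (b^~ w).
  move=> a x y; apply/jX_inj/funext => phi.
  by rewrite jX_lin !bE scalerDr !scalerA mulrC.
have br v : linear (b v).
  move=> a x y; apply/jX_inj/funext => phi.
  by rewrite jX_lin !bE (prr phi) scalerDl scalerA.
have jl phi : linear (fun x => jX x phi) by move=> a x y; exact: jX_lin.
have expand x : x = \sum_i b (jX x (f i)) (e i).
  apply/jX_inj/funext => phi; rewrite (lin_sum (jl phi)).
  have {1}-> : phi = \sum_i pr phi (e i) *: f i.
    apply/jD_inj/funext => v; have h : linear (fun phi => jD phi v) by move=> a y z; exact: jD_lin.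
    rewrite (lin_sum h) {1}(le v) (lin_sum (hommod_lin phi hD)); apply: eq_bigr => i _.
    rewrite (linZ h) (linZ (hommod_lin phi hD)) -[jD (f i) v]/(pr (f i) v) fP.
    exact: mulrC.
  rewrite (lin_sum (hommod_lin x hX)); apply: eq_bigr => i _.
  by rewrite (linZ (hommod_lin x hX)) bE.
exists b; split.
- by split.
- move=> Z c cl cr; exists (fun x => \sum_i c (jX x (f i)) (e i)); split.
    split=> [a x y|v w].
      rewrite scaler_sumr -big_split; apply: eq_bigr => i _.
      by rewrite jX_lin cl.
    rewrite [w in RHS](le w) (lin_sum (cr v)); apply: eq_bigr => i _.
    by rewrite bE fP (linZ (cl _)) (linZ (cr v)).
  move=> g [g_lin gE]; apply/funext => x; rewrite [x in RHS]expand (lin_sum g_lin).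
  by apply: eq_bigr => i _; rewrite gE.
- move=> k v w Kk; apply/jX_inj/funext => phi; have Kv := gg_V hP Kk.
  rewrite jX_act // !bE pr_act // invmxK (linZ (gk_act_linear Kk)) //.
- move=> A v w; apply/jX_inj/funext => phi.
  rewrite jX_lie !bE (linD (jl phi)) !bE pr_lie (linZ (gk_lie_linear A)).
  by rewrite scaleNr opprK.
Qed.

End DualTensor.

Section NilpotentForms.
Variables (R : realType) (P : gk_pair R) (hP : gk_group P).
Variables (b : gkmod P) (iota : b -> lie P).
Local Notation Ct := (trivial_mod P).

(* Every application of [b] lowers the total weight of the arguments on which
   the form can be nonzero. *)
Lemma alt_forms_nilpotent (U E : gkmod P) p N (j : E -> ('I_p -> U) -> Ct) :
  is_altf j -> (forall x : U, nilpotent_on iota N x) ->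
  forall x : E, nilpotent_on iota (p * N).+1 x.
Proof.
move=> [j_lin j_inj j_alt j_act j_lie] nilU x s ss.
have zero u : (forall y, j u y = 0) -> u = 0.
  move=> h; apply/j_inj/funext => y; rewrite h.
  by have := j_lin (-1) 0 0 y; rewrite scaler0 addr0 scaleN1r addNr => ->.
(* [w i] bounds the nilpotency index of the argument in slot i. The last operator applied acts on
   one argument and lowers its bound, so [t] operators kill the form once [t] exceeds the sum of the
   bounds. *)
have main t : forall (s : seq b) (f : E), size s = t -> forall (w : 'I_p -> nat) y,
    (forall i, nilpotent_on iota (w i) (y i)) -> (\sum_i w i < t)%N ->
    j (foldl (fun w y => gk_lie (iota y) w) f s) y = 0.
  elim: t => [//|t IH] s1 f; case/lastP: s1 => // s1 z; rewrite size_rcons => -[st] w y hw wt.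
  rewrite foldl_rcons j_lie /flie -[gk_lie _ (j _ _)]/(0 : Ct) sub0r.
  rewrite big1 ?oppr0 // => i _; set u := foldl _ _ _.
  have [[ml _] _] := ((j_alt (j u)).2 (ex_intro _ u erefl), 0%N).
  have upd0 : j u (updb y i 0) = 0.
    have := ml y i (-1) 0 0; rewrite scaler0 addr0 => ->.
    by rewrite scaleN1r addNr.
  case wi : (w i) => [|n].
    have yi : y i = 0 by have := hw i; rewrite wi => /(_ [::] erefl).
    by rewrite yi (lin0 (gk_lie_linear _)).
  apply: (IH _ _ st (fun k => if k == i then n else w k)).
    move=> k; rewrite /updb; case: (k =P i) => _; last exact: hw.
    by move=> r rn; have := hw i; rewrite wi => /(_ (z :: r)) /=; apply; rewrite rn.
  move: wt; rewrite (bigD1 i) //= wi addSn ltnS; apply: leq_trans.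
  rewrite (bigD1 i) //= eqxx ltnS leq_add2l; apply/eq_leq.
  by apply: eq_bigr => k ki; rewrite (negbTE ki).
apply: zero => y; apply: (main _ _ _ ss (fun=> N)); first by move=> i; exact: nilU.
by rewrite sum_nat_const card_ord ltnS.
Qed.

(** The contragredient action moves the operators to the argument, in reverse order and up to a
    scalar. *)
Lemma dual_nilpotent (E D : gkmod P) (jD : D -> E -> Ct) m : is_hommod jD ->
  (forall x : E, nilpotent_on iota m x) -> forall x : D, nilpotent_on iota m x.
Proof.
move=> hD nilE phi s ss; have [j_lin j_inj j_im j_act j_lie] := hD.
apply/j_inj/funext => v; rewrite (hommod0 _ hD).
have main r : forall phi v, exists c : R[i], jD (foldl (fun w y => gk_lie (iota y) w) phi r) v =
    c *: jD phi (foldl (fun w y => gk_lie (iota y) w) v (rev r)).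
  elim: r => [|z r IH] {}phi {}v; first by exists 1; rewrite /= scale1r.
  rewrite /= rev_cons foldl_rcons; have [c ->] := IH (gk_lie (iota z) phi) v.
  exists (- c); rewrite j_lie -[gk_lie _ (jD _ _)]/(0 : Ct) sub0r.
  by rewrite scaleNr scalerN.
have [c ->] := main s phi v.
by rewrite nilE ?size_rev // (lin0 (hommod_lin phi hD)) scaler0.
Qed.

End NilpotentForms.

Section EulerIdentity.
Variables (R : realType) (P : gk_pair R) (hP : gk_group P).
Variables (b : gkmod P) (fb : findim b) (iota : b -> lie P) (hi : ce_data iota).
Variables (d : nat) (e : 'I_d -> b) (l : 'I_d -> b -> R[i]^o).
Hypothesis l_lin : forall i, linear (l i).
Hypothesis le : forall x, x = \sum_i l i x *: e i.
Variable C : gkmod P -> Prop.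
Hypothesis hC : full_abelian C.
Variables (U : gkmod P) (fU : findim U) (n0 : nat).
Hypothesis nilU : forall x : U, nilpotent_on iota n0 x.
Hypothesis cloB : forall N q T, C N -> is_altmod hP fb N q T -> C T.
Hypothesis cloU : forall N p T, C N -> is_altmod hP fU N p T -> C T.

Local Notation coh := (is_coh hP fb iota).
Local Notation chi := (chi hP fb iota d (C := C)).
Local Notation Ct := (trivial_mod P).

Variables (V : gkmod P) (N : nat -> gkmod P).
Hypotheses (cohN : forall q, coh V q (N q)) (CN : forall q, C (N q)).

(* Forms of degree [p] on [U] with values in a module [M] are Hom(D, M), where
   D is the dual of the forms with values in the trivial module. *)
Lemma altmod_homm p : exists D : gkmod P, [/\ findim D, exists m, forall x : D, nilpotent_on iota m x
  & forall M X, is_altmod hP fU M p X <-> is_homm D M X].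
Proof.
have [dU [eU [lU [lU_lin leU]]]] := fU.
have [E hE] := altmod_exists hP fU Ct p.
have [pE hpE] := hE.
have fE : findim E.
  have one (m : Ct) : m = (m : R[i]) *: (1 : Ct) by exact: (esym (mulr1 (m : R[i]))).
  have id_lin : linear (id : Ct -> R[i]^o) by move=> a x y.
  exact: (alt_findim lU_lin leU hpE id_lin one).
have [jE hjE] := (altmodP hP fU _ _ _).1 hE.
have [D [jD hjD]] := homm_exists hP fE Ct.
have extE : is_extb (b := U) (E := E) jE.
  have [h1 h2 h3 h4 h5] := hjE; split=> //.
    by move=> k u x Kk; rewrite h4.
  by move=> A u x; rewrite h5 /flie -[gk_lie _ (jE _ _)]/(0 : Ct) sub0r.
have fD := dual_findim fE hjD.
exists D; split=> //.
  exists (p * n0).+1; apply: (dual_nilpotent hjD).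
  exact: (alt_forms_nilpotent hjE nilU).
move=> M X.
have [X0 hX0] := homm_exists hP fD M; have [T0 hT0] := altmod_exists hP fU M p.
(* Both modules are the tensor product of [M] with the scalar forms [E]. *)
have iso : gk_iso T0 X0.
  have [pT hpT] := hT0; have [jX hjX] := hX0.
  apply: (tensor_iso (V := M) (W := E)); first exact: (alt_tensor lU_lin leU extE hpT).
  exact: (dual_tensor hP fE hjD hjX).
split=> hX.
  apply: homm_transport hX0; apply: gk_iso_trans (gk_iso_sym iso) _.
  exact: altmod_iso hT0 hX.
have [pT hpT] := hT0.
have iso' : gk_iso T0 X := gk_iso_trans iso (homm_iso hP fD hX0 hX).
have [g [g_hom g_bij]] := iso'; have [g' gK g'K] := g_bij.
have [g_lin g_act g_lie] := g_hom; have [p_lin p_surj p_ker p_act p_lie] := hpT.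
exists (g \o pT); split=> /=.
- by move=> a x y hx hy; rewrite p_lin // g_lin.
- by move=> x; have [F hF eF] := p_surj (g' x); exists F => //; rewrite /= eF g'K.
- move=> F hF; rewrite -p_ker //; split=> [h|->]; last exact: (lin0 g_lin).
  by apply: (can_inj gK); rewrite h (lin0 g_lin).
- by move=> k F Kk hF; rewrite p_act // g_act.
- by move=> A F hF; rewrite p_lie // g_lie.
Qed.

Lemma chi_altmod p X : is_altmod hP fU V p X ->
  chi X (alt_sum d (fun q => cls_of C (is_altmod hP fU (N q) p))).
Proof.
have [D [fD [m nilD] hD]] := altmod_homm p; move=> /hD hX.
have clo : homclosed C D by move=> M Y CM /hD hY; exact: cloU CM hY.
have := chi_hom hi l_lin le hC cloB cohN CN fD nilD clo hX.
rewrite (eq_alt_sum (y := fun q => cls_of C (is_altmod hP fU (N q) p))) // => q _.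
by congr cls_of; apply/predeqP => Y; split=> /hD.
Qed.

Variables (X Z B H : nat -> gkmod P) (dU : nat).
Hypotheses (sesX : forall p, short_exact (Z p) (X p) (B p.+1))
  (sesZ : forall p, short_exact (B p) (Z p) (H p))
  (B0 : forall x : B 0%N, x = 0) (Bd : forall x : B dU.+1, x = 0)
  (altX : forall p, is_altmod hP fU V p (X p)) (CH : forall p, C (H p)).

(** [chi] is known for cochains by [chi_altmod] and for [H p] by [chi_complex]. Starting from [B 0],
    the two short exact sequences yield it for [Z p] and then for [B p.+1], and the sum telescopes.
    The complex is given abstractly because it will be the restriction of one over a larger pair. *)
Lemma euler_identity :
  alt_sum dU (fun p => alt_sum d (fun q => cls_of C (is_altmod hP fb (H p) q))) =
  alt_sum dU (fun p => alt_sum d (fun q => cls_of C (is_altmod hP fU (N q) p))).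
Proof.
have hX p := chi_altmod (altX p).
have hH p : chi (H p) (alt_sum d (fun q => cls_of C (is_altmod hP fb (H p) q))).
  by apply: (chi_complex hi le hC) => q T; exact: cloB.
have hB p : exists a, chi (B p) a.
  elim: p => [|p [a ha]]; first by exists ab_zero; apply: chi_zero.
  have hZ := chi_middle hi l_lin le hC (sesZ p) ha (hH p).
  by have [z hz _] := chi_right hi l_lin le hC (sesX p) hZ (hX p); exists z.
have [beta hbeta] := choice hB.
have hZ p := chi_middle hi l_lin le hC (sesZ p) (hbeta p) (hH p).
apply/esym; apply: (alt_sum_telescope (b := beta)
  (z := fun p => ab_add (beta p) (alt_sum d (fun q => cls_of C (is_altmod hP fb (H p) q))))) => //.
- move=> p; have [z hz ->] := chi_right hi l_lin le hC (sesX p) (hZ p) (hX p).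
  by congr ab_add; exact: (chi_uniq hi hC hz (hbeta p.+1)).
- apply: (chi_uniq hi hC (hbeta 0%N)); exact: chi_zero.
- apply: (chi_uniq hi hC (hbeta dU.+1)); exact: chi_zero.
Qed.

End EulerIdentity.

(** * Exact functors and the Levi pair *)

Section ExactRelations.
Variables (R : realType) (P P' : gk_pair R).
Variables (C : gkmod P -> Prop) (C' : gkmod P' -> Prop).
Hypotheses (hP : gk_group P) (hC : full_abelian C) (hP' : gk_group P') (hC' : full_abelian C').

(* An exact functor on [C] with values in [C'], given up to isomorphism. *)
Record exact_rel (D : gkmod P -> gkmod P' -> Prop) : Prop := ExactRel {
  er_ex : forall V, C V -> exists T, D V T;
  er_uniq : forall V T T', D V T -> D V T' -> gk_iso T T';
  er_cat : forall V T, C V -> D V T -> C' T;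
  er_ses : forall V' V V'' T' T T'', short_exact V' V V'' ->
    D V' T' -> D V T -> D V'' T'' -> short_exact T' T T'' }.

Lemma exact_rel_cls D V T : exact_rel D -> C V -> D V T -> cls_of C' (D V) = cls C' T.
Proof.
move=> [ex un cat _] CV DT; apply: (cls_of_eq hP' hC') => //; last exact: cat CV DT.
by move=> U W; exact: un.
Qed.

Lemma exact_rel_ses D V' V V'' : exact_rel D -> C V' -> C V -> C V'' ->
  short_exact V' V V'' ->
  cls_of C' (D V) = ab_add (cls_of C' (D V')) (cls_of C' (D V'')).
Proof.
move=> hD CV' CV CV'' ses; have [ex un cat hses] := hD.
have [T' hT'] := ex _ CV'; have [T hT] := ex _ CV; have [T'' hT''] := ex _ CV''.
rewrite (exact_rel_cls hD CV' hT') (exact_rel_cls hD CV hT) (exact_rel_cls hD CV'' hT'').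
by apply: cls_ses; [exact: cat hT'|exact: cat hT|exact: cat hT''|exact: hses ses hT' hT hT''].
Qed.

Lemma exact_rel_ext D : exact_rel D ->
  additive_map (Kgroup_ext (C := C) (fun V => cls_of C' (D V))) /\
  forall V, C V -> Kgroup_ext (C := C) (fun V => cls_of C' (D V)) (cls C V) = cls_of C' (D V).
Proof.
move=> hD; apply: Kgroup_ext_cls => V' V V'' c' c c'' ses; exact: exact_rel_ses.
Qed.

Lemma exact_rel_alt d (D : nat -> gkmod P -> gkmod P' -> Prop) : (forall q, exact_rel (D q)) ->
  additive_map (Kgroup_ext (C := C) (fun V => alt_sum d (fun q => cls_of C' (D q V)))) /\
  forall V, C V -> Kgroup_ext (C := C) (fun V => alt_sum d (fun q => cls_of C' (D q V)))
    (cls C V) = alt_sum d (fun q => cls_of C' (D q V)).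
Proof.
move=> hD; apply: Kgroup_ext_cls => V' V V'' c' c c'' ses.
rewrite -alt_sumD; apply: eq_alt_sum => q _; exact: exact_rel_ses.
Qed.

End ExactRelations.

Section Transport.
Variables (R : realType) (P : gk_pair R) (hP : gk_group P).

Lemma altmod_transport (b : gkmod P) (fb : findim b) M q T T' : gk_iso T T' ->
  is_altmod hP fb M q T -> is_altmod hP fb M q T'.
Proof.
move=> [g [g_hom [g' gK g'K]]] [p hp]; have [g_lin g_act g_lie] := g_hom.
have [p_lin p_surj p_ker p_act p_lie] := hp.
exists (g \o p); split=> /=.
- by move=> a x y hx hy; rewrite p_lin // g_lin.
- by move=> x; have [F hF eF] := p_surj (g' x); exists F => //; rewrite /= eF g'K.
- move=> F hF; rewrite -p_ker //; split=> [h|->]; last exact: (lin0 g_lin).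
  by apply: (can_inj gK); rewrite h (lin0 g_lin).
- by move=> k F Kk hF; rewrite p_act // g_act.
- by move=> A F hF; rewrite p_lie // g_lie.
Qed.

Lemma altf_transport (b b' M T : gkmod P) q (phi : b' -> b) (j : T -> ('I_q -> b) -> M) :
  gk_hom phi -> bijective phi -> is_altf j -> is_altf (fun u x => j u (phi \o x)).
Proof.
move=> phi_hom [psi phiK psiK] [j_lin j_inj j_alt j_act j_lie].
have [phi_lin phi_act phi_lie] := phi_hom.
have [psi_lin _ _] := gk_hom_inv phi_hom phiK psiK.
have updE (c c' : gkmod P) (th : c' -> c) (x : 'I_q -> c') i y :
    th \o updb x i y = updb (th \o x) i (th y).
  by apply/funext => k; rewrite /updb /=; case: eqP.
have altE (c c' : gkmod P) (th : c' -> c) (f : ('I_q -> c) -> M) : linear th -> altb f ->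
    altb (fun x => f (th \o x)).
  move=> th_lin [f1 f2]; split=> [x i a y z|x i i' ii xx].
    by rewrite !updE th_lin f1.
  by apply: (f2 _ i i') => //=; rewrite xx.
split.
- by move=> a u v x; rewrite j_lin.
- move=> u v e; apply/j_inj/funext => x.
  have := congr1 (fun f => f (psi \o x)) e.
  by rewrite (_ : phi \o (psi \o x) = x) //; apply/funext => i /=; rewrite psiK.
- move=> f; split=> [hf|[u ->]]; last first.
    by apply: altE => //; apply/j_alt; exists u.
  have /j_alt[u eu] := altE _ _ psi f psi_lin hf.
  exists u; rewrite -eu; apply/funext => x; congr f.
  by apply/funext => i /=; rewrite phiK.
- move=> k u Kk; rewrite j_act //; apply/funext => x; rewrite /fact; congr (gk_act k (j u _)).
  apply/funext => s /=; rewrite phi_act //; exact: (gg_V hP).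
- move=> A u; rewrite j_lie; apply/funext => x; rewrite /flie; congr (_ - _).
  by apply: eq_bigr => s _; rewrite updE phi_lie.
Qed.

Lemma altmod_transport_b (b b' : gkmod P) (fb : findim b) (fb' : findim b') M q T :
  gk_iso b' b -> is_altmod hP fb M q T -> is_altmod hP fb' M q T.
Proof.
move=> [phi [phi_hom phi_bij]] /altmodP[j hj]; apply/altmodP.
by eexists; exact: altf_transport phi_hom phi_bij hj.
Qed.

Variables (b : gkmod P) (fb : findim b) (iota : b -> lie P) (hi : ce_data iota).

Lemma coh_iso_l M M' q H H' : gk_iso M M' -> is_coh hP fb iota M q H ->
  is_coh hP fb iota M' q H' -> gk_iso H H'.
Proof.
move=> [f [f_hom [g fK gK]]] [p hp] [p' hp']; have g_hom := gk_hom_inv f_hom fK gK.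
have [u [u_hom uE]] := coh_map hi f_hom hp hp'.
have [v [v_hom vE]] := coh_map hi g_hom hp' hp.
have pcK (A B : gkmod P) (x : A -> B) y n (F : ML hP fb A n) : cancel x y -> pc y (pc x F) = F.
  by move=> xK; elim: n F => [|n IH] F; [exact: xK | apply/funext => z; exact: IH].
have [_ p_surj _ _ _] := hp; have [_ p'_surj _ _ _] := hp'.
exists u; split=> //; exists v => x.
  have [F hF <-] := p_surj x; rewrite uE // vE ?pcK //; exact: (pc_cocyc f_hom hF).
have [F hF <-] := p'_surj x; rewrite vE // uE ?pcK //; exact: (pc_cocyc g_hom hF).
Qed.

Lemma complex_exists (d : nat) (e : 'I_d -> b) (l : 'I_d -> b -> R[i]^o) M :
  (forall x, x = \sum_i l i x *: e i) ->
  exists X Z B H : nat -> gkmod P,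
  [/\ (forall q, short_exact (Z q) (X q) (B q.+1)) /\
      (forall q, short_exact (B q) (Z q) (H q)),
      (forall x : B 0%N, x = 0), (forall x : B d.+1, x = 0),
      forall q, is_altmod hP fb M q (X q) & forall q, is_coh hP fb iota M q (H q)].
Proof.
move=> le; have [i1 i2 i3 i4] := hi.
have aS q := @alt_stable _ _ hP _ fb M q; have cS q := cocycS hP fb hi M q.
have bS q := cobordS hP fb hi M q; have zS q := zero_stable (ML hP fb M q).
have z0 q (S : ML hP fb M q -> Prop) : stable S -> forall x, x = 0 -> S x.
  by move=> [hS _ _ _] x ->; exact: (subsp0 hS).
have bc q (F : ML hP fb M q) : cobord iota F -> cocyc iota F by exact: cobord_cocyc.
have ca q (F : ML hP fb M q) : cocyc iota F -> alt F by case.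
have [X /dchoice[pX hX]] := choice (fun q => sq_exists hP (aS q) (zS q) (@z0 q _ (aS q))).
have [Z /dchoice[pZ hZ]] := choice (fun q => sq_exists hP (cS q) (zS q) (@z0 q _ (cS q))).
have [B /dchoice[pB hB]] := choice (fun q => sq_exists hP (bS q) (zS q) (@z0 q _ (bS q))).
have [H /dchoice[pH hH]] := choice (fun q => sq_exists hP (cS q) (bS q) (@bc q)).
exists X, Z, B, H; split.
- split=> q; last first.
    exact: (sq_short_exact (cS q) (bS q) (@z0 q _ (bS q)) (@bc q) (hB q) (hZ q) (hH q)).
  have [Y [pY hY]] := sq_exists hP (aS q) (cS q) (@ca q).
  have ses := sq_short_exact (aS q) (cS q) (@z0 q _ (cS q)) (@ca q) (hZ q) (hX q) hY.
  have [f [f_hom [g fK gK]]] : gk_iso Y (B q.+1).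
    apply: (sq_iso (aS q) (bS q.+1) hY (hB q.+1) (@ce_linear _ _ hP _ fb M iota q)).
    + by move=> F hF; exists F.
    + by move=> k F Kk hF; rewrite ce_act.
    + by move=> A F hF; rewrite ce_lie.
    + by move=> F hF; split=> [[]|cF].
    + by move=> F [G hG ->]; exists G => //; rewrite subrr.
  have [f_lin _ _] := f_hom.
  have [s [t [[s_hom t_hom] s_inj t_surj ex]]] := ses.
  exists s, (f \o t); split=> //.
  + by split=> //; exact: gk_hom_comp.
  + by move=> w; have [v tv] := t_surj (g w); exists v; rewrite /= tv gK.
  + move=> v; rewrite -ex /=; split=> [h|->]; last exact: (lin0 f_lin).
    by apply: (can_inj fK); rewrite h (lin0 f_lin).
- move=> x; have [_ p_surj p_ker _ _] := hB 0%N.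
  by have [F hF <-] := p_surj x; apply/p_ker.
- move=> x; have [_ p_surj p_ker _ _] := hB d.+1.
  have [F hF <-] := p_surj x; apply/p_ker => //.
  exact: (alt_vanish le (ltnSn d) (ca _ _ (bc _ _ hF))).
- by move=> q; exists (@pX q); exact: hX.
- by move=> q; exists (@pH q); exact: hH.
Qed.

End Transport.

Section RestrictForms.
Variables (R : realType) (P' P : gk_pair R) (i : pair_map P' P) (hi : pm_ok i).
Hypotheses (hP : gk_group P) (hP' : gk_group P').

Lemma gres_altf (b M T : gkmod P) q (j : T -> ('I_q -> b) -> M) : is_altf j ->
  @is_altf _ _ (gres hi b) (gres hi M) q (gres hi T) j.
Proof.
move=> [j_lin j_inj j_alt j_act j_lie]; split=> //.
  move=> k u Kk; have := j_act _ u (pm_grpP hi Kk); rewrite /= => ->.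
  by apply/funext => x; rewrite /fact /= pm_V.
by move=> A u; rewrite /= j_lie.
Qed.

Lemma gres_altmod (b : gkmod P) (fb : findim b) (fb' : findim (gres hi b)) M q T :
  is_altmod hP fb M q T -> is_altmod hP' fb' (gres hi M) q (gres hi T).
Proof. by move=> /altmodP[j hj]; apply/altmodP; exists j; exact: gres_altf. Qed.

Lemma gres_extb (b E : gkmod P) q (j : E -> ('I_q -> b) -> R[i]^o) : is_extb j ->
  @is_extb _ _ (gres hi b) q (gres hi E) j.
Proof.
move=> [j_lin j_inj j_alt j_act j_lie]; split=> //.
  move=> k u x Kk; have := j_act _ u x (pm_grpP hi Kk); rewrite /= => ->.
  by rewrite pm_V.
by move=> A u x; rewrite /= j_lie.
Qed.

End RestrictForms.

Lemma extb_transport (R : realType) (P : gk_pair R) (b E E' : gkmod P) q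
    (j : E -> ('I_q -> b) -> R[i]^o) : gk_iso E' E -> is_extb j ->
  exists j' : E' -> ('I_q -> b) -> R[i]^o, is_extb j'.
Proof.
move=> [f [[f_lin f_act f_lie] [g fK gK]]] [j_lin j_inj j_alt j_act j_lie].
exists (j \o f); split=> /=.
- by move=> a u v x; rewrite f_lin j_lin.
- by move=> u v /j_inj /(can_inj fK).
- move=> h; rewrite j_alt; split=> [[u ->]|[u ->]]; last by exists (f u).
  by exists (g u); rewrite /= gK.
- by move=> k u x Kk; rewrite f_act // j_act.
- by move=> A u x; rewrite f_lie j_lie.
Qed.

(** * The functors of a quadruple expressed through modules of forms *)

Section LeviModules.
Variables (R : realType) (P : reductive_pair R) (Q : germane_parabolic P).
Local Notation lp := (levi_pair Q).
Local Notation hl := (levi_group Q).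
Local Notation hq := (q_group Q).
Local Notation b := (nrad_mod Q).
Local Notation fb := (nrad_findim Q).
Local Notation iota := (@nrad_incl R P Q).
Local Notation hi := (nrad_ce_data Q).
Local Notation lqr := (gres (lq_incl_ok Q)).

Definition levi_nrad : gkmod lp := lqr b.

Definition levi_nrad_findim : findim levi_nrad := fb.

Local Notation bl := levi_nrad.
Local Notation fbl := levi_nrad_findim.

Lemma alternatingE q (V : lmodType R[i]) (f : ('I_q -> b) -> V) :
  Defs.alternating (Q := Q) f <-> altb (b := b) f.
Proof.
have updE (x : 'I_q -> b) i (y : b) : upd (Q := Q) x i (vsval (y : subvs_of (nrad Q))) = updb x i y.
  by apply/funext => k; rewrite /upd /updb; case: eqP => // _; exact: vsvalK.
split=> -[f1 f2]; split=> // x i a y z.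
  by have := f1 x i a y z; rewrite !updE.
by rewrite !updE; exact: f1.
Qed.

Lemma levi_br_nrad (X : lie lp) (y : b) :
  gk_lie (X : lie lp) (y : bl) =
  vsproj (nrad Q) (br (vsval (X : subvs_of (levi Q))) (vsval (y : subvs_of (nrad Q)))) :> subvs_of (nrad Q).
Proof. by rewrite /= vsprojK // levi_parab // subvsP. Qed.

Lemma is_extP q (E : gkmod lp) :
  is_ext q E <-> exists j : E -> ('I_q -> bl) -> R[i]^o, is_extb j.
Proof.
split=> -[j [j_lin j_inj j_alt j_act j_lie]]; exists j; split; try exact: j_lin;
  try exact: j_inj.
- by move=> f; apply: iff_trans (j_alt f); apply: iff_sym; exact: alternatingE.
- by move=> k u x Kk; have := j_act k u Kk => ->.
- move=> X u x; have := j_lie X u => ->; rewrite /form_lie sub0r; congr (- _).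
  apply: eq_bigr => s _; congr (j u _); apply/funext => t.
  by rewrite /upd /updb -levi_br_nrad.
- by move=> f; apply: iff_trans (j_alt f); exact: alternatingE.
- by move=> k u Kk; apply/funext => x; exact: j_act.
- move=> X u; apply/funext => x; have := j_lie X u x => ->; rewrite /form_lie sub0r.
  congr (- _); apply: eq_bigr => s _; congr (j u _); apply/funext => t.
  by rewrite /upd /updb -levi_br_nrad.
Qed.

Lemma ext_exists q : exists E : gkmod lp, is_ext q E.
Proof.
have [E /altmodP[j [j_lin j_inj j_alt j_act j_lie]]] := altmod_exists hl fbl (trivial_mod lp) q.
exists E; apply/is_extP; exists j; split=> //.
  by move=> k u x Kk; rewrite j_act.
by move=> A u x; rewrite j_lie /flie -[gk_lie _ (j _ _)]/(0 : trivial_mod lp) sub0r.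
Qed.

Lemma tensor_altmod (bm : gkmod lp) (fm : findim bm) q (V E T : gkmod lp)
    (j : E -> ('I_q -> bm) -> R[i]^o) : is_extb j ->
  is_tensor V E T <-> is_altmod hl fm V q T.
Proof.
move=> hj; have [d [e [l [l_lin le]]]] := fm.
have [T0 hT0] := altmod_exists hl fm V q; have [p0 hp0] := hT0.
have t0 := alt_tensor l_lin le hj hp0.
split=> [hT|[p hp]]; first exact: (altmod_transport (tensor_iso t0 hT) hT0).
exact: (alt_tensor l_lin le hj hp).
Qed.

Lemma tensor_extP q (V T : gkmod lp) : is_tensor_ext q V T <-> is_altmod hl fbl V q T.
Proof.
split=> [[E /is_extP[j hj] hT]|hT].
  exact/(tensor_altmod fbl V T hj).
have [E hE] := ext_exists q; have [j hj] := (is_extP _ _).1 hE.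
by exists E => //; apply/(tensor_altmod fbl V T hj).
Qed.

Section OneModule.
Variable V : gkmod P.
Local Notation Vq := (gres (q_incl_ok Q) V).

Lemma ce_diffE q (f : ('I_q -> b) -> V) :
  ce_diff (Q := Q) (V := V) f = ced (b := b) (M := Vq) iota f.
Proof.
apply/funext => x; rewrite /ce_diff /ced; congr (_ + _); apply: eq_bigr => i _.
  by congr (_ *: _); rewrite /= nrad_inclE.
apply: eq_bigr => j _; congr (_ *: f _); apply/funext => s.
by rewrite /upd /updb /=; case: eqP => // _; rewrite nrad_inclE.
Qed.

Lemma cocycleE q (f : ('I_q -> b) -> V) :
  cocycle (Q := Q) (V := V) f <-> cocf (M := Vq) iota f.
Proof.
split=> -[/alternatingE fa fc]; split=> //.
  by apply/funext => x; rewrite -ce_diffE fc.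
by move=> x; rewrite ce_diffE fc.
Qed.

Lemma coboundaryE q (f : ('I_q -> b) -> V) :
  coboundary (Q := Q) (V := V) f <-> cobf (M := Vq) iota f.
Proof.
case: q f => [|q] f //=.
by split=> -[g /alternatingE ga fe]; exists g; rewrite ?fe ?ce_diffE.
Qed.

Lemma form_lieE q (X : lie lp) (f : ('I_q -> b) -> V) :
  form_lie (Q := Q) (gk_lie (vsval (X : subvs_of (levi Q)))) (vsval (X : subvs_of (levi Q))) f =
  flie (b := b) (M := Vq) (pm_lie (lq_incl Q) X) f.
Proof.
have e : vsval (pm_lie (lq_incl Q) X : subvs_of (parab Q)) = vsval (X : subvs_of (levi Q)).
  by rewrite vsprojK // levi_parab // subvsP.
apply/funext => x; rewrite /form_lie /flie /= e; congr (_ - _); exact: eq_bigr.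
Qed.

(** The cochains are modules over [q_pair]; the Levi module H^q(u; V) is the restriction of their
    cohomology. *)
Lemma cohomology_coh q (H : gkmod (q_pair Q)) :
  is_coh hq fb iota Vq q H -> is_cohomology q V (lqr H).
Proof.
move=> /(coh_fun hq fb hi)[p [p_lin p_surj p_ker p_act p_lie]].
exists p; split.
- by move=> a f g /cocycleE hf /cocycleE hg; exact: p_lin.
- by move=> h; have [f hf <-] := p_surj h; exists f => //; apply/cocycleE.
- by move=> f /cocycleE hf; rewrite coboundaryE; exact: p_ker.
- by move=> k f Kk /cocycleE hf; rewrite -p_act.
- by move=> X f /cocycleE hf; rewrite form_lieE p_lie.
Qed.

(** A module satisfying [is_cohomology] is only a Levi module, so it is a subquotient of the complex
    restricted along [lq_incl]. *)
Lemma cohomology_proj q (H : gkmod lp) : is_cohomology q V H ->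
  exists p, sq_proj (X := gresA (lq_incl_ok Q) (ML hq fb Vq q))
    (fun F => cocyc iota (F : ML hq fb Vq q)) (fun F => cobord iota (F : ML hq fb Vq q)) (Q := H) p.
Proof.
move=> [p [p_lin p_surj p_ker p_act p_lie]].
have co (F : ML hq fb Vq q) : cocyc iota F -> cocycle (Q := Q) (V := V) (ev F).
  by move=> hF; apply/cocycleE/(cocyc_ev hi).
exists (fun F => p (ev (F : ML hq fb Vq q))); split.
- move=> a F G hF hG; have := p_lin a _ _ (co F hF) (co G hG) => <-; congr (p _).
  by apply/funext => x; exact: (@ev_linear _ _ hq _ fb Vq q a F G x).
- move=> h; have [f hf <-] := p_surj h; exists (cur hq fb (f : ('I_q -> b) -> Vq)).
    by apply/(cocyc_ev hi); rewrite curK; apply/cocycleE.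
  by rewrite curK.
- move=> F hF; apply: iff_trans (p_ker _ (co F hF)) _.
  apply: iff_trans (coboundaryE _) _; apply: iff_sym.
  exact: (cobord_ev hi (F : ML hq fb Vq q)).
- move=> k F Kk hF; have := p_act k _ Kk (co F hF) => <-; congr (p _).
  by apply/funext => x; exact: (@ev_act _ (q_pair Q) hq b fb Vq q k F x).
- move=> X F hF; have := p_lie X _ (co F hF) => <-; rewrite form_lieE; congr (p _).
  by apply/funext => x; exact: (@ev_lie _ (q_pair Q) hq b fb Vq q (pm_lie (lq_incl Q) X) F x).
Qed.

Lemma cohomology_unique q H H' : is_cohomology (Q := Q) q V H -> is_cohomology q V H' ->
  gk_iso H H'.
Proof.
move=> /cohomology_proj[p hp] /cohomology_proj[p' hp'].
have s := gres_stable (lq_incl_ok Q) (cocycS hq fb hi Vq q).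
apply: (sq_iso (h := id) s s hp hp') => // F hF; exists F => //.
by rewrite subrr; have [h _ _ _] := cobordS hq fb hi Vq q; exact: (subsp0 h).
Qed.

End OneModule.

Section Quadruple.
Variable A : quadruple Q.

Lemma catG_abelian : full_abelian (catG A).
Proof. by case: (qd_admissible A) => -[]. Qed.

Lemma catL_abelian : full_abelian (catL A).
Proof. by case: (qd_admissible A) => -[]. Qed.

Lemma tensor_exact q : exact_rel (catL A) (catL A) (is_tensor_ext q).
Proof.
have [_ _ h _] := qd_admissible A; split.
- move=> V LV; have [T hT] := altmod_exists hl fbl V q.
  by exists T; apply/tensor_extP.
- by move=> V T T' /tensor_extP hT /tensor_extP hT'; exact: altmod_iso hT hT'.
- by move=> V T LV hT; exact: h LV hT.
- move=> V' V V'' T' T T'' ses /tensor_extP h' /tensor_extP h0 /tensor_extP h''.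
  exact: altmod_short_exact ses h' h0 h''.
Qed.

(** Euler characteristics are formed in this category of modules over [q_pair], abelian because
    restriction to the Levi pair is exact, and then carried to K(L) by [CL_map]. *)
Local Notation CL := (fun N : gkmod (q_pair Q) => catL A (lqr N)).

Lemma CL_abelian : full_abelian CL.
Proof. exact: gres_cat catL_abelian. Qed.

Lemma CL_altmod N q T : CL N -> is_altmod hq fb N q T -> CL T.
Proof.
move=> LN hT0; have hT : is_altmod hl fbl (lqr N) q (lqr T) by exact: gres_altmod hT0.
have [_ _ h _] := qd_admissible A; apply: (h q _ _ LN); exact/tensor_extP.
Qed.

Lemma CL_coh V q H : catG A V -> is_coh hq fb iota (gres (q_incl_ok Q) V) q H -> CL H.
Proof.
move=> GV hH; have [_ _ _ h] := qd_admissible A; apply: (h q V _ GV).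
exact: cohomology_coh.
Qed.

Definition CL_map : Kgroup CL -> Kgroup (catL A) :=
  Kgroup_ext (fun N => cls (catL A) (lqr N)).

Lemma CL_mapP : additive_map CL_map /\ forall N, CL N -> CL_map (cls CL N) = cls (catL A) (lqr N).
Proof.
apply: Kgroup_ext_cls => V' V V'' c' c c'' ses.
by apply: cls_ses => //; exact: gres_short_exact.
Qed.

Lemma cls_cohomology V q H : catG A V -> is_coh hq fb iota (gres (q_incl_ok Q) V) q H ->
  cls_of (catL A) (is_cohomology q V) = cls (catL A) (lqr H).
Proof.
move=> GV hH; apply: (cls_of_eq hl catL_abelian).
- by move=> H1 H2; exact: cohomology_unique.
- exact: CL_coh GV hH.
- exact: cohomology_coh.
Qed.

(** [Hmap] is built with [Kgroup_ext], which is meaningful for additive functions only. Additivity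
    is [chi_middle] in the Grothendieck group of [CL], transported by [CL_map]. *)
Lemma Hmap_cls : additive_map (Hmap (G := catG A) (catL A)) /\
  forall V, catG A V -> Hmap (catL A) (cls (catG A) V) =
    alt_sum (\dim (nrad Q)) (fun q => cls_of (catL A) (is_cohomology q V)).
Proof.
apply: Kgroup_ext_cls => V' V V'' g' g g'' ses.
have [e [l [l_lin le]]] := nrad_basis Q.
have [cm_add cmE] := CL_mapP.
have hV W : catG A W -> exists2 a : Kgroup CL,
    chi hq fb iota (\dim (nrad Q)) (gres (q_incl_ok Q) W) a &
    CL_map a = alt_sum (\dim (nrad Q)) (fun q => cls_of (catL A) (is_cohomology q W)).
  move=> GW; have [H hH] := choice (coh_exists hq fb hi (gres (q_incl_ok Q) W)).
  exists (alt_sum (\dim (nrad Q)) (fun q => cls CL (H q))).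
    have hE q : Eu (H q) (cls CL (H q)) by apply: (Eu_cat hq); exact: CL_coh (hH q).
    by have := chi_intro hi _ hH hE; apply.
  rewrite (additive_map_alt_sum cm_add); apply: eq_alt_sum => q _.
  by rewrite cmE ?(cls_cohomology GW (hH q)) //; exact: CL_coh (hH q).
have [a' ha' <-] := hV _ g'; have [a ha <-] := hV _ g; have [a'' ha'' <-] := hV _ g''.
rewrite -cm_add; congr CL_map; apply: (chi_uniq hi CL_abelian ha).
exact: (chi_middle hi l_lin le CL_abelian (gres_short_exact (q_incl_ok Q) ses)).
Qed.

End Quadruple.

End LeviModules.

(** * Restriction of Euler characteristics *)

Lemma alt_sum_exchange (A : abGroup) d d' (x : nat -> nat -> A) :
  alt_sum d (fun q => alt_sum d' (x q)) = alt_sum d' (fun p => alt_sum d (fun q => x q p)).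
Proof.
have sD q : additive_map (@ab_mulz A ((-1) ^+ q)) by move=> y z; exact: ab_mulz_signD.
rewrite /alt_sum; under eq_bigr => q _ do rewrite (additive_map_sum (sD q)).
rewrite exchange_big; apply: eq_bigr => p _ /=.
rewrite (additive_map_sum (sD p)); apply: eq_bigr => q _.
exact: additive_map_mulz.
Qed.

Lemma restriction_exact (R : realType) (P' P : gk_pair R) (i : pair_map P' P)
    (hi : pm_ok i) (C : gkmod P -> Prop) (C' : gkmod P' -> Prop) :
  (forall V V', C V -> is_restriction i V V' -> C' V') ->
  exact_rel C C' (is_restriction i).
Proof.
move=> CC'; split.
- by move=> V _; exists (gres hi V); exact: gres_restriction.
- by move=> V T T'; exact: (restriction_unique hi).
- by move=> V T; exact: CC'.
- move=> V' V V'' T' T T'' ses /(restrictionP hi) h'.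
  move=> /(restrictionP hi) h /(restrictionP hi) h''.
  have [f [p [[f_hom p_hom] f_inj p_surj ex]]] := gres_short_exact hi ses.
  have [u' [u'_hom [v' uK' vK']]] := h'; have [u [u_hom [v uK vK]]] := h.
  have [u'' [u''_hom [v'' uK'' vK'']]] := h''.
  have v'_hom := gk_hom_inv u'_hom uK' vK'; have v_hom := gk_hom_inv u_hom uK vK.
  exists (u \o (f \o v')), (u'' \o (p \o v)); split.
  + split; exact: gk_hom_comp (gk_hom_comp _ _) _.
  + by move=> x y /(can_inj uK) /f_inj /(can_inj vK').
  + move=> w; have [x px] := p_surj (v'' w); exists (u x).
    by rewrite /= uK px vK''.
  + move=> w; have u''_lin : linear u'' by case: u''_hom.
    split=> [/= h0|[x ->]] /=.
      have /ex[x ex'] : p (v w) = 0.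
        by apply: (can_inj uK''); rewrite h0 (lin0 u''_lin).
      by exists (u' x); rewrite /= uK' -ex' vK.
    have -> : p (v (u (f (v' x)))) = 0 by rewrite uK; apply/ex; exists (v' x).
    exact: (lin0 u''_lin).
Qed.

Section InclusionModules.
Variables (R : realType) (P' P : reductive_pair R) (i : pair_map P' P).
Hypothesis Hi : inclusion i.
Variables (Q' : germane_parabolic P') (Q : germane_parabolic P).
Hypothesis HQ : parabolic_inclusion i Q' Q.
Variables (A : quadruple Q) (A' : quadruple Q').
Hypothesis Hres : restrictable i A A'.
Hypothesis Hmul : Wquot_multiplies i Q A'.

Local Notation L' := (catL A').
Local Notation lm := (levi_map i Q' Q).
Local Notation lmr := (gres (levi_map_ok Hi HQ)).
Local Notation qmr := (gres (q_map_ok Hi HQ)).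
Local Notation ir := (gres (incl_ok Hi)).
Local Notation lqr := (gres (lq_incl_ok Q)).
Local Notation lqr' := (gres (lq_incl_ok Q')).
Local Notation hl' := (levi_group Q').
Local Notation hq' := (q_group Q').

Definition res_nrad : gkmod (levi_pair Q') := lmr (levi_nrad Q).
Definition res_nrad_findim : findim res_nrad := nrad_findim Q.

Lemma tensor_ext_resP q (V T : gkmod (levi_pair Q')) :
  is_tensor_ext_res i Q q V T <-> is_altmod hl' res_nrad_findim V q T.
Proof.
split=> [[E [E' [/is_extP[j hj] hE hT]]]|hT].
  have hjr := gres_extb (levi_map_ok Hi HQ) (levi_group Q) hl' hj.
  have /(restrictionP (levi_map_ok Hi HQ))/gk_iso_sym iso := hE.
  have [j' hj'] := extb_transport iso hjr.
  exact/(tensor_altmod res_nrad_findim V T hj').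
have [E hE] := ext_exists Q q; have [j hj] := (is_extP _ _).1 hE.
exists E, (lmr E); split=> //; first exact: gres_restriction.
have hjr := gres_extb (levi_map_ok Hi HQ) (levi_group Q) hl' hj.
exact/(tensor_altmod res_nrad_findim V T hjr).
Qed.

Lemma levi_restriction_exact : exact_rel (catL A) L' (is_restriction lm).
Proof. by apply: (restriction_exact (levi_map_ok Hi HQ)); exact: (re_L Hres). Qed.

Lemma G_restriction_exact : exact_rel (catG A) (catG A') (is_restriction i).
Proof. by apply: (restriction_exact (incl_ok Hi)); exact: (re_G Hres). Qed.

Lemma tensor_res_exact q : exact_rel L' L' (is_tensor_ext_res i Q (Q' := Q') q).
Proof.
split.
- move=> V LV; have [T hT] := altmod_exists hl' res_nrad_findim V q.
  by exists T; apply/tensor_ext_resP.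
- by move=> V T T' /tensor_ext_resP hT /tensor_ext_resP hT'; exact: altmod_iso hT hT'.
- by move=> V T LV hT; exact: Hmul LV hT.
- move=> V' V V'' T' T T'' ses /tensor_ext_resP h' /tensor_ext_resP h0 /tensor_ext_resP h''.
  exact: altmod_short_exact ses h' h0 h''.
Qed.

Local Notation CL' := (fun N : gkmod (q_pair Q') => L' (lqr' N)).
Local Notation U := (qmr (nrad_mod Q)).

Lemma U_findim : findim U.
Proof. exact: nrad_findim. Qed.

Lemma q_map_nrad (y : nrad_mod Q') : exists z : nrad_mod Q,
  pm_lie (q_map i Q' Q) (nrad_incl y) = nrad_incl z.
Proof.
have yu := subvsP (y : subvs_of (nrad Q')).
exists (vsproj (nrad Q) (pm_lie i (vsval (y : subvs_of (nrad Q'))))).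
rewrite /nrad_incl /= [vsval (vsproj (parab Q') _)]vsprojK ?nrad_parab //.
by rewrite [vsval (vsproj (nrad Q) _)]vsprojK // (pi_nrad HQ).
Qed.

(** The map [q_map] carries u' into u, and u acts nilpotently on itself. *)
Lemma U_nilpotent : exists n0, forall x : U, nilpotent_on (@nrad_incl R P' Q') n0 x.
Proof.
have [N hN] := nrad_mod_nilpotent Q; exists N => x s ss.
have [z zE] := choice q_map_nrad.
have := hN (map z s); rewrite size_map => /(_ ss (x : nrad_mod Q)) <-.
have step y (w : U) : gk_lie (nrad_incl y) w = gk_lie (nrad_incl (z y)) (w : nrad_mod Q).
  by rewrite -zE.
elim: s x {ss} => // y s IH x.
rewrite -[RHS]/(foldl _ (gk_lie (nrad_incl (z y)) (x : nrad_mod Q)) (map z s)).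
by rewrite -step -IH.
Qed.

(** The composites l' -> q' -> q and l' -> l -> q agree. *)
Lemma levi_q_iso (M : gkmod (q_pair Q)) : gk_iso (lqr' (qmr M)) (lmr (lqr M)).
Proof.
exists id; split; last by exists id.
split=> //= X v; congr (gk_lie _ v).
have Xl := subvsP (X : subvs_of (levi Q')).
by rewrite !vsprojK ?levi_parab // (pi_levi HQ).
Qed.

Lemma q_G_iso (V : gkmod P) :
  gk_iso (qmr (gres (q_incl_ok Q) V)) (gres (q_incl_ok Q') (ir V)).
Proof.
exists id; split; last by exists id.
split=> //= X v; congr (gk_lie _ v).
by rewrite vsprojK // (pi_parab HQ) // subvsP.
Qed.

Lemma CL_altmod_res N p T : CL' N -> is_altmod hq' U_findim N p T -> CL' T.
Proof.
move=> LN hT; apply: (Hmul (q := p) LN); apply/tensor_ext_resP.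
have fU' : findim (lqr' U) := nrad_findim Q.
have : is_altmod hl' fU' (lqr' N) p (lqr' T) by exact: gres_altmod hT.
by apply: altmod_transport_b; apply: gk_iso_sym; exact: levi_q_iso.
Qed.

Lemma CL_map_altmod N q : CL' N ->
  CL_map (A := A') (cls_of CL' (is_altmod hq' (nrad_findim Q') N q)) =
  cls_of L' (is_tensor_ext q (lqr' N)).
Proof.
move=> LN; have [T hT] := altmod_exists hq' (nrad_findim Q') N q.
have CT := CL_altmod LN hT; have [_ cmE] := CL_mapP A'.
rewrite (cls_of_eq hq' (CL_abelian A') _ CT hT); last first.
  by move=> V W; exact: altmod_iso.
rewrite cmE //; apply/esym/(exact_rel_cls hl' (catL_abelian A') (tensor_exact A' q) LN).
by apply/tensor_extP; exact: gres_altmod hT.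
Qed.

Lemma CL_map_altmod_res N p : CL' N ->
  CL_map (A := A') (cls_of CL' (is_altmod hq' U_findim N p)) =
  cls_of L' (is_tensor_ext_res i Q p (lqr' N)).
Proof.
move=> LN; have [T hT] := altmod_exists hq' U_findim N p.
have CT := CL_altmod_res LN hT; have [_ cmE] := CL_mapP A'.
rewrite (cls_of_eq hq' (CL_abelian A') _ CT hT); last first.
  by move=> V W; exact: altmod_iso.
rewrite cmE //; apply/esym/(exact_rel_cls hl' (catL_abelian A') (tensor_res_exact p) LN).
apply/tensor_ext_resP; have fU' : findim (lqr' U) := nrad_findim Q.
have : is_altmod hl' fU' (lqr' N) p (lqr' T) by exact: gres_altmod hT.
by apply: altmod_transport_b; apply: gk_iso_sym; exact: levi_q_iso.
Qed.

Local Notation d' := (\dim (nrad Q')).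
Local Notation d := (\dim (nrad Q)).

Lemma Wq_mul_cls V : L' V ->
  Wq_mul (cls L' V) = alt_sum d' (fun q => cls_of L' (is_tensor_ext q V)).
Proof.
move=> LV; have [_ h] := exact_rel_alt hl' (catL_abelian A') d' (tensor_exact A').
exact: h.
Qed.

Lemma Wq_mul_additive : additive_map (Wq_mul (L := L')).
Proof.
by have [h _] := exact_rel_alt hl' (catL_abelian A') d' (tensor_exact A').
Qed.

Lemma Wres_mul_cls V : L' V -> Wres_mul i Q (A' := A') (cls L' V) =
  alt_sum d (fun p => cls_of L' (is_tensor_ext_res i Q p V)).
Proof.
move=> LV; have [_ h] := exact_rel_alt hl' (catL_abelian A') d tensor_res_exact.
exact: h.
Qed.

Lemma Wres_mul_additive : additive_map (Wres_mul i Q (A' := A')).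
Proof.
by have [h _] := exact_rel_alt hl' (catL_abelian A') d tensor_res_exact.
Qed.

Lemma Kres_levi : additive_map (Kres lm (C := catL A) L') /\
  forall V, catL A V -> Kres lm L' (cls (catL A) V) = cls L' (lmr V).
Proof.
have [h hE] := exact_rel_ext hl' (catL_abelian A') levi_restriction_exact.
split=> // V LV; have := hE V LV; rewrite -/(Kres lm L') => ->.
apply: (exact_rel_cls hl' (catL_abelian A') levi_restriction_exact LV).
exact: gres_restriction.
Qed.

Lemma Kres_G : additive_map (Kres i (C := catG A) (catG A')) /\
  forall V, catG A V -> Kres i (catG A') (cls (catG A) V) = cls (catG A') (ir V).
Proof.
have [h hE] := exact_rel_ext (grp_group P') (catG_abelian A') G_restriction_exact.
split=> // V GV; have := hE V GV; rewrite -/(Kres i (catG A')) => ->.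
apply: (exact_rel_cls (grp_group P') (catG_abelian A') G_restriction_exact GV).
exact: gres_restriction.
Qed.

(** [euler_identity] over [q_pair Q'], for the complex of u with coefficients in V restricted along
    [q_map]. Under [CL_map] its left side becomes W_q' . H(V)|, and its right side, after exchanging
    the two sums, W_q| . H'(V|). *)
Lemma restricted_euler V : catG A V ->
  Wq_mul (Kres lm L' (Hmap (catL A) (cls (catG A) V))) =
  Wres_mul i Q (A' := A') (Hmap L' (Kres i (catG A') (cls (catG A) V))).
Proof.
move=> GV; have [kl_add kl] := Kres_levi; have [_ kg] := Kres_G.
have GV' : catG A' (ir V) by apply: (re_G Hres) GV _; exact: gres_restriction.
have [e' [l' [l'_lin le']]] := nrad_basis Q'; have [e [l [l_lin le]]] := nrad_basis Q.
have [n0 nilU] := U_nilpotent.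
have hi := nrad_ce_data Q; have hi' := nrad_ce_data Q'.
have [X [Z [B [H [[sX sZ] B0 Bd aX cH]]]]] :=
  complex_exists (q_group Q) (nrad_findim Q) hi (gres (q_incl_ok Q) V) le.
have [N cN] := choice (coh_exists hq' (nrad_findim Q') hi' (qmr (gres (q_incl_ok Q) V))).
have [N' cN'] := choice (coh_exists hq' (nrad_findim Q') hi' (gres (q_incl_ok Q') (ir V))).
have NN' q : gk_iso (N' q) (N q).
  exact: gk_iso_sym (coh_iso_l hi' (q_G_iso V) (cN q) (cN' q)).
have CLc := CL_abelian A'.
have CN' q : CL' (N' q) by exact: CL_coh GV' (cN' q).
have CN q : CL' (N q) by apply: (cat_iso CLc (NN' q)); exact: CN'.
have LH p : catL A (lqr (H p)) by exact: CL_coh GV (cH p).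
have CH p : CL' (qmr (H p)).
  have [c _ _ _ _] := catL_abelian A'.
  apply: c (gk_iso_sym (levi_q_iso (H p))) _.
  by apply: (re_L Hres) (LH p) _; exact: gres_restriction.
have aX' p : is_altmod hq' U_findim (qmr (gres (q_incl_ok Q) V)) p (qmr (X p)).
  exact: gres_altmod (aX p).
have eul := euler_identity hi' l'_lin le' CLc nilU
  (fun M q T => @CL_altmod _ _ _ A' M q T) (fun M p T => @CL_altmod_res M p T) cN CN
  (fun p => gres_short_exact (q_map_ok Hi HQ) (sX p))
  (fun p => gres_short_exact (q_map_ok Hi HQ) (sZ p)) B0 Bd
  aX' CH.
have [cm_add cmE] := CL_mapP A'.
have [_ hm] := Hmap_cls A; have [_ hm'] := Hmap_cls A'.
rewrite kg // hm // hm' // (additive_map_alt_sum kl_add).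
rewrite (additive_map_alt_sum Wq_mul_additive) (additive_map_alt_sum Wres_mul_additive).
transitivity (CL_map (A := A') (alt_sum d (fun p => alt_sum d' (fun q =>
    cls_of CL' (is_altmod hq' (nrad_findim Q') (qmr (H p)) q))))).
  rewrite (additive_map_alt_sum cm_add); apply: eq_alt_sum => p _.
  rewrite (cls_cohomology GV (cH p)) kl //.
  rewrite -(cls_iso hl' (catL_abelian A') (levi_q_iso (H p))) Wq_mul_cls //.
  rewrite (additive_map_alt_sum cm_add); apply: eq_alt_sum => q _.
  by rewrite CL_map_altmod.
rewrite eul alt_sum_exchange (additive_map_alt_sum cm_add); apply: eq_alt_sum => q _.
rewrite (cls_cohomology GV' (cN' q)).
rewrite (cls_iso hl' (catL_abelian A') (gres_iso (lq_incl_ok Q') (NN' q))) Wres_mul_cls //.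
rewrite (additive_map_alt_sum cm_add); apply: eq_alt_sum => p _.
by rewrite CL_map_altmod_res.
Qed.

End InclusionModules.

(** * Restriction of localized classes *)

Section TensorDual.
Variables (R : realType) (P' P : gk_pair R) (i : pair_map P' P) (hi : pm_ok i).
Hypotheses (hP : gk_group P) (hP' : gk_group P').

Lemma gres_tensor (V W T : gkmod P) :
  is_tensor V W T -> is_tensor (gres hi V) (gres hi W) (gres hi T).
Proof.
move=> [b [b_lin b_univ b_act b_lie]]; exists b; split=> //.
  by move=> k v w Kk; apply: b_act; exact: pm_grpP.
by move=> X v w; exact: b_lie.
Qed.

(** A functional can be finite under the smaller group without being finite under the larger one, so
    locally finite duals need not restrict to locally finite duals; the first hypothesis rules this
    out. *)
Lemma gres_dual (V D : gkmod P) :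
  (forall f : V -> R[i]^o, linear f ->
    finite_functional (@grp R P') (fun k => gk_act (pm_grp i k)) f ->
    finite_functional (@grp R P) (@gk_act R P V) f) ->
  is_dual V D -> is_dual (gres hi V) (gres hi D).
Proof.
move=> same [j [j_lin j_inj j_fin j_act j_lie]]; exists j; split=> //.
- move=> f; split=> [/j_fin[f_lin [m [e [fe ee]]]]|[f_lin f_fin]].
    split=> //; exists m, e; split=> // k p Kk.
    have [a ea] := ee _ p (pm_grpP hi Kk); exists a => v.
    by rewrite /= pm_V.
  by apply/j_fin; split=> //; exact: same.
- by move=> k x v Kk; have := j_act _ x v (pm_grpP hi Kk) => /= ->; rewrite pm_V.
- by move=> X x v; exact: j_lie.
Qed.

End TensorDual.

(** Equality in K(L)[W^-1] gives equality in K_L[W^-1]: it amounts to an identity after clearing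
    denominators, and K_L is stable under W. The extra [c] allows a further common denominator. *)
Lemma eq_Kfrac_Cfrac (R : realType) (P : reductive_pair R)
    (Q : germane_parabolic P) (A : quadruple Q) x y a b c :
  KL A x -> KL A y -> Kfrac x a = Kfrac y b -> Cfrac x (c + a) = Cfrac y (c + b).
Proof.
move=> Kx Ky; have WD := Wq_mul_additive (A' := A).
move=> /(fraction_eq WD (fun _ _ => iff_refl _) I I)[N [aN bN e]].
have it z n m : KL A z -> Cfrac z m = Cfrac (iter n (Wq_mul (L := catL A)) z) (n + m).
  by move=> Kz; rewrite /Cfrac (fraction_iter (@qd_W _ _ _ A) (fun _ _ => iff_refl _)).
rewrite (it x (N - a)%N) // (it y (N - b)%N) // e; congr Cfrac.
by rewrite !(addnCA _ c) !subnK.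
Qed.

Section RestrictionMap.
Variables (R : realType) (P' P : reductive_pair R) (i : pair_map P' P).
Hypothesis Hi : inclusion i.
Variables (Q' : germane_parabolic P') (Q : germane_parabolic P).
Hypothesis HQ : parabolic_inclusion i Q' Q.
Variables (A : quadruple Q) (A' : quadruple Q').
Hypothesis Hres : restrictable i A A'.
Hypothesis HW : Wquot_closed i A A'.

Local Notation L' := (catL A').
Local Notation lm := (levi_map i Q' Q).
Local Notation lmr := (gres (levi_map_ok Hi HQ)).
Local Notation hl' := (levi_group Q').
Local Notation d := (\dim (nrad Q)).
Local Notation kappa := (Kres lm (C := catL A) L').
Local Notation Hmul := (wc_multiplies HW).

Lemma gres_tensor_ext q (V T : gkmod (levi_pair Q)) : is_tensor_ext q V T ->
  is_tensor_ext_res i Q q (lmr V) (lmr T).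
Proof. by move=> /tensor_extP hT; apply/(tensor_ext_resP Hi HQ); exact: gres_altmod hT. Qed.

Lemma Kres_tensor_ext q V : catL A V ->
  kappa (cls_of (catL A) (is_tensor_ext q V)) =
  cls_of L' (is_tensor_ext_res i Q q (lmr V)).
Proof.
move=> LV; have [_ kE] := Kres_levi Hi HQ Hres.
have hD := tensor_exact A q; have [T hT] := er_ex hD LV.
have LT := er_cat hD LV hT.
rewrite (exact_rel_cls (levi_group Q) (catL_abelian A) hD LV hT) kE //.
apply/esym/(exact_rel_cls hl' (catL_abelian A') (tensor_res_exact Hi HQ Hmul q)).
  by apply: (re_L Hres LV); exact: gres_restriction.
exact: gres_tensor_ext.
Qed.

Lemma Kres_L V : catL A V -> L' (lmr V).
Proof. by move=> LV; apply: (re_L Hres LV); exact: gres_restriction. Qed.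

Lemma Kres_Wq x : kappa (Wq_mul x) = Wres_mul i Q (A' := A') (kappa x).
Proof.
have [kD kE] := Kres_levi Hi HQ Hres.
have [WD WE] := exact_rel_alt (levi_group Q) (catL_abelian A) d (tensor_exact A).
have WrD := Wres_mul_additive Hi HQ Hmul.
apply: (additive_map_presented (f := kappa \o @Wq_mul _ _ Q (catL A))
  (g := Wres_mul i Q (A' := A') \o kappa)) x; try exact: additive_map_comp.
move=> [V LV]; rewrite -(clsE LV) /= kE // /Wq_mul WE // (additive_map_alt_sum kD).
rewrite (Wres_mul_cls Hi HQ Hmul (Kres_L LV)).
apply: (@eq_alt_sum (Kgroup L')) => q _; exact: Kres_tensor_ext.
Qed.

Lemma Kres_top x : kappa (top_mul x) = topres_mul i Q (A' := A') (kappa x).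
Proof.
have [kD kE] := Kres_levi Hi HQ Hres.
have [tD tE] := exact_rel_ext (levi_group Q) (catL_abelian A) (tensor_exact A d).
have [trD trE] := exact_rel_ext hl' (catL_abelian A') (tensor_res_exact Hi HQ Hmul d).
apply: (additive_map_presented (f := kappa \o @top_mul _ _ Q (catL A))
  (g := topres_mul i Q (A' := A') \o kappa)) x; try exact: additive_map_comp.
move=> [V LV]; rewrite -(clsE LV) /= kE // /top_mul tE // /topres_mul.
by rewrite trE; [exact: Kres_tensor_ext | exact: Kres_L].
Qed.

Lemma Kres_euler X : Wq_mul (kappa (Hmap (catL A) X)) =
  Wres_mul i Q (A' := A') (Hmap L' (Kres i (C := catG A) (catG A') X)).
Proof.
have [kD _] := Kres_levi Hi HQ Hres; have [kgD _] := Kres_G Hi Hres.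
have [HD _] := Hmap_cls A; have [HD' _] := Hmap_cls A'.
have WD := Wq_mul_additive (A' := A'); have WrD := Wres_mul_additive Hi HQ Hmul.
apply: (additive_map_presented
  (f := @Wq_mul _ _ Q' L' \o (kappa \o Hmap (G := catG A) (catL A)))
  (g := Wres_mul i Q (A' := A') \o (Hmap L' \o Kres i (C := catG A) (catG A')))) X.
- by apply: additive_map_comp => //; exact: additive_map_comp.
- by apply: additive_map_comp => //; exact: additive_map_comp.
- move=> [V GV]; rewrite -(clsE GV); exact: (restricted_euler Hi HQ Hres Hmul GV).
Qed.

Lemma Kres_lincomb m (a : 'I_m -> int) (V : 'I_m -> gkmod (levi_pair Q)) :
  (forall p, catL A (V p)) ->
  kappa (K_lincomb (catL A) a V) = K_lincomb L' a (fun p => lmr (V p)).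
Proof.
move=> LV; have [kD kE] := Kres_levi Hi HQ Hres.
rewrite /K_lincomb (additive_map_sum kD); apply: eq_bigr => p _.
by rewrite (additive_map_mulz kD) kE.
Qed.

Lemma Kres_mul x y z : K_mul x y z -> K_mul (kappa x) (kappa y) (kappa z).
Proof.
move=> [m [n [a [V [b [W [T [[LV LW] hT -> -> ->]]]]]]]].
have [kD kE] := Kres_levi Hi HQ Hres.
exists m, n, a, (fun p => lmr (V p)), b, (fun p => lmr (W p)), (fun p q => lmr (T p q)).
split; rewrite ?Kres_lincomb //.
- by split=> p; exact: Kres_L.
- by move=> p q; have [LT tT] := hT p q; split; [exact: Kres_L | exact: gres_tensor].
- rewrite (additive_map_sum kD); apply: eq_bigr => p _.
  rewrite (additive_map_sum kD); apply: eq_bigr => q _.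
  by rewrite (additive_map_mulz kD) kE //; have [] := hT p q.
Qed.

Lemma Kres_dual x y : K_dual (same_dual i Q' (Q := Q)) x y ->
  K_dual (fun=> True) (kappa x) (kappa y).
Proof.
move=> [m [a [V [D [h -> ->]]]]].
exists m, a, (fun p => lmr (V p)), (fun p => lmr (D p)); split.
- move=> p; have [LV LD hd same] := h p; split=> //; try exact: Kres_L.
  exact: (gres_dual (levi_map_ok Hi HQ) (levi_group Q) hl' same hd).
- by rewrite Kres_lincomb // => p; have [] := h p.
- by rewrite Kres_lincomb // => p; have [] := h p.
Qed.

(** Since W_q| = W_q' W_(q/q'), the denominator W_q^a splits into the a-th powers of the two factors
    that are inverted in succession. *)
Definition Cq_res_gen (g : {x : Kgroup (catL A) | KL A x} * nat) : Cquot i Q A' :=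
  Cqfrac i Q (Cfrac (kappa (sval g.1)) g.2) g.2.

Lemma Cq_res_rel s t : @frac_rel _ (KL A) (@Wgraph _ _ Q A) s t ->
  term_eval Cq_res_gen s = term_eval Cq_res_gen t.
Proof.
have [kD _] := Kres_levi Hi HQ Hres.
case=> [[x Kx] [y Ky] [z Kz] a /= e|[x Kx] [y Ky] a /= e]; rewrite /Cq_res_gen /=.
  have Kx' := re_KL Hres Kx; have Ky' := re_KL Hres Ky; have Kz' := re_KL Hres Kz.
  have {}e : z = ab_add x y := e.
  rewrite -[RHS]/(ab_add (Cqfrac i Q (Cfrac (kappa x) a) a) (Cqfrac i Q (Cfrac (kappa y) a) a)).
  by rewrite e kD in Kz' *; rewrite /Cqfrac -fractionD // /Cfrac fractionD.
have Kx' := re_KL Hres Kx; have Ky' := re_KL Hres Ky.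
have [z Kz hz] := wc_KL HW Kx'.
(* From y = W_q x follows kappa y = W_q| kappa x, so dividing by W_q' gives z = W_(q/q') kappa x;
   raising the exponent of W_(q/q') then compensates the multiplication. *)
have -> : Cfrac (kappa y) a.+1 = Cfrac z a.
  have hzy : Kfrac z 0 = Kfrac (kappa y) 1 by rewrite hz e Kres_Wq.
  by have := eq_Kfrac_Cfrac a Kz Ky' hzy; rewrite addn0 addn1.
apply: (@fraction_mul (Cq A') (fun=> True) (@Cquot_graph _ _ _ i Q' Q A')) => //.
by exists (kappa x), z, a.
Qed.

End RestrictionMap.

Theorem proposition1p7 (R : realType) (P' P : reductive_pair R)
    (i : pair_map P' P) (Hi : inclusion i)
    (Q' : germane_parabolic P') (Q : germane_parabolic P)
    (HQ : parabolic_inclusion i Q' Q)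
    (A : quadruple Q) (A' : quadruple Q')
    (Hres : restrictable i A A')
    (HW : Wquot_closed i A A') :
  exists iota : Cq A -> Cquot i Q A',
  [/\ forall c d, iota (ab_add c d) = ab_add (iota c) (iota d),
      forall x a, KL A x ->
        iota (Cfrac x a) =
        Cqfrac i Q (Cfrac (Kres (levi_map i Q' Q) (catL A') x) a) a,
      forall c d e, C_mul c d e -> Cquot_mul (iota c) (iota d) (iota e),
      forall c d, C_dual (same_dual i Q' (Q := Q)) c d ->
        Cquot_dual (iota c) (iota d)
    & forall X, KG A X ->
        iota (cq X) = Cqfrac i Q (cq (Kres i (catG A') X)) 0].
Proof.
have grel := Cq_res_rel Hi HQ Hres HW.
exists (pext (@Cq_res_gen _ _ _ i Q' Q A A')).
have gD := pextD grel.
have gE x a : KL A x -> pext (@Cq_res_gen _ _ _ i Q' Q A A') (Cfrac x a) =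
    Cqfrac i Q (Cfrac (Kres (levi_map i Q' Q) (catL A') x) a) a.
  by move=> Kx; rewrite /Cfrac fractionE (pext_gen grel).
split=> //.
- move=> c d e [x [y [z [a [b [[Kx Ky Kz] xyz -> -> ->]]]]]].
  exists (Kres (levi_map i Q' Q) (catL A') x), (Kres (levi_map i Q' Q) (catL A') y),
    (Kres (levi_map i Q' Q) (catL A') z), a, b, a, b.
  rewrite !gE //; split=> //; first by split; exact: (re_KL Hres).
  exact: (Kres_mul Hi HQ Hres xyz).
- move=> c d [x [y [a [[Kx Ky] xy -> ->]]]].
  have ke : Kres (levi_map i Q' Q) (catL A') (iter a (@top_mul _ _ Q (catL A)) y) =
      iter a (@topres_mul _ _ _ i Q' Q A') (Kres (levi_map i Q' Q) (catL A') y).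
    by elim: (a) => //= n IH; rewrite (Kres_top Hi HQ Hres HW) IH.
  exists (Kres (levi_map i Q' Q) (catL A') x), (Kres (levi_map i Q' Q) (catL A') y), a.
  rewrite (additive_map_mulz gD) !gE // -ke; split=> //.
    by split; exact: (re_KL Hres).
  exact: (Kres_dual Hi HQ Hres xy).
- move=> X KX; have KH := qd_H KX; rewrite /cq gE //.
  (* It remains to see that W_(q/q') H'(X|) is the restriction of H(X), both over W_q'. This is
     [Kres_euler] divided by W_q', and it cancels the denominator W_(q/q'). *)
  apply: (@fraction_mul (Cq A') (fun=> True) (@Cquot_graph _ _ _ i Q' Q A')) => //.
  exists (Hmap (catL A') (Kres i (catG A') X)),
    (Kres (levi_map i Q' Q) (catL A') (Hmap (catL A) X)), 1%N.
  have K1 := re_KL Hres KH; have K2 := qd_H (re_KG Hres KX).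
  split=> //; rewrite /Wquot_mul -(Kres_euler Hi HQ Hres HW).
  by apply/esym/fraction_mul.
Qed.
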